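(* Let $M^3$ be a nondegenerate positive definite affine hypersurface of $\mathbb R^4$ admitting a pointwise $\mathbb Z_3$-symmetry or a pointwise $SO(2)$-symmetry, and introduce a coordinate function $t$ by $\frac{\partial}{\partial t}:=e_1$. Then $(M,h)$ admits a warped product structure $M^3=\mathbb R\times_{e^f}N^2$ with $f:\mathbb R\to\mathbb R$ satisfying $$\frac{\partial f}{\partial t}=\eta .$$
   Context: Blaschke structure: for a nondegenerate immersed hypersurface $F:M^3\to\mathbb R^4$, with $D$ the standard flat connection and $\det$ the standard volume form, the affine (Blaschke) normal $\xi$ is the transversal field, unique up to sign, such that $D_XY=\nabla_XY+h(X,Y)\xi$, $D_X\xi=-SX$ (tangential), and $|\det(X_1,X_2,X_3,\xi)|=|\det(h(X_i,X_j))|^{1/2}$. $h$ is the affine metric (assumed positive definite), $S$ the affine shape operator, $\hat\nabla$ the Levi-Civita connection of $h$, and $K(X,Y)=K_XY=\nabla_XY-\hat\nabla_XY$ the difference tensor. Symmetry: $M^3$ admits a pointwise $\mathbb Z_3$-symmetry (resp. $SO(2)$-symmetry) if at every $p\in M$ the group of orientation-preserving linear maps of $T_pM$ preserving $h$, $S$ and $K$ is isomorphic to $\mathbb Z_3$ (resp. $SO(2)$). For such $M^3$ there is near every point a smooth $h$-orthonormal frame $e_1,e_2,e_3$ with $K_{e_1}e_1=2\mu_1e_1$, $K_{e_1}e_2=-\mu_1e_2$, $K_{e_1}e_3=-\mu_1e_3$, $K_{e_2}e_2=-\mu_1e_1+\mu_2e_2$, $K_{e_2}e_3=-\mu_2e_3$,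 $K_{e_3}e_3=-\mu_1e_1-\mu_2e_2$, $Se_1=\lambda e_1$, $Se_2=ae_2$, $Se_3=ae_3$, with $\mu_1\neq0$ everywhere and $\mu_2$ vanishing exactly in the $SO(2)$ case. $e_1$ is determined up to sign and may be taken globally defined, and $\eta$ is the function with $\hat\nabla_Xe_1=\eta X$ for all $X\perp e_1$. Warped product: $\mathbb R\times_{e^f}N^2$ denotes $\mathbb R\times N^2$ with the metric $dt^2+e^{2f(t)}g_N$, where $(N^2,g_N)$ is a Riemannian surface.
   Formalization: The warped product structure is stated locally: near every point (M,h) is I × N² with I an open interval in place of ℝ and f smooth on I. The global form with all of ℝ fails, e.g. for a small open piece of such an M, where the integral curves of e₁ have finite length. *)

(* Defs.v *)
From HB Require Import structures.
From mathcomp Require Import all_boot all_order all_algebra.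
From mathcomp Require Import all_classical all_reals all_analysis.

Set Implicit Arguments.
Unset Strict Implicit.
Unset Printing Implicit Defensive.
Import Order.TTheory GRing.Theory Num.Theory.
Import numFieldNormedType.Exports.
Local Open Scope classical_set_scope.
Local Open Scope ring_scope.

(* Tangent and ambient vectors are row vectors, so a linear map with matrix L *)
(* sends v to v *m L and a bilinear form with matrix B sends (v, w) to        *)
(* v *m B *m w^T.                                                             *)

Section Calculus.
Context {R : realType}.

Definition iter_derive {V W : normedModType R} (vs : seq V) (f : V -> W) :
  V -> W := foldr (fun v g x => 'D_v g x) f vs.

(* C^oo on U, for U open: every iterated directional derivative is (Frechet)  *)
(* differentiable, hence continuous, at every point of U.                     *)
Definition smooth_on {V W : normedModType R} (U : set V) (f : V -> W) : Prop :=
  forall (vs : seq V) (x : V), U x -> differentiable (iter_derive vs f) x.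

Definition unit_vec {n} (i : 'I_n) : 'rV[R]_n := delta_mx 0 i.

Definition bilin {n} (B : 'M[R]_n) (v w : 'rV[R]_n) : R :=
  (v *m B *m w^T) 0 0.

Definition posdef {n} (B : 'M[R]_n) : Prop :=
  B^T = B /\ forall v : 'rV[R]_n, v != 0 -> 0 < bilin B v v.

(* Coefficients, in the coordinate frame, of the Levi-Civita derivative of    *)
(* the j-th coordinate field along the i-th one.                              *)
Definition christoffel {n} (g : 'rV[R]_n -> 'M[R]_n) (i j : 'I_n)
    (x : 'rV[R]_n) : 'rV[R]_n :=
  (\row_l (2^-1 * ('D_(unit_vec i) (fun y => g y j l) x
                 + 'D_(unit_vec j) (fun y => g y i l) x
                 - 'D_(unit_vec l) (fun y => g y i j) x))) *m invmx (g x).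

Definition levi_civita {n} (g : 'rV[R]_n -> 'M[R]_n)
    (X Y : 'rV[R]_n -> 'rV[R]_n) (x : 'rV[R]_n) : 'rV[R]_n :=
  'D_(X x) Y x
  + \sum_(i < n) \sum_(j < n) (X x 0 i * Y x 0 j) *: christoffel g i j x.

End Calculus.

Section Manifold.
Context {R : realType} {M : topologicalType} {n : nat}.

(* [chart_of] inverts [chart_to] on [chart_dom]; the values of the two maps   *)
(* outside [chart_dom] and [chart_img] are irrelevant.                        *)
Record chart := Chart {
  chart_dom : set M;
  chart_to : M -> 'rV[R]_n;
  chart_of : 'rV[R]_n -> M }.

Definition chart_img (c : chart) : set 'rV[R]_n := chart_to c @` chart_dom c.

Definition is_chart (c : chart) : Prop :=
  [/\ open (chart_dom c), open (chart_img c),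
      forall p, chart_dom c p -> chart_of c (chart_to c p) = p,
      {within chart_dom c, continuous (chart_to c)} &
      {within chart_img c, continuous (chart_of c)}].

Definition smooth_transition (c d : chart) : Prop :=
  smooth_on (chart_to c @` (chart_dom c `&` chart_dom d))
            (chart_to d \o chart_of c).

Definition smooth_manifold (A : set chart) : Prop :=
  [/\ hausdorff_space M, @second_countable M,
      forall c, A c -> is_chart c,
      (forall p, exists c, A c /\ chart_dom c p) &
      forall c d, A c -> A d -> smooth_transition c d].

Definition smooth_chart (A : set chart) (c : chart) : Prop :=
  is_chart c /\
  forall d, A d -> smooth_transition c d /\ smooth_transition d c.

End Manifold.
Arguments chart : clear implicits.

(* G : U -> R^4 is a local parametrization of the hypersurface and xi a field *)
(* along it, with U open in R^3; tangent vectors are given by their           *)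
(* components in R^3.                                                         *)
Section Hypersurface.
Context {R : realType}.
Variables G xi : 'rV[R]_3 -> 'rV[R]_4.
Implicit Types (X Y : 'rV[R]_3 -> 'rV[R]_3) (x v w : 'rV[R]_3).

(* The rows are dG(d/dx_1), dG(d/dx_2), dG(d/dx_3), xi. *)
Definition gauss_frame x : 'M[R]_4 := col_mx ('J G x : 'M[R]_(3, 4)) (xi x).

(* w = dG(tangential w) + (transversal w) xi when [gauss_frame] is invertible *)
Definition tangential x (w : 'rV[R]_4) : 'rV[R]_3 :=
  lsubmx (w *m invmx (gauss_frame x) : 'rV[R]_(3 + 1)).
Definition transversal x (w : 'rV[R]_4) : R :=
  (rsubmx (w *m invmx (gauss_frame x) : 'rV[R]_(3 + 1))) 0 0.

Definition flat_derivative X Y x : 'rV[R]_4 :=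
  'D_(X x) (fun y => Y y *m 'J G y) x.

(* The Gauss formula D_X Y = nabla_X Y + h(X, Y) xi and the Weingarten        *)
(* formula D_X xi = - S X.                                                    *)
Definition nabla X Y x : 'rV[R]_3 := tangential x (flat_derivative X Y x).
Definition affine_form X Y x : R := transversal x (flat_derivative X Y x).
Definition shape x v : 'rV[R]_3 := - tangential x ('D_v xi x).

Definition affine_metric x : 'M[R]_3 :=
  \matrix_(i, j) affine_form (cst (unit_vec i)) (cst (unit_vec j)) x.

(* K is tensorial, so its value at x may be computed on fields with constant  *)
(* components.                                                                *)
Definition difference_tensor x v w : 'rV[R]_3 :=
  nabla (cst v) (cst w) x - levi_civita affine_metric (cst v) (cst w) x.

Definition immersion_on (U : set 'rV[R]_3) : Prop :=
  smooth_on U G /\ forall x, U x -> row_free ('J G x).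

(* xi is the affine normal; the rows of X are the tangent vectors X_1, X_2,   *)
(* X_3 in the volume condition.                                               *)
Definition blaschke_normal_on (U : set 'rV[R]_3) : Prop :=
  smooth_on U xi /\
  forall x, U x ->
    [/\ gauss_frame x \in unitmx,
        forall v, transversal x ('D_v xi x) = 0 &
        forall X : 'M[R]_3,
          `|\det (col_mx (X *m 'J G x) (xi x) : 'M[R]_(3 + 1))|
          = Num.sqrt `|\det (X *m affine_metric x *m X^T)| ].

Definition nondegenerate_on (U : set 'rV[R]_3) : Prop :=
  forall x, U x -> affine_metric x \in unitmx.

Definition positive_definite_on (U : set 'rV[R]_3) : Prop :=
  forall x, U x -> posdef (affine_metric x).

Definition symmetry_group x : set 'M[R]_3 :=
  [set L | [/\ 0 < \det L,
    forall v w, bilin (affine_metric x) (v *m L) (w *m L)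
                = bilin (affine_metric x) v w,
    forall v, shape x (v *m L) = shape x v *m L &
    forall v w, difference_tensor x (v *m L) (w *m L)
                = difference_tensor x v w *m L]].

End Hypersurface.

Definition group_isomorphic {T1 T2 : Type} (A : set T1) (mulA : T1 -> T1 -> T1)
    (B : set T2) (mulB : T2 -> T2 -> T2) : Prop :=
  exists2 phi : T1 -> T2, set_bij A B phi &
    forall x y, A x -> A y -> phi (mulA x y) = mulB (phi x) (phi y).

Definition SO (R : realType) (n : nat) : set 'M[R]_n :=
  [set Q | Q *m Q^T = 1%:M /\ \det Q = 1].
Arguments SO : clear implicits.

Section Symmetry.
Context {R : realType}.
Variables G xi : 'rV[R]_3 -> 'rV[R]_4.

Definition Z3_symmetric_at (x : 'rV[R]_3) : Prop :=
  group_isomorphic [set: 'Z_3] +%R (symmetry_group G xi x) mulmx.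

Definition SO2_symmetric_at (x : 'rV[R]_3) : Prop :=
  group_isomorphic (SO R 2) mulmx (symmetry_group G xi x) mulmx.

Definition adapted_frame_on (W : set 'rV[R]_3)
    (e1 e2 e3 : 'rV[R]_3 -> 'rV[R]_3) : Prop :=
  [/\ smooth_on W e1, smooth_on W e2, smooth_on W e3 &
  exists mu1 mu2 lambda a : 'rV[R]_3 -> R, forall x, W x ->
  let h := bilin (affine_metric G xi x) in
  let K := difference_tensor G xi x in
  let S := shape G xi x in
  [/\ [/\ h (e1 x) (e1 x) = 1, h (e2 x) (e2 x) = 1 & h (e3 x) (e3 x) = 1],
      [/\ h (e1 x) (e2 x) = 0, h (e1 x) (e3 x) = 0 & h (e2 x) (e3 x) = 0],
      [/\ K (e1 x) (e1 x) = (2 * mu1 x) *: e1 x,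
          K (e1 x) (e2 x) = - mu1 x *: e2 x,
          K (e1 x) (e3 x) = - mu1 x *: e3 x &
      [/\ K (e2 x) (e2 x) = - mu1 x *: e1 x + mu2 x *: e2 x,
          K (e2 x) (e3 x) = - mu2 x *: e3 x &
          K (e3 x) (e3 x) = - mu1 x *: e1 x - mu2 x *: e2 x]],
      [/\ S (e1 x) = lambda x *: e1 x, S (e2 x) = a x *: e2 x &
          S (e3 x) = a x *: e3 x] &
      mu1 x != 0 /\ (mu2 x = 0 <-> SO2_symmetric_at x)]].

End Symmetry.

Section GlobalHypersurface.
Context {R : realType} {M : topologicalType}.

Definition in_chart (c : chart R M 3) (F : M -> 'rV[R]_4) :
  'rV[R]_3 -> 'rV[R]_4 := F \o chart_of c.

Definition positive_definite_affine_hypersurface (A : set (chart R M 3))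
    (F xi : M -> 'rV[R]_4) : Prop :=
  forall c, A c ->
    [/\ immersion_on (in_chart c F) (chart_img c),
        blaschke_normal_on (in_chart c F) (in_chart c xi) (chart_img c),
        nondegenerate_on (in_chart c F) (in_chart c xi) (chart_img c) &
        positive_definite_on (in_chart c F) (in_chart c xi) (chart_img c)].

Definition pointwise_Z3_symmetric (A : set (chart R M 3))
    (F xi : M -> 'rV[R]_4) : Prop :=
  forall c p, A c -> chart_dom c p ->
    Z3_symmetric_at (in_chart c F) (in_chart c xi) (chart_to c p).

Definition pointwise_SO2_symmetric (A : set (chart R M 3))
    (F xi : M -> 'rV[R]_4) : Prop :=
  forall c p, A c -> chart_dom c p ->
    SO2_symmetric_at (in_chart c F) (in_chart c xi) (chart_to c p).

End GlobalHypersurface.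

Section WarpedProduct.
Context {R : realType}.

(* Coordinates (t, u, v) on I x N, with I = ]a, b[ and N open in R^2. *)
Definition line_coord (x : 'rV[R]_3) : R := x 0 0.
Definition leaf_coord (x : 'rV[R]_3) : 'rV[R]_2 :=
  rsubmx (x : 'rV[R]_(1 + 2)).

Definition warped_domain (a b : R) (N : set 'rV[R]_2) : set 'rV[R]_3 :=
  [set x | a < line_coord x < b /\ N (leaf_coord x)].

Definition riemannian_metric_on (N : set 'rV[R]_2)
    (gN : 'rV[R]_2 -> 'M[R]_2) : Prop :=
  smooth_on N gN /\ forall y, N y -> posdef (gN y).

(* dt^2 + e^(2 f(t)) gN *)
Definition warped_metric (f : R -> R) (gN : 'rV[R]_2 -> 'M[R]_2)
    (x : 'rV[R]_3) : 'M[R]_3 :=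
  block_mx 1%:M 0 0 (expR (2 * f (line_coord x)) *: gN (leaf_coord x))
  : 'M[R]_(1 + 2).

End WarpedProduct.

(* Main.v *)
(** Fix a point.  A linear map preserving h, S and K of order 3, together with the commutativity of
    the symmetry group, forces the normal form of K and S in an orthonormal basis e_1, e_2, e_3.  The
    axis e_1 is an eigenvector of an operator built from S and from the traces tr(K_v K_w), so it
    depends smoothly on the point, and e_2, e_3 follow by Gram-Schmidt and a rotation.

    Write D_{e_i} E_j = sum_k w_ijk E_k + delta_ij xi for the images E_j of the frame in R^4.  The
    flatness of D (Gauss equation), compared with the normal form of K, makes e_1 geodesic with
    D_{e_i} E_1 = k E_i for i = 2, 3, where k and mu_1 have no derivative along e_2, e_3; hence
    eta = k + mu_1, and eta is constant on the leaves tangent to e_2, e_3.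

    No Frobenius theorem is needed: E_1 - k (G - G(x_0)) is constant along e_2 and e_3, so one of its
    components is a first coordinate, up to a reparametrization; the plane G + span(E_1, xi) is
    constant along e_1, so its intersection with a fixed plane provides the two others.  In these
    coordinates e_1 = d/dt, and the Koszul formula turns nabla^_v e_1 = eta v into d_t h = 2 eta h
    on the leaves. *)

Require Import Defs.
From HB Require Import structures.
From mathcomp Require Import all_boot all_order all_algebra all_fingroup.
From mathcomp Require Import all_classical all_reals all_analysis.
From mathcomp Require Import ring lra.
Import Order.TTheory GRing.Theory Num.Theory.
Import numFieldNormedType.Exports.
Local Open Scope classical_set_scope.
Local Open Scope ring_scope.

(** * Smooth maps *)

(** The symmetry hypothesis concerns each point separately: neither the group elements nor the
    frames are related from one point to the next, so the smooth frame has to be rebuilt from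
    tensors that are visibly smooth. Commutativity of the group is what makes the axis visible. In
    the normal form with parameters [mu], [p], [l], [a], the form tr(K_v K_w) has the eigenvalue 6
    mu^2 on the axis and 2 mu^2 + 2 p^2 on the plane, while S has [l] and [a]. If both pairs
    coincide, K has the rotational symmetries of a regular tetrahedron; if mu = 0 there are
    additional half-turns. Both groups are noncommutative, so one of the two operators always
    isolates the axis. After that, one device carries the proof: the E_i are maps into R^4, so Gauss
    and Codazzi equations are equalities of mixed derivatives, and uniqueness of the decomposition
    along E_1, E_2, E_3, xi transports the structure through a change of chart. *)

Section SmoothBasics.
Context {R : realType}.

(** Finite-order regularity, peeling off the innermost derivative first, so that closure properties
    go by induction on [k]: the derivative of a product, a composite or an inverse is assembled from
    pieces of one order less. *)
Fixpoint differentiable_n {V W : normedModType R} (k : nat) (U : set V) (f : V -> W) : Prop :=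
  (forall x, U x -> differentiable f x) /\
  (if k is k'.+1 then forall v, differentiable_n k' U (fun x => 'D_v f x) else True).

Lemma differentiable_n_differentiable {V W : normedModType R} k (U : set V) (f : V -> W) x :
  differentiable_n k U f -> U x -> differentiable f x.
Proof. by case: k => [|k] [df _]; apply: df. Qed.

Lemma differentiable_nW {V W : normedModType R} k (U : set V) (f : V -> W) :
  differentiable_n k.+1 U f -> differentiable_n k U f.
Proof.
elim: k f => [|k IH] f [df Df]; split => // v.
exact/IH/Df.
Qed.

Lemma iter_derive_rcons {V W : normedModType R} vs v (f : V -> W) :
  iter_derive (rcons vs v) f = iter_derive vs (fun x => 'D_v f x).
Proof. by rewrite /iter_derive -cats1 foldr_cat. Qed.

Lemma smooth_onP {V W : normedModType R} (U : set V) (f : V -> W) :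
  smooth_on U f <-> forall k, differentiable_n k U f.
Proof.
split=> [sf k|nf vs].
  elim: k f sf => [|k IH] f sf; split => //; [exact: (sf [::])|exact: (sf [::])|].
  by move=> v; apply: IH => vs; rewrite -iter_derive_rcons; apply: sf.
have : differentiable_n (size vs) U f by exact: nf.
elim/last_ind: vs f {nf} => [|vs v IH] f; first by move=> /= [df _] x; apply: df.
by rewrite size_rcons iter_derive_rcons => -[_ Df]; apply: IH (Df v).
Qed.

Lemma smooth_on_differentiable {V W : normedModType R} (U : set V) (f : V -> W) x :
  smooth_on U f -> U x -> differentiable f x.
Proof. by move=> sf; apply: (sf [::]). Qed.

Lemma smooth_on_derive {V W : normedModType R} (U : set V) (f : V -> W) v :
  smooth_on U f -> smooth_on U (fun x => 'D_v f x).
Proof. by move=> sf vs; rewrite -iter_derive_rcons; apply: sf. Qed.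

Lemma smooth_onS {V W : normedModType R} (U U' : set V) (f : V -> W) :
  U' `<=` U -> smooth_on U f -> smooth_on U' f.
Proof. by move=> sU sf vs x /sU; apply: sf. Qed.

(** Trades the little-o of the definition for an explicit epsilon estimate and identifies the
    differential at the same time; differentiability of a local inverse is proved in this form. *)
Lemma differentiableP_le {V W : normedModType R} (f : V -> W) (L : {linear V -> W}) x :
  continuous L ->
  (forall e, 0 < e -> \forall h \near (0 : V), `|f (h + x) - f x - L h| <= e * `|h|) ->
  differentiable f x /\ 'd f x = L :> (V -> W).
Proof.
move=> Lc fL.
have fE : f \o shift x = cst (f x) + L +o_ (0 : V) id.
  apply/eqaddoP => e e0; have := fL e e0; apply: filterS => h /=.
  by rewrite !fctE opprD addrA.
have dE := @diff_unique _ _ _ f L x Lc fE.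
by split => //; apply/diff_locallyP; rewrite dE.
Qed.

Lemma differentiable_le {V W : normedModType R} (f : V -> W) x e :
  differentiable f x -> 0 < e ->
  \forall h \near (0 : V), `|f (h + x) - f x - 'd f x h| <= e * `|h|.
Proof.
move=> /diff_locallyP[_ /eqaddoP fE] e0.
by have := fE e e0; apply: filterS => h /=; rewrite !fctE opprD addrA.
Qed.

Lemma near_eq_differentiable {V W : normedModType R} (f g : V -> W) x :
  {near x, f =1 g} -> differentiable f x -> differentiable g x.
Proof.
move=> fg df; have fgx : f x = g x := nbhs_singleton fg.
apply: (proj1 (differentiableP_le g ('d f x) x _ _)) => [|e e0]; first exact: diff_continuous.
have := differentiable_le _ _ _ df e0.
have : \forall h \near (0 : V), f (h + x) = g (h + x).
  by move: fg; rewrite [X in X -> _](near_shift 0) /= subr0.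
by apply: filterS2 => h <-; rewrite -fgx.
Qed.

Lemma eq_in_near {V : normedModType R} {W : Type} (U : set V) (f g : V -> W) x :
  open U -> U x -> (forall y, U y -> f y = g y) -> {near x, f =1 g}.
Proof. by move=> oU Ux fg; near=> y; apply: fg; near: y; apply: open_nbhs_nbhs. Unshelve. all: by end_near. Qed.

Lemma eq_in_derive {V W : normedModType R} (U : set V) (f g : V -> W) x v :
  open U -> U x -> (forall y, U y -> f y = g y) -> 'D_v f x = 'D_v g x.
Proof. by move=> oU Ux fg; apply: near_eq_derive; apply: eq_in_near fg. Qed.

(** Rules of differentiation give formulas valid only at points of [U]. As [U] is open, two
    functions that agree on it agree near each of its points, so a derivative may be replaced by its
    formula in every closure proof below. *)
Lemma eq_in_differentiable_n {V W : normedModType R} k (U : set V) (f g : V -> W) :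
  open U -> (forall y, U y -> f y = g y) -> differentiable_n k U f -> differentiable_n k U g.
Proof.
move=> oU; elim: k f g => [|k IH] f g fg [df Df]; split => //.
- by move=> x Ux; apply: near_eq_differentiable (df _ Ux); apply: eq_in_near fg.
- by move=> x Ux; apply: near_eq_differentiable (df _ Ux); apply: eq_in_near fg.
- move=> v; apply: IH (Df v) => y Uy; exact: eq_in_derive fg.
Qed.

Lemma eq_in_smooth_on {V W : normedModType R} (U : set V) (f g : V -> W) :
  open U -> (forall y, U y -> f y = g y) -> smooth_on U f -> smooth_on U g.
Proof.
by move=> oU fg /smooth_onP nf; apply/smooth_onP => k; apply: eq_in_differentiable_n fg (nf k).
Qed.

Lemma differentiable_n_cst {V W : normedModType R} k (U : set V) (w : W) :
  differentiable_n k U (cst w : V -> W).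
Proof.
elim: k w => [|k IH] w; split => //; try by move=> x _; apply: differentiable_cst.
by move=> v; rewrite (_ : (fun _ => _) = cst 0) //; apply/funext => x; rewrite derive_cst.
Qed.

Lemma smooth_on_cst {V W : normedModType R} (U : set V) (w : W) : smooth_on U (fun _ : V => w).
Proof. by apply/smooth_onP => k; apply: differentiable_n_cst. Qed.

Section Open.
Context {V : normedModType R} (U : set V) (oU : open U).

Lemma differentiable_nD {W : normedModType R} k (f g : V -> W) :
  differentiable_n k U f -> differentiable_n k U g ->
  differentiable_n k U (fun x => f x + g x).
Proof.
elim: k f g => [|k IH] f g nf ng; have df := fun x => differentiable_n_differentiable _ _ _ x nf;
  have dg := fun x => differentiable_n_differentiable _ _ _ x ng;
  split => //; try by (move=> x Ux; apply: differentiableD; [exact: df|exact: dg]).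
move=> v; apply: (eq_in_differentiable_n k U (fun x => 'D_v f x + 'D_v g x)) => // [x Ux|].
  by rewrite (deriveD (f := f) (g := g)) //; apply: diff_derivable; [apply: df|apply: dg].
by apply: IH; [have [_] := nf|have [_] := ng]; apply.
Qed.

Lemma smooth_onD {W : normedModType R} (f g : V -> W) :
  smooth_on U f -> smooth_on U g -> smooth_on U (fun x => f x + g x).
Proof. by move=> /smooth_onP nf /smooth_onP ng; apply/smooth_onP => k; apply: differentiable_nD. Qed.

Lemma smooth_on_sum {W : normedModType R} {I : Type} (r : seq I) (P : pred I) (f : I -> V -> W) :
  (forall i, P i -> smooth_on U (f i)) -> smooth_on U (fun x => \sum_(i <- r | P i) f i x).
Proof.
move=> sf; elim: r => [|i r IH].
  by under eq_fun do rewrite big_nil; apply: smooth_on_cst.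
under eq_fun do rewrite big_cons.
case: (boolP (P i)) => [Pi|_]; last exact: IH.
by apply: smooth_onD => //; apply: sf.
Qed.

Lemma differentiable_n_sum {W : normedModType R} k {I : Type} (r : seq I) (P : pred I) (f : I -> V -> W) :
  (forall i, P i -> differentiable_n k U (f i)) -> differentiable_n k U (fun x => \sum_(i <- r | P i) f i x).
Proof.
move=> sf; elim: r => [|i r IH].
  by under eq_fun do rewrite big_nil; apply: differentiable_n_cst.
under eq_fun do rewrite big_cons.
case: (boolP (P i)) => [Pi|_]; last exact: IH.
by apply: differentiable_nD => //; apply: sf.
Qed.

Lemma differentiable_nM k (f g : V -> R) :
  differentiable_n k U f -> differentiable_n k U g ->
  differentiable_n k U (fun x => f x * g x).
Proof.
elim: k f g => [|k IH] f g nf ng; have df := fun x => differentiable_n_differentiable _ _ _ x nf;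
  have dg := fun x => differentiable_n_differentiable _ _ _ x ng;
  split => //; try by (move=> x Ux; apply: differentiableM; [exact: df|exact: dg]).
move=> v; apply: (eq_in_differentiable_n k U (fun x => f x * 'D_v g x + g x * 'D_v f x)) => // [x Ux|].
  by rewrite (deriveM (f := f) (g := g)) //; apply: diff_derivable; [apply: df|apply: dg].
by apply: differentiable_nD; apply: IH; do ?[exact: differentiable_nW];
  [have [_] := ng|have [_] := nf]; apply.
Qed.

Lemma smooth_onM (f g : V -> R) :
  smooth_on U f -> smooth_on U g -> smooth_on U (fun x => f x * g x).
Proof. by move=> /smooth_onP nf /smooth_onP ng; apply/smooth_onP => k; apply: differentiable_nM. Qed.

Lemma smooth_onN (f : V -> R) : smooth_on U f -> smooth_on U (fun x => - f x).
Proof.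
move=> sf; under eq_fun do rewrite -mulN1r; apply: smooth_onM => //.
exact: smooth_on_cst.
Qed.

Lemma smooth_onB (f g : V -> R) :
  smooth_on U f -> smooth_on U g -> smooth_on U (fun x => f x - g x).
Proof. by move=> sf sg; apply: smooth_onD => //; apply: smooth_onN. Qed.

Lemma differentiable_n_prod k {I : Type} (r : seq I) (P : pred I) (f : I -> V -> R) :
  (forall i, P i -> differentiable_n k U (f i)) ->
  differentiable_n k U (fun x => \prod_(i <- r | P i) f i x).
Proof.
move=> sf; elim: r => [|i r IH].
  by under eq_fun do rewrite big_nil; apply: differentiable_n_cst.
under eq_fun do rewrite big_cons.
case: (boolP (P i)) => [Pi|_]; last exact: IH.
by apply: differentiable_nM => //; apply: sf.
Qed.

Lemma smooth_onX n (f : V -> R) : smooth_on U f -> smooth_on U (fun x => f x ^+ n).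
Proof.
move=> sf; elim: n => [|n IH]; first exact: smooth_on_cst.
by under eq_fun do rewrite exprS; apply: smooth_onM.
Qed.

Lemma differentiable_mx {m n} (f : V -> 'M[R]_(m, n)) x :
  (forall i j, differentiable (fun y => f y i j) x) -> differentiable f x.
Proof.
move=> df; rewrite (_ : f = \sum_(i < m) (\sum_(j < n) (fun y => f y i j *: delta_mx i j))).
  apply: differentiable_sum => i; apply: differentiable_sum => j.
  exact: differentiableZl.
apply/funext => y; rewrite [LHS]matrix_sum_delta fct_sumE.
by apply: eq_bigr => i _; rewrite fct_sumE.
Qed.

Lemma differentiable_mxE {m n} (f : V -> 'M[R]_(m, n)) x i j :
  differentiable f x -> differentiable (fun y => f y i j) x.
Proof.
by move=> df; apply: (differentiable_comp df (differentiable_coord _ i j)).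
Qed.

Lemma derive_mxE {m n} (f : V -> 'M[R]_(m, n)) x v i j :
  differentiable f x -> ('D_v f x) i j = 'D_v (fun y => f y i j) x.
Proof. by move=> df; rewrite derive_mx ?mxE //; apply: diff_derivable. Qed.

Lemma differentiable_n_mxP {m n} k (f : V -> 'M[R]_(m, n)) :
  differentiable_n k U f <-> forall i j, differentiable_n k U (fun x => f x i j).
Proof.
split.
  elim: k f => [|k IH] f [df Df] i j; split => //;
    try by (move=> x Ux; apply: differentiable_mxE; apply: df).
  move=> v; apply: (eq_in_differentiable_n k U (fun x => ('D_v f x) i j)) => // [x Ux|].
    by rewrite derive_mxE //; apply: df.
  exact: IH (Df v) i j.
elim: k f => [|k IH] f nf; split => //;
  try by (move=> x Ux; apply: differentiable_mx => i j; apply: differentiable_n_differentiable (nf i j) Ux).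
move=> v; apply: IH => i j.
apply: (eq_in_differentiable_n k U (fun x => 'D_v (fun y => f y i j) x)) => // [x Ux|].
  rewrite derive_mxE //; apply: differentiable_mx => i' j'; apply: differentiable_n_differentiable (nf i' j') Ux.
by have [_] := nf i j; apply.
Qed.

Lemma smooth_on_mxP {m n} (f : V -> 'M[R]_(m, n)) :
  smooth_on U f <-> forall i j, smooth_on U (fun x => f x i j).
Proof.
split=> [/smooth_onP nf i j|nf].
  by apply/smooth_onP => k; apply: (differentiable_n_mxP k f).1.
by apply/smooth_onP => k; apply/differentiable_n_mxP => i j; have /smooth_onP := nf i j; apply.
Qed.

Lemma smooth_on_mulmx {m n p} (f : V -> 'M[R]_(m, n)) (g : V -> 'M[R]_(n, p)) :
  smooth_on U f -> smooth_on U g -> smooth_on U (fun x => f x *m g x).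
Proof.
move=> /smooth_on_mxP sf /smooth_on_mxP sg; apply/smooth_on_mxP => i j.
by under eq_fun do rewrite mxE; apply: smooth_on_sum => l _; apply: smooth_onM.
Qed.

Lemma smooth_on_tr {m n} (f : V -> 'M[R]_(m, n)) :
  smooth_on U f -> smooth_on U (fun x => (f x)^T).
Proof.
move=> /smooth_on_mxP sf; apply/smooth_on_mxP => i j; under eq_fun do rewrite mxE; exact: sf.
Qed.

Lemma smooth_onZ {m n} (k : V -> R) (f : V -> 'M[R]_(m, n)) :
  smooth_on U k -> smooth_on U f -> smooth_on U (fun x => k x *: f x).
Proof.
move=> sk /smooth_on_mxP sf; apply/smooth_on_mxP => i j.
by under eq_fun do rewrite mxE; apply: smooth_onM.
Qed.

Lemma smooth_on_oppmx {m n} (f : V -> 'M[R]_(m, n)) :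
  smooth_on U f -> smooth_on U (fun x => - f x).
Proof.
move=> sf; under eq_fun do rewrite -scaleN1r; apply: smooth_onZ => //.
exact: smooth_on_cst.
Qed.

Lemma smooth_on_submx {m n} (f g : V -> 'M[R]_(m, n)) :
  smooth_on U f -> smooth_on U g -> smooth_on U (fun x => f x - g x).
Proof. by move=> sf sg; apply: smooth_onD => //; apply: smooth_on_oppmx. Qed.

Lemma differentiable_n_det k {n} (f : V -> 'M[R]_n) :
  differentiable_n k U f -> differentiable_n k U (fun x => \det (f x)).
Proof.
move=> /differentiable_n_mxP nf; apply: differentiable_n_sum => s _.
apply: differentiable_nM; first exact: differentiable_n_cst.
by apply: differentiable_n_prod => i _; exact: nf.
Qed.

Lemma differentiable_n_adj k {n} (f : V -> 'M[R]_n) :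
  differentiable_n k U f -> differentiable_n k U (fun x => \adj (f x)).
Proof.
move=> /differentiable_n_mxP nf; apply/differentiable_n_mxP => i j; under eq_fun do rewrite mxE.
apply: differentiable_nM; first exact: differentiable_n_cst.
apply: differentiable_n_det; apply/differentiable_n_mxP => i' j'; under eq_fun do rewrite !mxE.
exact: nf.
Qed.

End Open.
End SmoothBasics.

Local Opaque smooth_on.

Section SmoothComposition.
Context {R : realType}.

Lemma derive_comp {V V' W : normedModType R} (f : V -> V') (g : V' -> W) x v :
  differentiable f x -> differentiable g (f x) ->
  'D_v (fun y => g (f y)) x = 'D_('D_v f x) g (f x).
Proof.
move=> df dg; rewrite (deriveE (f := g \o f)); last exact: differentiable_comp.
by rewrite diff_comp //= !deriveE.
Qed.

Lemma derive_rV {W : normedModType R} {n} (g : 'rV[R]_n -> W) y w :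
  differentiable g y -> 'D_w g y = \sum_(j < n) w 0 j *: 'D_(unit_vec j) g y.
Proof.
move=> dg; rewrite deriveE // [in LHS](row_sum_delta w) linear_sum.
by apply: eq_bigr => j _; rewrite linearZ /= deriveE.
Qed.

(** The derivative of the composite is a sum of components of D_v f times partial derivatives of [g]
    composed with the same [f], so the induction varies [g] and only lowers the order of [f]. *)
Lemma differentiable_n_comp {V : normedModType R} {n} k (U : set V) (U' : set 'rV[R]_n)
    (f : V -> 'rV[R]_n) (g : 'rV[R]_n -> R) :
  open U -> (forall x, U x -> U' (f x)) ->
  differentiable_n k U f -> differentiable_n k U' g ->
  differentiable_n k U (fun x => g (f x)).
Proof.
move=> oU UU'; elim: k f g UU' => [|k IH] f g UU' nf ng;
  have df := fun x => differentiable_n_differentiable _ _ _ x nf;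
  have dg := fun x => differentiable_n_differentiable _ _ _ x ng;
  have dgf : forall x, U x -> differentiable (fun x => g (f x)) x
    by move=> x Ux; apply: (@differentiable_comp _ _ _ _ f g); [exact: df|exact/dg/UU'].
  by split.
split => // v.
apply: (eq_in_differentiable_n k U (fun x => \sum_(j < n) ('D_v f x) 0 j * 'D_(unit_vec j) g (f x))) => //.
  move=> x Ux; rewrite (derive_comp f g); [|by apply: df|by apply/dg/UU'].
  by rewrite derive_rV //; apply/dg/UU'.
apply: differentiable_n_sum => // j _; apply: differentiable_nM => //.
  by have [_ /(_ v)] := nf => /(differentiable_n_mxP U oU); apply.
apply: (IH f (fun y => 'D_(unit_vec j) g y)) => //; first exact: differentiable_nW.
by have [_] := ng; apply.
Qed.

Lemma differentiable_n_comp1 {V : normedModType R} k (U : set V) (U' : set R)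
    (f : V -> R) (g : R -> R) :
  open U -> (forall x, U x -> U' (f x)) ->
  differentiable_n k U f -> differentiable_n k U' g ->
  differentiable_n k U (fun x => g (f x)).
Proof.
move=> oU UU'; elim: k f g UU' => [|k IH] f g UU' nf ng;
  have df := fun x => differentiable_n_differentiable _ _ _ x nf;
  have dg := fun x => differentiable_n_differentiable _ _ _ x ng;
  have dgf : forall x, U x -> differentiable (fun x => g (f x)) x
    by move=> x Ux; apply: (@differentiable_comp _ _ _ _ f g); [exact: df|exact/dg/UU'].
  by split.
split => // v.
apply: (eq_in_differentiable_n k U (fun x => 'D_v f x * 'D_1 g (f x))) => //.
  move=> x Ux; rewrite (derive_comp f g); [|by apply: df|by apply/dg/UU'].
  have dgx : differentiable g (f x) by apply/dg/UU'.
  by rewrite !(deriveE (f := g)) // -[X in _ = 'd _ _ X]mulr1 [RHS]linearZ.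
apply: differentiable_nM => //; first by have [_] := nf; apply.
apply: (IH f (fun y => 'D_1 g y)) => //; first exact: differentiable_nW.
by have [_] := ng; apply.
Qed.

Lemma smooth_on_comp {V : normedModType R} {n m p} (U : set V) (U' : set 'rV[R]_n)
    (f : V -> 'rV[R]_n) (g : 'rV[R]_n -> 'M[R]_(m, p)) :
  open U -> open U' -> (forall x, U x -> U' (f x)) ->
  smooth_on U f -> smooth_on U' g -> smooth_on U (fun x => g (f x)).
Proof.
move=> oU oU' UU' /smooth_onP nf sg; apply/smooth_on_mxP => // i j; apply/smooth_onP => k.
apply: (differentiable_n_comp k U U' f (fun y => g y i j)) => //.
by move: k; apply/smooth_onP; move/smooth_on_mxP : sg; apply.
Qed.

Lemma smooth_on_compR {V : normedModType R} {n} (U : set V) (U' : set 'rV[R]_n)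
    (f : V -> 'rV[R]_n) (g : 'rV[R]_n -> R) :
  open U -> (forall x, U x -> U' (f x)) ->
  smooth_on U f -> smooth_on U' g -> smooth_on U (fun x => g (f x)).
Proof.
move=> oU UU' /smooth_onP nf /smooth_onP ng; apply/smooth_onP => k.
exact: (differentiable_n_comp k U U' f g).
Qed.

Lemma smooth_on_comp1 {V : normedModType R} (U : set V) (U' : set R)
    (f : V -> R) (g : R -> R) :
  open U -> (forall x, U x -> U' (f x)) ->
  smooth_on U f -> smooth_on U' g -> smooth_on U (fun x => g (f x)).
Proof.
move=> oU UU' /smooth_onP nf /smooth_onP ng; apply/smooth_onP => k.
exact: (differentiable_n_comp1 k U U' f g).
Qed.

Lemma differentiable_nV {V : normedModType R} k (U : set V) (f : V -> R) :
  open U -> (forall x, U x -> f x != 0) -> differentiable_n k U f ->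
  differentiable_n k U (fun x => (f x)^-1).
Proof.
move=> oU f0; elim: k => [|k IH] nf; have df := fun x => differentiable_n_differentiable _ _ _ x nf.
  by split=> // x Ux; apply: differentiableV; [exact: df|exact: f0].
split => [x Ux|v]; first by apply: differentiableV; [exact: df|exact: f0].
apply: (eq_in_differentiable_n k U (fun x => - 1 * ((f x)^-1 * (f x)^-1) * 'D_v f x)) => //.
  move=> x Ux; rewrite (deriveV (f := f)) ?f0 //; last by apply: diff_derivable; exact: df.
  by rewrite mulN1r -expr2 -exprVn.
apply: differentiable_nM => //; last by have [_] := nf; apply.
apply: differentiable_nM => //; first exact: differentiable_n_cst.
by apply: differentiable_nM => //; apply: IH; exact: differentiable_nW.
Qed.

Lemma smooth_onV {V : normedModType R} (U : set V) (f : V -> R) :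
  open U -> (forall x, U x -> f x != 0) -> smooth_on U f -> smooth_on U (fun x => (f x)^-1).
Proof. by move=> oU f0 /smooth_onP nf; apply/smooth_onP => k; apply: differentiable_nV. Qed.

(** Cramer's rule: the adjugate and the determinant are polynomials in the entries. *)
Lemma differentiable_n_invmx {V : normedModType R} k {n} (U : set V) (f : V -> 'M[R]_n) :
  open U -> (forall x, U x -> f x \in unitmx) -> differentiable_n k U f ->
  differentiable_n k U (fun x => invmx (f x)).
Proof.
move=> oU fu nf; apply: (eq_in_differentiable_n k U (fun x => (\det (f x))^-1 *: \adj (f x))) => //.
  by move=> x Ux; rewrite /invmx fu.
apply/differentiable_n_mxP => // i j; under eq_fun do rewrite mxE.
apply: differentiable_nM => //.
  apply: differentiable_nV => //; last exact: differentiable_n_det.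
  by move=> x /fu; rewrite unitmxE unitfE.
by have /(differentiable_n_mxP _ oU) := differentiable_n_adj _ oU _ _ nf; apply.
Qed.

Lemma smooth_on_invmx {V : normedModType R} {n} (U : set V) (f : V -> 'M[R]_n) :
  open U -> (forall x, U x -> f x \in unitmx) -> smooth_on U f ->
  smooth_on U (fun x => invmx (f x)).
Proof. by move=> oU fu /smooth_onP nf; apply/smooth_onP => k; apply: differentiable_n_invmx. Qed.

(** One order is gained over the derivative. This bootstraps functions known through their
    derivative: [sqrt], [sin], [cos], [atan], and later the reparametrization of the axis and the
    warping function. *)
Lemma differentiable_n_antiderivative k (U : set R) (f g : R -> R) :
  open U -> (forall t, U t -> is_derive t 1 f (g t)) -> differentiable_n k U g -> differentiable_n k.+1 U f.
Proof.
move=> oU fg ng.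
have df t : U t -> differentiable f t.
  by move=> Ut; apply/derivable1_diffP; have [] := fg _ Ut.
split => // v; apply: (eq_in_differentiable_n k U (fun t => v * g t)) => //.
  move=> t Ut; have [_ <-] := fg _ Ut; rewrite !deriveE; try exact: df.
  by rewrite -[v in RHS]mulr1 [RHS]linearZ.
by apply: differentiable_nM => //; apply: differentiable_n_cst.
Qed.

Lemma smooth_on_antiderivative (U : set R) (f g : R -> R) :
  open U -> (forall t, U t -> is_derive t 1 f (g t)) -> smooth_on U g -> smooth_on U f.
Proof.
move=> oU fg /smooth_onP ng; apply/smooth_onP => k.
by apply: differentiable_nW; apply: differentiable_n_antiderivative (ng k).
Qed.

Lemma differentiable_n_id {V : normedModType R} k (U : set V) : differentiable_n k U (fun x : V => x).
Proof.
case: k => [|k]; split => //; try by move=> x _; apply: ex_diff.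
move=> v; rewrite (_ : (fun _ => _) = cst v); first exact: differentiable_n_cst.
by apply/funext => x; rewrite derive_id.
Qed.

Lemma smooth_on_sqrt : smooth_on [set t : R | 0 < t] Num.sqrt.
Proof.
have oU : open [set t : R | 0 < t] by exact: open_gt.
have ds (t : R) : 0 < t -> is_derive t 1 Num.sqrt (2 * Num.sqrt t)^-1.
  by move=> t0; apply: is_derive1_sqrt.
apply/smooth_onP; elim=> [|k IH].
  by split => // t t0; apply/derivable1_diffP; have [] := ds _ t0.
(* The derivative (2 sqrt t)^-1 is as regular as the square root itself, so order [k] feeds back
   into order [k.+1]. *)
apply: differentiable_n_antiderivative oU ds _.
apply: (differentiable_n_comp1 k _ [set t : R | t != 0] (fun t => 2 * Num.sqrt t) (fun t => t^-1)) => //.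
- by move=> t /= t0; rewrite mulf_neq0 // gt_eqF // sqrtr_gt0.
- by apply: differentiable_nM => //; exact: differentiable_n_cst.
- move: k {IH}; apply/smooth_onP; apply: smooth_onV => //.
  by apply/smooth_onP => k; apply: differentiable_n_id.
Qed.

Lemma smooth_on_id {V : normedModType R} (U : set V) : smooth_on U (fun x : V => x).
Proof. by apply/smooth_onP => k; exact: differentiable_n_id. Qed.

Lemma smooth_on_coord {m n} (U : set 'M[R]_(m, n)) i j : open U -> smooth_on U (fun x => x i j).
Proof. by move=> oU; move/(smooth_on_mxP _ oU) : (smooth_on_id U); apply. Qed.

Lemma smooth_on_sin_cos : smooth_on setT (@sin R) /\ smooth_on setT (@cos R).
Proof.
suff H k : differentiable_n k setT (@sin R) /\ differentiable_n k setT (@cos R).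
  by split; apply/smooth_onP => k; have [] := H k.
elim: k => [|k [IHs IHc]].
  by split; split => // t _; apply/derivable1_diffP; [exact: derivable_sin|exact: derivable_cos].
split; first by apply: differentiable_n_antiderivative openT _ IHc => // t _; exact: is_derive_sin.
apply: (differentiable_n_antiderivative k setT cos (fun x => - 1 * sin x) openT).
  by move=> t _; rewrite mulN1r; exact: is_derive_cos.
by apply: (differentiable_nM _ openT) => //; exact: differentiable_n_cst.
Qed.

Lemma smooth_on_atan : smooth_on setT (@atan R).
Proof.
apply: (smooth_on_antiderivative setT atan (fun x => (1 + x ^+ 2)^-1) openT) => //.
apply: (smooth_onV _ _ openT); first by move=> x _; rewrite gt_eqF // ltr_pwDl // sqr_ge0.
by apply: (smooth_onD _ openT); [exact: smooth_on_cst|apply: (smooth_onX _ openT); exact: smooth_on_id].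
Qed.

End SmoothComposition.

(** * Symmetry of second derivatives *)

Section Schwarz.
Context {R : realType} {V : normedModType R}.

Lemma is_derive_line (f : V -> R) (v y : V) (s : R) :
  differentiable f (s *: v + y) ->
  is_derive s 1 (fun r : R => f (r *: v + y)) ('D_v f (s *: v + y)).
Proof.
move=> df.
have dl : is_diff s (fun r : R => r *: v + y) (fun r => r *: v + 0).
  by apply: is_diff_eq.
have dl' : differentiable (fun r : R => r *: v + y) s by apply: ex_diff.
have dfl : differentiable (fun r : R => f (r *: v + y)) s.
  exact: (@differentiable_comp _ _ _ _ (fun r : R => r *: v + y) f).
apply: DeriveDef; first exact/derivable1_diffP.
rewrite (derive_comp (fun r : R => r *: v + y) f) //; congr ('D__ f _).
by rewrite deriveE // diff_val /= scale1r addr0.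
Qed.

Lemma MVT_line (f : V -> R) (v y : V) (t : R) : 0 < t ->
  (forall s, 0 <= s <= t -> differentiable f (s *: v + y)) ->
  exists2 s : R, 0 < s < t & f (t *: v + y) - f y = t * 'D_v f (s *: v + y).
Proof.
move=> t0 df.
have [||s] := @MVT R (fun r => f (r *: v + y)) (fun s => 'D_v f (s *: v + y)) 0 t t0.
- by move=> s; rewrite in_itv /= => /andP[s0 st]; apply: is_derive_line; apply: df; rewrite !ltW.
- apply: derivable_within_continuous => s; rewrite in_itv /= => st.
  by have [] := is_derive_line f v y s (df _ st).
- by rewrite in_itv /= => st; rewrite subr0 scale0r add0r mulrC => ?; exists s.
Qed.

(** The mean value theorem in the direction [v] turns the mixed second difference into [t] times a
    difference of values of D_v f, which is then linearized at [x]. The second difference is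
    symmetric in [v] and [w] while its limit is computed asymmetrically, so applying the estimate in
    both orders gives Schwarz's theorem. *)
Lemma second_difference_le (f : V -> R) (U : set V) (x v w : V) (e : R) :
  open U -> U x -> smooth_on U f -> 0 < e ->
  exists2 d : R, 0 < d & forall t : R, 0 < t < d ->
   `|f (t *: w + (t *: v + x)) - f (t *: v + x) - (f (t *: w + x) - f x)
      - t ^+ 2 * 'D_w (fun y => 'D_v f y) x| <= t ^+ 2 * (e * (2 * `|v| + `|w|)).
Proof.
move=> oU Ux sf e0.
have dDf : differentiable (fun y => 'D_v f y) x.
  exact: smooth_on_differentiable (smooth_on_derive _ _ _ sf) Ux.
have [r /= r0 rU] : nbhs_ball x U by apply/nbhs_ballP; apply: open_nbhs_nbhs.
have /nbhs_normP[d /= d0 Hd] := differentiable_le _ _ _ dDf e0.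
set c := `|v| + `|w| + 1.
have c0 : 0 < c by rewrite ltr_pwDr // addr_ge0.
exists (Num.min r d / c) => [|t]; first by rewrite divr_gt0 // lt_min r0.
rewrite ltr_pdivlMr // lt_min => /andP[t0 /andP[tr td]].
have hle (s q : R) : 0 <= s <= t -> 0 <= q <= t -> `|s *: v + q *: w| <= t * (`|v| + `|w|).
  move=> /andP[s0 st] /andP[q0 qt]; rewrite (le_trans (ler_normD _ _)) // !normrZ mulrDr.
  by rewrite !ger0_norm // lerD // ler_wpM2r.
have hc (s q : R) : 0 <= s <= t -> 0 <= q <= t -> `|s *: v + q *: w| < t * c.
  by move=> hs hq; rewrite (le_lt_trans (hle _ _ hs hq)) // /c [ltRHS]mulrDr mulr1 ltrDl.
have UU (s q : R) : 0 <= s <= t -> 0 <= q <= t -> U (s *: v + (q *: w + x)).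
  move=> hs hq; apply: rU; rewrite -ball_normE /= addrA opprD addrCA subrr addr0 normrN.
  exact: lt_trans (hc _ _ hs hq) tr.
have tt : 0 <= t <= t by rewrite ltW //=.
have t00 : (0 : R) <= 0 <= t by apply/andP; split => //; apply: ltW.
have dfU (s q : R) : 0 <= s <= t -> 0 <= q <= t -> differentiable f (s *: v + (q *: w + x)).
  by move=> hs hq; apply: smooth_on_differentiable sf _; apply: UU.
have dfU0 (s : R) : 0 <= s <= t -> differentiable f (s *: v + x).
  by move=> hs; have := dfU s 0 hs t00; rewrite scale0r add0r.
have dtr y : differentiable (fun y => t *: w + y) y by exact: ex_diff.
have Dtr y : 'D_v (fun y => t *: w + y) y = v.
  rewrite deriveE // (_ : (fun _ => _) = cst (t *: w) + id) // diffD; [|exact: differentiable_cst|exact: ex_diff].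
  by rewrite diff_cst diff_val /= add0r.
have [|s /andP[s0 st]] := MVT_line (fun y => f (t *: w + y) - f y) v x t t0.
  move=> s hs; apply: differentiableB; last exact: dfU0.
  by apply: (@differentiable_comp _ _ _ _ (fun y => t *: w + y) f); rewrite // addrCA; apply: dfU.
have hs : 0 <= s <= t by rewrite !ltW.
have dfs : differentiable f (t *: w + (s *: v + x)) by rewrite addrCA; apply: dfU.
rewrite (deriveB (f := fun y => f (t *: w + y)) (g := f)); last 2 first.
- by apply: diff_derivable; apply: (@differentiable_comp _ _ _ _ (fun y => t *: w + y) f).
- by apply: diff_derivable; apply: dfU0.
rewrite (derive_comp (fun y => t *: w + y) f) // Dtr => mvt.
rewrite mvt expr2 -!mulrA -mulrBr normrM gtr0_norm // ler_pM2l //.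
have H1 : `|s *: v + t *: w| <= t * (`|v| + `|w|) by apply: hle.
have H2 : `|s *: v| <= t * `|v| by rewrite normrZ gtr0_norm // ler_wpM2r // ltW.
have tcd (h : V) : `|h| < t * c -> `|'D_v f (h + x) - 'D_v f x - 'd (fun y => 'D_v f y) x h| <= e * `|h|.
  by move=> hc'; apply: Hd; rewrite /= sub0r normrN (lt_trans hc').
have B1 := tcd _ (hc s t hs tt).
have B2 := tcd (s *: v); rewrite -[s *: v]addr0 -[X in _ + X](scale0r w) in B2.
have {}B2 := B2 (hc s 0 hs t00); rewrite scale0r addr0 in B2.
rewrite (deriveE (f := fun y => 'D_v f y)) //.
rewrite linearD linearZ [in X in _ - (_ + X)]linearZ /= in B1; rewrite linearZ /= in B2.
rewrite [s *: v + t *: w]addrC -(addrA (t *: w) (s *: v) x) in B1.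
set A := 'D_v f _ in B1 *; set B := 'D_v f (s *: v + x) in B2 *.
set C := 'D_v f x in B1 B2.
set P := 'd _ x v in B1 B2; set Q := 'd _ x w in B1 *.
(* Both values of D_v f are compared with the linearization at [x]; the contributions [s *: P]
   cancel and only [t * Q] remains. *)
have -> : A - B - t * Q = (A - C - (s *: P + t *: Q)) - (B - C - s *: P).
  by rewrite /GRing.scale /=; ring.
rewrite (le_trans (ler_normB _ _)) // (le_trans (lerD B1 B2)) //.
rewrite -mulrDr [leRHS]mulrCA ler_wpM2l ?(ltW e0) //.
rewrite [t *: w + _]addrC (le_trans (lerD H1 H2)) // -mulrDr ler_pM2l // mulr_natl mulr2n.
by rewrite le_eqVlt; apply/orP; left; apply/eqP; rewrite addrAC.
Qed.

Lemma derive_derive_comm (f : V -> R) (U : set V) (x v w : V) :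
  open U -> U x -> smooth_on U f ->
  'D_w (fun y => 'D_v f y) x = 'D_v (fun y => 'D_w f y) x.
Proof.
move=> oU Ux sf; apply/eqP; rewrite -subr_eq0 -normr_le0 real_leNgt ?num_real //; apply/negP => D0.
pose X := 'D_w (fun y => 'D_v f y) x; pose Y := 'D_v (fun y => 'D_w f y) x.
rewrite -/X -/Y in D0; pose D := `|X - Y|; rewrite -/D in D0.
(* The two error terms add up to 3 (|v| + |w|) times the tolerance; one more unit makes the
   tolerance D / c too small to account for a discrepancy [D]. *)
set c := 3 * (`|v| + `|w|) + 1.
have c0 : 0 < c by rewrite ltr_wpDl // mulr_ge0 // addr_ge0.
have e0 : 0 < D / c by rewrite divr_gt0.
have [d1 d10 H1] := second_difference_le f U x v w _ oU Ux sf e0.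
have [d2 d20 H2] := second_difference_le f U x w v _ oU Ux sf e0.
pose t := Num.min d1 d2 / 2.
have t0 : 0 < t by rewrite divr_gt0 // lt_min d10.
have tm : t < Num.min d1 d2 by rewrite /t ltr_pdivrMr // ltr_pMr ?lt_min ?d10 // ltr1n.
move: tm; rewrite lt_min => /andP[td1 td2].
have {}H1 := H1 t _; have {}H2 := H2 t _.
rewrite t0 td1 in H1; rewrite t0 td2 in H2.
have {}H1 := H1 isT; have {}H2 := H2 isT.
rewrite [t *: v + (_ + _)]addrCA in H2.
rewrite -/X in H1; rewrite -/Y in H2.
set a := f _ in H1 H2; set b := f (t *: w + x) in H1 H2; set b' := f (t *: v + x) in H1 H2; set b'' := f x in H1 H2.
have t2 : 0 < t ^+ 2 by rewrite exprn_gt0.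
have : t ^+ 2 * D <= t ^+ 2 * (D / c * (3 * (`|v| + `|w|))).
  rewrite -[t ^+ 2 in leLHS](gtr0_norm t2) -normrM -/X.
  rewrite (_ : t ^+ 2 * (X - Y) = (a - b - (b' - b'') - t ^+ 2 * Y) - (a - b' - (b - b'') - t ^+ 2 * X)); last by ring.
  rewrite (le_trans (ler_normB _ _)) // (le_trans (lerD H2 H1)) //.
  by rewrite -mulrDr -mulrDr le_eqVlt; apply/orP; left; apply/eqP; ring.
rewrite ler_pM2l // mulrAC ler_pdivlMr // ler_pM2l // /c gerDl.
by rewrite ler10.
Qed.

End Schwarz.

(** * Product rule for matrices and Jacobi's formula for determinants *)

Section MatrixDerivatives.
Context {R : realType} {V : normedModType R}.

Lemma differentiable_mulmx {m n p} (f : V -> 'M[R]_(m, n)) (g : V -> 'M[R]_(n, p)) x :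
  differentiable f x -> differentiable g x -> differentiable (fun y => f y *m g y) x.
Proof.
move=> df dg; apply: differentiable_mx => i j; under eq_fun do rewrite mxE.
rewrite (_ : (fun _ => _) = \sum_k (fun y => f y i k * g y k j)); last first.
  by apply/funext => y; rewrite fct_sumE.
by apply: differentiable_sum => k; apply: differentiableM; apply: differentiable_mxE.
Qed.

Lemma derive_mulmx {m n p} (f : V -> 'M[R]_(m, n)) (g : V -> 'M[R]_(n, p)) x v :
  differentiable f x -> differentiable g x ->
  'D_v (fun y => f y *m g y) x = 'D_v f x *m g x + f x *m 'D_v g x.
Proof.
move=> df dg; apply/matrixP => i j; rewrite derive_mxE; last exact: differentiable_mulmx.
under eq_fun do rewrite mxE.
rewrite (_ : (fun _ => _) = \sum_k (fun y => f y i k * g y k j)); last first.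
  by apply/funext => y; rewrite fct_sumE.
have dfk k : derivable (fun y => f y i k) x v by apply: diff_derivable; apply: differentiable_mxE.
have dgk k : derivable (fun y => g y k j) x v by apply: diff_derivable; apply: differentiable_mxE.
rewrite derive_sum; last by move=> k; apply: derivableM.
rewrite !mxE -big_split /=; apply: eq_bigr => k _.
rewrite (deriveM (f := fun y => f y i k) (g := fun y => g y k j)) // !derive_mxE // addrC.
by congr (_ + _); apply: mulrC.
Qed.

Lemma derive_trmx {m n} (f : V -> 'M[R]_(m, n)) x v :
  differentiable f x -> 'D_v (fun y => (f y)^T) x = ('D_v f x)^T.
Proof.
move=> df; apply/matrixP => i j; rewrite mxE !derive_mxE //; last first.
  by apply: differentiable_mx => k l; under eq_fun do rewrite mxE; apply: differentiable_mxE.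
by under eq_fun do rewrite mxE.
Qed.

Lemma derive_prod {I : eqType} (r : seq I) (f : I -> V -> R) x v :
  uniq r -> (forall i, differentiable (f i) x) ->
  differentiable (fun y => \prod_(i <- r) f i y) x /\
  'D_v (fun y => \prod_(i <- r) f i y) x
  = \sum_(i <- r) 'D_v (f i) x * \prod_(j <- r | j != i) f j x.
Proof.
move=> + df; elim: r => [_|a r IH /= /andP[ar ur]].
  under eq_fun do rewrite big_nil; rewrite big_nil; split; first exact: differentiable_cst.
  exact: derive_cst.
have [dr Dr] := IH ur.
under eq_fun do rewrite big_cons; split; first exact: differentiableM.
rewrite (deriveM (f := f a) (g := fun y => \prod_(i <- r) f i y)); try exact: diff_derivable.
rewrite Dr [RHS]big_cons [in RHS]big_cons eqxx /= addrC; congr (_ + _).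
  rewrite /GRing.scale /= mulrC; congr (_ * _).
  rewrite [RHS]big_seq_cond [LHS]big_seq; apply: eq_bigl => j.
  by case: (boolP (j \in r)) => //= jr; apply/esym; apply: contraNneq ar => <-.
rewrite /GRing.scale /= mulr_sumr [LHS]big_seq [RHS]big_seq; apply: eq_bigr => i ir.
rewrite big_cons; case: eqVneq => [ai|_]; first by rewrite ai ir in ar.
by rewrite mulrCA.
Qed.

Lemma derive_sum_seq {W : normedModType R} {I : Type} (r : seq I) (f : I -> V -> W) x v :
  (forall i, differentiable (f i) x) ->
  differentiable (fun y => \sum_(i <- r) f i y) x /\
  'D_v (fun y => \sum_(i <- r) f i y) x = \sum_(i <- r) 'D_v (f i) x.
Proof.
move=> df; elim: r => [|a r [dr Dr]].
  under eq_fun do rewrite big_nil; rewrite big_nil; split; first exact: differentiable_cst.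
  exact: derive_cst.
under eq_fun do rewrite big_cons; rewrite big_cons; split; first exact: differentiableD.
by rewrite (deriveD (f := f a) (g := fun y => \sum_(i <- r) f i y)) ?Dr //; exact: diff_derivable.
Qed.

(** In the Leibniz expansion at the identity only the identity permutation survives: any other one
    moves at least two indices, so after one factor has been differentiated an off-diagonal zero is
    still left. *)
Lemma derive_det1 {n} (f : V -> 'M[R]_n) x v :
  differentiable f x -> f x = 1%:M ->
  differentiable (fun y => \det (f y)) x /\ 'D_v (fun y => \det (f y)) x = \tr ('D_v f x).
Proof.
move=> df fx1.
have dfi i j : differentiable (fun y => f y i j) x by exact: differentiable_mxE.
have dp (s : 'S_n) := derive_prod (enum 'I_n) (fun i y => f y i (s i)) x v (enum_uniq _) (fun i => dfi i (s i)).
pose F (s : 'S_n) y : R := (-1) ^+ s *: \prod_(i <- enum 'I_n) f y i (s i).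
have detE : (fun y => \det (f y)) = (fun y => \sum_s F s y).
  by apply/funext => y; apply: eq_bigr => s _; rewrite /F big_enum.
have dF (s : 'S_n) : differentiable (F s) x.
  exact: (@differentiableZ _ _ _ (fun y => \prod_(i <- enum 'I_n) f y i (s i)) _ _ (dp s).1).
have [d1 D1] := derive_sum_seq (index_enum _) F x v dF.
rewrite detE; split => //.
rewrite D1 (bigD1 1%g) //= [X in _ + X]big1 ?addr0 => [|s s1].
  rewrite (deriveZ (f := fun y => \prod_(i <- enum 'I_n) f y i ((1%g : 'S_n) i))); last exact: diff_derivable (dp 1%g).1.
  rewrite (dp 1%g).2 odd_perm1 expr0 scale1r big_enum /=; apply: eq_bigr => i _.
  rewrite derive_mxE // perm1 big1 ?mulr1 // => j _.
  by rewrite fx1 mxE perm1 eqxx.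
rewrite (deriveZ (f := fun y => \prod_(i <- enum 'I_n) f y i (s i))); last exact: diff_derivable (dp s).1.
rewrite (dp s).2 big1 ?scaler0 // => i _.
(* If [i] were the only index moved, injectivity of [s] at the fixed index [s i] would force s i =
   i. *)
have [j ji sj] : exists2 j, j != i & s j != j.
  apply: contrapT => H; move/eqP : s1; apply; apply/permP => j; rewrite perm1.
  have fixed k : k != i -> s k = k by move=> ki; apply/eqP/negPn/negP => sk; apply: H; exists k.
  have [->|/fixed //] := eqVneq j i.
  apply/eqP/negPn/negP => si; have /perm_inj /eqP := fixed _ si.
  by rewrite (negbTE si).
by rewrite big_enum_cond /= (bigD1 j) //= fx1 mxE eq_sym (negbTE sj) mul0r mulr0.
Qed.

(** Jacobi's formula, reduced to the identity matrix by multiplying with the constant inverse of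
    [f x]. *)
Lemma derive_det {n} (f : V -> 'M[R]_n) x v :
  differentiable f x -> f x \in unitmx ->
  differentiable (fun y => \det (f y)) x /\
  'D_v (fun y => \det (f y)) x = \det (f x) * \tr ('D_v f x *m invmx (f x)).
Proof.
move=> df fu.
have dg : differentiable (fun y => f y *m invmx (f x)) x.
  by apply: differentiable_mulmx => //; exact: differentiable_cst.
have [|d1 D1] := derive_det1 (fun y => f y *m invmx (f x)) x v dg; first by rewrite mulmxV.
have detE : (fun y => \det (f y)) = (fun y => \det (f x) *: \det (f y *m invmx (f x))).
  apply/funext => y; rewrite det_mulmx det_inv /GRing.scale /= mulrCA divff ?mulr1 //.
  by rewrite -unitfE -unitmxE.
rewrite detE; split; first exact: (@differentiableZ _ _ _ (fun y => \det (f y *m invmx (f x)))).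
rewrite (deriveZ (f := fun y => \det (f y *m invmx (f x)))); last exact: diff_derivable.
rewrite D1 (derive_mulmx f (cst (invmx (f x))) x v df (differentiable_cst _ _)).
by rewrite derive_cst mulmx0 addr0.
Qed.
End MatrixDerivatives.

(** Registers matrix spaces as complete, as the Banach fixed point theorem below requires. *)
HB.instance Definition _ (R : realType) (m n : nat) := Complete.on 'M[R]_(m, n).

(** * The inverse function theorem *)

Section InverseFunction.
Context {R : realType} {n : nat}.
Implicit Types (v w x y : 'rV[R]_n).

Lemma rV_coord_le v j : `|v 0 j| <= `|v|.
Proof. by rewrite [leRHS]/Num.Def.normr /= mx_normrE; apply: (le_bigmax _ (fun ij => `|v ij.1 ij.2|) (0, j)). Qed.

Lemma rV_norm_le v c : 0 <= c -> (forall j, `|v 0 j| <= c) -> `|v| <= c.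
Proof.
move=> c0 vc; rewrite [leLHS]/Num.Def.normr /= mx_normrE; apply: bigmax_le => // -[i j] _ /=.
by rewrite ord1.
Qed.

Lemma rV_norm_lt v c : 0 < c -> (forall j, `|v 0 j| < c) -> `|v| < c.
Proof.
move=> c0 vc; rewrite [ltLHS]/Num.Def.normr /= mx_normrE; apply: bigmax_lt => // -[i j] _ /=.
by rewrite ord1.
Qed.

Lemma mulmx_norm_le (A : 'M[R]_n) : exists2 C, 0 < C & forall v, `|v *m A| <= C * `|v|.
Proof.
exists (n%:R * `|A| + 1) => [|v]; first by rewrite ltr_pwDr // mulr_ge0.
apply: rV_norm_le => [|j]; first by rewrite mulr_ge0 // addr_ge0 // mulr_ge0.
rewrite mxE (le_trans (ler_norm_sum _ _ _)) //.
apply: (@le_trans _ _ (\sum_(k < n) `|v| * `|A|)).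
  apply: ler_sum => k _; rewrite normrM ler_pM ?rV_coord_le //.
  by rewrite [leRHS]/Num.Def.normr /= mx_normrE; apply: (le_bigmax _ (fun ij => `|A ij.1 ij.2|) (k, j)).
rewrite sumr_const card_ord -[leLHS]mulr_natl [leRHS]mulrDl [X in _ <= _ + X]mul1r.
by apply: ler_wpDr => //; rewrite -mulrA (mulrC `|v|).
Qed.

Lemma convex_ball_line x y z (r : R) (s : R) : ball z r x -> ball z r y -> 0 <= s <= 1 ->
  ball z r (s *: (x - y) + y).
Proof.
rewrite -!ball_normE /= => zx zy /andP[s0 s1].
have -> : z - (s *: (x - y) + y) = s *: (z - x) + (1 - s) *: (z - y).
  by apply/rowP => j; rewrite !mxE; ring.
rewrite (le_lt_trans (ler_normD _ _)) // !normrZ ger0_norm // ger0_norm ?subr_ge0 //.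
have [->|s0'] := eqVneq s 0; first by rewrite mul0r add0r subr0 mul1r.
have -> : r = s * r + (1 - s) * r by ring.
apply: ltr_leD; first by rewrite ltr_pM2l // lt_neqAle eq_sym s0'.
by apply: ler_wpM2l; [rewrite subr_ge0|exact: ltW].
Qed.

Lemma MVT_coord (g : 'rV[R]_n -> R) z r x y (c : R) :
  (forall x, ball z r x -> differentiable g x) ->
  (forall x j, ball z r x -> `|'D_(unit_vec j) g x| <= c) ->
  ball z r x -> ball z r y -> `|g x - g y| <= n%:R * (c * `|x - y|).
Proof.
move=> dg gc bx byy.
have [|s /andP[s0 s1]] := MVT_line g (x - y) y 1 ltr01.
  by move=> s s01; apply/dg/convex_ball_line.
rewrite scale1r subrK mul1r => ->.
have bs : ball z r (s *: (x - y) + y) by apply: convex_ball_line => //; rewrite !ltW.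
rewrite derive_rV; last exact: dg.
rewrite (le_trans (ler_norm_sum _ _ _)) //.
have -> : n%:R * (c * `|x - y|) = \sum_(j < n) c * `|x - y| by rewrite sumr_const card_ord mulr_natl.
apply: ler_sum => j _.
by rewrite normrZ mulrC ler_pM // ?gc // rV_coord_le.
Qed.

Lemma banach_fixpoint_ball (T : 'rV[R]_n -> 'rV[R]_n) z (r : R) : 0 < r ->
  (forall x, closed_ball z r x -> closed_ball z r (T x)) ->
  (forall x y, closed_ball z r x -> closed_ball z r y -> `|T x - T y| <= 2^-1 * `|x - y|) ->
  exists2 x, closed_ball z r x & x = T x.
Proof.
move=> r0 TU TL.
have funT : set_fun (closed_ball z r) (closed_ball z r) T by move=> x; exact: TU.
pose Tf : {fun closed_ball z r >-> closed_ball z r} := mkfun funT.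
have ctr : is_contraction Tf.
  exists (2^-1)%:nng; split; first by rewrite /= invf_lt1 // ltr1n.
  by move=> [x y] [/= xU yU]; exact: TL.
have cl : closed (closed_ball z r) by exact: closed_ball_closed.
have ne : closed_ball z r !=set0 by exists z; exact: closed_ballxx.
have := banach_fixed_point ctr cl ne.
exact.
Qed.

Lemma jacobianE {m} (f : 'rV[R]_n -> 'rV[R]_m) x i j : differentiable f x ->
  ('J f x) i j = 'D_(unit_vec i) (fun y => f y 0 j) x.
Proof.
move=> df; rewrite -derive_mxE // deriveEjacobian // /unit_vec [RHS]mxE (bigD1 i) //= big1.
  by rewrite addr0 [in RHS]mxE !eqxx mul1r.
by move=> k ki; rewrite [X in X * _]mxE (negbTE ki) andbF mul0r.
Qed.

Lemma smooth_on_jacobian {m} (U : set 'rV[R]_n) (f : 'rV[R]_n -> 'rV[R]_m) :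
  open U -> smooth_on U f -> smooth_on U (fun x => 'J f x : 'M[R]_(n, m)).
Proof.
move=> oU sf; apply/smooth_on_mxP => // i j.
apply: (eq_in_smooth_on U (fun x => 'D_(unit_vec i) (fun y => f y 0 j) x)) => //.
  by move=> x Ux; rewrite jacobianE //; apply: smooth_on_differentiable sf Ux.
by apply: smooth_on_derive; move/(smooth_on_mxP _ oU) : sf; apply.
Qed.

(** The map x - F x has zero derivative at [x0]; its partial derivatives are continuous, hence small
    nearby, so [F] is a contractive perturbation of the identity there. *)
Lemma near_jacobian1_contraction (U : set 'rV[R]_n) (F : 'rV[R]_n -> 'rV[R]_n) x0 :
  open U -> U x0 -> smooth_on U F -> 'J F x0 = 1%:M ->
  exists2 r, 0 < r &
    [/\ closed_ball x0 r `<=` U,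
      forall x y, closed_ball x0 r x -> closed_ball x0 r y ->
        `|(x - F x) - (y - F y)| <= 2^-1 * `|x - y| &
      forall x, closed_ball x0 r x -> 'J F x \in unitmx].
Proof.
move=> oU Ux sF J1.
have oNx : nbhs x0 U by exact: open_nbhs_nbhs.
pose G i x := x 0 i - F x 0 i.
have sG i : smooth_on U (G i).
  apply: smooth_onB => //; last by move/(smooth_on_mxP _ oU) : sF; apply.
  exact: smooth_on_coord.
have DG i j : {for x0, continuous (fun x => 'D_(unit_vec j) (G i) x)}.
  apply: differentiable_continuous.
  exact: smooth_on_differentiable (smooth_on_derive _ _ _ (sG i)) Ux.
have DGE i j x : U x -> 'D_(unit_vec j) (G i) x = (j == i)%:R - ('J F x) j i.
  move=> Ux'; have dF : differentiable F x := smooth_on_differentiable _ _ _ sF Ux'.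
  rewrite (deriveB (f := fun x => x 0 i) (g := fun x => F x 0 i)); last 2 first.
  - by apply: diff_derivable; exact: differentiable_coord.
  - by apply: diff_derivable; exact: differentiable_mxE.
  rewrite -(jacobianE F) //; congr (_ - _).
  have did : differentiable (fun y : 'rV[R]_n => y) x by apply: ex_diff.
  by rewrite -(derive_mxE (fun y : 'rV[R]_n => y)) // derive_id mxE eqxx eq_sym.
(* The mean value estimate sums [n] partial derivatives, and n c <= 1/2; [n.+1] keeps the
   denominator nonzero when n = 0. *)
pose c : R := (2 * n.+1%:R)^-1.
have c0 : 0 < c by rewrite invr_gt0 mulr_gt0.
have Hc : \forall x \near x0, forall i, forall j, `|'D_(unit_vec j) (G i) x| <= c.
  apply: (@filter_forall _ _ (fun i x => forall j, `|'D_(unit_vec j) (G i) x| <= c) (nbhs x0) (nbhs_filter x0)) => i.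
  apply: (@filter_forall _ _ (fun j x => `|'D_(unit_vec j) (G i) x| <= c) (nbhs x0) (nbhs_filter x0)) => j.
  have /cvgrPdist_le /(_ _ c0) := DG i j.
  by apply: filterS => x; rewrite /= DGE // J1 mxE subrr sub0r normrN.
have : \forall x \near x0, U x /\ forall i j, `|'D_(unit_vec j) (G i) x| <= c.
  by near=> x; split; near: x.
move=> /nbhs_ballP[r /= r0 Hr].
(* The estimates hold on an open ball; halving the radius makes room for a closed one. *)
exists (r / 2); first by rewrite divr_gt0.
have sb : closed_ball x0 (r / 2) `<=` ball x0 r.
  move=> y; rewrite closed_ballE ?divr_gt0 // -ball_normE /closed_ball_ /= => /le_lt_trans; apply.
  by rewrite ltr_pdivrMr // ltr_pMr // ltr1n.
have nc : n%:R * c <= 2^-1.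
  by rewrite /c invfM mulrCA ler_piMr // ler_pdivrMr // mul1r ler_nat.
split=> [x /sb /Hr []//|x y /sb bx /sb byy|x /sb bx].
  apply: rV_norm_le => [|i]; first by rewrite mulr_ge0.
  rewrite !mxE (le_trans (MVT_coord (G i) x0 r x y c _ _ bx byy)) //.
  - by move=> z /Hr[Uz _]; apply: smooth_on_differentiable (sG i) Uz.
  - by move=> z j /Hr[_]; apply.
  - by rewrite mulrA ler_wpM2r.
have [Ux' Hx] := Hr _ bx.
(* A nonzero vector killed by the Jacobian of [F] would be fixed by the differential of x - F x,
   which at least halves norms. *)
rewrite -row_free_unit; apply/row_freeP; apply: contrapT => H.
have : ~~ row_free ('J F x) by apply/negP => /row_freeP.
rewrite -kermx_eq0 => /rowV0Pn[v /sub_kermxP vJ v0].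
have : `|v| <= 2^-1 * `|v|.
  apply: rV_norm_le => [|i]; first by rewrite mulr_ge0.
  have -> : v 0 i = \sum_j v 0 j * 'D_(unit_vec j) (G i) x.
    have /rowP/(_ i) := vJ; rewrite !mxE => vJi.
    under eq_bigr do rewrite DGE // mulrBr.
    rewrite sumrB vJi subr0 (bigD1 i) //= eqxx mulr1 big1 ?addr0 // => j ji.
    by rewrite (negbTE ji) mulr0.
  rewrite (le_trans (ler_norm_sum _ _ _)) //.
  apply: (@le_trans _ _ (\sum_(j < n) `|v| * c)).
    by apply: ler_sum => j _; rewrite normrM ler_pM // rV_coord_le.
  by rewrite sumr_const card_ord -[leLHS]mulr_natl mulrCA mulrC ler_wpM2r.
by rewrite -[leLHS]mul1r ler_pM2r ?normr_gt0 // leNgt invf_lt1 // ltr1n.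
Unshelve. all: by end_near. Qed.

End InverseFunction.

Section InverseFunctionTheorem.
Context {R : realType} {n : nat}.
Implicit Types (v w x y : 'rV[R]_n).

Lemma jacobian_mulmxr {m p} (f : 'rV[R]_n -> 'rV[R]_m) (B : 'M[R]_(m, p)) x :
  differentiable f x -> 'J (fun y => f y *m B) x = 'J f x *m B.
Proof.
move=> df; apply/row_matrixP => i; rewrite !rowE mulmxA -!deriveEjacobian //; last first.
  by apply: differentiable_mulmx => //; exact: differentiable_cst.
rewrite (derive_mulmx f (cst B) x _ df (differentiable_cst _ _)).
by rewrite derive_cst mulmx0 addr0.
Qed.

(** Let k be the increment of y, h that of g, and J the Jacobian. Differentiability of [f] makes k -
    h J an o(h), the Lipschitz bound makes it an o(k), and multiplication by the inverse of J gives
    the linearization of [g]. *)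
Lemma local_inverse_derive (f g : 'rV[R]_n -> 'rV[R]_n) y (C : R) :
  0 < C -> differentiable f (g y) -> 'J f (g y) \in unitmx ->
  (\forall k \near (0 : 'rV[R]_n), `|g (k + y) - g y| <= C * `|k| /\ f (g (k + y)) = k + y) ->
  f (g y) = y ->
  differentiable g y /\ forall v, 'D_v g y = v *m invmx ('J f (g y)).
Proof.
move=> C0 df Ju near_g fgy.
set J := 'J f (g y) in Ju *.
pose L : {linear 'rV[R]_n -> 'rV[R]_n} := mulmxr (invmx J).
have [D D0 HD] := mulmx_norm_le (invmx J).
have Lc : continuous L.
  move=> v; apply: differentiable_continuous.
  by apply: (differentiable_mulmx id (cst (invmx J))); [exact: ex_diff|exact: differentiable_cst].
suff [dg dgE] : differentiable g y /\ 'd g y = L :> (_ -> _).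
  by split => // v; rewrite deriveE // dgE.
apply: differentiableP_le => // e e0.
have CD0 : 0 < e / (D * C) by rewrite divr_gt0 // mulr_gt0.
have /nbhs_normP[d /= d0 Hd] := differentiable_le _ _ _ df CD0.
move/nbhs_normP : near_g => -[d' /= d'0 Hd'].
apply/nbhs_normP; exists (Num.min d' (d / C)) => [|k]; first by rewrite /= lt_min d'0 divr_gt0.
rewrite /= sub0r normrN lt_min => /andP[kd' kd].
have [gk fgk] : `|g (k + y) - g y| <= C * `|k| /\ f (g (k + y)) = k + y.
  by apply: Hd'; rewrite /= sub0r normrN.
set h := g (k + y) - g y in gk *.
have hd : `|h| < d by rewrite (le_lt_trans gk) // mulrC -ltr_pdivlMr.
have := Hd h; rewrite /= sub0r normrN => /(_ hd).
rewrite subrK fgk fgy addrK -deriveE // deriveEjacobian // -/J => kh.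
have -> : h - k *m invmx J = - ((k - h *m J) *m invmx J).
  by rewrite mulmxBl mulmxK // opprB.
rewrite normrN (le_trans (HD _)) // (le_trans (ler_wpM2l (ltW D0) kh)) //.
rewrite mulrA (le_trans (ler_wpM2l _ gk)) //.
  by rewrite mulr_ge0 ?ltW.
have -> : D * (e / (D * C)) * (C * `|k|) = e * `|k| by field; rewrite !gt_eqF.
by [].
Qed.

(** The formula for the derivative of [g] contains [g] itself but none of its derivatives, so
    regularity of order [k] gives order [k.+1]. *)
Lemma local_inverse_smooth (U W : set 'rV[R]_n) (f g : 'rV[R]_n -> 'rV[R]_n) :
  open U -> open W -> smooth_on U f ->
  (forall y, W y -> [/\ U (g y), 'J f (g y) \in unitmx, differentiable g y &
    forall v, 'D_v g y = v *m invmx ('J f (g y))]) ->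
  smooth_on W g.
Proof.
move=> oU oW sf gW; apply/smooth_onP.
have dg y : W y -> differentiable g y by move=> /gW[].
elim=> [|k IH]; split; [exact: dg|by []|exact: dg|move=> v].
apply: (eq_in_differentiable_n k _ (fun y => v *m invmx ('J f (g y)))); first exact: oW.
  by move=> y /gW[_ _ _ ->].
have nJ : differentiable_n k W (fun y => 'J f (g y)).
  apply/(differentiable_n_mxP _ oW) => i j.
  apply: (differentiable_n_comp k _ U g (fun x => 'J f x i j)); [exact: oW|by move=> y /gW[]|exact: IH|].
  by move: k {IH}; apply/smooth_onP; move/(smooth_on_mxP _ oU) : (smooth_on_jacobian U f oU sf); apply.
have {}nJ : differentiable_n k W (fun y => invmx ('J f (g y))).
  by apply: differentiable_n_invmx; [exact: oW|move=> y /gW[]|exact: nJ].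
apply/(differentiable_n_mxP _ oW) => i j; under eq_fun do rewrite mxE.
apply: (differentiable_n_sum _ oW) => l _; apply: (differentiable_nM _ oW); first exact: differentiable_n_cst.
by move/(differentiable_n_mxP _ oW) : nJ; apply.
Qed.

Lemma inverse_function (U : set 'rV[R]_n) (f : 'rV[R]_n -> 'rV[R]_n) x0 :
  open U -> U x0 -> smooth_on U f -> 'J f x0 \in unitmx ->
  exists (r e : R) (g : 'rV[R]_n -> 'rV[R]_n),
  [/\ 0 < r /\ 0 < e, ball x0 r `<=` U,
      forall y, ball (f x0) e y -> ball x0 r (g y) /\ f (g y) = y,
      forall x, ball x0 r x -> ball (f x0) e (f x) -> g (f x) = x &
      smooth_on (ball (f x0) e) g /\
      forall y, ball (f x0) e y -> 'J f (g y) \in unitmx /\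
         forall v, 'D_v g y = v *m invmx ('J f (g y))].
Proof.
move=> oU Ux0 sf Ju.
set A := 'J f x0 in Ju.
pose F x := f x *m invmx A.
have df x : U x -> differentiable f x by exact: smooth_on_differentiable.
have JF x : U x -> 'J F x = 'J f x *m invmx A by move=> Ux; rewrite jacobian_mulmxr //; exact: df.
have sF : smooth_on U F by apply: smooth_on_mulmx => //; exact: smooth_on_cst.
have [|r r0 [rU HF HJ]] := near_jacobian1_contraction U F x0 oU Ux0 sF.
  by rewrite JF // mulmxV.
have [C C0 HC] := mulmx_norm_le (invmx A).
have cbE x : closed_ball x0 r x <-> `|x0 - x| <= r by rewrite closed_ballE.
have bE z x s : ball z s x <-> `|z - x| < s by rewrite -ball_normE.
have bcb x : ball x0 r x -> closed_ball x0 r x by move/bE/ltW/cbE.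
have cb0 : closed_ball x0 r x0 by apply/cbE; rewrite subrr normr0 ltW.
have lip x x' : closed_ball x0 r x -> closed_ball x0 r x' -> `|x - x'| <= 2 * C * `|f x - f x'|.
  move=> bx bx'; have := HF _ _ bx bx'; have := HC (f x - f x').
  rewrite mulmxBl -/(F x) -/(F x') => H1 H2.
  have : `|x - x'| <= `|x - F x - (x' - F x')| + `|F x - F x'|.
    rewrite (le_trans _ (ler_normD _ _)) // le_eqVlt; apply/orP; left; apply/eqP; congr (`|_|).
    by apply/rowP => j; rewrite !mxE; ring.
  move: H1 H2; set a := `|x - x'|; set b := `|_ - (x' - F x')|; set c := `|F x - _|; set d := `|f x - _|.
  clear; move=> H1 H2 H3; have : a <= 2^-1 * a + C * d by rewrite (le_trans H3) // lerD.
  by move=> H; rewrite -mulrA; move: H; move: (C * d) => q H; lra.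
(* [C] bounds multiplication by the inverse Jacobian. For y within [e] of f x0 the displacement of
   the target is less than r / 2, and the contraction adds at most r / 2, so [T] below sends the
   closed ball into the open one. *)
pose e := r / (2 * C).
have e0 : 0 < e by rewrite divr_gt0 // mulr_gt0.
pose g y := xget x0 [set x | ball x0 r x /\ f x = y].
have gP y : ball (f x0) e y -> ball x0 r (g y) /\ f (g y) = y.
  move=> /bE ye.
  have yC : `|(y - f x0) *m invmx A| < 2^-1 * r.
    rewrite (le_lt_trans (HC _)) // distrC -ltr_pdivlMl // (lt_le_trans ye) // /e.
    by rewrite (_ : r / (2 * C) = C^-1 * (2^-1 * r)) //; field; rewrite gt_eqF.
  (* A fixed point solves F x = y A^-1, that is f x = y. *)
  pose T x := x - F x + y *m invmx A.
  have TE x : T x - x0 = (x - F x - (x0 - F x0)) + (y - f x0) *m invmx A.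
    by rewrite /T mulmxBl -/(F x0); apply/rowP => j; rewrite !mxE; ring.
  have Tx x : closed_ball x0 r x -> `|x0 - T x| < r.
    move=> bx; rewrite distrC TE (le_lt_trans (ler_normD _ _)) //.
    have -> : r = 2^-1 * r + 2^-1 * r by field.
    apply: ler_ltD => //; rewrite (le_trans (HF _ _ bx cb0)) // ler_pM2l ?invr_gt0 // distrC.
    exact/cbE.
  have [x|x x' bx bx'|x bx xT] := banach_fixpoint_ball T x0 r r0.
  - by move=> /Tx /ltW /cbE.
  - by rewrite (_ : T x - T x' = x - F x - (x' - F x')) ?HF // /T; apply/rowP => j; rewrite !mxE; ring.
  - apply: (@xgetPex _ x0 [set x | ball x0 r x /\ f x = y]); exists x; split.
      by apply/bE; rewrite xT; exact: Tx.
    have : F x = y *m invmx A.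
      by move: xT => /rowP xT; apply/rowP => j; have := xT j; rewrite !mxE => H; lra.
    by move=> /(congr1 (fun z => z *m A)); rewrite !mulmxKV.
have gK x : ball x0 r x -> ball (f x0) e (f x) -> g (f x) = x.
  move=> bx /gP[bg fg]; apply/eqP; rewrite -subr_eq0 -normr_le0.
  by rewrite (le_trans (lip _ _ (bcb _ bg) (bcb _ bx))) // fg subrr normr0 mulr0.
have Uball x : ball x0 r x -> U x by move=> /bcb /rU.
have Junit x : ball x0 r x -> 'J f x \in unitmx.
  move=> bx; have := HJ _ (bcb _ bx); rewrite JF; last exact: Uball.
  by rewrite unitmx_mul => /andP[].
have dg y : ball (f x0) e y -> differentiable g y /\ forall v, 'D_v g y = v *m invmx ('J f (g y)).
  move=> bey; have [bgy fgy] := gP _ bey.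
  have C2 : 0 < 2 * C by rewrite mulr_gt0.
  apply: (local_inverse_derive f g y (2 * C) C2 (df _ (Uball _ bgy)) (Junit _ bgy) _ fgy).
  have : \forall z \near y, ball (f x0) e z by apply: open_nbhs_nbhs; split => //; exact: ball_open.
  rewrite (near_shift 0) /= subr0; apply: filterS => k /= bek.
  have [bgk fgk] := gP _ bek; split => //.
  by rewrite (le_trans (lip _ _ (bcb _ bgk) (bcb _ bgy))) // fgk fgy addrK.
exists r, e, g; split; [by split|by move=> x /Uball|exact: gP|exact: gK|].
split; last by move=> y bey; split; [by apply: Junit; case: (gP _ bey)|case: (dg _ bey)].
apply: (local_inverse_smooth U _ f g oU (ball_open _ _) sf) => y bey.
have [bgy _] := gP _ bey; have [dgy Dgy] := dg _ bey.
by split; [exact: Uball|exact: Junit|exact: dgy|exact: Dgy].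
Qed.

End InverseFunctionTheorem.

Local Opaque derive jacobian.

(** * Structure equations of an affine hypersurface *)

Section Bilin.
Context {R : realType} {n : nat}.
Implicit Types (B : 'M[R]_n) (u v w : 'rV[R]_n) (c : R).

Lemma bilinDl B u v w : bilin B (u + v) w = bilin B u w + bilin B v w.
Proof. by rewrite /bilin !mulmxDl mxE. Qed.
Lemma bilinDr B u v w : bilin B w (u + v) = bilin B w u + bilin B w v.
Proof. by rewrite /bilin linearD mulmxDr mxE. Qed.
Lemma bilinZl B c u v : bilin B (c *: u) v = c * bilin B u v.
Proof. by rewrite /bilin -!scalemxAl mxE. Qed.
Lemma bilinZr B c u v : bilin B u (c *: v) = c * bilin B u v.
Proof. by rewrite /bilin linearZ /= -scalemxAr mxE. Qed.
Lemma bilinNl B u v : bilin B (- u) v = - bilin B u v.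
Proof. by rewrite -scaleN1r bilinZl mulN1r. Qed.
Lemma bilinNr B u v : bilin B u (- v) = - bilin B u v.
Proof. by rewrite -scaleN1r bilinZr mulN1r. Qed.
Lemma bilinBl B u v w : bilin B (u - v) w = bilin B u w - bilin B v w.
Proof. by rewrite bilinDl bilinNl. Qed.
Lemma bilin0l B v : bilin B 0 v = 0.
Proof. by rewrite /bilin !mul0mx mxE. Qed.
Lemma bilin0r B v : bilin B v 0 = 0.
Proof. by rewrite /bilin trmx0 mulmx0 mxE. Qed.
Lemma bilin_suml B {I : Type} (r : seq I) (F : I -> 'rV[R]_n) v :
  bilin B (\sum_(i <- r) F i) v = \sum_(i <- r) bilin B (F i) v.
Proof. by rewrite /bilin !mulmx_suml summxE. Qed.
Lemma bilinC B u v : B^T = B -> bilin B u v = bilin B v u.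
Proof.
move=> BT; rewrite /bilin -[in RHS]BT.
by rewrite (_ : v *m B^T *m u^T = (u *m B *m v^T)^T) ?mxE // !trmx_mul trmxK mulmxA.
Qed.
Lemma bilin_unit B i j : bilin B (unit_vec i) (unit_vec j) = B i j.
Proof.
rewrite /bilin /unit_vec -rowE trmx_delta -colE !mxE.
by [].
Qed.
Lemma bilin_unitr B u j : bilin B u (unit_vec j) = (u *m B) 0 j.
Proof. by rewrite /bilin /unit_vec trmx_delta -colE mxE. Qed.

Lemma bilin_mul B (E : 'M[R]_n) u v : bilin B (u *m E) (v *m E) = bilin (E *m B *m E^T) u v.
Proof. by rewrite /bilin trmx_mul !mulmxA. Qed.

Lemma linear_unit_vec {W : lmodType R} (f : 'rV[R]_n -> W) :
  (forall c u v, f (c *: u + v) = c *: f u + f v) ->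
  forall w, f w = \sum_l w 0 l *: f (unit_vec l).
Proof.
move=> fl w; have f0 : f 0 = 0.
  by have := fl (-1) 0 0; rewrite scaler0 addr0 scaleN1r addNr.
have fD u v : f (u + v) = f u + f v by have := fl 1 u v; rewrite !scale1r.
have fZ c u : f (c *: u) = c *: f u by have := fl c u 0; rewrite f0 !addr0.
rewrite [in LHS](row_sum_delta w); elim/big_rec2 : _ => // j a b _ <-.
by rewrite fD fZ.
Qed.

End Bilin.

Section Derive2.
Context {R : realType} {V : normedModType R}.

Lemma derive_derive_comm_mx {m n} (f : V -> 'M[R]_(m, n)) (U : set V) (x v w : V) :
  open U -> U x -> smooth_on U f ->
  'D_w (fun y => 'D_v f y) x = 'D_v (fun y => 'D_w f y) x.
Proof.
move=> oU Ux sf.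
have df y : U y -> differentiable f y by exact: smooth_on_differentiable.
have dDf u : differentiable (fun y => 'D_u f y) x.
  exact: smooth_on_differentiable (smooth_on_derive _ _ _ sf) Ux.
apply/matrixP => i j.
have E1 := derive_mxE (fun y => 'D_v f y) x w i j (dDf v).
have E2 := derive_mxE (fun y => 'D_w f y) x v i j (dDf w).
apply: etrans E1 _.
apply: etrans (esym E2).
have E u y : U y -> ('D_u f y) i j = 'D_u (fun z => f z i j) y by move=> /df; exact: derive_mxE.
apply: etrans (eq_in_derive U _ _ x w oU Ux (E v)) _.
apply: etrans _ (esym (eq_in_derive U _ _ x v oU Ux (E w))).
apply: (derive_derive_comm (fun z => f z i j) U _ _ _ oU Ux).
by move/(smooth_on_mxP _ oU) : sf; apply.
Qed.

End Derive2.

Section Gauss.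
Context {R : realType} (U : set 'rV[R]_3) (G xi : 'rV[R]_3 -> 'rV[R]_4).
Context (oU : open U) (sG : smooth_on U G) (sxi : smooth_on U xi).
Context (frame_unit : forall x, U x -> gauss_frame G xi x \in unitmx).
Implicit Types (x u v : 'rV[R]_3).

Local Notation tan := (tangential G xi).
Local Notation trans := (Defs.transversal G xi).
Local Notation h := (affine_metric G xi).

Lemma tangential_transversal x (w : 'rV[R]_4) : U x -> w = tan x w *m 'J G x + trans x w *: xi x.
Proof.
move=> Ux; pose m : 'rV[R]_(3 + 1) := w *m invmx (gauss_frame G xi x).
have mE : m *m (col_mx ('J G x : 'M[R]_(3, 4)) (xi x) : 'M[R]_(3 + 1, 4)) = w.
  exact: (mulmxKV (frame_unit x Ux) w).
rewrite -[in LHS]mE -[in LHS](hsubmxK m) mul_row_col; congr (_ + _).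
by rewrite [X in X *m _]mx11_scalar mul_scalar_mx.
Qed.

Lemma tangential_transversalK x v (c : R) : U x ->
  tan x (v *m 'J G x + c *: xi x) = v /\ trans x (v *m 'J G x + c *: xi x) = c.
Proof.
move=> Ux; have -> : v *m 'J G x + c *: xi x = (row_mx v c%:M : 'rV_4) *m gauss_frame G xi x.
  by rewrite -mul_scalar_mx; apply: esym; exact: (mul_row_col v).
rewrite /tangential /Defs.transversal mulmxK ?frame_unit //.
by rewrite row_mxKl row_mxKr mxE.
Qed.

Lemma tangentialD x w1 w2 : tan x (w1 + w2) = tan x w1 + tan x w2.
Proof. by rewrite /tangential mulmxDl linearD. Qed.
Lemma tangentialZ x c w : tan x (c *: w) = c *: tan x w.
Proof. by rewrite /tangential -scalemxAl linearZ. Qed.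
Lemma transversalD x w1 w2 : trans x (w1 + w2) = trans x w1 + trans x w2.
Proof. by rewrite /Defs.transversal mulmxDl linearD mxE. Qed.
Lemma transversalZ x c w : trans x (c *: w) = c * trans x w.
Proof. by rewrite /Defs.transversal -scalemxAl linearZ mxE. Qed.

Lemma smooth_on_gauss_frame : smooth_on U (gauss_frame G xi).
Proof.
have sJ : smooth_on U (fun x => 'J G x : 'M[R]_(3, 4)) := smooth_on_jacobian U G oU sG.
apply/(smooth_on_mxP _ oU) => i j; rewrite /gauss_frame.
have [k ->|k ->] := @split_ordP 3 1 i.
  by under eq_fun do rewrite (col_mxEu ('J G _)); move/(smooth_on_mxP _ oU) : sJ; apply.
by under eq_fun do rewrite (col_mxEd ('J G _)); move/(smooth_on_mxP _ oU) : sxi; apply.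
Qed.

Lemma smooth_on_tangential (w : 'rV[R]_3 -> 'rV[R]_4) : smooth_on U w -> smooth_on U (fun x => tan x (w x)).
Proof.
move=> sw; have := smooth_on_mulmx U oU _ _ sw (smooth_on_invmx U _ oU frame_unit smooth_on_gauss_frame).
move=> /(smooth_on_mxP _ oU) sm; apply/(smooth_on_mxP _ oU) => i j.
by under eq_fun do rewrite mxE; exact: sm.
Qed.

Lemma smooth_on_transversal (w : 'rV[R]_3 -> 'rV[R]_4) : smooth_on U w -> smooth_on U (fun x => trans x (w x)).
Proof.
move=> sw; have := smooth_on_mulmx U oU _ _ sw (smooth_on_invmx U _ oU frame_unit smooth_on_gauss_frame).
move=> /(smooth_on_mxP _ oU) sm; rewrite /Defs.transversal.
by under eq_fun do rewrite mxE; exact: sm.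
Qed.

Let sJ : smooth_on U (fun x => 'J G x : 'M[R]_(3, 4)) := smooth_on_jacobian U G oU sG.
Let dG x (Ux : U x) : differentiable G x := smooth_on_differentiable U G x sG Ux.
Let dJ x (Ux : U x) : differentiable (fun x => 'J G x : 'M[R]_(3, 4)) x := smooth_on_differentiable U _ x sJ Ux.

Lemma flat_derivativeE X Y x : U x -> differentiable Y x ->
  flat_derivative G X Y x = 'D_(X x) Y x *m 'J G x + Y x *m 'D_(X x) (fun y => 'J G y) x.
Proof.
by move=> Ux dY; rewrite /flat_derivative (derive_mulmx Y (fun y => 'J G y)) //; exact: dJ.
Qed.

Lemma flat_derivative_cst u v x : U x ->
  flat_derivative G (cst u) (cst v) x = v *m 'D_u (fun y => 'J G y) x.
Proof.
by move=> Ux; rewrite flat_derivativeE // derive_cst mul0mx add0r.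
Qed.

Lemma flat_derivative_derive u v x : U x ->
  flat_derivative G (cst u) (cst v) x = 'D_u (fun y => 'D_v G y) x.
Proof.
by move=> Ux; apply: (eq_in_derive U) => // y Uy; rewrite deriveEjacobian //; exact: dG.
Qed.

Lemma flat_derivative_cstC u v x : U x ->
  flat_derivative G (cst u) (cst v) x = flat_derivative G (cst v) (cst u) x.
Proof.
move=> Ux; apply: etrans (flat_derivative_derive u v x Ux) _.
apply: etrans _ (esym (flat_derivative_derive v u x Ux)).
exact: derive_derive_comm_mx oU Ux sG.
Qed.

Lemma smooth_on_flat_derivative u v : smooth_on U (flat_derivative G (cst u) (cst v)).
Proof.
apply: (eq_in_smooth_on U (fun x => 'D_u (fun y => 'D_v G y) x)) => //.
  by move=> x Ux; rewrite flat_derivative_derive.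
by apply: smooth_on_derive; apply: smooth_on_derive.
Qed.

Lemma flat_derivative_cst_linearr u x c v (w : 'rV[R]_3) : U x ->
  flat_derivative G (cst u) (cst (c *: v + w)) x
  = c *: flat_derivative G (cst u) (cst v) x + flat_derivative G (cst u) (cst w) x.
Proof. by move=> Ux; rewrite !flat_derivative_cst // mulmxDl scalemxAl. Qed.

Lemma affine_form_cst u v x : U x -> affine_form G xi (cst u) (cst v) x = bilin (h x) u v.
Proof.
move=> Ux; rewrite /affine_form.
rewrite (linear_unit_vec (fun v => trans x (flat_derivative G (cst u) (cst v) x))); last first.
  by move=> c v1 v2; rewrite flat_derivative_cst_linearr // transversalD transversalZ.
rewrite [RHS](linear_unit_vec (fun v => bilin (h x) u v)); last first.
  by move=> c v1 v2; rewrite bilinDr bilinZr.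
apply: eq_bigr => j _; congr (_ *: _); rewrite flat_derivative_cstC //.
rewrite (linear_unit_vec (fun u => trans x (flat_derivative G (cst (unit_vec j)) (cst u) x))); last first.
  by move=> c v1 v2; rewrite flat_derivative_cst_linearr // transversalD transversalZ.
rewrite [RHS](linear_unit_vec (fun u => bilin (h x) u _)); last first.
  by move=> c v1 v2; rewrite bilinDl bilinZl.
by apply: eq_bigr => i _; congr (_ *: _); rewrite bilin_unit mxE flat_derivative_cstC.
Qed.

Lemma affine_metric_sym x : U x -> (h x)^T = h x.
Proof. by move=> Ux; apply/matrixP => i j; rewrite !mxE /affine_form flat_derivative_cstC. Qed.

Lemma smooth_on_affine_metric : smooth_on U h.
Proof.
apply/(smooth_on_mxP _ oU) => i j; under eq_fun do rewrite mxE.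
by apply: smooth_on_transversal; exact: smooth_on_flat_derivative.
Qed.

(** Differentiating the components of [Y] produces only a tangential vector, so the transversal part
    depends on the value of [Y] at [x] alone. *)
Lemma affine_formE X Y x : U x -> differentiable Y x ->
  affine_form G xi X Y x = bilin (h x) (X x) (Y x).
Proof.
move=> Ux dY; apply: etrans _ (affine_form_cst (X x) (Y x) x Ux).
rewrite /affine_form (flat_derivativeE X Y x Ux dY) transversalD (flat_derivative_cst _ _ x Ux).
have -> : trans x ('D_(X x) Y x *m 'J G x) = 0; last exact: add0r.
by have := (tangential_transversalK x ('D_(X x) Y x) 0 Ux).2; rewrite scale0r addr0.
Qed.

Lemma nablaE X Y x : U x -> differentiable Y x ->
  nabla G xi X Y x = 'D_(X x) Y x + nabla G xi (cst (X x)) (cst (Y x)) x.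
Proof.
move=> Ux dY; rewrite /nabla (flat_derivativeE X Y x Ux dY) tangentialD (flat_derivative_cst _ _ x Ux).
have -> : tan x ('D_(X x) Y x *m 'J G x) = 'D_(X x) Y x; last by [].
by have := (tangential_transversalK x ('D_(X x) Y x) 0 Ux).1; rewrite scale0r addr0.
Qed.

Lemma gauss_formula X Y x : U x -> differentiable Y x ->
  flat_derivative G X Y x = nabla G xi X Y x *m 'J G x + bilin (h x) (X x) (Y x) *: xi x.
Proof.
move=> Ux dY; rewrite -affine_formE //; exact: tangential_transversal.
Qed.

Lemma levi_civitaE (g : 'rV[R]_3 -> 'M[R]_3) X Y x :
  levi_civita g X Y x = 'D_(X x) Y x + levi_civita g (cst (X x)) (cst (Y x)) x.
Proof. by rewrite /levi_civita derive_cst add0r. Qed.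

Lemma nabla_levi_civita X Y x : U x -> differentiable Y x ->
  nabla G xi X Y x = levi_civita h X Y x + difference_tensor G xi x (X x) (Y x).
Proof.
move=> Ux dY; rewrite (nablaE X Y x Ux dY) levi_civitaE /difference_tensor -addrA.
by congr (_ + _); rewrite addrC subrK.
Qed.

End Gauss.

(** * The Koszul formula in coordinates *)

Section ChristoffelForm.
Context {R : realType} {n : nat} (D : 'rV[R]_n -> 'M[R]_n).
Implicit Types (u v w : 'rV[R]_n).

(** Christoffel symbols of the first kind as a trilinear form, where [D u] stands for the derivative
    of the metric along [u]: the Koszul formula for fields with constant components. Working with
    the form avoids the inverse metric. *)
Definition christoffel_form u v w : R :=
  2^-1 * (bilin (D u) v w + bilin (D v) u w - bilin (D w) u v).

Lemma bilinDm (A B : 'M[R]_n) u v : bilin (A + B) u v = bilin A u v + bilin B u v.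
Proof. by rewrite /bilin mulmxDr mulmxDl mxE. Qed.
Lemma bilinZm c (A : 'M[R]_n) u v : bilin (c *: A) u v = c * bilin A u v.
Proof. by rewrite /bilin -scalemxAr -scalemxAl mxE. Qed.

Context (Dlin : forall c u v, D (c *: u + v) = c *: D u + D v).

Lemma christoffel_form_linear1 c u1 u2 v w :
  christoffel_form (c *: u1 + u2) v w = c *: christoffel_form u1 v w + christoffel_form u2 v w.
Proof.
rewrite /christoffel_form Dlin !(bilinDm, bilinZm, bilinDl, bilinZl, bilinDr, bilinZr) /GRing.scale /=.
by ring.
Qed.

Lemma christoffel_form_linear2 c u v1 v2 w :
  christoffel_form u (c *: v1 + v2) w = c *: christoffel_form u v1 w + christoffel_form u v2 w.
Proof.
rewrite /christoffel_form Dlin !(bilinDm, bilinZm, bilinDl, bilinZl, bilinDr, bilinZr) /GRing.scale /=.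
by ring.
Qed.

Lemma christoffel_form_linear3 c u v w1 w2 :
  christoffel_form u v (c *: w1 + w2) = c *: christoffel_form u v w1 + christoffel_form u v w2.
Proof.
rewrite /christoffel_form Dlin !(bilinDm, bilinZm, bilinDl, bilinZl, bilinDr, bilinZr) /GRing.scale /=.
by ring.
Qed.

Lemma christoffel_form_unit u v w :
  christoffel_form u v w = \sum_i \sum_j \sum_l
    (u 0 i * v 0 j * w 0 l) * christoffel_form (unit_vec i) (unit_vec j) (unit_vec l).
Proof.
rewrite (linear_unit_vec (fun u => christoffel_form u v w)); last first.
  by move=> c u1 u2; exact: christoffel_form_linear1.
apply: eq_bigr => i _.
rewrite (linear_unit_vec (fun v => christoffel_form _ v w)); last first.
  by move=> c u1 u2; exact: christoffel_form_linear2.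
rewrite scaler_sumr; apply: eq_bigr => j _.
rewrite (linear_unit_vec (fun w => christoffel_form _ _ w)); last first.
  by move=> c u1 u2; exact: christoffel_form_linear3.
by rewrite !scaler_sumr; apply: eq_bigr => l _; rewrite /GRing.scale /= !mulrA.
Qed.
Lemma christoffel_form_metric (DT : forall u, (D u)^T = D u) u v w :
  christoffel_form u v w + christoffel_form u w v = bilin (D u) v w.
Proof. by rewrite /christoffel_form (bilinC (D u) w v) //; field. Qed.

Lemma christoffel_formC (DT : forall u, (D u)^T = D u) u v w :
  christoffel_form u v w = christoffel_form v u w.
Proof. by rewrite /christoffel_form (bilinC (D w) v u) //; ring. Qed.

Lemma christoffel_form_swap (DT : forall u, (D u)^T = D u) u v w :
  christoffel_form u v w - christoffel_form u w v = bilin (D v) u w - bilin (D w) u v.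
Proof. by rewrite /christoffel_form (bilinC (D u) w v) //; field. Qed.
End ChristoffelForm.

Section LeviCivita.
Context {R : realType} {n : nat} (g : 'rV[R]_n -> 'M[R]_n) (x : 'rV[R]_n).
Context (dg : differentiable g x).
Implicit Types (u v w : 'rV[R]_n).

Lemma derive_linear {W : normedModType R} (f : 'rV[R]_n -> W) c u v : differentiable f x ->
  'D_(c *: u + v) f x = c *: 'D_u f x + 'D_v f x.
Proof.
move=> df; apply: etrans (deriveE (c *: u + v) df) _.
by rewrite linearD linearZ; congr (_ *: _ + _); apply: esym; exact: deriveE.
Qed.

Local Notation Dg := (fun u => 'D_u g x).

Lemma bilin_levi_civita_cst u v w : g x \in unitmx ->
  bilin (g x) (levi_civita g (cst u) (cst v) x) w = christoffel_form Dg u v w.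
Proof.
move=> gu; rewrite /levi_civita derive_cst add0r bilin_suml.
rewrite christoffel_form_unit; last by move=> c u1 u2; exact: derive_linear.
apply: eq_bigr => i _; rewrite bilin_suml; apply: eq_bigr => j _.
rewrite bilinZl /christoffel /bilin mulmxKV // mxE mulr_sumr; apply: eq_bigr => l _.
rewrite -[RHS]mulrA; congr (_ * _); rewrite [RHS]mulrC !mxE; congr (_ * _).
have E k a b : ('D_(unit_vec k) g x) a b = 'D_(unit_vec k) (fun y => g y a b) x by exact: derive_mxE.
by rewrite /christoffel_form; congr (_ * (_ + _ - _)); rewrite bilin_unit; apply: esym; exact: E.
Qed.

Lemma derive_bilin (Y Z : 'rV[R]_n -> 'rV[R]_n) u : differentiable Y x -> differentiable Z x ->
  'D_u (fun y => bilin (g y) (Y y) (Z y)) x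
  = bilin ('D_u g x) (Y x) (Z x) + bilin (g x) ('D_u Y x) (Z x) + bilin (g x) (Y x) ('D_u Z x).
Proof.
move=> dY dZ.
have dZT : differentiable (fun y => (Z y)^T) x.
  apply: differentiable_mx => i j; under eq_fun do rewrite mxE; exact: differentiable_mxE.
have dYg := differentiable_mulmx Y g x dY dg.
have dYgZ := differentiable_mulmx _ _ x dYg dZT.
apply: etrans (esym (derive_mxE (fun y => Y y *m g y *m (Z y)^T) x u 0 0 dYgZ)) _.
rewrite (derive_mulmx (fun y => Y y *m g y) (fun y => (Z y)^T) x u dYg dZT).
rewrite (derive_mulmx Y g x u dY dg) (derive_trmx Z x u dZ) mulmxDl [LHS]mxE [X in X + _]mxE.
by rewrite [X in X + _]addrC.
Qed.

Lemma levi_civita_metric X (Y Z : 'rV[R]_n -> 'rV[R]_n) : g x \in unitmx -> (g x)^T = g x ->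
  (forall u, ('D_u g x)^T = 'D_u g x) ->
  differentiable Y x -> differentiable Z x ->
  'D_(X x) (fun y => bilin (g y) (Y y) (Z y)) x
  = bilin (g x) (levi_civita g X Y x) (Z x) + bilin (g x) (Y x) (levi_civita g X Z x).
Proof.
move=> gu gT DgT dY dZ; rewrite (derive_bilin Y Z (X x) dY dZ).
have lcE T : levi_civita g X T x = 'D_(X x) T x + levi_civita g (cst (X x)) (cst (T x)) x.
  by rewrite /levi_civita derive_cst add0r.
rewrite (lcE Y) (lcE Z) bilinDl bilinDr.
have E1 := bilin_levi_civita_cst (X x) (Y x) (Z x) gu.
have E2 := etrans (bilinC (g x) (Y x) (levi_civita g (cst (X x)) (cst (Z x)) x) gT)
  (bilin_levi_civita_cst (X x) (Z x) (Y x) gu).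
have E3 := christoffel_form_metric Dg DgT (X x) (Y x) (Z x).
have arith (a b c p q s t : R) : p = s -> q = t -> s + t = a -> a + b + c = (b + p) + (c + q).
  by move=> -> -> <-; ring.
exact: arith E1 E2 E3.
Qed.

End LeviCivita.

Lemma derive_scale {R : realType} {V : normedModType R} {m n} (k : V -> R) (f : V -> 'M[R]_(m, n)) x v :
  differentiable k x -> differentiable f x ->
  'D_v (fun y => k y *: f y) x = 'D_v k x *: f x + k x *: 'D_v f x.
Proof.
move=> dk df.
have dfij i j : differentiable (fun y => f y i j) x by exact: differentiable_mxE.
have dkf : differentiable (fun y => k y *: f y) x.
  apply: differentiable_mx => i j; under eq_fun do rewrite mxE.
  exact: (@differentiableM _ _ k (fun y => f y i j) x dk (dfij i j)).
apply/matrixP => i j; apply: etrans (derive_mxE _ x v i j dkf) _.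
under eq_fun do rewrite mxE.
apply: etrans (deriveM (f := k) (g := fun y => f y i j) _ _) _; try exact: diff_derivable.
rewrite !mxE (derive_mxE f x v i j df) addrC; congr (_ + _); exact: mulrC.
Qed.

Lemma derive_add {R : realType} {V W : normedModType R} (f g : V -> W) x v :
  differentiable f x -> differentiable g x ->
  'D_v (fun y => f y + g y) x = 'D_v f x + 'D_v g x.
Proof. by move=> df dg; apply: (deriveD (f := f) (g := g)); exact: diff_derivable. Qed.

Lemma bilin_inj {R : realType} {n} (B : 'M[R]_n) (a b : 'rV[R]_n) : B \in unitmx ->
  (forall w, bilin B a w = bilin B b w) -> a = b.
Proof.
move=> Bu ab; suff : a *m B = b *m B by move/(congr1 (mulmx^~ (invmx B))); rewrite !mulmxK.
by apply/rowP => j; rewrite -!bilin_unitr.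
Qed.

(** * Total symmetry of the cubic form *)

Section Codazzi.
Context {R : realType} (U : set 'rV[R]_3) (G xi : 'rV[R]_3 -> 'rV[R]_4).
Context (oU : open U) (sG : smooth_on U G) (sxi : smooth_on U xi).
Context (frame_unit : forall x, U x -> gauss_frame G xi x \in unitmx).
Context (equiaffine : forall x v, U x -> Defs.transversal G xi x ('D_v xi x) = 0).
Context (h_unit : forall x, U x -> affine_metric G xi x \in unitmx).
Implicit Types (x u v w : 'rV[R]_3).

Local Notation tan := (tangential G xi).
Local Notation trans := (Defs.transversal G xi).
Local Notation h := (affine_metric G xi).
Local Notation K := (difference_tensor G xi).
Local Notation A v w := (nabla G xi (cst v) (cst w)).

Let dJ x (Ux : U x) : differentiable (fun x => 'J G x : 'M[R]_(3, 4)) x :=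
  smooth_on_differentiable U _ x (smooth_on_jacobian U G oU sG) Ux.
Let sh : smooth_on U h := smooth_on_affine_metric U G xi oU sG sxi frame_unit.
Let dh x (Ux : U x) : differentiable h x := smooth_on_differentiable U _ x sh Ux.
Let dxi x (Ux : U x) : differentiable xi x := smooth_on_differentiable U _ x sxi Ux.
Let hT x (Ux : U x) : (h x)^T = h x := affine_metric_sym U G xi oU sG x Ux.

Lemma derive_affine_metric_sym x u : U x -> ('D_u h x)^T = 'D_u h x.
Proof.
move=> Ux; rewrite -(derive_trmx h x u (dh x Ux)).
by apply: (eq_in_derive U) => // y Uy; exact: hT.
Qed.

Lemma smooth_on_nabla_cst v w : smooth_on U (A v w).
Proof. by apply: (smooth_on_tangential U G xi) => //; exact: smooth_on_flat_derivative. Qed.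

Lemma differentiable_bilin (g : 'rV[R]_3 -> 'M[R]_3) (Y Z : 'rV[R]_3 -> 'rV[R]_3) x :
  differentiable g x -> differentiable Y x -> differentiable Z x ->
  differentiable (fun y => bilin (g y) (Y y) (Z y)) x.
Proof.
move=> dg dY dZ; apply: (differentiable_mxE (fun y => Y y *m g y *m (Z y)^T) x 0 0).
apply: differentiable_mulmx; first exact: differentiable_mulmx.
by apply: differentiable_mx => i j; under eq_fun do rewrite mxE; exact: differentiable_mxE.
Qed.

(** This is the [xi] component of a third derivative of [G]. The derivative of [xi] does not
    contribute, being tangential; symmetry of the third derivatives is then the Codazzi equation for
    [h]. *)
Lemma transversal_derive_flat_derivative u v w x : U x ->
  trans x ('D_u (flat_derivative G (cst v) (cst w)) x)
  = bilin (h x) u (A v w x) + bilin ('D_u h x) v w.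
Proof.
move=> Ux.
pose f y := A v w y *m 'J G y; pose k y := bilin (h y) v w.
have dA : differentiable (A v w) x := smooth_on_differentiable U _ x (smooth_on_nabla_cst v w) Ux.
have df : differentiable f x by exact: differentiable_mulmx dA (dJ x Ux).
have dk : differentiable k x.
  exact: differentiable_bilin h (cst v) (cst w) x (dh x Ux) (differentiable_cst _ _) (differentiable_cst _ _).
have dkxi : differentiable (fun y => k y *: xi y) x.
  apply: differentiable_mx => i j; under eq_fun do rewrite mxE.
  exact: (@differentiableM _ _ k (fun y => xi y i j) x dk (differentiable_mxE _ _ _ _ (dxi x Ux))).
have -> : 'D_u (flat_derivative G (cst v) (cst w)) x = 'D_u (fun y => f y + k y *: xi y) x.
  apply: (eq_in_derive U) => // y Uy.
  exact: (gauss_formula U G xi oU sG frame_unit (cst v) (cst w) y Uy (differentiable_cst _ _)).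
have -> : 'D_u (fun y => f y + k y *: xi y) x = 'D_u f x + 'D_u (fun y => k y *: xi y) x.
  exact: derive_add df dkxi.
rewrite (derive_mulmx (A v w) (fun y => 'J G y) x u dA (dJ x Ux)) (derive_scale k xi x u dk (dxi x Ux)).
rewrite !transversalD !transversalZ (equiaffine x u Ux) mulr0 addr0.
have [_] := tangential_transversalK U G xi frame_unit x ('D_u (A v w) x) 0 Ux.
rewrite scale0r addr0 => ->; rewrite add0r.
have [_] := tangential_transversalK U G xi frame_unit x 0 1 Ux.
rewrite mul0mx add0r scale1r => ->; rewrite mulr1.
rewrite -(flat_derivative_cst U G oU sG u (A v w x) x Ux).
congr (_ + _); first exact: (affine_form_cst U G xi oU sG u (A v w x) x Ux).
have := derive_bilin h x (dh x Ux) (cst v) (cst w) u (differentiable_cst _ _) (differentiable_cst _ _).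
by rewrite !derive_cst bilin0l bilin0r !addr0.
Qed.

Lemma derive_flat_derivativeC u v w x : U x ->
  'D_u (flat_derivative G (cst v) (cst w)) x = 'D_v (flat_derivative G (cst u) (cst w)) x.
Proof.
move=> Ux.
have E a b y : U y -> flat_derivative G (cst a) (cst b) y = 'D_a (fun z => 'D_b G z) y.
  exact: (flat_derivative_derive U G oU sG a b y).
apply: etrans (eq_in_derive U _ _ x u oU Ux (E v w)) _.
apply: etrans _ (esym (eq_in_derive U _ _ x v oU Ux (E u w))).
by apply: (derive_derive_comm_mx _ U _ _ _ oU Ux); exact: smooth_on_derive.
Qed.

Lemma cubic_formE u v w x : U x ->
  bilin (h x) (K x u v) w = bilin (h x) w (A u v x)
    - christoffel_form (fun u => 'D_u h x) u v w.
Proof.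
move=> Ux; rewrite /difference_tensor bilinBl (bilinC _ (A u v x) w (hT x Ux)).
by rewrite (bilin_levi_civita_cst h x (dh x Ux) u v w (h_unit x Ux)).
Qed.

Lemma cubic_formC12 u v w x : U x -> bilin (h x) (K x u v) w = bilin (h x) (K x v u) w.
Proof.
move=> Ux; apply: etrans (cubic_formE u v w x Ux) _; apply: etrans _ (esym (cubic_formE v u w x Ux)).
apply: (f_equal2 (fun a b => a - b)); last first.
  by apply: christoffel_formC => t; exact: derive_affine_metric_sym.
exact: (f_equal (fun z => bilin (h x) w (tan x z)) (flat_derivative_cstC U G oU sG u v x Ux)).
Qed.

(** Third derivatives of [G] make h(w, A(u, v)) + (D_w h)(u, v) symmetric in [v] and [w], and
    antisymmetrizing the Christoffel form produces exactly the same two derivatives of the metric,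
    so they cancel. *)
Lemma cubic_formC23 u v w x : U x -> bilin (h x) (K x u v) w = bilin (h x) (K x u w) v.
Proof.
move=> Ux; apply: etrans (cubic_formE u v w x Ux) _; apply: etrans _ (esym (cubic_formE u w v x Ux)).
have T a b c := transversal_derive_flat_derivative a b c x Ux.
have DT a : ('D_a h x)^T = 'D_a h x := derive_affine_metric_sym x a Ux.
have : bilin (h x) w (A u v x) + bilin ('D_w h x) u v = bilin (h x) v (A u w x) + bilin ('D_v h x) u w.
  apply: etrans (esym (T w u v)) _; apply: etrans _ (T v u w); apply: (f_equal (trans x)).
  apply: etrans (derive_flat_derivativeC w u v x Ux) _.
  apply: etrans _ (esym (derive_flat_derivativeC v u w x Ux)).
  apply: (eq_in_derive U _ _ x u oU Ux) => y Uy.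
  exact: (flat_derivative_cstC U G oU sG w v y Uy).
have := christoffel_form_swap (fun a => 'D_a h x) DT u v w.
have arith (a b c c' p q : R) : c - c' = q - p -> a + p = b + q -> a - c = b - c'.
  move=> H1 H2; apply/eqP; rewrite -subr_eq0.
  have -> : a - c - (b - c') = (a + p - (b + q)) - (c - c' - (q - p)) by ring.
  by rewrite H1 H2 !subrr.
exact: arith.
Qed.

End Codazzi.

Lemma derive_exp {R : realType} {V : normedModType R} (f : V -> R) n x v : differentiable f x ->
  differentiable (fun y => f y ^+ n.+1) x /\
  'D_v (fun y => f y ^+ n.+1) x = n.+1%:R * f x ^+ n * 'D_v f x.
Proof.
move=> df; elim: n => [|n [dfn IH]].
  by under eq_fun do rewrite expr1; rewrite expr0 !mul1r.
under eq_fun do rewrite exprS; split; first exact: (differentiableM df dfn).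
apply: etrans (deriveM (f := f) (g := fun y => f y ^+ n.+1) _ _) _; try exact: diff_derivable.
by rewrite IH /GRing.scale /= exprS -[n.+2]add1n natrD; ring.
Qed.

(** * Linearity, symmetry of the shape operator, and apolarity *)

Section Apolarity.
Context {R : realType} (U : set 'rV[R]_3) (G xi : 'rV[R]_3 -> 'rV[R]_4).
Context (oU : open U) (sG : smooth_on U G) (sxi : smooth_on U xi).
Context (frame_unit : forall x, U x -> gauss_frame G xi x \in unitmx).
Context (equiaffine : forall x v, U x -> Defs.transversal G xi x ('D_v xi x) = 0).
Context (h_unit : forall x, U x -> affine_metric G xi x \in unitmx).
Implicit Types (x u v w : 'rV[R]_3).

Local Notation tan := (tangential G xi).
Local Notation trans := (Defs.transversal G xi).
Local Notation h := (affine_metric G xi).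
Local Notation K := (difference_tensor G xi).
Local Notation A v w := (nabla G xi (cst v) (cst w)).

Let sh : smooth_on U h := smooth_on_affine_metric U G xi oU sG sxi frame_unit.
Let dh x (Ux : U x) : differentiable h x := smooth_on_differentiable U _ x sh Ux.
Let dxi x (Ux : U x) : differentiable xi x := smooth_on_differentiable U _ x sxi Ux.
Let hT x (Ux : U x) : (h x)^T = h x := affine_metric_sym U G xi oU sG x Ux.
Let C12 u v w x (Ux : U x) := cubic_formC12 U G xi oU sG sxi frame_unit h_unit u v w x Ux.
Let C23 u v w x (Ux : U x) := cubic_formC23 U G xi oU sG sxi frame_unit equiaffine h_unit u v w x Ux.

Lemma difference_tensorC x u v : U x -> K x u v = K x v u.
Proof. by move=> Ux; apply: (bilin_inj (h x)); [exact: h_unit|move=> w; exact: C12]. Qed.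

Lemma difference_tensor_linearr x u c v w : U x -> K x u (c *: v + w) = c *: K x u v + K x u w.
Proof.
move=> Ux; apply: (bilin_inj (h x)) => [|t]; first exact: h_unit.
apply: etrans (C23 _ _ _ _ Ux) _; rewrite (bilinDr _ (c *: v) w) (bilinZr _ c) (bilinDl _ (c *: K x u v)) (bilinZl _ c (K x u v)).
by apply: (f_equal2 (fun a b => c * a + b)); exact: C23.
Qed.

Definition difference_mx x u : 'M[R]_3 := \matrix_(j < 3) K x u (unit_vec j).

Lemma difference_mxE x u v : U x -> K x u v = v *m difference_mx x u.
Proof.
move=> Ux; rewrite [LHS](linear_unit_vec (K x u)); last first.
  by move=> c v1 v2; exact: difference_tensor_linearr.
rewrite [RHS]mulmx_sum_row; apply: eq_bigr => j _; congr (_ *: _).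
by rewrite rowK.
Qed.

Lemma shape_linear x c u v : U x -> Defs.shape G xi x (c *: u + v) = c *: Defs.shape G xi x u + Defs.shape G xi x v.
Proof.
move=> Ux; rewrite /Defs.shape (derive_linear x xi c u v (dxi x Ux)) tangentialD tangentialZ.
by rewrite opprD scalerN.
Qed.

Definition shape_mx x : 'M[R]_3 := \matrix_(j < 3) Defs.shape G xi x (unit_vec j).

Lemma shape_mxE x v : U x -> Defs.shape G xi x v = v *m shape_mx x.
Proof.
move=> Ux; rewrite [LHS](linear_unit_vec (Defs.shape G xi x)); last first.
  by move=> c v1 v2; exact: shape_linear.
rewrite [RHS]mulmx_sum_row; apply: eq_bigr => j _; congr (_ *: _).
by rewrite rowK.
Qed.

Lemma weingarten x v : U x -> 'D_v xi x = - Defs.shape G xi x v *m 'J G x.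
Proof.
move=> Ux; apply: etrans (tangential_transversal U G xi frame_unit x _ Ux) _.
by rewrite equiaffine // scale0r addr0 /Defs.shape opprK.
Qed.

Lemma smooth_on_shape v : smooth_on U (fun x => Defs.shape G xi x v).
Proof.
apply: (smooth_on_oppmx _ oU); apply: (smooth_on_tangential U G xi) => //.
exact: smooth_on_derive.
Qed.

Lemma transversal_derive_weingarten x u v : U x ->
  trans x ('D_u (fun y => 'D_v xi y) x) = - bilin (h x) u (Defs.shape G xi x v).
Proof.
move=> Ux.
pose S y := - Defs.shape G xi y v.
have dS : differentiable S x.
  by apply: smooth_on_differentiable Ux; apply: (smooth_on_oppmx _ oU); exact: smooth_on_shape.
have dJ : differentiable (fun y => 'J G y : 'M[R]_(3, 4)) x.
  by apply: smooth_on_differentiable Ux; exact: smooth_on_jacobian.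
have -> : 'D_u (fun y => 'D_v xi y) x = 'D_u (fun y => S y *m 'J G y) x.
  by apply: (eq_in_derive U _ _ x u oU Ux) => y Uy; exact: weingarten.
rewrite (derive_mulmx S (fun y => 'J G y) x u dS dJ) transversalD.
have [_] := tangential_transversalK U G xi frame_unit x ('D_u S x) 0 Ux.
rewrite scale0r addr0 => ->; rewrite add0r.
rewrite -(flat_derivative_cst U G oU sG u (S x) x Ux).
apply: etrans (affine_form_cst U G xi oU sG u (S x) x Ux) _.
by rewrite bilinNr.
Qed.

(** The Ricci equation: the [xi] component of the second derivative of [xi] along u and v is -h(u, S
    v), and second derivatives commute. *)
Lemma shape_selfadjoint x u v : U x -> bilin (h x) (Defs.shape G xi x u) v = bilin (h x) u (Defs.shape G xi x v).
Proof.
move=> Ux; rewrite bilinC; last exact: hT.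
apply: oppr_inj; apply: etrans (esym (transversal_derive_weingarten x v u Ux)) _.
apply: etrans _ (transversal_derive_weingarten x u v Ux).
by apply: (f_equal (trans x)); exact: derive_derive_comm_mx oU Ux sxi.
Qed.

Context (volume : forall x (X : 'M[R]_3), U x ->
  `|\det (col_mx (X *m 'J G x) (xi x) : 'M[R]_(3 + 1))| = Num.sqrt `|\det (X *m h x *m X^T)|).

(** Taking fourth powers removes both the absolute values and the square root from the volume
    condition, leaving an identity that can be differentiated. *)
Lemma det_frame_metric x : U x -> (\det (gauss_frame G xi x)) ^+ 4 = (\det (h x)) ^+ 2.
Proof.
move=> Ux; have := volume x 1%:M Ux; rewrite mul1mx mul1mx trmx1 mulmx1 => E.
have -> : \det (gauss_frame G xi x) ^+ 4 = (`|\det (gauss_frame G xi x)| ^+ 2) ^+ 2.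
  by rewrite real_normK ?num_real // -exprM.
have -> : `|\det (gauss_frame G xi x)| = Num.sqrt `|\det (h x)| by exact: E.
by rewrite sqr_sqrtr // real_normK // num_real.
Qed.

(** The left side is the logarithmic derivative of the determinant of the moving frame. The row of
    [xi] contributes nothing because [xi] is equiaffine, and the other rows give the trace of the
    induced connection. *)
Lemma trace_nabla x u : U x ->
  \tr ('D_u (gauss_frame G xi) x *m invmx (gauss_frame G xi x)) = \sum_j (A u (unit_vec j) x) 0 j.
Proof.
move=> Ux.
have df : differentiable (gauss_frame G xi) x.
  by apply: smooth_on_differentiable Ux; exact: smooth_on_gauss_frame.
pose M := 'D_u (gauss_frame G xi) x.
have Mi i : row i M = 'D_u (fun y => row i (gauss_frame G xi y)) x.
  apply/rowP => j; rewrite mxE; apply: etrans (derive_mxE _ _ _ _ _ df) _.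
  have dr : differentiable (fun y => row i (gauss_frame G xi y)) x.
    by apply: differentiable_mx => a b; under eq_fun do rewrite mxE; exact: differentiable_mxE.
  apply: etrans _ (esym (derive_mxE _ _ _ _ _ dr)).
  by under [in RHS]eq_fun do rewrite mxE.
rewrite /mxtrace (@big_split_ord _ _ _ 3 1) /= big_ord1.
have E i k : ((M *m invmx (gauss_frame G xi x)) i k) = (row i M *m invmx (gauss_frame G xi x)) 0 k.
  by rewrite -row_mul [RHS]mxE.
rewrite E Mi (_ : (fun y => row _ _) = xi); last first.
  by apply/funext => y; apply/rowP => j; rewrite mxE (col_mxEd ('J G _)) ord1.
have -> : ('D_u xi x *m invmx (gauss_frame G xi x)) 0 (@rshift 3 1 0) = 0.
  by apply: etrans _ (equiaffine x u Ux); rewrite /Defs.transversal [RHS]mxE.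
rewrite addr0; apply: eq_bigr => j _.
have rowG : (fun y => row (@lshift 3 1 j) (gauss_frame G xi y)) = (fun y => unit_vec j *m 'J G y).
  by apply/funext => y; apply/rowP => k; rewrite -rowE [LHS]mxE (col_mxEu ('J G _)) [RHS]mxE.
by rewrite E Mi rowG /nabla /tangential [RHS]mxE.
Qed.

Lemma trace_nabla_metric x u : U x ->
  2 * \sum_j (A u (unit_vec j) x) 0 j = \tr ('D_u h x *m invmx (h x)).
Proof.
move=> Ux.
have df : differentiable (gauss_frame G xi) x.
  by apply: smooth_on_differentiable Ux; exact: smooth_on_gauss_frame.
rewrite -trace_nabla //.
have [d1 D1] := derive_det (gauss_frame G xi) x u df (frame_unit x Ux).
have [d2 D2] := derive_det h x u (dh x Ux) (h_unit x Ux).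
have fn0 : \det (gauss_frame G xi x) != 0 by rewrite -unitfE -unitmxE; exact: frame_unit.
have : 'D_u (fun y => (\det (gauss_frame G xi y)) ^+ 4) x = 'D_u (fun y => (\det (h y)) ^+ 2) x.
  by apply: (eq_in_derive U _ _ x u oU Ux) => y Uy; exact: det_frame_metric.
move=> H.
have [_ H4] := derive_exp (fun y => \det (gauss_frame G xi y)) 3 x u d1.
have [_ H2] := derive_exp (fun y => \det (h y)) 1 x u d2.
have {}H := etrans (esym H4) (etrans H H2).
rewrite D1 D2 in H.
have Ex := det_frame_metric x Ux.
have arith (a b s t : R) : a != 0 -> a ^+ 4 = b ^+ 2 ->
    4%:R * a ^+ 3 * (a * s) = 2%:R * b ^+ 1 * (b * t) -> 2 * s = t.
  move=> a0 ab E; apply: (mulfI (x := 2 * a ^+ 4)); first by rewrite mulf_neq0 // ?pnatr_eq0 // expf_neq0.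
  have -> : 2 * a ^+ 4 * (2 * s) = 4%:R * a ^+ 3 * (a * s) by ring.
  by rewrite E ab; ring.
exact: arith fn0 Ex H.
Qed.

(** The trace of K_u is the difference of the traces of the induced and of the Levi-Civita
    connection. Both are the logarithmic derivative of the metric volume, the first by the volume
    condition on [xi]. *)
Lemma apolar x u : U x -> \sum_j (K x u (unit_vec j)) 0 j = 0.
Proof.
move=> Ux.
pose Gm : 'M[R]_3 := \matrix_j levi_civita h (cst u) (cst (unit_vec j)) x.
pose D a := 'D_a h x.
have DT a : (D a)^T = D a := derive_affine_metric_sym U G xi oU sG sxi frame_unit x a Ux.
pose CF : 'M[R]_3 := \matrix_(j, l) christoffel_form D u (unit_vec j) (unit_vec l).
have GmE : Gm = CF *m invmx (h x).
  suff : Gm *m h x = CF by move=> <-; rewrite mulmxK // h_unit.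
  apply/matrixP => j l; rewrite [RHS]mxE.
  apply: etrans _ (bilin_levi_civita_cst h x (dh x Ux) u (unit_vec j) (unit_vec l) (h_unit x Ux)).
  by rewrite bilin_unitr -[in RHS](rowK (fun j => levi_civita h (cst u) (cst (unit_vec j)) x) j) -row_mul [RHS]mxE.
(* Adding [CF] to its transpose leaves only the derivative of the metric, and transposition does not
   change the trace against a symmetric matrix. *)
have trG : 2 * \tr Gm = \tr (D u *m invmx (h x)).
  have hiT : (invmx (h x))^T = invmx (h x) by rewrite trmx_inv hT.
  have trT : \tr Gm = \tr (CF^T *m invmx (h x)).
    by rewrite GmE -mxtrace_tr trmx_mul hiT mxtrace_mulC.
  rewrite (_ : 2 * \tr Gm = \tr Gm + \tr Gm); last by rewrite mulrC mulr_natr mulr2n.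
  rewrite {1}trT GmE -linearD /= -mulmxDl; congr (\tr (_ *m _)).
  apply/matrixP => j l; rewrite !mxE addrC.
  apply: etrans (christoffel_form_metric D DT u (unit_vec j) (unit_vec l)) _.
  exact: bilin_unit.
have := trace_nabla_metric x u Ux; rewrite -trG => E.
have two0 : (2 : R) != 0 by rewrite pnatr_eq0.
have {}E := mulfI two0 E.
have -> : \sum_j (K x u (unit_vec j)) 0 j = \sum_j (A u (unit_vec j) x) 0 j - \tr Gm.
  rewrite /mxtrace -sumrB; apply: eq_bigr => j _; rewrite /difference_tensor [LHS]mxE; congr (_ + _).
  by rewrite !mxE.
by rewrite E subrr.
Qed.

Lemma apolar_frame x u (E : 'M[R]_3) : U x -> E *m h x *m E^T = 1%:M ->
  \sum_i bilin (h x) (K x u (row i E)) (row i E) = 0.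
Proof.
move=> Ux EhE; pose Km := difference_mx x u.
have hEE : h x *m E^T *m E = 1%:M by apply: mulmx1C; rewrite mulmxA.
have -> : \sum_i bilin (h x) (K x u (row i E)) (row i E) = \tr (E *m Km *m (h x *m E^T)).
  apply: eq_bigr => i _; rewrite difference_mxE // /bilin -/Km.
  rewrite -row_mul -row_mul mulmxA.
  by rewrite [LHS]mxE [RHS]mxE; apply: eq_bigr => k _; rewrite !mxE.
rewrite -mulmxA mxtrace_mulC -mulmxA hEE mulmx1 -[RHS](apolar x u Ux).
by apply: eq_bigr => j _; rewrite mxE.
Qed.

End Apolarity.

(** * Pointwise normal form *)

Section Vec3.
Context {R : comUnitRingType}.
Implicit Types (u v w : 'rV[R]_3) (L : 'M[R]_3).

Definition i0 : 'I_3 := Ordinal (isT : (0 < 3)%N).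
Definition i1 : 'I_3 := Ordinal (isT : (1 < 3)%N).
Definition i2 : 'I_3 := Ordinal (isT : (2 < 3)%N).

Lemma ord3P (P : 'I_3 -> Prop) : P i0 -> P i1 -> P i2 -> forall i, P i.
Proof.
move=> P0 P1 P2 [[|[|[|//]]] Hi].
- by rewrite (_ : Ordinal Hi = i0) //; apply: val_inj.
- by rewrite (_ : Ordinal Hi = i1) //; apply: val_inj.
- by rewrite (_ : Ordinal Hi = i2) //; apply: val_inj.
Qed.

Lemma sum3 {V : nmodType} (F : 'I_3 -> V) : \sum_(i < 3) F i = F i0 + F i1 + F i2.
Proof.
rewrite !big_ord_recr big_ord0 /= add0r.
by congr (F _ + F _ + F _); apply: val_inj.
Qed.

(** With all entries explicit, identities between matrices and products split into polynomial
    identities for [ring] and [lra]. *)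
Definition vec3 (a b c : R) : 'rV[R]_3 := \row_j [:: a; b; c]`_j.
Definition mx3 (a b c d e f g h i : R) : 'M[R]_3 :=
  \matrix_(j, k) (nth [::] [:: [:: a; b; c]; [:: d; e; f]; [:: g; h; i]] j)`_k.

Lemma vec3_eta v : v = vec3 (v 0 i0) (v 0 i1) (v 0 i2).
Proof. by apply/rowP; apply: ord3P; rewrite mxE. Qed.

Lemma vec3_inj a b c a' b' c' : vec3 a b c = vec3 a' b' c' -> [/\ a = a', b = b' & c = c'].
Proof.
by move=> /rowP E; split; [have := E i0|have := E i1|have := E i2]; rewrite !mxE.
Qed.

Lemma mx3_eta L : L = mx3 (L i0 i0) (L i0 i1) (L i0 i2) (L i1 i0) (L i1 i1) (L i1 i2)
   (L i2 i0) (L i2 i1) (L i2 i2).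
Proof. by apply/matrixP; apply: ord3P; apply: ord3P; rewrite mxE. Qed.

Lemma mx3_inj a b c d e f g h i a' b' c' d' e' f' g' h' i' :
  mx3 a b c d e f g h i = mx3 a' b' c' d' e' f' g' h' i' ->
  [/\ [/\ a = a', b = b' & c = c'], [/\ d = d', e = e' & f = f'] & [/\ g = g', h = h' & i = i']].
Proof.
move=> /matrixP E; split; split.
- by have := E i0 i0; rewrite !mxE.
- by have := E i0 i1; rewrite !mxE.
- by have := E i0 i2; rewrite !mxE.
- by have := E i1 i0; rewrite !mxE.
- by have := E i1 i1; rewrite !mxE.
- by have := E i1 i2; rewrite !mxE.
- by have := E i2 i0; rewrite !mxE.
- by have := E i2 i1; rewrite !mxE.
- by have := E i2 i2; rewrite !mxE.
Qed.

Lemma vec3_mul x y z a b c d e f g h i :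
  vec3 x y z *m mx3 a b c d e f g h i =
  vec3 (x * a + y * d + z * g) (x * b + y * e + z * h) (x * c + y * f + z * i).
Proof. by apply/rowP; apply: ord3P; rewrite mxE sum3 !mxE. Qed.

Lemma mx3_mul a b c d e f g h i a' b' c' d' e' f' g' h' i' :
  mx3 a b c d e f g h i *m mx3 a' b' c' d' e' f' g' h' i' =
  mx3 (a * a' + b * d' + c * g') (a * b' + b * e' + c * h') (a * c' + b * f' + c * i')
      (d * a' + e * d' + f * g') (d * b' + e * e' + f * h') (d * c' + e * f' + f * i')
      (g * a' + h * d' + i * g') (g * b' + h * e' + i * h') (g * c' + h * f' + i * i').
Proof. by apply/matrixP; apply: ord3P; apply: ord3P; rewrite mxE sum3 !mxE. Qed.

Lemma mx3_tr a b c d e f g h i : (mx3 a b c d e f g h i)^T = mx3 a d g b e h c f i.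
Proof. by apply/matrixP; apply: ord3P; apply: ord3P; rewrite !mxE. Qed.

Lemma mx3_1 : 1%:M = mx3 1 0 0 0 1 0 0 0 1.
Proof. by apply/matrixP; apply: ord3P; apply: ord3P; rewrite !mxE. Qed.

Lemma vec3Z k a b c : k *: vec3 a b c = vec3 (k * a) (k * b) (k * c).
Proof. by apply/rowP; apply: ord3P; rewrite !mxE. Qed.

Lemma det_mx3 a b c d e f g h i : \det (mx3 a b c d e f g h i) =
  a * (e * i - f * h) - b * (d * i - f * g) + c * (d * h - e * g).
Proof.
rewrite (expand_det_row _ ord0) sum3 /cofactor.
rewrite !(expand_det_row _ ord0) !big_ord_recl !big_ord0 /cofactor !det_mx11 !mxE /=.
by rewrite !expr0 !expr1 /bump /=; ring.
Qed.

End Vec3.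

Lemma bilin1_vec3 {R : realType} (a b c a' b' c' : R) :
  bilin 1%:M (vec3 a b c) (vec3 a' b' c') = a * a' + b * b' + c * c'.
Proof. by rewrite /bilin mulmx1 mxE sum3 !mxE. Qed.

Section NormalForm.
Context {R : realType}.
Implicit Types (u v w : 'rV[R]_3) (L : 'M[R]_3) (mu p q l a c s : R).

(** [symmetry_group] detached from a hypersurface: the two agree by unfolding once metric, shape
    operator and difference tensor at a point are supplied. *)
Definition stabilizer (h : 'M[R]_3) (S : 'rV[R]_3 -> 'rV[R]_3)
    (K : 'rV[R]_3 -> 'rV[R]_3 -> 'rV[R]_3) : set 'M[R]_3 :=
  [set L | [/\ 0 < \det L,
    forall v w, bilin h (v *m L) (w *m L) = bilin h v w,
    forall v, S (v *m L) = S v *m L &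
    forall v w, K (v *m L) (w *m L) = K v w *m L]].

(** The most general traceless totally symmetric product invariant under the rotation of order three
    about the first axis. Its cubic form on the plane is the real part of (p - iq)(y + iz)^3; a
    rotation about the axis will remove [q]. *)
Definition normal_product mu p q u v : 'rV[R]_3 :=
  vec3 (2 * mu * (u 0 i0 * v 0 i0) - mu * (u 0 i1 * v 0 i1 + u 0 i2 * v 0 i2))
    (- mu * (u 0 i0 * v 0 i1 + u 0 i1 * v 0 i0) + p * (u 0 i1 * v 0 i1 - u 0 i2 * v 0 i2)
       + q * (u 0 i1 * v 0 i2 + u 0 i2 * v 0 i1))
    (- mu * (u 0 i0 * v 0 i2 + u 0 i2 * v 0 i0) + q * (u 0 i1 * v 0 i1 - u 0 i2 * v 0 i2)
       - p * (u 0 i1 * v 0 i2 + u 0 i2 * v 0 i1)).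

Definition normal_shape l a u : 'rV[R]_3 := vec3 (l * u 0 i0) (a * u 0 i1) (a * u 0 i2).

Definition normal_stabilizer mu p q l a :=
  stabilizer 1%:M (normal_shape l a) (normal_product mu p q).

Definition rotx c s : 'M[R]_3 := mx3 1 0 0 0 c s 0 (- s) c.

Lemma normal_product_vec3 mu p q x y z x' y' z' :
  normal_product mu p q (vec3 x y z) (vec3 x' y' z') =
  vec3 (2 * mu * (x * x') - mu * (y * y' + z * z'))
    (- mu * (x * y' + y * x') + p * (y * y' - z * z') + q * (y * z' + z * y'))
    (- mu * (x * z' + z * x') + q * (y * y' - z * z') - p * (y * z' + z * y')).
Proof. by rewrite /normal_product !mxE. Qed.

Lemma normal_shape_vec3 l a x y z : normal_shape l a (vec3 x y z) = vec3 (l * x) (a * y) (a * z).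
Proof. by rewrite /normal_shape !mxE. Qed.

Lemma rot_stabilizer mu l a c s : c ^+ 2 + s ^+ 2 = 1 -> normal_stabilizer mu 0 0 l a (rotx c s).
Proof.
move=> cs; have s2 : s ^+ 2 = 1 - c ^+ 2 by rewrite -cs addrC addKr.
split.
- by rewrite /rotx det_mx3; have -> : (1 * (c * c - s * - s) - 0 * (0 * c - s * 0) + 0 * (0 * - s - c * 0)) = c ^+ 2 + s ^+ 2; [ring|rewrite cs ltr01].
- move=> v w; rewrite (vec3_eta v) (vec3_eta w) !vec3_mul !bilin1_vec3; ring: s2.
- move=> v; rewrite (vec3_eta v) !(vec3_mul, normal_shape_vec3); congr vec3; ring.
- move=> v w; rewrite (vec3_eta v) (vec3_eta w) !(vec3_mul, normal_product_vec3); congr vec3; ring: s2.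
Qed.

Lemma rot3_stabilizer mu p q l a r : r ^+ 2 = 3 -> normal_stabilizer mu p q l a (rotx (- 2^-1) (r / 2)).
Proof.
move=> s2.
split.
- rewrite /rotx det_mx3 (_ : _ + _ = 4^-1 + 4^-1 * r ^+ 2); last by field.
  by rewrite s2 (_ : _ + _ = 1) ?ltr01 //; field.
- move=> v w; rewrite (vec3_eta v) (vec3_eta w) !vec3_mul !bilin1_vec3; by field: s2.
- move=> v; rewrite (vec3_eta v) !(vec3_mul, normal_shape_vec3); congr vec3; ring.
- move=> v w; rewrite (vec3_eta v) (vec3_eta w) !(vec3_mul, normal_product_vec3); congr vec3; by field: s2.
Qed.

Definition commutative_set (A : set 'M[R]_3) := forall L1 L2, A L1 -> A L2 -> L1 *m L2 = L2 *m L1.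

Lemma sqrt3_neq0 : (Num.sqrt 3 : R) != 0.
Proof. by rewrite gt_eqF // sqrtr_gt0. Qed.

(** For mu = 0 the half-turn about the second axis is a further symmetry, and it does not commute
    with the rotation of order three. *)
Lemma commutative_mu_neq0 mu p l a : commutative_set (normal_stabilizer mu p 0 l a) -> mu != 0.
Proof.
move=> cG; apply/eqP => mu0; rewrite mu0 in cG.
have s2 : (Num.sqrt 3 : R) ^+ 2 = 3 by rewrite sqr_sqrtr.
have sn0 := sqrt3_neq0; set s := Num.sqrt 3 in s2 sn0.
have G0 := rot3_stabilizer 0 p 0 l a s s2.
have G1 : normal_stabilizer 0 p 0 l a (mx3 (-1) 0 0 0 1 0 0 0 (-1)).
  split.
  - by rewrite det_mx3 (_ : _ + _ = 1) ?ltr01 //; ring.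
  - move=> v w; rewrite (vec3_eta v) (vec3_eta w) !vec3_mul !bilin1_vec3; ring.
  - move=> v; rewrite (vec3_eta v) !(vec3_mul, normal_shape_vec3); congr vec3; ring.
  - move=> v w; rewrite (vec3_eta v) (vec3_eta w) !(vec3_mul, normal_product_vec3); congr vec3; ring.
have := cG _ _ G0 G1; rewrite /rotx !mx3_mul => /mx3_inj[_ [_ _ H] _].
by move/eqP: sn0; apply; lra.
Qed.

(** In the excluded case the cubic form is tetrahedral and S is scalar. With t = p / mu, so t^2 = 2,
    the half-turn about the direction (1, t, 0) is then a symmetry that does not commute with the
    rotation of order three. *)
Lemma commutative_not_scalar mu p l a : mu != 0 -> commutative_set (normal_stabilizer mu p 0 l a) ->
  p ^+ 2 != 2 * mu ^+ 2 \/ l != a.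
Proof.
move=> mu0 cG; apply: contrapT => /not_orP[/negP/negPn/eqP p2 /negP/negPn/eqP la]; rewrite la in cG.
have s2 : (Num.sqrt 3 : R) ^+ 2 = 3 by rewrite sqr_sqrtr.
have sn0 := sqrt3_neq0; set s := Num.sqrt 3 in s2 sn0.
have G0 := rot3_stabilizer mu p 0 a a s s2.
pose t := p / mu.
have pt : p = t * mu by rewrite /t divfK.
have t2 : t ^+ 2 = 2 by rewrite /t expr_div_n p2 mulfK // expf_neq0.
have G1 : normal_stabilizer mu p 0 a a (mx3 (- 3^-1) (2 / 3 * t) 0 (2 / 3 * t) 3^-1 0 0 0 (-1)).
  rewrite pt; split.
  - rewrite det_mx3 (_ : _ + _ = 9^-1 + 4 / 9 * t ^+ 2); last by field.
    by rewrite t2 (_ : _ + _ = 1) ?ltr01 //; field.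
  - move=> v w; rewrite (vec3_eta v) (vec3_eta w) !vec3_mul !bilin1_vec3; by field: t2.
  - move=> v; rewrite (vec3_eta v) !(vec3_mul, normal_shape_vec3); congr vec3; ring.
  - move=> v w; rewrite (vec3_eta v) (vec3_eta w) !(vec3_mul, normal_product_vec3); congr vec3; by field: t2.
have := cG _ _ G0 G1; rewrite /rotx !mx3_mul => /mx3_inj[[_ _ H] _ _].
have ts : t * s = 0 by lra.
have /eqP := ts; rewrite mulf_eq0 (negbTE sn0) orbF => /eqP t0.
by rewrite t0 expr0n /= in t2; lra.
Qed.

(** If p = q = 0, every rotation about the axis is a symmetry, in particular the quarter turn, whose
    cube is not the identity. *)
Lemma cube1_not_rotational mu p q l a :
  (forall L, normal_stabilizer mu p q l a L -> L *m L *m L = 1%:M) -> p != 0 \/ q != 0.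
Proof.
move=> cG; apply: contrapT => /not_orP[/negP/negPn/eqP p0 /negP/negPn/eqP q0]; rewrite p0 q0 in cG.
have G0 : normal_stabilizer mu 0 0 l a (rotx 0 1) by apply: rot_stabilizer; rewrite expr0n expr1n add0r.
by have := cG _ G0; rewrite /rotx !mx3_mul mx3_1 => /mx3_inj[_ [_ H _] _]; lra.
Qed.

End NormalForm.

Section Rotational.
Context {R : realType}.
Implicit Types (u v w : 'rV[R]_3) (L : 'M[R]_3) (mu p q l a c s : R).

(** An order-four symmetry commuting with the rotation of order three has to be a quarter turn about
    the axis, and a quarter turn does not preserve a nonzero cubic of the form Re((p - iq)(y +
    iz)^3). *)
Lemma order4_rotational mu p q l a L : mu != 0 -> commutative_set (normal_stabilizer mu p q l a) ->
  normal_stabilizer mu p q l a L -> L *m L != 1%:M -> L *m L *m (L *m L) = 1%:M -> p = 0 /\ q = 0.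
Proof.
move=> mu0 cG GL; have [_ HB _ HK] := GL.
have r2 : (Num.sqrt 3 : R) ^+ 2 = 3 by rewrite sqr_sqrtr.
have rn0 : (Num.sqrt 3 : R) != 0 by exact: sqrt3_neq0.
set r := Num.sqrt 3 in r2 rn0.
have := cG _ _ (rot3_stabilizer mu p q l a r r2) GL.
move: HB HK; rewrite (mx3_eta L); move: (L i0 i0) (L i0 i1) (L i0 i2) (L i1 i0) (L i1 i1) (L i1 i2)
   (L i2 i0) (L i2 i1) (L i2 i2) => x0 x1 x2 y0 y1 y2 z0 z1 z2 HB HK.
rewrite /rotx !mx3_mul => /mx3_inj[[_ E01 E02] [E10 E11 E12] [E20 _ _]] nL2 L4.
(* Commutation says that the mixed entries of [L] form a plane vector fixed by a rotation through a
   third of a turn; such a vector is zero. *)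
have sol (b c : R) : 3 * b = - (c * r) -> 3 * c = b * r -> b = 0 /\ c = 0.
  move=> H1 H2; have b0 : b = 0.
    have E : 9 * b = - (3 * c * r) by move: H1; clear; lra.
    have E' : b * r * r = b * 3 by rewrite -mulrA -expr2 r2.
    by move: E; rewrite H2 E'; clear; lra.
  by split => //; move: H2; rewrite b0 mul0r => /eqP; rewrite mulf_eq0 pnatr_eq0 => /eqP.
have [x10 x20] : x1 = 0 /\ x2 = 0 by apply: sol; move: E01 E02; clear; lra.
have [z00 y00] : z0 = 0 /\ y0 = 0 by apply: sol; move: E10 E20; clear; lra.
have z1E : z1 = - y2.
  apply: (mulfI rn0); move: E11; clear; lra.
have z2E : z2 = y1 by apply: (mulfI rn0); move: E12; clear; lra.
have x02 : x0 * x0 = 1.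
  by have := HB (vec3 1 0 0) (vec3 1 0 0); rewrite !vec3_mul !bilin1_vec3 x10 x20; clear; lra.
have yy : y1 * y1 + y2 * y2 = 1.
  by have := HB (vec3 0 1 0) (vec3 0 1 0); rewrite !vec3_mul !bilin1_vec3 y00; clear; lra.
(* [L] preserves the axis up to sign. The sign is plus because K(e_1, e_1) = 2 mu e_1 with mu
   nonzero is quadratic in e_1. *)
have x01 : x0 = 1.
  have := HK (vec3 1 0 0) (vec3 1 0 0); rewrite !(vec3_mul, normal_product_vec3) x10 x20 => /vec3_inj[+ _ _].
  move=> H; have {}H : mu * (x0 * x0) = mu * x0 by move: H; clear; lra.
  by move: (mulfI mu0 H); rewrite x02.
move: L4 nL2; rewrite mx3_1 x10 x20 y00 z00 z1E z2E x01 => /mx3_inj[_ [_ H4 _] _] nL2.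
(* On the plane [L] is a rotation with cosine [y1] and sine [y2], and cos 4 theta = 1 - 8 (y1 y2)^2
   = 1. A vanishing sine would give L^2 = 1, so it is the cosine that vanishes. *)
have y12 : y1 * y2 = 0.
  have : (y1 * y2) ^+ 2 = 0.
    have : (y1 * y1 + y2 * y2) ^+ 2 - 8 * (y1 * y2) ^+ 2 = 1 by rewrite -[RHS]H4; ring.
    by rewrite yy; clear; lra.
  by move/eqP; rewrite sqrf_eq0 => /eqP.
have y10 : y1 = 0.
  move/eqP: y12; rewrite mulf_eq0 => /orP[/eqP //|/eqP y20].
  exfalso; move/eqP : nL2; apply; rewrite y20 in yy *.
  by congr mx3; move: yy; clear; lra.
rewrite y10 mul0r add0r in yy.
have := HK (vec3 0 1 0) (vec3 0 1 0); rewrite !(vec3_mul, normal_product_vec3) x10 x20 y00 z1E z2E y10.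
move=> /vec3_inj[_ H1 H2].
have p0 : p = 0.
  have P1 : p * (y2 * y2) = q * y2 by move: H1; clear; lra.
  have P2 : - (q * (y2 * y2)) = p * y2 by move: H2; clear; lra.
  rewrite yy !mulr1 in P1 P2.
  have qE : q = - (p * y2) by rewrite -P2 opprK.
  have : p = - p * (y2 * y2) by rewrite [LHS]P1 [in LHS]qE; ring.
  by rewrite yy; clear; lra.
split => //; rewrite p0 in H2; have : q * (y2 * y2) = 0 by move: H2; clear; lra.
by rewrite yy mulr1.
Qed.

Lemma SO2P (Q : 'M[R]_2) : SO R 2 Q ->
  [/\ Q 1 1 = Q 0 0, Q 1 0 = - Q 0 1 & Q 0 0 ^+ 2 + Q 0 1 ^+ 2 = 1].
Proof.
move=> [QQ dQ].
have D : Q 0 0 * Q 1 1 - Q 0 1 * Q 1 0 = 1.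
  rewrite -dQ (expand_det_row _ 0) !big_ord_recl big_ord0 /cofactor !det_mx11 !mxE /= addr0.
  rewrite expr0 expr1 mul1r mulN1r mulrN.
  by congr (Q _ _ * Q _ _ - Q _ _ * Q _ _); apply: val_inj.
have E i j : Q i 0 * Q j 0 + Q i 1 * Q j 1 = (i == j)%:R.
  have /matrixP/(_ i j) := QQ; rewrite !mxE !big_ord_recl big_ord0 !mxE addr0 => <-.
  by congr (_ + Q _ _ * Q _ _); apply: val_inj.
have E00 := E 0 0; have E01 := E 0 1; have E11 := E 1 1; rewrite /= in E00 E01 E11.
split.
- have -> : Q 1 1 = Q 1 1 * (Q 0 0 * Q 0 0 + Q 0 1 * Q 0 1) by rewrite E00 mulr1.
  have -> : Q 1 1 * (Q 0 0 * Q 0 0 + Q 0 1 * Q 0 1) =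
     Q 0 0 * (Q 0 0 * Q 1 1 - Q 0 1 * Q 1 0) + Q 0 1 * (Q 0 0 * Q 1 0 + Q 0 1 * Q 1 1) by ring.
  by rewrite D E01 mulr1 mulr0 addr0.
- have -> : Q 1 0 = Q 1 0 * (Q 0 0 * Q 0 0 + Q 0 1 * Q 0 1) by rewrite E00 mulr1.
  have -> : Q 1 0 * (Q 0 0 * Q 0 0 + Q 0 1 * Q 0 1) =
     - Q 0 1 * (Q 0 0 * Q 1 1 - Q 0 1 * Q 1 0) + Q 0 0 * (Q 0 0 * Q 1 0 + Q 0 1 * Q 1 1) by ring.
  by rewrite D E01 mulr1 mulr0 addr0.
- by rewrite !expr2.
Qed.

Definition mx2 a b c d : 'M[R]_2 := \matrix_(i, j) (nth [::] [:: [:: a; b]; [:: c; d]] i)`_j.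

Lemma mx2_eta (Q : 'M[R]_2) : Q = mx2 (Q 0 0) (Q 0 1) (Q 1 0) (Q 1 1).
Proof.
apply/matrixP => -[[|[|//]] Hi] [[|[|//]] Hj]; rewrite mxE /=; congr (Q _ _); exact: val_inj.
Qed.

Lemma mx2_mul a b c d a' b' c' d' : mx2 a b c d *m mx2 a' b' c' d' =
  mx2 (a * a' + b * c') (a * b' + b * d') (c * a' + d * c') (c * b' + d * d').
Proof.
by apply/matrixP => -[[|[|//]] Hi] [[|[|//]] Hj]; rewrite !mxE !big_ord_recl big_ord0 !mxE /= addr0.
Qed.

Lemma SO_rot2 c s : c ^+ 2 + s ^+ 2 = 1 -> SO R 2 (mx2 c s (- s) c).
Proof.
move=> cs; split.
  have -> : (mx2 c s (- s) c)^T = mx2 c (- s) s c.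
    by apply/matrixP => -[[|[|//]] Hi] [[|[|//]] Hj]; rewrite !mxE.
  rewrite mx2_mul; apply/matrixP => -[[|[|//]] Hi] [[|[|//]] Hj]; rewrite !mxE /=.
  - by rewrite -[RHS]cs; ring.
  - by ring.
  - by ring.
  - by rewrite -[RHS]cs; ring.
rewrite (expand_det_row _ 0) !big_ord_recl big_ord0 /cofactor !det_mx11 !mxE /= addr0 /bump /=.
by rewrite expr0 expr1 -[RHS]cs; ring.
Qed.

Definition rot_of_SO2 (Q : 'M[R]_2) : 'M[R]_3 := mx3 1 0 0 0 (Q 0 0) (Q 0 1) 0 (Q 1 0) (Q 1 1).

(** For p = q = 0 the first basis vector is the only unit vector v with K(v, v) = 2 mu v, so every
    symmetry fixes it; being an isometry with positive determinant, it is then a rotation of the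
    plane. *)
Lemma rotational_SO2 mu l a : mu != 0 ->
  group_isomorphic (SO R 2) mulmx (normal_stabilizer mu 0 0 l a) mulmx.
Proof.
move=> mu0; exists rot_of_SO2; last first.
  move=> Q1 Q2 _ _; rewrite /rot_of_SO2 mx3_mul.
  by congr mx3; rewrite ?mxE ?big_ord_recl ?big_ord0 ?mulr0 ?mul0r ?mulr1 ?addr0 ?add0r //;
     congr (_ + Q1 _ _ * Q2 _ _); apply: val_inj.
split.
- move=> Q /SO2P[Q11 Q10 Q2].
  by rewrite /rot_of_SO2 Q11 Q10; exact: rot_stabilizer.
- move=> Q1 Q2 _ _ /mx3_inj[_ [_ E1 E2] [_ E3 E4]].
  by rewrite (mx2_eta Q1) (mx2_eta Q2) E1 E2 E3 E4.
- move=> L GL; have [dL HB _ HK] := GL.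
  move: dL HB HK; rewrite (mx3_eta L); move: (L i0 i0) (L i0 i1) (L i0 i2) (L i1 i0) (L i1 i1) (L i1 i2)
   (L i2 i0) (L i2 i1) (L i2 i2) => x0 x1 x2 y0 y1 y2 z0 z1 z2 dL HB HK.
  have N : x0 * x0 + x1 * x1 + x2 * x2 = 1.
    by have := HB (vec3 1 0 0) (vec3 1 0 0); rewrite !vec3_mul !bilin1_vec3; clear; lra.
  have := HK (vec3 1 0 0) (vec3 1 0 0); rewrite !(vec3_mul, normal_product_vec3) => /vec3_inj[H0 H1 H2].
  have {}H0 : 2 * (x0 * x0) - (x1 * x1 + x2 * x2) = 2 * x0.
    by apply: (mulfI mu0); move: H0; clear; lra.
  have {}H1 : - (x0 * x1) = x1 by apply: (mulfI mu0); move: H1; clear; lra.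
  have {}H2 : - (x0 * x2) = x2 by apply: (mulfI mu0); move: H2; clear; lra.
  have x01 : x0 = 1.
    have : (x0 - 1) * (3 * x0 + 1) = 0 by move: N H0; clear; nra.
    move/eqP; rewrite mulf_eq0 subr_eq0 => /orP[/eqP //|/eqP x03].
    have x0E : x0 = - 3^-1 by move: x03; clear; lra.
    rewrite x0E in H1 H2 N.
    have x10 : x1 = 0 by move: H1; clear; lra.
    have x20 : x2 = 0 by move: H2; clear; lra.
    by move: N; rewrite x10 x20; clear; lra.
  have x10 : x1 = 0 by move: H1; rewrite x01; clear; lra.
  have x20 : x2 = 0 by move: H2; rewrite x01; clear; lra.
  have y00 : y0 = 0.
    by have := HB (vec3 1 0 0) (vec3 0 1 0); rewrite !vec3_mul !bilin1_vec3 x01 x10 x20; clear; lra.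
  have z00 : z0 = 0.
    by have := HB (vec3 1 0 0) (vec3 0 0 1); rewrite !vec3_mul !bilin1_vec3 x01 x10 x20; clear; lra.
  have yy : y1 * y1 + y2 * y2 = 1.
    by have := HB (vec3 0 1 0) (vec3 0 1 0); rewrite !vec3_mul !bilin1_vec3 y00; clear; lra.
  have zz : z1 * z1 + z2 * z2 = 1.
    by have := HB (vec3 0 0 1) (vec3 0 0 1); rewrite !vec3_mul !bilin1_vec3 z00; clear; lra.
  have yz : y1 * z1 + y2 * z2 = 0.
    by have := HB (vec3 0 1 0) (vec3 0 0 1); rewrite !vec3_mul !bilin1_vec3 y00; clear; lra.
  have d0 : 0 < y1 * z2 - y2 * z1.
    by move: dL; rewrite det_mx3 x01 x10 x20; clear; rewrite (_ : _ + _ = y1 * z2 - y2 * z1) //; ring.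
  have d1 : y1 * z2 - y2 * z1 = 1.
    have : (y1 * z2 - y2 * z1) ^+ 2 = 1.
      have -> : (y1 * z2 - y2 * z1) ^+ 2 = (y1 * y1 + y2 * y2) * (z1 * z1 + z2 * z2) - (y1 * z1 + y2 * z2) ^+ 2 by ring.
      by rewrite yy zz yz; ring.
    move/eqP; rewrite sqrf_eq1 => /orP[/eqP //|/eqP H].
    by move: d0; rewrite H ltr0N1.
  have z2E : z2 = y1.
    have -> : z2 = z2 * (y1 * y1 + y2 * y2) by rewrite yy mulr1.
    have -> : z2 * (y1 * y1 + y2 * y2) = y1 * (y1 * z2 - y2 * z1) + y2 * (y1 * z1 + y2 * z2) by ring.
    by rewrite d1 yz; ring.
  have z1E : z1 = - y2.
    have -> : z1 = z1 * (y1 * y1 + y2 * y2) by rewrite yy mulr1.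
    have -> : z1 * (y1 * y1 + y2 * y2) = - y2 * (y1 * z2 - y2 * z1) + y1 * (y1 * z1 + y2 * z2) by ring.
    by rewrite d1 yz; ring.
  exists (mx2 y1 y2 (- y2) y1); first by apply: SO_rot2; rewrite !expr2.
  by rewrite /rot_of_SO2 !mxE /= x01 x10 x20 y00 z00 z2E z1E.
Qed.

End Rotational.

Section NormalFrames.
Context {R : realType}.
Implicit Types (u v w e : 'rV[R]_3) (L E h : 'M[R]_3) (mu p q l a c s : R).

Definition rows3 e1 e2 e3 : 'M[R]_3 := \matrix_i nth 0 [:: e1; e2; e3] i.

Lemma rows3_mul x y z e1 e2 e3 : vec3 x y z *m rows3 e1 e2 e3 = x *: e1 + y *: e2 + z *: e3.
Proof. by rewrite mulmx_sum_row sum3 !rowK !mxE. Qed.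

Lemma rows3_gram h e1 e2 e3 : rows3 e1 e2 e3 *m h *m (rows3 e1 e2 e3)^T =
  mx3 (bilin h e1 e1) (bilin h e1 e2) (bilin h e1 e3)
      (bilin h e2 e1) (bilin h e2 e2) (bilin h e2 e3)
      (bilin h e3 e1) (bilin h e3 e2) (bilin h e3 e3).
Proof.
apply/matrixP => i j; rewrite -bilin_unit -bilin_mul -!rowE !rowK.
by move: j; elim/ord3P: i; apply: ord3P; rewrite mxE.
Qed.

Lemma row_rows3 e1 e2 e3 i : row i (rows3 e1 e2 e3) = nth 0 [:: e1; e2; e3] i.
Proof. exact: rowK. Qed.

(** The rows of [E] are the frame vectors, so [x *m E] is the vector with components [x]. The
    parameter [q] stays free until the frame has been rotated about its first vector. *)
Variant is_normal_frame h (S : 'rV[R]_3 -> 'rV[R]_3) (K : 'rV[R]_3 -> 'rV[R]_3 -> 'rV[R]_3)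
    E mu p q l a : Prop :=
  NormalFrame of E *m h *m E^T = 1%:M
    & (forall x, S (x *m E) = normal_shape l a x *m E)
    & (forall x y, K (x *m E) (y *m E) = normal_product mu p q x y *m E).

Section Transport.
Context {h : 'M[R]_3} {S : 'rV[R]_3 -> 'rV[R]_3} {K : 'rV[R]_3 -> 'rV[R]_3 -> 'rV[R]_3}.
Context {E : 'M[R]_3} {mu p q l a : R} (nfE : is_normal_frame h S K E mu p q l a).

Lemma normal_frame_unit : E \in unitmx.
Proof. by case: nfE => EhE _ _; have /mulmx1_unit[] : E *m (h *m E^T) = 1%:M by rewrite mulmxA. Qed.

Lemma normal_stabilizerE L : normal_stabilizer mu p q l a L <-> stabilizer h S K (invmx E *m L *m E).
Proof.
have Eu := normal_frame_unit; case: nfE => EhE SE KE.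
have xE v : v = (v *m invmx E) *m E by rewrite mulmxKV.
have vL v : v *m (invmx E *m L *m E) = (v *m invmx E *m L) *m E by rewrite !mulmxA.
have dE : \det (invmx E *m L *m E) = \det L.
  by rewrite !det_mulmx mulrAC -det_mulmx mulVmx // det1 mul1r.
have canE : injective (fun x : 'rV[R]_3 => x *m E) by exact: can_inj (mulmxK Eu).
split=> -[dL HB HS HK]; split.
- by rewrite dE.
- by move=> v w; rewrite !vL bilin_mul EhE HB [in RHS](xE v) [in RHS](xE w) [in RHS]bilin_mul EhE.
- by move=> v; rewrite vL SE HS [in RHS](xE v) SE vL mulmxK.
- by move=> v w; rewrite !vL KE HK [in RHS](xE v) [in RHS](xE w) KE mulmxK.
- by rewrite -dE.
- move=> v w; have := HB (v *m E) (w *m E); rewrite !vL !mulmxK // !bilin_mul EhE; exact.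
- by move=> v; apply: canE; have := HS (v *m E); rewrite !(vL, SE, mulmxK).
- by move=> v w; apply: canE; have := HK (v *m E) (w *m E); rewrite !(vL, KE, mulmxK).
Qed.

Lemma commutative_normal_stabilizer :
  commutative_set (stabilizer h S K) -> commutative_set (normal_stabilizer mu p q l a).
Proof.
have Eu := normal_frame_unit; move=> cG L1 L2 /normal_stabilizerE G1 /normal_stabilizerE G2.
have := cG _ _ G1 G2; rewrite !mulmxA !mulmxK // -!mulmxA => /(can_inj (mulKVmx Eu)).
by rewrite !mulmxA => /(can_inj (mulmxK Eu)).
Qed.

Lemma group_isomorphic_normal_stabilizer {T : Type} (A : set T) mulA :
  group_isomorphic A mulA (normal_stabilizer mu p q l a) mulmx ->
  group_isomorphic A mulA (stabilizer h S K) mulmx.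
Proof.
have Eu := normal_frame_unit; move=> [phi [fphi iphi sphi] mphi].
exists (fun x => invmx E *m phi x *m E); last first.
  by move=> x y Ax Ay; rewrite mphi // !mulmxA mulmxK.
split.
- by move=> x /fphi /normal_stabilizerE.
- move=> x y Ax Ay; rewrite -!mulmxA => /(can_inj (mulKVmx Eu)) /(can_inj (mulmxK Eu)).
  exact: iphi.
- move=> L GL; have LE : L = invmx E *m (E *m L *m invmx E) *m E by rewrite !mulmxA mulVmx // mul1mx mulmxKV.
  have /normal_stabilizerE/sphi[x Ax xE] : stabilizer h S K (invmx E *m (E *m L *m invmx E) *m E) by rewrite -LE.
  by exists x => //; rewrite xE -LE.
Qed.

Lemma normal_stabilizer_conj L : stabilizer h S K L -> normal_stabilizer mu p q l a (E *m L *m invmx E).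
Proof.
have Eu := normal_frame_unit; move=> GL; apply/normal_stabilizerE.
by rewrite !mulmxA mulVmx // mul1mx mulmxKV.
Qed.

(** The plane part of the cubic form has degree three, so rotating the frame by theta turns (p, q)
    by 3 theta: [P] and [Q] carry the first two steps, the conclusion the third. *)
Lemma rotate_normal_frame c s : c ^+ 2 + s ^+ 2 = 1 ->
  let P := (c ^+ 2 - s ^+ 2) * p + 2 * c * s * q in
  let Q := (c ^+ 2 - s ^+ 2) * q - 2 * c * s * p in
  is_normal_frame h S K (rotx c s *m E) mu (c * P + s * Q) (- s * P + c * Q) l a.
Proof.
move=> cs P Q; case: nfE => EhE SE KE.
have s2 : s ^+ 2 = 1 - c ^+ 2 by rewrite -cs addrC addKr.
split.
- rewrite trmx_mul !mulmxA -(mulmxA (rotx c s)) -(mulmxA (rotx c s)) EhE mulmx1 /rotx mx3_tr mx3_mul mx3_1.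
  by congr mx3; ring: s2.
- move=> x; rewrite !mulmxA SE; congr (_ *m _).
  by rewrite (vec3_eta x) /rotx !(vec3_mul, normal_shape_vec3); congr vec3; ring.
- move=> x y; rewrite !mulmxA KE; congr (_ *m _).
  rewrite (vec3_eta x) (vec3_eta y) /rotx !(vec3_mul, normal_product_vec3) /P /Q.
  by congr vec3; ring: s2.
Qed.

End Transport.

(** The equation reads q cos 3 theta = p sin 3 theta, solved by a third of atan (q / p). If p = 0, a
    twelfth of a turn makes cos 3 theta vanish. *)
Lemma triple_angle_solution p q : exists c s, c ^+ 2 + s ^+ 2 = 1 /\
  - s * ((c ^+ 2 - s ^+ 2) * p + 2 * c * s * q) + c * ((c ^+ 2 - s ^+ 2) * q - 2 * c * s * p) = 0.
Proof.
have [->|p0] := eqVneq p 0.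
  have r2 : (Num.sqrt 3 : R) ^+ 2 = 3 by rewrite sqr_sqrtr.
  set r := Num.sqrt 3 in r2.
  by exists (2^-1 * r), 2^-1; split; field: r2.
pose t := atan (q / p) / 3; exists (cos t), (sin t); rewrite cos2Dsin2; split => //.
have t3 : atan (q / p) = t + t + t by rewrite /t; field.
have := atanK (q / p); rewrite /tan t3 !(cosD, sinD).
set C := cos t * cos t - _; set S := sin t * cos t + _.
have c0 : C * cos t - S * sin t != 0.
  by rewrite gt_eqF // /C /S -!(cosD, sinD) -t3; by rewrite cos_atan invr_gt0 sqrtr_gt0 ltr_pwDl // sqr_ge0.
move=> /(congr1 (fun z => z * (C * cos t - S * sin t) * p)); rewrite divfK //.
rewrite [RHS]mulrAC divfK // => H.
have -> : - sin t * ((cos t ^+ 2 - sin t ^+ 2) * p + 2 * cos t * sin t * q) + cos t * ((cos t ^+ 2 - sin t ^+ 2) * q - 2 * cos t * sin t * p) =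
   q * (C * cos t - S * sin t) - (S * cos t + C * sin t) * p by rewrite /C /S; ring.
by rewrite H subrr.
Qed.

End NormalFrames.

(** * Consequences of the abstract group isomorphisms *)

Section SymmetryGroups.
Context {R : realType}.
Implicit Types (L : 'M[R]_3).

Lemma idempotent_unitmx L : L \in unitmx -> L *m L = L -> L = 1%:M.
Proof. by move=> Lu /(congr1 (mulmx (invmx L))); rewrite mulmxA mulVmx // mul1mx. Qed.

Section Iso.
Context {T : Type} (A : set T) (mulA : T -> T -> T) (h : 'M[R]_3) (S : 'rV[R]_3 -> 'rV[R]_3)
  (K : 'rV[R]_3 -> 'rV[R]_3 -> 'rV[R]_3).
Context (iso : group_isomorphic A mulA (stabilizer h S K) mulmx).

Lemma isomorphic_commutative : (forall x y, A x -> A y -> mulA x y = mulA y x) ->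
  commutative_set (stabilizer h S K).
Proof.
case: iso => phi [_ _ sphi] mphi cA L1 L2 /sphi[x Ax <-] /sphi[y Ay <-].
by rewrite -!mphi // cA.
Qed.

(** [group_isomorphic] asks only for a multiplicative bijection. A neutral element goes to an
    idempotent of positive determinant, and an invertible idempotent is the identity. *)
Lemma isomorphism_one : exists phi : T -> 'M[R]_3,
  [/\ set_bij A (stabilizer h S K) phi,
      forall x y, A x -> A y -> phi (mulA x y) = phi x *m phi y &
      forall e, A e -> mulA e e = e -> phi e = 1%:M].
Proof.
case: iso => phi bphi mphi; exists phi; split => // e Ae ee.
apply: idempotent_unitmx; last by rewrite -mphi // ee.
have [fphi _ _] := bphi; have [d0 _ _ _] := fphi _ Ae.
by rewrite unitmxE unitfE gt_eqF.
Qed.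
End Iso.

Lemma Z3_symmetry h S K : group_isomorphic [set: 'Z_3] +%R (stabilizer h S K) mulmx ->
  [/\ commutative_set (stabilizer h S K),
      exists L, [/\ stabilizer h S K L, L != 1%:M & L *m L *m L = 1%:M] &
      forall L, stabilizer h S K L -> L *m L *m L = 1%:M].
Proof.
move=> iso; have [phi [[fphi iphi sphi] mphi phi1]] := isomorphism_one _ _ _ _ _ iso.
have cube (x : 'Z_3) : phi x *m phi x *m phi x = 1%:M.
  rewrite -!mphi // phi1 //; last by case: x => [[|[|[|//]]] Hx]; apply: val_inj.
split.
- by apply: isomorphic_commutative iso _ => x y _ _; rewrite addrC.
- exists (phi 1); split; [exact: fphi| |exact: cube].
  apply/eqP; rewrite -(phi1 0) // ?addr0 // => /iphi.
  by move=> H; have := H (mem_set I) (mem_set I).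
- by move=> L /sphi[x _ <-].
Qed.

(** The element of order three is shared with Z_3, so that both cases reach the normal form by one
    argument; the element of order four will force p = q = 0. *)
Lemma SO2_symmetry h S K : group_isomorphic (SO R 2) mulmx (stabilizer h S K) mulmx ->
  [/\ commutative_set (stabilizer h S K),
      exists L, [/\ stabilizer h S K L, L != 1%:M & L *m L *m L = 1%:M] &
      exists L, [/\ stabilizer h S K L, L *m L != 1%:M & L *m L *m (L *m L) = 1%:M]].
Proof.
move=> iso; have [phi [[fphi iphi sphi] mphi phi1]] := isomorphism_one _ _ _ _ _ iso.
have SOM Q1 Q2 : SO R 2 Q1 -> SO R 2 Q2 -> SO R 2 (Q1 *m Q2).
  move=> [q1 d1] [q2 d2]; split; last by rewrite det_mulmx d1 d2 mulr1.
  by rewrite trmx_mul !mulmxA -(mulmxA Q1) q2 mulmx1 q1.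
have SO1 : SO R 2 1%:M by split; [rewrite mul1mx trmx1|rewrite det1].
have phi11 : phi 1%:M = 1%:M by apply: phi1 => //; rewrite mul1mx.
have neq1 Q : SO R 2 Q -> Q != 1%:M -> phi Q != 1%:M.
  move=> SQ; apply: contra_neq; rewrite -phi11; apply: iphi; exact: mem_set.
split.
- apply: isomorphic_commutative iso _ => Q1 Q2 /SO2P[a1 b1 _] /SO2P[a2 b2 _].
  rewrite (mx2_eta Q1) (mx2_eta Q2) !mx2_mul a1 b1 a2 b2.
  by congr mx2; ring.
- have r2 : (Num.sqrt 3 : R) ^+ 2 = 3 by rewrite sqr_sqrtr.
  set r := Num.sqrt 3 in r2.
  have SQ : SO R 2 (mx2 (- 2^-1) (r / 2) (- (r / 2)) (- 2^-1)) by apply: SO_rot2; field: r2.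
  exists (phi (mx2 (- 2^-1) (r / 2) (- (r / 2)) (- 2^-1))); split; first exact: fphi.
    apply: neq1 => //; apply/eqP => /matrixP/(_ 0 0); rewrite !mxE /= => H.
    by move: H; clear; lra.
  rewrite -!mphi //; last exact: SOM.
  rewrite [X in phi X](_ : _ = 1%:M) // !mx2_mul (mx2_eta 1%:M) !mxE /=.
  by congr mx2; field: r2.
- have SQ : SO R 2 (mx2 0 1 (- 1) 0) by apply: SO_rot2; ring.
  have Q2 : mx2 0 1 (- 1) 0 *m mx2 0 1 (- 1) 0 = mx2 (-1) 0 0 (-1) :> 'M[R]_2.
    by rewrite mx2_mul; congr mx2; ring.
  exists (phi (mx2 0 1 (- 1) 0)); rewrite -mphi // Q2.
  have SQ2 : SO R 2 (mx2 (-1) 0 0 (-1)) by rewrite -Q2; exact: SOM.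
  split; first exact: fphi.
    apply: neq1 => //; apply/eqP => /matrixP/(_ 0 0); rewrite !mxE /= => H.
    by move: H; clear; lra.
  rewrite -mphi // [X in phi X](_ : _ = 1%:M) // mx2_mul (mx2_eta 1%:M) !mxE /=.
  by congr mx2; ring.
Qed.
End SymmetryGroups.

Section OrderThree.
Context {R : realType} (h : 'M[R]_3) (S : 'rV[R]_3 -> 'rV[R]_3)
  (K : 'rV[R]_3 -> 'rV[R]_3 -> 'rV[R]_3).
Context (h_pos : posdef h).
Context (K_linear : forall u c v w, K u (c *: v + w) = c *: K u v + K u w).
Context (KC : forall u v, K u v = K v u).
Context (K_sym : forall u v w, bilin h (K u v) w = bilin h (K u w) v).
Context (K_apolar : forall u (E : 'M[R]_3), E *m h *m E^T = 1%:M ->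
  \sum_i bilin h (K u (row i E)) (row i E) = 0).
Context (S_linear : forall c v w, S (c *: v + w) = c *: S v + S w).
Context (S_sym : forall v w, bilin h (S v) w = bilin h v (S w)).
Implicit Types (u v w e : 'rV[R]_3) (L E : 'M[R]_3).

Let hT : h^T = h := proj1 h_pos.

Lemma posdef_unitmx : h \in unitmx.
Proof.
rewrite -row_free_unit -kermx_eq0; apply/eqP/eqP; apply: contraT => /rowV0Pn[v /sub_kermxP vh v0].
by have := proj2 h_pos v v0; rewrite /bilin vh mul0mx mxE ltxx.
Qed.

Lemma normalizable v : v != 0 -> exists c, bilin h (c *: v) (c *: v) = 1.
Proof.
move=> /(proj2 h_pos) v0; exists (Num.sqrt (bilin h v v))^-1.
by rewrite bilinZl bilinZr mulrA -expr2 exprVn sqr_sqrtr ?ltW // mulVf // gt_eqF.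
Qed.

Lemma orthogonal_vector m (A : 'M[R]_(3, m)) : (m < 3)%N -> exists2 v : 'rV[R]_3, v != 0 & v *m A = 0.
Proof.
move=> m3; have : kermx A != 0.
  by rewrite -mxrank_eq0 mxrank_ker subn_eq0 -ltnNge (leq_ltn_trans (rank_leq_col A)).
by move=> /rowV0Pn[v /sub_kermxP vA v0]; exists v.
Qed.

Lemma orthonormal_completion e1 : bilin h e1 e1 = 1 ->
  exists e2 e3, rows3 e1 e2 e3 *m h *m (rows3 e1 e2 e3)^T = 1%:M.
Proof.
move=> e11.
have [v v0 v1] := orthogonal_vector 1 (h *m e1^T) isT.
have [c e22] := normalizable v v0; set e2 := c *: v in e22.
have e21 : bilin h e2 e1 = 0 by rewrite bilinZl /bilin -mulmxA v1 mxE mulr0.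
have [w w0 w12] := orthogonal_vector (1 + 1) (row_mx (h *m e1^T) (h *m e2^T)) isT.
have [d e33] := normalizable w w0; set e3 := d *: w in e33.
have /eq_row_mx[w1 w2] : row_mx (w *m (h *m e1^T)) (w *m (h *m e2^T)) = row_mx 0 0.
  by rewrite row_mx0 -mul_mx_row.
have e31 : bilin h e3 e1 = 0 by rewrite bilinZl /bilin -mulmxA w1 mxE mulr0.
have e32 : bilin h e3 e2 = 0 by rewrite bilinZl /bilin -mulmxA w2 mxE mulr0.
exists e2, e3; rewrite rows3_gram mx3_1 e11 e22 e33 e21 e31 e32.
by rewrite (bilinC h e1 e2 hT) (bilinC h e1 e3 hT) (bilinC h e2 e3 hT) e21 e31 e32.
Qed.

(** From L h L^T = h follows (L - 1) h L^T = -h (L - 1)^T. In dimension three the sign comes out of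
    the determinant as -1, so det(L - 1) det(h) (det L + 1) = 0, where only the first factor can
    vanish. *)
Lemma isometry_fixed_vector L : 0 < \det L ->
  (forall v w, bilin h (v *m L) (w *m L) = bilin h v w) -> exists2 v : 'rV[R]_3, v != 0 & v *m L = v.
Proof.
move=> dL HL.
have LhL : L *m h *m L^T = h by apply/matrixP => i j; rewrite -!bilin_unit -bilin_mul HL.
have E : (L - 1%:M) *m h *m L^T = - (h *m (L - 1%:M)^T).
  by rewrite !mulmxBl mul1mx LhL linearB /= trmx1 mulmxBr mulmx1 opprB.
have dh : \det h != 0 by rewrite -unitfE -unitmxE; exact: posdef_unitmx.
have : \det (L - 1%:M) = 0.
  have := congr1 (fun A => \det A) E; rewrite -[in RHS](scaleN1r (h *m _)) detZ !det_mulmx !det_tr => D.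
  have : (\det (L - 1%:M) * \det h) * (\det L + 1) = 0.
    by rewrite mulrDr mulr1 D; ring.
  move/eqP; rewrite !mulf_eq0 (negbTE dh) orbF => /orP[/eqP //|].
  by rewrite gt_eqF // addr_gt0.
move/eqP/det0P => [v v0 vL]; exists v => //.
by move: vL; rewrite mulmxBr mulmx1 => /eqP; rewrite subr_eq0 => /eqP.
Qed.

End OrderThree.

(** A certificate for linear consequences of one equation: the multiplier [k] is supplied by hand
    and the remaining identity is left to [ring] or [field]. *)
Lemma linear_combination {R : comPzRingType} (E x k a b : R) :
  E = x -> a - b = k * (E - x) -> a = b.
Proof. by move=> -> /eqP; rewrite subrr mulr0 subr_eq0 => /eqP. Qed.

Section Axis.
Context {R : realType} (h : 'M[R]_3) (S : 'rV[R]_3 -> 'rV[R]_3)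
  (K : 'rV[R]_3 -> 'rV[R]_3 -> 'rV[R]_3).
Context (h_pos : posdef h).
Context (K_linear : forall u c v w, K u (c *: v + w) = c *: K u v + K u w).
Context (KC : forall u v, K u v = K v u).
Context (K_sym : forall u v w, bilin h (K u v) w = bilin h (K u w) v).
Context (K_apolar : forall u (E : 'M[R]_3), E *m h *m E^T = 1%:M ->
  \sum_i bilin h (K u (row i E)) (row i E) = 0).
Context (S_linear : forall c v w, S (c *: v + w) = c *: S v + S w).
Context (S_sym : forall v w, bilin h (S v) w = bilin h v (S w)).
Implicit Types (u v w e : 'rV[R]_3) (L E : 'M[R]_3).

Let hT : h^T = h := proj1 h_pos.

Let K0r u : K u 0 = 0.
Proof. by have := K_linear u (-1) 0 0; rewrite scaler0 addr0 scaleN1r addNr. Qed.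
Let KDr u v w : K u (v + w) = K u v + K u w.
Proof. by have := K_linear u 1 v w; rewrite !scale1r. Qed.
Let KZr u c v : K u (c *: v) = c *: K u v.
Proof. by have := K_linear u c v 0; rewrite K0r !addr0. Qed.
Let KDl u v w : K (v + w) u = K v u + K w u.
Proof. by rewrite KC KDr !(KC u). Qed.
Let KZl u c v : K (c *: v) u = c *: K v u.
Proof. by rewrite KC KZr (KC u). Qed.
Let S0 : S 0 = 0.
Proof. by have := S_linear (-1) 0 0; rewrite scaler0 addr0 scaleN1r addNr. Qed.
Let SD v w : S (v + w) = S v + S w.
Proof. by have := S_linear 1 v w; rewrite !scale1r. Qed.
Let SZ c v : S (c *: v) = c *: S v.
Proof. by have := S_linear c v 0; rewrite S0 !addr0. Qed.

Section Frame.
Context (e1 e2 e3 : 'rV[R]_3) (ortho : rows3 e1 e2 e3 *m h *m (rows3 e1 e2 e3)^T = 1%:M).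

Lemma orthonormal_rows3 :
  [/\ [/\ bilin h e1 e1 = 1, bilin h e1 e2 = 0 & bilin h e1 e3 = 0],
      [/\ bilin h e2 e1 = 0, bilin h e2 e2 = 1 & bilin h e2 e3 = 0] &
      [/\ bilin h e3 e1 = 0, bilin h e3 e2 = 0 & bilin h e3 e3 = 1]].
Proof. by move: ortho; rewrite rows3_gram mx3_1 => /mx3_inj. Qed.

Lemma orthonormal_expansion v :
  v = bilin h v e1 *: e1 + bilin h v e2 *: e2 + bilin h v e3 *: e3.
Proof.
rewrite -rows3_mul.
have E : h *m (rows3 e1 e2 e3)^T *m rows3 e1 e2 e3 = 1%:M by apply: mulmx1C; rewrite mulmxA.
rewrite -[LHS]mulmx1 -E !mulmxA; congr (_ *m _).
apply/rowP; apply: ord3P; rewrite [RHS]mxE /= mxE /bilin mxE; apply: eq_bigr => k _; by rewrite !mxE.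
Qed.

Lemma normal_frame_of_products mu p q l a :
  K e1 e1 = (2 * mu) *: e1 -> K e1 e2 = - mu *: e2 -> K e1 e3 = - mu *: e3 ->
  K e2 e2 = - mu *: e1 + p *: e2 + q *: e3 -> K e2 e3 = q *: e2 + - p *: e3 ->
  K e3 e3 = - mu *: e1 + - p *: e2 + - q *: e3 ->
  S e1 = l *: e1 -> S e2 = a *: e2 -> S e3 = a *: e3 ->
  is_normal_frame h S K (rows3 e1 e2 e3) mu p q l a.
Proof.
move=> K11 K12 K13 K22 K23 K33 S1 S2 S3; split => // [x|x y].
  rewrite (vec3_eta x) normal_shape_vec3 !rows3_mul !(SD, SZ) S1 S2 S3.
  by apply/rowP => j; rewrite !mxE; ring.
rewrite (vec3_eta x) (vec3_eta y) normal_product_vec3 !rows3_mul.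
rewrite !(KDl, KZl, KDr, KZr) (KC e2 e1) (KC e3 e1) (KC e3 e2) K11 K12 K13 K22 K23 K33.
by apply/rowP => j; rewrite !mxE; ring.
Qed.

Lemma apolar_rows3 u : bilin h (K u e1) e1 + bilin h (K u e2) e2 + bilin h (K u e3) e3 = 0.
Proof. by have := K_apolar u _ ortho; rewrite sum3 !row_rows3. Qed.

(** Once K_{e_1} and S are diagonal, total symmetry and apolarity leave just two free coefficients
    of K on the plane, namely the components of K(e_2, e_2) along e_2 and e_3. *)
Lemma normal_frame_of_axis mu l a :
  K e1 e1 = (2 * mu) *: e1 -> K e1 e2 = - mu *: e2 -> K e1 e3 = - mu *: e3 ->
  S e1 = l *: e1 -> S e2 = a *: e2 -> S e3 = a *: e3 ->
  is_normal_frame h S K (rows3 e1 e2 e3) mu (bilin h (K e2 e2) e2) (bilin h (K e2 e2) e3) l a.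
Proof.
move=> K11 K12 K13 S1 S2 S3.
have [[g11 g12 g13] [g21 g22 g23] [g31 g32 g33]] := orthonormal_rows3.
have t221 : bilin h (K e2 e2) e1 = - mu by rewrite K_sym KC K12 bilinZl g22 mulr1.
have t231 : bilin h (K e2 e3) e1 = 0 by rewrite K_sym KC K12 bilinZl g23 mulr0.
have t331 : bilin h (K e3 e3) e1 = - mu by rewrite K_sym KC K13 bilinZl g33 mulr1.
have t232 : bilin h (K e2 e3) e2 = bilin h (K e2 e2) e3 by rewrite K_sym.
have t233 : bilin h (K e2 e3) e3 = - bilin h (K e2 e2) e2.
  have := apolar_rows3 e2; rewrite (KC e2 e1) K12 bilinZl g21 mulr0 add0r => /eqP.
  by rewrite addrC addr_eq0 => /eqP.
have t332 : bilin h (K e3 e3) e2 = - bilin h (K e2 e2) e2 by rewrite K_sym KC t233.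
have t333 : bilin h (K e3 e3) e3 = - bilin h (K e2 e2) e3.
  have := apolar_rows3 e3; rewrite (KC e3 e1) K13 bilinZl g31 mulr0 add0r (KC e3 e2) t232 => /eqP.
  by rewrite addrC addr_eq0 => /eqP.
apply: normal_frame_of_products => //.
- by rewrite [LHS]orthonormal_expansion t221.
- by rewrite [LHS]orthonormal_expansion t231 t232 t233 scale0r add0r.
- by rewrite [LHS]orthonormal_expansion t331 t332 t333.
Qed.

End Frame.

Lemma order3_rotation L : stabilizer h S K L -> L != 1%:M -> L *m L *m L = 1%:M ->
  exists e1 e2 e3 s, [/\ rows3 e1 e2 e3 *m h *m (rows3 e1 e2 e3)^T = 1%:M, s ^+ 2 = 3 / 4 &
   [/\ e1 *m L = e1, e2 *m L = - 2^-1 *: e2 + s *: e3 & e3 *m L = - s *: e2 - 2^-1 *: e3]].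
Proof.
move=> [dL HL _ _] L1 L3.
have [v v0 vL] := isometry_fixed_vector h h_pos L dL HL.
have [c e11] := normalizable h h_pos v v0; set e1 := c *: v in e11.
have e1L : e1 *m L = e1 by rewrite -scalemxAl vL.
have [e2 [e3 ortho]] := orthonormal_completion h h_pos e1 e11.
exists e1, e2, e3; set E := rows3 e1 e2 e3 in ortho.
have [[g11 g12 g13] [g21 g22 g23] [g31 g32 g33]] := orthonormal_rows3 e1 e2 e3 ortho.
have x2 := orthonormal_expansion e1 e2 e3 ortho (e2 *m L).
have x3 := orthonormal_expansion e1 e2 e3 ortho (e3 *m L).
have b21 : bilin h (e2 *m L) e1 = 0 by rewrite -[X in bilin _ _ X]e1L HL.
have b31 : bilin h (e3 *m L) e1 = 0 by rewrite -[X in bilin _ _ X]e1L HL.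
rewrite b21 scale0r add0r in x2; rewrite b31 scale0r add0r in x3.
move: x2 x3; move: (bilin h (e2 *m L) e2) (bilin h (e2 *m L) e3) (bilin h (e3 *m L) e2) (bilin h (e3 *m L) e3).
move=> x s t d e2L e3L.
have E22 : x ^+ 2 + s ^+ 2 = 1.
  have := HL e2 e2; rewrite e2L !(bilinDl, bilinDr, bilinZl, bilinZr) g22 g23 g32 g33 => <-; ring.
have E33 : t ^+ 2 + d ^+ 2 = 1.
  have := HL e3 e3; rewrite e3L !(bilinDl, bilinDr, bilinZl, bilinZr) g22 g23 g32 g33 => <-; ring.
have E23 : x * t + s * d = 0.
  have := HL e2 e3; rewrite e2L e3L !(bilinDl, bilinDr, bilinZl, bilinZr) g22 g23 g32 g33 => <-; ring.
have EL : E *m L = mx3 1 0 0 0 x s 0 t d *m E.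
  apply/row_matrixP; apply: ord3P; rewrite !row_mul row_rows3 /=.
  - by rewrite (_ : row _ _ = vec3 1 0 0) ?rows3_mul ?scale0r ?scale1r ?addr0 //; apply/rowP => j; rewrite !mxE.
  - by rewrite (_ : row _ _ = vec3 0 x s) ?rows3_mul ?scale0r ?add0r //; apply/rowP => j; rewrite !mxE.
  - by rewrite (_ : row _ _ = vec3 0 t d) ?rows3_mul ?scale0r ?add0r //; apply/rowP => j; rewrite !mxE.
have Eu : E \in unitmx by have /mulmx1_unit[] : E *m (h *m E^T) = 1%:M by rewrite mulmxA.
set M := mx3 1 0 0 0 x s 0 t d in EL.
have M3 : M *m M *m M = 1%:M.
  have : E *m (L *m L *m L) = M *m M *m M *m E by rewrite !mulmxA EL -(mulmxA M E L) EL mulmxA -(mulmxA (M *m M) E L) EL !mulmxA.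
  by rewrite L3 mulmx1 -{1}[E]mul1mx => /(can_inj (mulmxK Eu)).
have M1 : M != 1%:M.
  apply: contra_neq L1 => M1; have : E *m L = E *m 1%:M by rewrite EL M1 mul1mx mulmx1.
  exact: (can_inj (mulKmx Eu)).
(* The determinant of the plane block: orthogonality gives (t, d) = k (-s, x) with k = 1 or -1. For
   k = -1 the block is a reflection, which squares to the identity and so cannot have order
   three. *)
pose k := x * d - s * t.
have tE : t = - s * k.
  have : t = t * (x ^+ 2 + s ^+ 2) by rewrite E22 mulr1.
  move=> ->; have -> : t * (x ^+ 2 + s ^+ 2) = x * (x * t + s * d) - s * k by rewrite /k; ring.
  by rewrite E23; ring.
have dE : d = x * k.
  have : d = d * (x ^+ 2 + s ^+ 2) by rewrite E22 mulr1.
  move=> ->; have -> : d * (x ^+ 2 + s ^+ 2) = s * (x * t + s * d) + x * k by rewrite /k; ring.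
  by rewrite E23; ring.
have k2 : k ^+ 2 = 1.
  have -> : k ^+ 2 = (x ^+ 2 + s ^+ 2) * (t ^+ 2 + d ^+ 2) - (x * t + s * d) ^+ 2 by rewrite /k; ring.
  by rewrite E22 E33 E23; ring.
have k1 : k = 1.
  move/eqP: k2; rewrite sqrf_eq1 => /orP[/eqP //|/eqP km].
  have MM : M *m M = 1%:M.
    rewrite /M tE dE km mx3_mul mx3_1; congr mx3; do ?ring.
    - by rewrite -[RHS]E22; ring.
    - by rewrite -[RHS]E22; ring.
  by move: M3; rewrite MM mul1mx => M1'; rewrite M1' eqxx in M1.
rewrite k1 !mulr1 in tE dE.
rewrite /M tE dE !mx3_mul mx3_1 in M3; have [_ [_ H1 H2] _] := mx3_inj _ _ _ _ _ _ _ _ _ _ _ _ _ _ _ _ _ _ M3.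
have s2 : s ^+ 2 = 1 - x ^+ 2 by rewrite -E22 addrC addKr.
(* The diagonal entry of the cube is cos 3 theta, and 4 x^3 - 3 x - 1 = (x - 1)(2 x + 1)^2, where x
   = 1 would be the identity. *)
have Hc : 4 * x ^+ 3 - 3 * x = 1 by rewrite -[RHS]H1; ring: s2.
have x1 : x != 1.
  apply: contra_neq M1 => x1; rewrite /M tE dE mx3_1.
  have s0 : s = 0 by apply/eqP; rewrite -sqrf_eq0 s2 x1; apply/eqP; ring.
  by rewrite x1 s0 oppr0.
have xE : x = - 2^-1.
  have : (x - 1) * (2 * x + 1) ^+ 2 = 0.
    have -> : (x - 1) * (2 * x + 1) ^+ 2 = 4 * x ^+ 3 - 3 * x - 1 by ring.
    by rewrite Hc subrr.
  move/eqP; rewrite mulf_eq0 subr_eq0 (negbTE x1) sqrf_eq0 => /eqP H.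
  by move/eqP: H; rewrite addr_eq0 => /eqP H; apply: (mulfI (x := 2)) => //; rewrite H; field.
exists s; split; [exact: ortho|by rewrite s2 xE; field|split; [exact: e1L|by rewrite e2L xE|]].
by rewrite e3L tE dE xE !scaleNr.
Qed.

Lemma order3_normal_frame L : stabilizer h S K L -> L != 1%:M -> L *m L *m L = 1%:M ->
  exists E mu p q l a, is_normal_frame h S K E mu p q l a.
Proof.
move=> GL L1 L3; have [e1 [e2 [e3 [s [ortho s2 [e1L e2L e3L]]]]]] := order3_rotation L GL L1 L3.
have [dL HL SL KL] := GL.
have [[g11 g12 g13] [g21 g22 g23] [g31 g32 g33]] := orthonormal_rows3 e1 e2 e3 ortho.
have TL u v w : bilin h (K (u *m L) (v *m L)) (w *m L) = bilin h (K u v) w by rewrite KL HL.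
have SL' u v : bilin h (S (u *m L)) (v *m L) = bilin h (S u) v by rewrite SL HL.
have s0 : s != 0.
  by apply/eqP => s0; move: s2; rewrite s0 expr0n /= => /esym/eqP; rewrite mulf_eq0 invr_eq0 !pnatr_eq0.
(* A plane vector fixed by a rotation through a third of a turn is zero. This serves for the plane
   parts of K(e_1, e_1) and S e_1, which turn with [L], and for the trace-free parts of K_{e_1} and
   S on the plane, which turn by twice the angle. *)
have two (b c : R) : 3 / 2 * b = s * c -> 3 / 2 * c = - (s * b) -> b = 0 /\ c = 0.
  move=> H1 H2.
  have b0 : b = 0.
    have : 3 * b = 4 / 3 * (3 / 2 * (3 / 2 * b) - s * (3 / 2 * c)) + (4 / 3 * s * (3 / 2 * c)) by field.
    rewrite H1 (_ : 3 / 2 * (s * c) - s * (3 / 2 * c) = 0); last by field.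
    rewrite H2 mulr0 add0r (_ : 4 / 3 * s * - (s * b) = - (4 / 3 * s ^+ 2 * b)); last by ring.
    rewrite s2 (_ : 4 / 3 * (3 / 4) = 1) ?mul1r; last by field.
    move=> H; have : 4 * b = 0 by rewrite (_ : 4 * b = 3 * b + b); [rewrite H addNr|ring].
    by move/eqP; rewrite mulf_eq0 pnatr_eq0 => /eqP.
  split => //; move: H1; rewrite b0 mulr0 => /esym/eqP; rewrite mulf_eq0 (negbTE s0) => /eqP //.
have [t112 t113] : bilin h (K e1 e1) e2 = 0 /\ bilin h (K e1 e1) e3 = 0.
  have H1 := TL e1 e1 e2; have H2 := TL e1 e1 e3.
  rewrite e1L e2L bilinDr !bilinZr in H1; rewrite e1L e3L bilinDr bilinNr !bilinZr in H2.
  apply: two.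
  - by apply: (linear_combination _ _ (-1) _ _ H1); field.
  - by apply: (linear_combination _ _ (-1) _ _ H2); field.
have t132 : bilin h (K e1 e3) e2 = bilin h (K e1 e2) e3 by exact: K_sym.
have [t12m t123] : bilin h (K e1 e2) e2 - bilin h (K e1 e3) e3 = 0 /\ - 2 * bilin h (K e1 e2) e3 = 0.
  have H1 := TL e1 e2 e2; have H2 := TL e1 e2 e3.
  rewrite e1L e2L !(KDr, KZr, bilinDr, bilinZr, bilinDl, bilinZl) t132 in H1.
  rewrite e1L e2L e3L !(KDr, KZr, bilinDr, bilinNr, bilinZr, bilinDl, bilinZl) t132 in H2.
  move: H1 H2; move: (bilin h (K e1 e2) e2) (bilin h (K e1 e2) e3) (bilin h (K e1 e3) e3) => x y z H1 H2.
  apply: two.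
  - have {}H1 : 3 / 4 * x = - s * y + s ^+ 2 * z by apply: (linear_combination _ _ (-1) _ _ H1); field.
    rewrite s2 in H1; rewrite (_ : 3 / 2 * (x - z) = 2 * (3 / 4 * x) - 3 / 2 * z); last by field.
    by rewrite H1; field.
  - have {}H2 : 3 / 4 * y = 2^-1 * s * x - s ^+ 2 * y - 2^-1 * s * z by apply: (linear_combination _ _ (-1) _ _ H2); field.
    rewrite s2 in H2.
    by apply: (linear_combination _ _ (-2) _ _ H2); field.
have {}t123 : bilin h (K e1 e2) e3 = 0.
  by move/eqP: t123; rewrite mulf_eq0 oppr_eq0 pnatr_eq0 => /eqP.
have t133 : bilin h (K e1 e3) e3 = bilin h (K e1 e2) e2 by move/eqP: t12m; rewrite subr_eq0 => /eqP.
have [u12 u13] : bilin h (S e1) e2 = 0 /\ bilin h (S e1) e3 = 0.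
  have H1 := SL' e1 e2; have H2 := SL' e1 e3.
  rewrite e1L e2L bilinDr !bilinZr in H1; rewrite e1L e3L bilinDr bilinNr !bilinZr in H2.
  apply: two.
  - by apply: (linear_combination _ _ (-1) _ _ H1); field.
  - by apply: (linear_combination _ _ (-1) _ _ H2); field.
have u32 : bilin h (S e3) e2 = bilin h (S e2) e3 by rewrite S_sym (bilinC h _ _ hT).
have [u2m u23] : bilin h (S e2) e2 - bilin h (S e3) e3 = 0 /\ - 2 * bilin h (S e2) e3 = 0.
  have H1 := SL' e2 e2; have H2 := SL' e2 e3.
  rewrite e2L !(SD, SZ, bilinDr, bilinZr, bilinDl, bilinZl) u32 in H1.
  rewrite e2L e3L !(SD, SZ, bilinDr, bilinNr, bilinZr, bilinDl, bilinZl) u32 in H2.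
  move: H1 H2; move: (bilin h (S e2) e2) (bilin h (S e2) e3) (bilin h (S e3) e3) => x y z H1 H2.
  apply: two.
  - have {}H1 : 3 / 4 * x = - s * y + s ^+ 2 * z by apply: (linear_combination _ _ (-1) _ _ H1); field.
    rewrite s2 in H1; rewrite (_ : 3 / 2 * (x - z) = 2 * (3 / 4 * x) - 3 / 2 * z); last by field.
    by rewrite H1; field.
  - have {}H2 : 3 / 4 * y = 2^-1 * s * x - s ^+ 2 * y - 2^-1 * s * z by apply: (linear_combination _ _ (-1) _ _ H2); field.
    rewrite s2 in H2.
    by apply: (linear_combination _ _ (-2) _ _ H2); field.
have {}u23 : bilin h (S e2) e3 = 0.
  by move/eqP: u23; rewrite mulf_eq0 oppr_eq0 pnatr_eq0 => /eqP.
have u33 : bilin h (S e3) e3 = bilin h (S e2) e2 by move/eqP: u2m; rewrite subr_eq0 => /eqP.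
have exp := orthonormal_expansion e1 e2 e3 ortho.
have ap := apolar_rows3 e1 e2 e3 ortho e1.
exists (rows3 e1 e2 e3), (2^-1 * bilin h (K e1 e1) e1), (bilin h (K e2 e2) e2), (bilin h (K e2 e2) e3),
  (bilin h (S e1) e1), (bilin h (S e2) e2).
have t111 : bilin h (K e1 e1) e1 = - (2 * bilin h (K e1 e2) e2).
  by move: ap; rewrite t133 -addrA => /eqP; rewrite addr_eq0 => /eqP ->; ring.
have t121 : bilin h (K e1 e2) e1 = 0 by rewrite K_sym.
have t131 : bilin h (K e1 e3) e1 = 0 by rewrite K_sym.
have muE : - (2^-1 * bilin h (K e1 e1) e1) = bilin h (K e1 e2) e2 by rewrite t111; field.
apply: normal_frame_of_axis => //.
- by rewrite [LHS]exp t112 t113 !scale0r !addr0 mulrA divff ?mul1r // pnatr_eq0.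
- by rewrite muE [LHS]exp t121 t123 !scale0r add0r addr0.
- by rewrite muE [LHS]exp t131 t132 t123 t133 !scale0r !add0r.
- by rewrite [LHS]exp u12 u13 !scale0r !addr0.
- by rewrite [LHS]exp u23 (S_sym e2 e1) (bilinC h _ _ hT) u12 !scale0r add0r addr0.
- by rewrite [LHS]exp u32 u23 u33 (S_sym e3 e1) (bilinC h _ _ hT) u13 !scale0r !add0r.
Qed.

(** The last clause says that the trace form and S are not both multiples of the metric, so that the
    axis is the eigenline of a simple eigenvalue of one of them. *)
Definition special_normal_frame E mu p l a : Prop :=
  [/\ is_normal_frame h S K E mu p 0 l a, mu != 0 & p ^+ 2 != 2 * mu ^+ 2 \/ l != a].

Lemma special_normal_frame_exists :
  commutative_set (stabilizer h S K) ->
  (exists L, [/\ stabilizer h S K L, L != 1%:M & L *m L *m L = 1%:M]) ->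
  exists E mu p l a, special_normal_frame E mu p l a.
Proof.
move=> cG [L [GL L1 L3]].
have [E [mu [p [q [l [a nf]]]]]] := order3_normal_frame L GL L1 L3.
have [c [s [cs cs0]]] := triple_angle_solution p q.
have := rotate_normal_frame nf c s cs; rewrite /= cs0.
set p' := c * _ + _ => nf'.
have cG' := commutative_normal_stabilizer nf' cG.
have mu0 := commutative_mu_neq0 _ _ _ _ cG'.
exists (rotx c s *m E), mu, p', l, a; split => //.
exact: commutative_not_scalar mu0 cG'.
Qed.

Lemma Z3_normal_frame E mu p l a :
  group_isomorphic [set: 'Z_3] +%R (stabilizer h S K) mulmx ->
  is_normal_frame h S K E mu p 0 l a -> p != 0.
Proof.
move=> /Z3_symmetry[_ _ cube] nf; have Eu := normal_frame_unit nf.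
have [|//|/eqP //] := cube1_not_rotational mu p 0 l a.
move=> L /(normal_stabilizerE nf)/cube.
rewrite !mulmxA !mulmxK // -!mulmxA => /(congr1 (mulmx E)); rewrite mulKVmx // mulmx1.
by rewrite !mulmxA -{2}[E]mul1mx => /(can_inj (mulmxK Eu)).
Qed.

Lemma SO2_normal_frame E mu p q l a : mu != 0 ->
  group_isomorphic (SO R 2) mulmx (stabilizer h S K) mulmx ->
  is_normal_frame h S K E mu p q l a -> p = 0 /\ q = 0.
Proof.
move=> mu0 /SO2_symmetry[cG _ [L [GL L2 L4]]] nf; have Eu := normal_frame_unit nf.
have conjM A B : E *m A *m invmx E *m (E *m B *m invmx E) = E *m (A *m B) *m invmx E.
  by rewrite !mulmxA mulmxKV.
apply: (order4_rotational mu p q l a (E *m L *m invmx E) mu0).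
- exact: commutative_normal_stabilizer nf cG.
- exact: normal_stabilizer_conj nf _ GL.
- apply: contra_neq L2; rewrite conjM => H.
  have -> : L *m L = invmx E *m (E *m (L *m L) *m invmx E) *m E by rewrite !mulmxA mulVmx // mul1mx mulmxKV.
  by rewrite H mulmx1 mulVmx.
- by rewrite !conjM L4 mulmx1 mulmxV.
Qed.

Lemma normal_frame_SO2 E mu p l a : mu != 0 -> is_normal_frame h S K E mu p 0 l a ->
  p = 0 <-> group_isomorphic (SO R 2) mulmx (stabilizer h S K) mulmx.
Proof.
move=> mu0 nf; split=> [p0|/(SO2_normal_frame _ _ _ _ _ _ mu0)/(_ nf)[]//].
by rewrite p0 in nf; apply: (group_isomorphic_normal_stabilizer nf); exact: rotational_SO2.
Qed.

End Axis.

(** * Smooth adapted frames *)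

Section SmoothHelpers.
Context {R : realType} {X : normedModType R} (U : set X) (oU : open U).

Lemma open_smooth_gt0 (g : X -> R) : smooth_on U g -> open (U `&` [set x | 0 < g x]).
Proof.
move=> sg; rewrite openE => x [Ux gx].
have cg : {for x, continuous g} by apply: differentiable_continuous; exact: smooth_on_differentiable sg Ux.
have : \forall y \near x, 0 < g y by exact: cvgr_gt cg _ gx.
by apply: filterI; apply: open_nbhs_nbhs.
Qed.

Lemma open_smooth_neq0 (g : X -> R) : smooth_on U g -> open (U `&` [set x | g x != 0]).
Proof.
move=> sg; rewrite openE => x [Ux gx].
have cg : {for x, continuous g} by apply: differentiable_continuous; exact: smooth_on_differentiable sg Ux.
have : \forall y \near x, g y != 0 by exact: cvgr_neq0 cg gx.
by apply: filterI; apply: open_nbhs_nbhs.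
Qed.

Lemma smooth_on_bilin {n} (g : X -> 'M[R]_n) (Y Z : X -> 'rV[R]_n) :
  smooth_on U g -> smooth_on U Y -> smooth_on U Z ->
  smooth_on U (fun x => bilin (g x) (Y x) (Z x)).
Proof.
move=> sg sY sZ; have := smooth_on_mulmx U oU _ _ (smooth_on_mulmx U oU _ _ sY sg) (smooth_on_tr U oU _ sZ).
by move/(smooth_on_mxP _ oU); apply.
Qed.

Lemma smooth_on_trace {n} (f : X -> 'M[R]_n) : smooth_on U f -> smooth_on U (fun x => \tr (f x)).
Proof. by move=> /(smooth_on_mxP _ oU) sf; apply: (smooth_on_sum _ oU) => i _; exact: sf. Qed.

Definition normalize (g : 'M[R]_3) (v : 'rV[R]_3) : 'rV[R]_3 := (Num.sqrt (bilin g v v))^-1 *: v.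

Lemma normalize_unit (g : 'M[R]_3) v : 0 < bilin g v v -> bilin g (normalize g v) (normalize g v) = 1.
Proof.
move=> v0; rewrite bilinZl bilinZr mulrA -expr2 exprVn sqr_sqrtr ?ltW // mulVf //.
by rewrite gt_eqF.
Qed.

Lemma smooth_on_normalize (g : X -> 'M[R]_3) (Y : X -> 'rV[R]_3) :
  smooth_on U g -> smooth_on U Y -> (forall x, U x -> 0 < bilin (g x) (Y x) (Y x)) ->
  smooth_on U (fun x => normalize (g x) (Y x)).
Proof.
move=> sg sY pY; apply: (smooth_onZ _ oU) => //; apply: (smooth_onV _ _ oU).
  by move=> x Ux; rewrite gt_eqF // sqrtr_gt0; exact: pY.
apply: (smooth_on_comp1 U [set t : R | 0 < t] (fun x => bilin (g x) (Y x) (Y x)) Num.sqrt oU pY).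
  exact: smooth_on_bilin.
exact: smooth_on_sqrt.
Qed.

End SmoothHelpers.

Lemma unit_vec_i0 {R : realType} : unit_vec i0 = vec3 1 0 0 :> 'rV[R]_3.
Proof. by apply/rowP; apply: ord3P; rewrite !mxE. Qed.
Lemma unit_vec_i1 {R : realType} : unit_vec i1 = vec3 0 1 0 :> 'rV[R]_3.
Proof. by apply/rowP; apply: ord3P; rewrite !mxE. Qed.
Lemma unit_vec_i2 {R : realType} : unit_vec i2 = vec3 0 0 1 :> 'rV[R]_3.
Proof. by apply/rowP; apply: ord3P; rewrite !mxE. Qed.

(** * The axis as an eigenline of a smooth operator *)

Section AxisOperator.
Context {R : realType} (h : 'M[R]_3) (Sm : 'M[R]_3) (Km : 'rV[R]_3 -> 'M[R]_3).
Context (Km_linear : forall c u v, Km (c *: u + v) = c *: Km u + Km v).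
Context (E : 'M[R]_3) (mu p l a : R).
Context (nf : is_normal_frame h (fun v => v *m Sm) (fun u v => v *m Km u) E mu p 0 l a).

Definition trace_form : 'M[R]_3 := \matrix_(i, j) \tr (Km (unit_vec i) *m Km (unit_vec j)).
(** The inverse metric turns the trace form into an operator. The weight [r] brings in S at points
    where the trace form alone is a multiple of the metric. *)
Definition axis_operator r : 'M[R]_3 := trace_form *m invmx h + r *: Sm.
Definition diag3 (x y : R) : 'M[R]_3 := mx3 x 0 0 0 y 0 0 0 y.

Lemma trace_formE u v : (u *m trace_form *m v^T) 0 0 = \tr (Km u *m Km v).
Proof.
rewrite -[LHS]/(bilin trace_form u v) (linear_unit_vec (fun u => bilin trace_form u v)); last first.
  by move=> c u1 u2; rewrite bilinDl bilinZl.
rewrite [RHS](linear_unit_vec (fun u => \tr (Km u *m Km v))); last first.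
  by move=> c u1 u2; rewrite Km_linear mulmxDl -scalemxAl linearP.
apply: eq_bigr => i _; congr (_ *: _).
rewrite (linear_unit_vec (fun v => bilin trace_form _ v)); last first.
  by move=> c u1 u2; rewrite bilinDr bilinZr.
rewrite [RHS](linear_unit_vec (fun v => \tr (Km _ *m Km v))); last first.
  by move=> c u1 u2; rewrite Km_linear mulmxDr -scalemxAr linearP.
by apply: eq_bigr => j _; rewrite bilin_unit mxE.
Qed.

Lemma Km_frame x y z : E *m Km (vec3 x y z *m E) =
  mx3 (2 * mu * x) (- mu * y) (- mu * z)
      (- mu * y) (- mu * x + p * y) (- p * z)
      (- mu * z) (- p * z) (- mu * x - p * y) *m E.
Proof.
case: nf => _ _ KE; apply/row_matrixP; apply: ord3P; rewrite !rowE -!/(unit_vec _) !mulmxA KE; congr (_ *m _).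
- rewrite unit_vec_i0.
  by rewrite normal_product_vec3 vec3_mul; congr vec3; ring.
- rewrite unit_vec_i1.
  by rewrite normal_product_vec3 vec3_mul; congr vec3; ring.
- rewrite unit_vec_i2.
  by rewrite normal_product_vec3 vec3_mul; congr vec3; ring.
Qed.

Lemma axis_operator_frame r : E *m axis_operator r =
  diag3 (6 * mu ^+ 2 + r * l) (2 * mu ^+ 2 + 2 * p ^+ 2 + r * a) *m E.
Proof.
have Eu := normal_frame_unit nf; case: (nf) => EhE SE KE.
have hi : invmx h = E^T *m E.
  have hu : h \in unitmx.
    have := congr1 (fun A => A \in unitmx) EhE; rewrite !unitmx_mul unitmx_tr Eu unitmx1 andbT.
    by move=> /= ->.
  have EEh : E^T *m E *m h = 1%:M by rewrite -mulmxA; exact: mulmx1C.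
  by rewrite -[RHS](mulmxK hu) EEh mul1mx.
have ES : E *m Sm = diag3 l a *m E.
  apply/row_matrixP; apply: ord3P; rewrite !rowE -!/(unit_vec _) !mulmxA SE; congr (_ *m _).
  - by apply/rowP; apply: ord3P; rewrite -rowE !mxE /= ?mulr0 ?mulr1.
  - by apply/rowP; apply: ord3P; rewrite -rowE !mxE /= ?mulr0 ?mulr1.
  - by apply/rowP; apply: ord3P; rewrite -rowE !mxE /= ?mulr0 ?mulr1.
have Tr x y z x' y' z' : \tr (Km (vec3 x y z *m E) *m Km (vec3 x' y' z' *m E)) =
   (6 * mu ^+ 2) * (x * x') + (2 * mu ^+ 2 + 2 * p ^+ 2) * (y * y' + z * z').
  have -> : Km (vec3 x y z *m E) *m Km (vec3 x' y' z' *m E) =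
     invmx E *m (E *m Km (vec3 x y z *m E) *m Km (vec3 x' y' z' *m E)) by rewrite !mulmxA mulVmx // mul1mx.
  rewrite Km_frame -mulmxA Km_frame mulmxA mulmxA -mulmxA mxtrace_mulC mulmxA mulmxK // mx3_mul.
  rewrite /mxtrace sum3 !mxE /=; ring.
have Eq : E *m trace_form *m E^T = diag3 (6 * mu ^+ 2) (2 * mu ^+ 2 + 2 * p ^+ 2).
  apply/matrixP => i j; rewrite -bilin_unit -bilin_mul /bilin trace_formE.
  by move: j; elim/ord3P: i; apply: ord3P;
    rewrite ?unit_vec_i0 ?unit_vec_i1 ?unit_vec_i2 Tr mxE /=; ring.
rewrite /axis_operator mulmxDr hi !mulmxA Eq -scalemxAr ES scalemxAl -mulmxDl; congr (_ *m _).
by apply/matrixP; apply: ord3P; apply: ord3P; rewrite !mxE /=; ring.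
Qed.

End AxisOperator.

Section Projector.
Context {R : realType}.
Implicit Types (T E : 'M[R]_3) (b c : R).

Definition traceless T : 'M[R]_3 := T - (\tr T / 3)%:M.
Definition trace_sq T := \tr (traceless T *m traceless T).
Definition trace_cube T := \tr (traceless T *m traceless T *m traceless T).

(* If T has eigenvalues b, c, c then the two traces are 2/3 (b - c)^2 and 2/9 (b - c)^3, so the
   projector onto the axis is a rational function of T. *)
Definition axis_projector T : 'M[R]_3 :=
  (trace_sq T / (3 * trace_cube T)) *: traceless T + (3^-1)%:M.

Lemma mxtrace_conj T E (D : 'M[R]_3) : E \in unitmx -> E *m T = D *m E -> \tr T = \tr D.
Proof.
move=> Eu ET; have -> : T = invmx E *m (D *m E) by rewrite -ET mulKmx.
by rewrite mxtrace_mulC mulmxK.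
Qed.

Section Eigen.
Context (T E : 'M[R]_3) (b c : R) (Eu : E \in unitmx) (ET : E *m T = diag3 b c *m E).

Lemma traceless_frame : E *m traceless T = diag3 (2 / 3 * (b - c)) (- 3^-1 * (b - c)) *m E.
Proof.
rewrite /traceless mulmxBr ET (mxtrace_conj T E _ Eu ET) mul_mx_scalar -mul_scalar_mx -mulmxBl.
congr (_ *m _); apply/matrixP; apply: ord3P; apply: ord3P; by rewrite /mxtrace sum3 !mxE /=; field.
Qed.

Lemma trace_sq_frame : trace_sq T = 2 / 3 * (b - c) ^+ 2.
Proof.
have T0 := traceless_frame; rewrite /trace_sq.
have E2 : E *m (traceless T *m traceless T) = diag3 (2 / 3 * (b - c)) (- 3^-1 * (b - c)) *m diag3 (2 / 3 * (b - c)) (- 3^-1 * (b - c)) *m E.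
  by rewrite mulmxA T0 -mulmxA T0 mulmxA.
by rewrite (mxtrace_conj _ E _ Eu E2) mx3_mul /mxtrace sum3 !mxE /=; field.
Qed.

Lemma trace_cube_frame : trace_cube T = 2 / 9 * (b - c) ^+ 3.
Proof.
have T0 := traceless_frame; rewrite /trace_cube; set D := diag3 _ _ in T0.
have E3 : E *m (traceless T *m traceless T *m traceless T) = D *m D *m D *m E.
  by rewrite !mulmxA T0 -(mulmxA D E) T0 mulmxA -(mulmxA (D *m D) E) T0 !mulmxA.
by rewrite (mxtrace_conj _ E _ Eu E3) !mx3_mul /mxtrace sum3 !mxE /=; field.
Qed.

Lemma trace_cube_neq0 : (trace_cube T != 0) = (b != c).
Proof.
rewrite trace_cube_frame mulf_eq0 expf_eq0 /= subr_eq0; have [//|bc] := boolP (b == c).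
  by rewrite orbT.
by rewrite orbF mulf_eq0 invr_eq0 !pnatr_eq0.
Qed.

Lemma axis_projector_frame : b != c -> E *m axis_projector T = diag3 1 0 *m E.
Proof.
move=> bc; have bc0 : b - c != 0 by rewrite subr_eq0.
rewrite /axis_projector mulmxDr -scalemxAr traceless_frame (scalar_mxC _ E) scalemxAl -mulmxDl.
rewrite trace_sq_frame trace_cube_frame.
congr (_ *m _); apply/matrixP; apply: ord3P; apply: ord3P; by rewrite !mxE /=; field; rewrite ?bc0.
Qed.

End Eigen.

Lemma smooth_on_scalar_mx {X : normedModType R} (U : set X) (f : X -> R) n : open U ->
  smooth_on U f -> smooth_on U (fun x => (f x)%:M : 'M[R]_n).
Proof.
move=> oU sf; apply/(smooth_on_mxP _ oU) => i j; under eq_fun do rewrite mxE -mulr_natr.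
by apply: (smooth_onM _ oU) => //; exact: smooth_on_cst.
Qed.

Lemma smooth_on_axis_projector {X : normedModType R} (U : set X) (T : X -> 'M[R]_3) : open U ->
  smooth_on U T -> (forall x, U x -> trace_cube (T x) != 0) -> smooth_on U (fun x => axis_projector (T x)).
Proof.
move=> oU sT T0.
have s0 : smooth_on U (fun x => traceless (T x)).
  apply: (smooth_on_submx _ oU) => //; apply: smooth_on_scalar_mx => //.
  by apply: (smooth_onM _ oU); [exact: smooth_on_trace|exact: smooth_on_cst].
have s2 := smooth_on_mulmx _ oU _ _ s0 s0; have s3 := smooth_on_mulmx _ oU _ _ s2 s0.
apply: smooth_onD => //; last exact: smooth_on_cst.
apply: (smooth_onZ _ oU) => //; apply: (smooth_onM _ oU); first exact: smooth_on_trace.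
apply: (smooth_onV _ _ oU); first by move=> x Ux; rewrite mulf_neq0 ?pnatr_eq0 // T0.
by apply: (smooth_onM _ oU); [exact: smooth_on_cst|exact: smooth_on_trace].
Qed.

Lemma smooth_on_trace_cube {X : normedModType R} (U : set X) (T : X -> 'M[R]_3) : open U ->
  smooth_on U T -> smooth_on U (fun x => trace_cube (T x)).
Proof.
move=> oU sT.
have s0 : smooth_on U (fun x => traceless (T x)).
  apply: (smooth_on_submx _ oU) => //; apply: smooth_on_scalar_mx => //.
  by apply: (smooth_onM _ oU); [exact: smooth_on_trace|exact: smooth_on_cst].
have s2 := smooth_on_mulmx _ oU _ _ s0 s0; have s3 := smooth_on_mulmx _ oU _ _ s2 s0.
exact: smooth_on_trace.
Qed.

End Projector.

Section SmoothAxis.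
Context {R : realType} {X : normedModType R}.
Context (U : set X) (oU : open U) (h Sm : X -> 'M[R]_3) (Km : X -> 'rV[R]_3 -> 'M[R]_3).
Context (sh : smooth_on U h) (sS : smooth_on U Sm) (sK : forall u, smooth_on U (Km^~ u)).
Context (h_pos : forall x, U x -> posdef (h x)).
Context (Km_linear : forall x c u v, U x -> Km x (c *: u + v) = c *: Km x u + Km x v).
Context (nf : forall x, U x -> exists E mu p l a,
  is_normal_frame (h x) (fun v => v *m Sm x) (fun u v => v *m Km x u) E mu p 0 l a).
Context (x0 : X) (Ux0 : U x0) (E0 : 'M[R]_3) (mu0 p0 l0 a0 : R).
Context (nf0 : is_normal_frame (h x0) (fun v => v *m Sm x0) (fun u v => v *m Km x0 u) E0 mu0 p0 0 l0 a0).
Context (generic0 : p0 ^+ 2 != 2 * mu0 ^+ 2 \/ l0 != a0).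

(** The weight is fixed once, at the base point. With r = 0 the two eigenvalues differ by 4 mu^2 - 2
    p^2; if that vanishes, r = 1 makes them differ by l - a. Nearby they stay distinct by
    continuity. *)
Let r : R := if p0 ^+ 2 != 2 * mu0 ^+ 2 then 0 else 1.
Let T x := axis_operator (h x) (Sm x) (Km x) r.
Let P x := axis_projector (T x).
(** A constant vector to be projected onto the axis at nearby points. At [x0] it is the axis vector
    itself, so its projection does not vanish close to [x0], and normalizing it selects the sign
    smoothly. *)
Let w := row i0 E0.

Let sT : smooth_on U T.
Proof.
apply: (smooth_onD _ oU); last by apply: (smooth_onZ _ oU) => //; exact: smooth_on_cst.
apply: (smooth_on_mulmx _ oU); last first.
  by apply: (smooth_on_invmx _ _ oU) => // x Ux; apply: posdef_unitmx; exact: h_pos.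
apply/(smooth_on_mxP _ oU) => i j; under eq_fun do rewrite mxE.
by apply: (smooth_on_trace _ oU); apply: (smooth_on_mulmx _ oU); exact: sK.
Qed.

Let V1 := U `&` [set x | trace_cube (T x) != 0].
Let oV1 : open V1.
Proof. by apply: open_smooth_neq0 => //; exact: smooth_on_trace_cube. Qed.
Let sV1 : V1 `<=` U. Proof. by move=> x []. Qed.

Let sP : smooth_on V1 P.
Proof.
by apply: smooth_on_axis_projector oV1 (smooth_onS _ _ _ sV1 sT) _ => x [].
Qed.

Let swP : smooth_on V1 (fun x => w *m P x).
Proof. by apply: (smooth_on_mulmx _ oV1) => //; exact: smooth_on_cst. Qed.

Let V := V1 `&` [set x | 0 < bilin (h x) (w *m P x) (w *m P x)].
Let oV : open V.
Proof.
apply: open_smooth_gt0 => //; apply: smooth_on_bilin => //.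
exact: smooth_onS sV1 sh.
Qed.

Let e1 x := normalize (h x) (w *m P x).

Let wP_frame x E mu p l a : trace_cube (T x) != 0 ->
  is_normal_frame (h x) (fun v => v *m Sm x) (fun u v => v *m Km x u) E mu p 0 l a -> U x ->
  forall y, (y *m E) *m P x = y 0 i0 *: row i0 E.
Proof.
move=> T0 nfx Ux y; have Eu := normal_frame_unit nfx.
have ET := axis_operator_frame (h x) (Sm x) (Km x) (fun c u v => Km_linear x c u v Ux) E mu p l a nfx r.
rewrite -mulmxA /P (axis_projector_frame _ E _ _ Eu ET); last by rewrite -(trace_cube_neq0 _ E _ _ Eu ET).
rewrite mulmxA [in LHS](vec3_eta y) vec3_mul rowE -/(unit_vec _) unit_vec_i0 scalemxAl vec3Z.
by congr (_ *m _); congr vec3; ring.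
Qed.

Let row_form x E mu p l a :
  is_normal_frame (h x) (fun v => v *m Sm x) (fun u v => v *m Km x u) E mu p 0 l a ->
  bilin (h x) (row i0 E) (row i0 E) = 1.
Proof. by case=> EhE _ _; rewrite !rowE bilin_mul EhE -!/(unit_vec _) unit_vec_i0 bilin1_vec3; ring. Qed.

(** The field comes from the projector, not from the frames [E], which may jump from point to point;
    each of them agrees with it only up to the sign [s]. *)
Lemma smooth_axis : exists V e1, [/\ open V /\ V `<=` U, V x0, smooth_on V e1, e1 x0 = row i0 E0 &
  forall x, V x -> forall E mu p l a,
   is_normal_frame (h x) (fun v => v *m Sm x) (fun u v => v *m Km x u) E mu p 0 l a ->
   exists2 s, s ^+ 2 = 1 & e1 x = s *: row i0 E].
Proof.
have T00 : trace_cube (T x0) != 0.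
  have Eu := normal_frame_unit nf0.
  have ET := axis_operator_frame (h x0) (Sm x0) (Km x0) (fun c u v => Km_linear x0 c u v Ux0) E0 mu0 p0 l0 a0 nf0 r.
  rewrite /T (trace_cube_neq0 _ E0 _ _ Eu ET) /r; case: ifPn generic0 => [p2 _|/negPn/eqP p2 [/eqP //|la]].
  - apply: contra_neq p2; rewrite !mul0r !addr0 => H.
    by apply: (mulfI (x := 2)); rewrite ?pnatr_eq0 //; apply: (linear_combination _ _ (-1) _ _ H); ring.
  - apply: contra_neq la; rewrite !mul1r p2 => H.
    by apply: (linear_combination _ _ 1 _ _ H); ring.
have wP0 : w *m P x0 = w.
  rewrite {1}/w rowE (wP_frame _ _ _ _ _ _ T00 nf0 Ux0) /w.
  by rewrite -/(unit_vec _) unit_vec_i0 mxE /= scale1r.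
exists V, e1; split.
- by split=> // x [/sV1].
- by split; [split|rewrite /= wP0 (row_form _ _ _ _ _ _ nf0) ltr01].
- apply: smooth_on_normalize => //; last by move=> x [].
  + by apply: smooth_onS sh => x [/sV1].
  + by apply: smooth_onS swP => x [].
- by rewrite /e1 /normalize wP0 (row_form _ _ _ _ _ _ nf0) sqrtr1 invr1 scale1r.
move=> x [[Ux Tx] /= pos] E mu p l a nfx; have Eu := normal_frame_unit nfx.
have wE : w *m P x = (w *m invmx E) 0 i0 *: row i0 E.
  by rewrite -(wP_frame _ _ _ _ _ _ Tx nfx Ux) mulmxKV.
rewrite /e1 /normalize wE scalerA; eexists; last by [].
move: pos; rewrite wE bilinZl bilinZr (row_form _ _ _ _ _ _ nfx) mulr1 => pos.
by rewrite exprMn exprVn sqr_sqrtr ?ltW // -expr2 mulVf // gt_eqF.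
Qed.

End SmoothAxis.

(** Reversing the axis only changes the sign of [mu]. As K_e and S are scalars on the plane
    orthogonal to [e], any orthonormal completion of [e] is a normal frame up to the value of
    [q]. *)
Lemma normal_frame_axis {R : realType} (h : 'M[R]_3) S K E (mu p q l a s : R) :
  is_normal_frame h S K E mu p q l a -> s ^+ 2 = 1 -> let e := s *: row i0 E in
  [/\ bilin h e e = 1, K e e = (2 * (s * mu)) *: e, S e = l *: e &
    forall v, bilin h v e = 0 -> K e v = - (s * mu) *: v /\ S v = a *: v].
Proof.
move=> nf s2 e; have Eu := normal_frame_unit nf; case: nf => EhE SE KE.
have eE : e = vec3 s 0 0 *m E.
  by rewrite /e rowE -/(unit_vec _) unit_vec_i0 scalemxAl vec3Z mulr1 !mulr0.
split.
- by rewrite eE bilin_mul EhE bilin1_vec3 -s2; ring.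
- rewrite {1 2}eE KE normal_product_vec3 eE -mul_scalar_mx mulmxA mul_scalar_mx vec3Z; congr (_ *m _).
  by congr vec3; ring.
- by rewrite {1}eE SE normal_shape_vec3 eE scalemxAl vec3Z; congr (_ *m _); congr vec3; ring.
move=> v; rewrite eE -(mulmxKV Eu v); move: (v *m invmx E) => y; rewrite (vec3_eta y).
move: (y 0 i0) (y 0 i1) (y 0 i2) => y0 y1 y2; rewrite bilin_mul EhE bilin1_vec3 => H.
have y00 : y0 = 0.
  have : s * (y0 * s) = 0 by rewrite (_ : y0 * s = y0 * s + y1 * 0 + y2 * 0); [rewrite H mulr0|ring].
  by rewrite mulrCA -expr2 s2 mulr1.
rewrite y00 KE SE normal_product_vec3 normal_shape_vec3 !scalemxAl !vec3Z.
by split; congr (_ *m _); congr vec3; ring.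
Qed.

Section GramSchmidt.
Context {R : realType} {X : normedModType R}.
Context (V : set X) (oV : open V) (h : X -> 'M[R]_3) (e1 : X -> 'rV[R]_3).
Context (sh : smooth_on V h) (se1 : smooth_on V e1).
Context (hT : forall x, V x -> (h x)^T = h x) (e1_unit : forall x, V x -> bilin (h x) (e1 x) (e1 x) = 1).

Let B x u v := bilin (h x) u v.

(** The constant vectors [w2] and [w3] complete the axis orthonormally at [x0], so the vectors to be
    normalized have norm one there and stay nonzero nearby, and the frame takes its prescribed value
    at [x0]. *)
Lemma smooth_gram_schmidt (x0 : X) (w2 w3 : 'rV[R]_3) : V x0 ->
  rows3 (e1 x0) w2 w3 *m h x0 *m (rows3 (e1 x0) w2 w3)^T = 1%:M ->
  exists W f2 f3, [/\ open W /\ W `<=` V, W x0, smooth_on W f2 /\ smooth_on W f3,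
    f2 x0 = w2 /\ f3 x0 = w3 &
    forall x, W x -> rows3 (e1 x) (f2 x) (f3 x) *m h x *m (rows3 (e1 x) (f2 x) (f3 x))^T = 1%:M].
Proof.
move=> Vx0 ortho0; have [[g11 g12 g13] [g21 g22 g23] [g31 g32 g33]] := orthonormal_rows3 _ _ _ _ ortho0.
pose g2 x := w2 - B x w2 (e1 x) *: e1 x.
have sc (W : set X) (w : 'rV[R]_3) : smooth_on W (fun _ : X => w) by exact: smooth_on_cst.
have sg2 : smooth_on V g2.
  apply: (smooth_on_submx _ oV) => //; apply: (smooth_onZ _ oV) => //.
  exact: smooth_on_bilin.
pose V2 := V `&` [set x | 0 < B x (g2 x) (g2 x)].
have oV2 : open V2 by apply: open_smooth_gt0 => //; exact: smooth_on_bilin.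
have V2V : V2 `<=` V by move=> x [].
pose f2 x := normalize (h x) (g2 x).
have sf2 : smooth_on V2 f2.
  by apply: smooth_on_normalize => //; [exact: smooth_onS sh|exact: smooth_onS sg2|move=> x []].
pose g3 x := w3 - B x w3 (e1 x) *: e1 x - B x w3 (f2 x) *: f2 x.
have sg3 : smooth_on V2 g3.
  apply: (smooth_on_submx _ oV2).
    apply: (smooth_on_submx _ oV2) => //; apply: (smooth_onZ _ oV2); last exact: smooth_onS se1.
    by apply: smooth_on_bilin => //; [exact: smooth_onS sh|exact: smooth_onS se1].
  apply: (smooth_onZ _ oV2) => //; apply: smooth_on_bilin => //; exact: smooth_onS sh.
pose W := V2 `&` [set x | 0 < B x (g3 x) (g3 x)].
have oW : open W.
  by apply: open_smooth_gt0 => //; apply: smooth_on_bilin => //; exact: smooth_onS sh.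
have WV2 : W `<=` V2 by move=> x [].
pose f3 x := normalize (h x) (g3 x).
have g20 : g2 x0 = w2 by rewrite /g2 /B g21 scale0r subr0.
have f20 : f2 x0 = w2 by rewrite /f2 /normalize g20 g22 sqrtr1 invr1 scale1r.
have g30 : g3 x0 = w3 by rewrite /g3 /B f20 g31 g32 !scale0r !subr0.
have f30 : f3 x0 = w3 by rewrite /f3 /normalize g30 g33 sqrtr1 invr1 scale1r.
exists W, f2, f3; split => //.
- by split => // x /WV2/V2V.
- by split; [split|]; rewrite //= ?g20 ?g30 /B ?g22 ?g33 ltr01.
- split; first exact: smooth_onS sf2.
  apply: smooth_on_normalize => //; last by move=> x [].
    by apply: smooth_onS sh => x /WV2/V2V.
  exact: smooth_onS sg3.
move=> x Wx; have V2x := WV2 _ Wx; have Vx := V2V _ V2x.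
have [_ p2] := V2x; have [_ p3] := Wx.
have u1 := e1_unit x Vx; have u2 := normalize_unit _ _ p2; have u3 := normalize_unit _ _ p3.
have sym u v : bilin (h x) u v = bilin (h x) v u by apply: bilinC; exact: hT.
have northo g u v : bilin g u v = 0 -> bilin g (normalize g u) v = 0 by move=> uv; rewrite bilinZl uv mulr0.
have g21' : bilin (h x) (f2 x) (e1 x) = 0.
  by apply: northo; rewrite bilinBl bilinZl u1 mulr1 subrr.
have g31' : bilin (h x) (f3 x) (e1 x) = 0.
  by apply: northo; rewrite 2!bilinBl (bilinZl _ (B x w3 (e1 x))) (bilinZl _ (B x w3 (f2 x))) u1 g21' mulr1 mulr0 subr0 subrr.
have g32' : bilin (h x) (f3 x) (f2 x) = 0.
  apply: northo; rewrite 2!bilinBl (bilinZl _ (B x w3 (e1 x))) (bilinZl _ (B x w3 (f2 x))) (sym (e1 x)) g21' mulr0 subr0.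
  by rewrite [X in _ - _ * X]u2 mulr1 subrr.
rewrite rows3_gram mx3_1 u1 (sym (e1 x)) g21' (sym (e1 x)) g31' (sym (f2 x)) g32'.
by rewrite [X in mx3 _ _ _ _ X]u2 [X in mx3 _ _ _ _ _ _ _ _ X]u3.
Qed.
End GramSchmidt.

(** The explicit angle is kept in the statement because it is a smooth function of [p] and [q]
    wherever [p] does not vanish. *)
Lemma triple_angle_atan {R : realType} (p q : R) : p != 0 ->
  let c := cos (atan (q / p) / 3) in let s := sin (atan (q / p) / 3) in
  - s * ((c ^+ 2 - s ^+ 2) * p + 2 * c * s * q) + c * ((c ^+ 2 - s ^+ 2) * q - 2 * c * s * p) = 0.
Proof.
move=> p0; set t := atan (q / p) / 3; rewrite /=.
have t3 : atan (q / p) = t + t + t by rewrite /t; field.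
have := atanK (q / p); rewrite /tan t3 !(cosD, sinD).
set C := cos t * cos t - _; set S := sin t * cos t + _.
have c0 : C * cos t - S * sin t != 0.
  rewrite gt_eqF // /C /S -!(cosD, sinD) -t3.
  by rewrite cos_atan invr_gt0 sqrtr_gt0 ltr_pwDl // sqr_ge0.
move=> /(congr1 (fun z => z * (C * cos t - S * sin t) * p)); rewrite divfK //.
rewrite [RHS]mulrAC divfK // => H.
have -> : - sin t * ((cos t ^+ 2 - sin t ^+ 2) * p + 2 * cos t * sin t * q) + cos t * ((cos t ^+ 2 - sin t ^+ 2) * q - 2 * cos t * sin t * p) =
   q * (C * cos t - S * sin t) - (S * cos t + C * sin t) * p by rewrite /C /S; ring.
by rewrite H subrr.
Qed.

Section SmoothNormalFrame.
Context {R : realType} {X : normedModType R}.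
Context (U : set X) (oU : open U) (h Sm : X -> 'M[R]_3) (Km : X -> 'rV[R]_3 -> 'M[R]_3).
Context (sh : smooth_on U h) (sS : smooth_on U Sm) (sK : forall u, smooth_on U (Km^~ u)).
Local Notation S x := (fun v => v *m Sm x).
Local Notation K x := (fun u v => v *m Km x u).
Context (h_pos : forall x, U x -> posdef (h x)).
Context (KC : forall x u v, U x -> v *m Km x u = u *m Km x v).
Context (K_sym : forall x u v w, U x -> bilin (h x) (v *m Km x u) w = bilin (h x) (w *m Km x u) v).
Context (K_apolar : forall x u (E : 'M[R]_3), U x -> E *m h x *m E^T = 1%:M ->
  \sum_i bilin (h x) (row i E *m Km x u) (row i E) = 0).
Context (nf : forall x, U x -> exists E mu p l a,
  is_normal_frame (h x) (S x) (K x) E mu p 0 l a /\ mu != 0).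
Context (x0 : X) (Ux0 : U x0) (E0 : 'M[R]_3) (mu0 p0 l0 a0 : R).
Context (nf0 : is_normal_frame (h x0) (S x0) (K x0) E0 mu0 p0 0 l0 a0).
Context (generic0 : p0 ^+ 2 != 2 * mu0 ^+ 2 \/ l0 != a0).
Context (rotational : p0 != 0 \/ forall x E mu p q l a, U x -> mu != 0 ->
   is_normal_frame (h x) (S x) (K x) E mu p q l a -> p = 0 /\ q = 0).

Let Km_linear x c u v : U x -> Km x (c *: u + v) = c *: Km x u + Km x v.
Proof.
move=> Ux; apply/row_matrixP => i; rewrite !rowE mulmxDr -scalemxAr !(KC x _ (delta_mx 0 i) Ux).
by rewrite mulmxDl scalemxAl.
Qed.

Lemma smooth_normal_frame : exists V e1 e2 e3,
  [/\ open V /\ V `<=` U, V x0, [/\ smooth_on V e1, smooth_on V e2 & smooth_on V e3] &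
   forall x, V x -> exists mu p l a,
     is_normal_frame (h x) (S x) (K x) (rows3 (e1 x) (e2 x) (e3 x)) mu p 0 l a /\ mu != 0].
Proof.
have nf' x : U x -> exists E mu p l a, is_normal_frame (h x) (S x) (K x) E mu p 0 l a.
  by move=> /nf[E [mu [p [l [a [? _]]]]]]; exists E, mu, p, l, a.
have [V [e1 [[oV VU] Vx0 se1 e10 He1]]] :=
  smooth_axis U oU h Sm Km sh sS sK h_pos Km_linear x0 Ux0 E0 mu0 p0 l0 a0 nf0 generic0.
have e1_unit x : V x -> bilin (h x) (e1 x) (e1 x) = 1.
  move=> Vx; have [E [mu [p [l [a nfx]]]]] := nf' x (VU _ Vx).
  have [s s2 ->] := He1 x Vx E mu p l a nfx.
  by have [] := normal_frame_axis _ _ _ _ _ _ _ _ _ s nfx s2.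
have ortho0 : rows3 (e1 x0) (row i1 E0) (row i2 E0) *m h x0 *m (rows3 (e1 x0) (row i1 E0) (row i2 E0))^T = 1%:M.
  have -> : rows3 (e1 x0) (row i1 E0) (row i2 E0) = E0.
    by apply/row_matrixP; apply: ord3P; rewrite row_rows3 //= e10.
  by case: nf0.
have hT x : V x -> (h x)^T = h x by move=> /VU /h_pos[].
have shV : smooth_on V h by exact: smooth_onS sh.
have [W [f2 [f3 [[oW WV] Wx0 [sf2 sf3] [f20 f30] orthoW]]]] :=
  smooth_gram_schmidt V oV h e1 shV se1 hT e1_unit x0 _ _ Vx0 ortho0.
have WU x : W x -> U x by move=> /WV/VU.
pose p x := bilin (h x) (f2 x *m Km x (f2 x)) (f2 x).
pose q x := bilin (h x) (f2 x *m Km x (f2 x)) (f3 x).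
have nfW x : W x -> exists mu l a,
    is_normal_frame (h x) (S x) (K x) (rows3 (e1 x) (f2 x) (f3 x)) mu (p x) (q x) l a /\ mu != 0.
  move=> Wx; have Ux := WU _ Wx; have [E [mu [p' [l [a [nfx mu1]]]]]] := nf x Ux.
  have [s s2 e1E] := He1 x (WV _ Wx) E mu p' l a nfx.
  have [_ K11 S1 perp] := normal_frame_axis _ _ _ _ _ _ _ _ _ s nfx s2; rewrite -e1E in K11 S1 perp.
  have [[g11 g12 g13] [g21 g22 g23] [g31 g32 g33]] := orthonormal_rows3 _ _ _ _ (orthoW x Wx).
  have [K12 S2] := perp _ g21; have [K13 S3] := perp _ g31.
  exists (s * mu), l, a; split; last first.
    by rewrite mulf_neq0 // -sqrf_eq0 s2 oner_neq0.
  apply: (normal_frame_of_axis (h x) (S x) (K x)) => //.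
  - by move=> u c v w; rewrite mulmxDl scalemxAl.
  - by move=> u v; exact: KC.
  - by move=> u v w; exact: K_sym.
  - by move=> u E'; exact: K_apolar.
  - by move=> c v w; rewrite mulmxDl scalemxAl.
  - exact: orthoW.
have sKf : smooth_on W (fun x => f2 x *m Km x (f2 x)).
  have Kf x : W x -> f2 x *m Km x (f2 x) = \sum_j (f2 x 0 j) *: (f2 x *m Km x (unit_vec j)).
    move=> Wx; rewrite (linear_unit_vec (fun u => f2 x *m Km x u)) // => c u v.
    by rewrite Km_linear ?mulmxDr ?scalemxAr //; exact: WU.
  apply: (eq_in_smooth_on W (fun x => \sum_j (f2 x 0 j) *: (f2 x *m Km x (unit_vec j)))) => //.
    by move=> x Wx; rewrite Kf.
  apply: (smooth_on_sum _ oW) => j _; apply: (smooth_onZ _ oW).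
    by move/(smooth_on_mxP _ oW) : sf2; apply.
  by apply: (smooth_on_mulmx _ oW) => //; exact: (smooth_onS _ _ _ WU (sK _)).
have shW : smooth_on W h by exact: (smooth_onS _ _ _ WU sh).
have sp : smooth_on W p by exact: smooth_on_bilin.
have sq : smooth_on W q by exact: smooth_on_bilin.
(* In the SO(2) alternative every normal frame has p = q = 0, and the Gram-Schmidt frame needs no
   change. Otherwise p is nonzero near [x0], and turning the plane by a third of atan (q / p)
   removes [q] smoothly. *)
case: rotational => [p00|rot0]; last first.
  exists W, e1, f2, f3; split => //.
    by split=> //; exact: smooth_onS se1.
  move=> x Wx; have [mu [l [a [nfx mu1]]]] := nfW x Wx.
  exists mu, (p x), l, a; split => //.
  by have [_ <-] := rot0 _ _ _ _ _ _ _ (WU _ Wx) mu1 nfx.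
pose W' := W `&` [set x | p x != 0].
have oW' : open W' by exact: open_smooth_neq0.
have W'W : W' `<=` W by move=> x [].
have px0 : p x0 = p0.
  rewrite /p f20; case: nf0 => EhE _ KE0.
  rewrite rowE -/(unit_vec _) unit_vec_i1 KE0 normal_product_vec3 bilin_mul EhE bilin1_vec3; ring.
pose th x := atan (q x / p x) / 3.
pose c x := cos (th x); pose s x := sin (th x).
have sth : smooth_on W' th.
  apply: (smooth_onM _ oW'); last exact: smooth_on_cst.
  apply: (smooth_on_comp1 W' setT (fun x => q x / p x) atan oW' (fun _ _ => I)); last exact: smooth_on_atan.
  apply: (smooth_onM _ oW'); first exact: smooth_onS sq.
  by apply: (smooth_onV _ _ oW'); [move=> x []|exact: smooth_onS sp].
have [ssin scos] := @smooth_on_sin_cos R.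
have sc : smooth_on W' c by exact: (smooth_on_comp1 W' setT th cos oW' (fun _ _ => I)).
have ss : smooth_on W' s by exact: (smooth_on_comp1 W' setT th sin oW' (fun _ _ => I)).
have sf2' := smooth_onS _ _ _ W'W sf2; have sf3' := smooth_onS _ _ _ W'W sf3.
exists W', e1, (fun x => c x *: f2 x + s x *: f3 x), (fun x => - s x *: f2 x + c x *: f3 x); split.
- by split => // x /W'W/WU.
- by split => //=; rewrite px0.
- split.
  + by apply: smooth_onS se1 => x /W'W/WV.
  + by apply: (smooth_onD _ oW'); apply: (smooth_onZ _ oW').
  + apply: (smooth_onD _ oW'); apply: (smooth_onZ _ oW') => //.
    exact: (smooth_onN _ oW').
move=> x W'x; have [Wx px] := W'x; have [mu [l [a [nfx mu1]]]] := nfW x Wx.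
have cs : c x ^+ 2 + s x ^+ 2 = 1 by exact: cos2Dsin2.
have := rotate_normal_frame nfx _ _ cs; rewrite /= (triple_angle_atan _ _ px).
set pr := c x * _ + _ => nfr; exists mu, pr, l, a; split => //.
have -> : rows3 (e1 x) (c x *: f2 x + s x *: f3 x) (- s x *: f2 x + c x *: f3 x) =
    rotx (c x) (s x) *m rows3 (e1 x) (f2 x) (f3 x); last exact: nfr.
apply/row_matrixP; apply: ord3P; rewrite row_rows3 row_mul /=.
- by rewrite (_ : row _ _ = vec3 1 0 0) ?rows3_mul ?scale0r ?scale1r ?addr0 //; apply/rowP => j; rewrite !mxE.
- by rewrite (_ : row _ _ = vec3 0 (c x) (s x)) ?rows3_mul ?scale0r ?add0r //; apply/rowP => j; rewrite !mxE.
- by rewrite (_ : row _ _ = vec3 0 (- s x) (c x)) ?rows3_mul ?scale0r ?add0r //; apply/rowP => j; rewrite !mxE.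
Qed.

End SmoothNormalFrame.

(** * The Gauss equation in an adapted frame *)

(** The Hessian of [f] is symmetric, so in the commutator only the derivatives of the fields
    themselves survive: this is the action of the Lie bracket. *)
Lemma derive_derive_bracket {R : realType} {n m} (V : set 'rV[R]_n) (f : 'rV[R]_n -> 'rV[R]_m)
    (X Y : 'rV[R]_n -> 'rV[R]_n) x :
  open V -> V x -> smooth_on V f -> smooth_on V X -> smooth_on V Y ->
  'D_(X x) (fun y => 'D_(Y y) f y) x - 'D_(Y x) (fun y => 'D_(X y) f y) x
  = 'D_('D_(X x) Y x - 'D_(Y x) X x) f x.
Proof.
move=> oV Vx sf sX sY.
have sJ := smooth_on_jacobian V f oV sf.
have dJ := smooth_on_differentiable _ _ _ sJ Vx.
have dX := smooth_on_differentiable _ _ _ sX Vx; have dY := smooth_on_differentiable _ _ _ sY Vx.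
have df y : V y -> differentiable f y by exact: smooth_on_differentiable.
have second (Z : 'rV[R]_n -> 'rV[R]_n) u : differentiable Z x ->
    'D_u (fun y => 'D_(Z y) f y) x = 'D_u Z x *m 'J f x + Z x *m 'D_u (fun y => 'J f y) x.
  move=> dZ; apply: etrans (eq_in_derive V _ (fun y => Z y *m 'J f y) x u oV Vx _) _.
    by move=> y Vy; exact: (deriveEjacobian _ (df y Vy)).
  exact: (derive_mulmx Z (fun y => 'J f y) x u dZ dJ).
have hess u w : u *m 'D_w (fun y => 'J f y) x = 'D_w (fun y => 'D_u f y) x.
  have := second (cst u) w (differentiable_cst _ _).
  by rewrite derive_cst mul0mx add0r => ->.
rewrite (second Y (X x) dY) (second X (Y x) dX) (hess (Y x)) (hess (X x)).
rewrite (derive_derive_comm_mx f V x (Y x) (X x) oV Vx sf).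
apply: etrans _ (esym (deriveEjacobian _ (df x Vx))).
by rewrite mulmxBl opprD addrACA subrr addr0.
Qed.

Section MovingFrame.
Context {R : realType} (U : set 'rV[R]_3) (G xi : 'rV[R]_3 -> 'rV[R]_4).
Context (oU : open U) (sG : smooth_on U G) (sxi : smooth_on U xi).
Context (frame_unit : forall x, U x -> gauss_frame G xi x \in unitmx).
Context (equiaffine : forall x v, U x -> Defs.transversal G xi x ('D_v xi x) = 0).
Context (h_unit : forall x, U x -> affine_metric G xi x \in unitmx).
Context (e : 'I_3 -> 'rV[R]_3 -> 'rV[R]_3) (se : forall i, smooth_on U (e i)).
Implicit Types (x u v w : 'rV[R]_3) (i j k l m : 'I_3).

Local Notation tan := (tangential G xi).
Local Notation trans := (Defs.transversal G xi).
Local Notation h := (affine_metric G xi).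
Local Notation K := (difference_tensor G xi).

Context (ortho : forall x i j, U x -> bilin (h x) (e i x) (e j x) = (i == j)%:R).

Let sh : smooth_on U h := smooth_on_affine_metric U G xi oU sG sxi frame_unit.
Let dh x (Ux : U x) : differentiable h x := smooth_on_differentiable U _ x sh Ux.
Let hT x (Ux : U x) : (h x)^T = h x := affine_metric_sym U G xi oU sG x Ux.
Let de i x (Ux : U x) : differentiable (e i) x := smooth_on_differentiable U _ x (se i) Ux.

Lemma frame_expansion x v : U x -> v = \sum_k bilin (h x) v (e k x) *: e k x.
Proof.
move=> Ux; pose E : 'M[R]_3 := \matrix_i e i x.
have EhE : E *m h x *m E^T = 1%:M.
  apply/matrixP => i j; rewrite -bilin_unit -bilin_mul -!rowE !rowK ortho //.
  by rewrite mxE.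
have hEE : h x *m E^T *m E = 1%:M by apply: mulmx1C; rewrite mulmxA.
rewrite -[LHS]mulmx1 -hEE !mulmxA mulmx_sum_row; apply: eq_bigr => k _; rewrite rowK; congr (_ *: _).
by rewrite /bilin !mxE; apply: eq_bigr => j _; rewrite !mxE.
Qed.

Definition frame_vector i x : 'rV[R]_4 := e i x *m 'J G x.
(** Coefficients of the induced affine connection, not of the Levi-Civita one: they appear directly
    when [frame_vector] is differentiated in R^4. *)
Definition connection i j k x : R := bilin (h x) (nabla G xi (e i) (e j) x) (e k x).

Lemma derive_position i x : U x -> 'D_(e i x) G x = frame_vector i x.
Proof. by move=> Ux; apply: deriveEjacobian; exact: smooth_on_differentiable sG Ux. Qed.

Lemma derive_frame_vector i j x : U x ->
  'D_(e i x) (frame_vector j) x = \sum_k connection i j k x *: frame_vector k x + (i == j)%:R *: xi x.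
Proof.
move=> Ux; have := gauss_formula U G xi oU sG frame_unit (e i) (e j) x Ux (de j x Ux).
rewrite ortho // => E; apply: etrans E _; congr (_ + _).
rewrite [X in X *m _](frame_expansion x _ Ux) mulmx_suml; apply: eq_bigr => k _.
by rewrite scalemxAl.
Qed.

Lemma smooth_on_frame_vector i : smooth_on U (frame_vector i).
Proof. by apply: (smooth_on_mulmx _ oU) => //; exact: smooth_on_jacobian. Qed.

Lemma smooth_on_along (Y : 'rV[R]_3 -> 'rV[R]_4) i : smooth_on U Y -> smooth_on U (fun x => 'D_(e i x) Y x).
Proof.
move=> sY; apply: (eq_in_smooth_on U (fun x => e i x *m 'J Y x)) => //.
  by move=> x Ux; apply: esym; apply: deriveEjacobian; exact: smooth_on_differentiable sY Ux.
by apply: (smooth_on_mulmx _ oU) => //; exact: smooth_on_jacobian.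
Qed.

Lemma smooth_on_connection i j k : smooth_on U (connection i j k).
Proof.
apply: (smooth_on_bilin _ oU) => //.
apply: (smooth_on_tangential U G xi) => //.
by apply: smooth_on_along; exact: smooth_on_frame_vector.
Qed.

Let K_sym23 u v w x (Ux : U x) := cubic_formC23 U G xi oU sG sxi frame_unit equiaffine h_unit u v w x Ux.

(** The Levi-Civita part is skew in an orthonormal frame. What remains is K counted twice, by its
    total symmetry; so the normal form of K determines the symmetric part of all connection
    coefficients. *)
Lemma connection_sym i j k x : U x ->
  connection i j k x + connection i k j x = 2 * bilin (h x) (K x (e i x) (e j x)) (e k x).
Proof.
move=> Ux.
have M := levi_civita_metric h x (dh x Ux) (e i) (e j) (e k) (h_unit x Ux) (hT x Ux)
  (fun u => derive_affine_metric_sym U G xi oU sG sxi frame_unit x u Ux) (de j x Ux) (de k x Ux).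
have D0 : 'D_(e i x) (fun y => bilin (h y) (e j y) (e k y)) x = 0.
  have E : 'D_(e i x) (fun y => bilin (h y) (e j y) (e k y)) x = 'D_(e i x) (cst ((j == k)%:R : R)) x.
    by apply: (eq_in_derive U _ _ x _ oU Ux) => y Uy; exact: ortho.
  by rewrite E; apply: derive_cst.
have {}M := etrans (esym M) D0.
rewrite /connection.
rewrite (nabla_levi_civita U G xi oU sG frame_unit (e i) (e j) x Ux (de j x Ux)).
rewrite (nabla_levi_civita U G xi oU sG frame_unit (e i) (e k) x Ux (de k x Ux)).
rewrite (bilinDl _ (levi_civita h (e i) (e j) x)) (bilinDl _ (levi_civita h (e i) (e k) x)).
rewrite (K_sym23 (e i x) (e k x) (e j x) x Ux).
rewrite (bilinC (h x) (levi_civita h (e i) (e k) x) (e j x) (hT x Ux)).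
by rewrite addrACA M add0r mulr_natl mulr2n.
Qed.

Lemma frame_bracket i j x : U x ->
  'D_(e i x) (e j) x - 'D_(e j x) (e i) x = \sum_k (connection i j k x - connection j i k x) *: e k x.
Proof.
move=> Ux; rewrite [LHS](frame_expansion x _ Ux); apply: eq_bigr => k _; congr (_ *: _).
rewrite /connection -bilinBl; congr (bilin _ _ _).
have E1 := nablaE U G xi oU sG frame_unit (e i) (e j) x Ux (de j x Ux).
have E2 := nablaE U G xi oU sG frame_unit (e j) (e i) x Ux (de i x Ux).
rewrite E1 E2 (_ : nabla G xi (cst (e j x)) (cst (e i x)) x = nabla G xi (cst (e i x)) (cst (e j x)) x).
  by rewrite opprD addrACA subrr addr0.
by rewrite /nabla (flat_derivative_cstC U G oU sG (e j x) (e i x) x Ux).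
Qed.

End MovingFrame.

Section GaussEquation.
Context {R : realType} (U : set 'rV[R]_3) (G xi : 'rV[R]_3 -> 'rV[R]_4).
Context (oU : open U) (sG : smooth_on U G) (sxi : smooth_on U xi).
Context (frame_unit : forall x, U x -> gauss_frame G xi x \in unitmx).
Context (equiaffine : forall x v, U x -> Defs.transversal G xi x ('D_v xi x) = 0).
Context (h_unit : forall x, U x -> affine_metric G xi x \in unitmx).
Context (e : 'I_3 -> 'rV[R]_3 -> 'rV[R]_3) (se : forall i, smooth_on U (e i)).
Context (ortho : forall x i j, U x -> bilin (affine_metric G xi x) (e i x) (e j x) = (i == j)%:R).
Context (s : 'I_3 -> 'rV[R]_3 -> R).
Context (shape_e : forall x i, U x -> Defs.shape G xi x (e i x) = s i x *: e i x).
Implicit Types (x u v w : 'rV[R]_3) (i j k l m : 'I_3).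

Local Notation Gam := (connection G xi e).
Local Notation Ev := (frame_vector G e).

Lemma derive_normal i x : U x -> 'D_(e i x) xi x = - s i x *: Ev i x.
Proof.
move=> Ux; rewrite (weingarten U G xi frame_unit equiaffine x (e i x) Ux).
by rewrite /frame_vector shape_e // scaleNr mulNmx scalemxAl.
Qed.

Let sGam i j k : smooth_on U (Gam i j k) :=
  smooth_on_connection U G xi oU sG sxi frame_unit e se i j k.
Let sEv i : smooth_on U (Ev i) := smooth_on_frame_vector U G oU sG e se i.

(** The component along the m-th frame vector of an ambient vector, modulo [xi]. *)
Definition frame_form (m : 'I_3) x (w : 'rV[R]_4) : R :=
  bilin (affine_metric G xi x) (tangential G xi x w) (e m x).

Lemma frame_formD m x (w w' : 'rV[R]_4) : frame_form m x (w + w') = frame_form m x w + frame_form m x w'.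
Proof. by rewrite /frame_form tangentialD bilinDl. Qed.

Lemma frame_formZ m x (k : R) (w : 'rV[R]_4) : frame_form m x (k *: w) = k * frame_form m x w.
Proof. by rewrite /frame_form tangentialZ bilinZl. Qed.

Lemma frame_form_sum m x (w : 'I_3 -> 'rV[R]_4) :
  frame_form m x (\sum_k w k) = \sum_k frame_form m x (w k).
Proof. by rewrite !sum3 !frame_formD. Qed.

Lemma sum_delta (c : 'I_3 -> R) m : \sum_k c k * (k == m)%:R = c m.
Proof.
rewrite (bigD1 m) //= eqxx mulr1 big1 ?addr0 // => k /negPf ->.
exact: mulr0.
Qed.

Lemma frame_form_frame m k x : U x -> frame_form m x (Ev k x) = (k == m)%:R.
Proof.
move=> Ux; rewrite /frame_form.
have [] := tangential_transversalK U G xi frame_unit x (e k x) 0 Ux.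
by rewrite scale0r addr0 /frame_vector => -> _; exact: ortho.
Qed.

Lemma derive2_frame_vector l i j x : U x ->
  'D_(e l x) (fun y => 'D_(e i y) (Ev j) y) x =
  \sum_k ('D_(e l x) (Gam i j k) x *: Ev k x + Gam i j k x *: 'D_(e l x) (Ev k) x)
  + (i == j)%:R *: (- s l x *: Ev l x).
Proof.
move=> Ux.
have dG k : differentiable (Gam i j k) x by exact: smooth_on_differentiable (sGam i j k) Ux.
have dE k : differentiable (Ev k) x by exact: smooth_on_differentiable (sEv k) Ux.
have dxi : differentiable xi x by exact: smooth_on_differentiable sxi Ux.
have dT k : differentiable (fun y => Gam i j k y *: Ev k y) x.
  have sT := smooth_onZ U oU _ _ (sGam i j k) (sEv k).
  exact: smooth_on_differentiable sT Ux.
have [dS DS] := derive_sum_seq (index_enum 'I_3) (fun k y => Gam i j k y *: Ev k y) x (e l x) dT.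
have dN : differentiable (fun y => (i == j)%:R *: xi y) x by exact: differentiableZ.
have E : 'D_(e l x) (fun y => 'D_(e i y) (Ev j) y) x
   = 'D_(e l x) (fun y => \sum_k Gam i j k y *: Ev k y + (i == j)%:R *: xi y) x.
  apply: (eq_in_derive U _ _ x _ oU Ux) => y Uy.
  exact: (derive_frame_vector U G xi oU sG frame_unit e se ortho i j y Uy).
apply: etrans E _; apply: etrans (derive_add _ _ x (e l x) dS dN) _.
f_equal.
  apply: etrans DS _; apply: eq_bigr => k _; exact: derive_scale.
rewrite -(derive_normal l x Ux).
have := derive_scale (cst ((i == j)%:R : R)) xi x (e l x) (differentiable_cst _ _) dxi.
by rewrite derive_cst scale0r add0r.
Qed.

(** Flatness of D: [derive_derive_bracket] for the ambient frame vector E_j, read along E_m. The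
    products with [s] come from differentiating [xi] in D_{e_i} E_j. *)
Lemma gauss_equation l i j m x : U x ->
  ('D_(e l x) (Gam i j m) x + \sum_k Gam i j k x * Gam l k m x - (i == j)%:R * (s l x * (l == m)%:R))
  - ('D_(e i x) (Gam l j m) x + \sum_k Gam l j k x * Gam i k m x - (l == j)%:R * (s i x * (i == m)%:R))
  = \sum_k (Gam l i k x - Gam i l k x) * Gam k j m x.
Proof.
move=> Ux.
have B := derive_derive_bracket U (Ev j) (e l) (e i) x oU Ux (sEv j) (se l) (se i).
have C : 'D_('D_(e l x) (e i) x - 'D_(e i x) (e l) x) (Ev j) x
   = \sum_k (Gam l i k x - Gam i l k x) *: 'D_(e k x) (Ev j) x.
  rewrite (frame_bracket U G xi oU sG frame_unit e se ortho l i x Ux).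
  have dEj := smooth_on_differentiable U _ x (sEv j) Ux.
  rewrite deriveEjacobian // mulmx_suml; apply: eq_bigr => k _.
  by rewrite deriveEjacobian // scalemxAl.
have two a b : frame_form m x ('D_(e a x) (fun y => 'D_(e b y) (Ev j) y) x)
   = 'D_(e a x) (Gam b j m) x + \sum_k Gam b j k x * Gam a k m x - (b == j)%:R * (s a x * (a == m)%:R).
  apply: etrans (congr1 (frame_form m x) (derive2_frame_vector a b j x Ux)) _.
  apply: etrans (frame_formD _ _ _ _) _.
  f_equal; last first.
    apply: etrans (frame_formZ _ _ _ _) _; apply: etrans (congr1 _ (frame_formZ _ _ _ _)) _.
    by rewrite (frame_form_frame m a x Ux) mulNr mulrN.
  apply: etrans (frame_form_sum _ _ _) _.
  rewrite -(sum_delta (fun k => 'D_(e a x) (Gam b j k) x) m) -big_split /=.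
  apply: eq_bigr => k _.
  apply: etrans (frame_formD _ _ _ _) _; f_equal.
    by apply: etrans (frame_formZ _ _ _ _) _; rewrite (frame_form_frame m k x Ux).
  exact: (frame_formZ m x (Gam b j k x) ('D_(e a x) (Ev k) x)).
have F (y z : 'rV[R]_4) : frame_form m x (y - z) = frame_form m x y - frame_form m x z.
  by rewrite frame_formD -scaleN1r frame_formZ mulN1r.
have T := congr1 (frame_form m x) (etrans B C).
apply: etrans (f_equal2 (fun a b : R => a - b) (esym (two l i)) (esym (two i l))) _.
apply: etrans (esym (F _ _)) _; apply: etrans T _.
apply: etrans (frame_form_sum _ _ _) _; apply: eq_bigr => k _.
exact: (frame_formZ m x _ ('D_(e k x) (Ev j) x)).
Qed.

End GaussEquation.

(** A homogeneous linear system. Elimination leaves 4 mu^2 + p^2 as the coefficient of [a1] and of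
    [b1], which is positive as mu is nonzero; p may vanish, so both symmetries are covered. *)
Lemma frame_system {R : realFieldType} (mu p a1 b1 a3 b2 d m2 m3 : R) : mu != 0 ->
  m2 = 2 * mu * a1 -> m3 = 2 * mu * b1 -> a3 = b2 ->
  m3 = - (p * (a3 + b2)) -> m2 = p * d -> 4 * mu * b2 = p * b1 ->
  2 * mu * d = - (p * a1) ->
  [/\ a1 = 0, b1 = 0, b2 = 0, a3 = 0 & d = 0 /\ m2 = 0 /\ m3 = 0].
Proof.
move=> mu0 H1 H2 H3 H4 H5 H6 H7.
have c0 : 4 * mu ^+ 2 + p ^+ 2 != 0.
  by apply: lt0r_neq0; apply: ltr_wpDr; [exact: sqr_ge0 | rewrite mulr_gt0 // exprn_even_gt0].
have a10 : a1 = 0.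
  apply: (mulfI c0); rewrite mulr0.
  have : 2 * mu * (2 * mu * a1) = p * (2 * mu * d) by rewrite -H1 H5; ring.
  rewrite H7 => E; transitivity (2 * mu * (2 * mu * a1) - p * (- (p * a1))); first by ring.
  by rewrite E subrr.
have b10 : b1 = 0.
  apply: (mulfI c0); rewrite mulr0.
  have E : 2 * mu * b1 = - (2 * p * b2) by rewrite -H2 H4 H3; ring.
  have E' : 2 * mu * (2 * mu * b1) = - (p * (p * b1)) by rewrite -H6 E; ring.
  transitivity (2 * mu * (2 * mu * b1) - - (p * (p * b1))); first by ring.
  by rewrite E' subrr.
have b20 : b2 = 0.
  have m40 : 4 * mu != 0 by rewrite mulf_neq0 // pnatr_eq0.
  by apply: (mulfI m40); rewrite H6 b10 !mulr0.
have d0 : d = 0.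
  have m20 : 2 * mu != 0 by rewrite mulf_neq0 // pnatr_eq0.
  by apply: (mulfI m20); rewrite H7 a10 !mulr0 oppr0.
by split => //; [rewrite H3 | rewrite H1 H2 a10 b10 !mulr0].
Qed.

(** * Elimination in the Gauss equation at one point *)

Section GaussAlgebra.
Context {R : realFieldType} (g : 'I_3 -> 'I_3 -> 'I_3 -> R) (dg : 'I_3 -> 'I_3 -> 'I_3 -> 'I_3 -> R).
Context (s : 'I_3 -> R) (mu p : R) (mu0 : mu != 0) (s12 : s i1 = s i2).
Context (gE :
  (g i0 i0 i0 = 2 * mu) * (g i0 i1 i0 = - g i0 i0 i1) * (g i0 i2 i0 = - g i0 i0 i2) *
  (g i0 i1 i1 = - mu) * (g i0 i2 i2 = - mu) * (g i0 i2 i1 = - g i0 i1 i2) *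
  (g i1 i0 i0 = 0) * (g i1 i1 i0 = - 2 * mu - g i1 i0 i1) * (g i1 i2 i0 = - g i1 i0 i2) *
  (g i1 i1 i1 = p) * (g i1 i2 i2 = - p) * (g i1 i2 i1 = - g i1 i1 i2) *
  (g i2 i0 i0 = 0) * (g i2 i1 i0 = - g i2 i0 i1) * (g i2 i2 i0 = - 2 * mu - g i2 i0 i2) *
  (g i2 i1 i1 = 0) * (g i2 i2 i2 = 0) * (g i2 i2 i1 = - 2 * p - g i2 i1 i2)).
Context (dgE : forall l,
  (dg l i0 i1 i0 = - dg l i0 i0 i1) * (dg l i0 i2 i0 = - dg l i0 i0 i2) *
  (dg l i1 i0 i0 = 0) * (dg l i1 i1 i0 = - dg l i0 i0 i0 - dg l i1 i0 i1) * (dg l i1 i2 i0 = - dg l i1 i0 i2) *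
  (dg l i2 i0 i0 = 0) * (dg l i2 i1 i0 = - dg l i2 i0 i1) * (dg l i2 i2 i0 = - dg l i0 i0 i0 - dg l i2 i0 i2)).
Context (gauss : forall l i j m,
  (dg l i j m + \sum_k g i j k * g l k m - (i == j)%:R * (s l * (l == m)%:R))
  - (dg i l j m + \sum_k g l j k * g i k m - (l == j)%:R * (s i * (i == m)%:R))
  = \sum_k (g l i k - g i l k) * g k j m).

(** Adding two components with the last indices exchanged removes the unknown derivatives of
    connection coefficients, since the symmetric part is K; only derivatives of g_000 = 2 mu
    survive. These sums are the Codazzi equation for K, linear in the remaining coefficients. *)
Lemma gauss_connection :
  [/\ g i0 i0 i1 = 0, g i0 i0 i2 = 0, g i1 i0 i2 = 0, g i2 i0 i1 = 0 &
      g i1 i0 i1 = g i2 i0 i2 /\ dg i1 i0 i0 i0 = 0 /\ dg i2 i0 i0 i0 = 0].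
Proof.
have := gauss i0 i1 i0 i0; rewrite !sum3 !gE ?dgE /= => E1.
have := gauss i0 i2 i0 i0; rewrite !sum3 !gE ?dgE /= => E2.
have := gauss i1 i2 i0 i0; rewrite !sum3 !gE ?dgE /= => E3.
have := gauss i1 i2 i0 i1; rewrite !sum3 !gE ?dgE /= => E4.
have := gauss i1 i2 i1 i0; rewrite !sum3 !gE ?dgE /= => E4'.
have := gauss i1 i2 i0 i2; rewrite !sum3 !gE ?dgE /= => E5.
have := gauss i1 i2 i2 i0; rewrite !sum3 !gE ?dgE /= => E5'.
have := gauss i0 i1 i0 i2; rewrite !sum3 !gE ?dgE /= => E6.
have := gauss i0 i1 i2 i0; rewrite !sum3 !gE ?dgE /= => E6'.
(* This pair and the next one contain the eigenvalues of S and the derivative of mu along the axis.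
   Both disappear in the difference of the two pairs because s_1 = s_2. *)
have := gauss i0 i1 i0 i1; rewrite !sum3 !gE ?dgE /= => E7.
have := gauss i0 i1 i1 i0; rewrite !sum3 !gE ?dgE /= => E7'.
have := gauss i0 i2 i0 i2; rewrite !sum3 !gE ?dgE /= => E8.
have := gauss i0 i2 i2 i0; rewrite !sum3 !gE ?dgE /= => E8'.
rewrite /= ?mulr1 ?mulr0 ?mul0r ?mul1r in E1 E2 E3 E4 E4' E5 E5' E6 E6' E7 E7' E8 E8'.
rewrite s12 in E7 E7' E8 E8'.
have R3 : g i2 i0 i1 = g i1 i0 i2.
  by apply: (mulfI mu0); lra.
have [-> -> -> -> [D [M2 M3]]] := frame_system mu p (g i0 i0 i1) (g i0 i0 i2) (g i2 i0 i1) (g i1 i0 i2)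
  (g i1 i0 i1 - g i2 i0 i2) (2^-1 * dg i1 i0 i0 i0) (2^-1 * dg i2 i0 i0 i0) mu0
  ltac:(lra) ltac:(lra) R3 ltac:(lra) ltac:(lra) ltac:(lra) ltac:(lra).
by split=> //; split; [lra | split; lra].
Qed.

(** A second pass through the Gauss equation. The coefficients found to vanish do so on an open set,
    hence so do their derivatives, and the remaining terms determine the derivatives of k along the
    leaves. *)
Lemma gauss_curvature : g i0 i0 i1 = 0 -> g i0 i0 i2 = 0 -> g i1 i0 i2 = 0 -> g i2 i0 i1 = 0 ->
  g i1 i0 i1 = g i2 i0 i2 -> dg i1 i2 i0 i1 = 0 -> dg i2 i1 i0 i2 = 0 ->
  dg i2 i1 i0 i1 = 0 /\ dg i1 i2 i0 i2 = 0.
Proof.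
move=> g1 g2 g3 g4 g5 d1 d2.
have := gauss i1 i2 i0 i1; rewrite !sum3 !gE ?dgE /= d1 g1 g3 g4 g5 => E4.
have := gauss i1 i2 i0 i2; rewrite !sum3 !gE ?dgE /= d2 g2 g3 g4 g5 => E5.
by split; lra.
Qed.

End GaussAlgebra.

Section WarpedFrame.
Context {R : realType} (U : set 'rV[R]_3) (G xi : 'rV[R]_3 -> 'rV[R]_4).
Context (oU : open U) (sG : smooth_on U G) (sxi : smooth_on U xi).
Context (frame_unit : forall x, U x -> gauss_frame G xi x \in unitmx).
Context (equiaffine : forall x v, U x -> Defs.transversal G xi x ('D_v xi x) = 0).
Context (h_unit : forall x, U x -> affine_metric G xi x \in unitmx).
Context (e : 'I_3 -> 'rV[R]_3 -> 'rV[R]_3) (se : forall i, smooth_on U (e i)).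
Context (mu p la a : 'rV[R]_3 -> R).
Context (nf : forall x, U x ->
  is_normal_frame (affine_metric G xi x) (Defs.shape G xi x) (difference_tensor G xi x)
    (rows3 (e i0 x) (e i1 x) (e i2 x)) (mu x) (p x) 0 (la x) (a x) /\ mu x != 0).
Implicit Types (x u v w : 'rV[R]_3) (i j k l m : 'I_3).

Local Notation Gam := (connection G xi e).
Local Notation h := (affine_metric G xi).

Let s i : 'rV[R]_3 -> R := if i == i0 then la else a.
Let cube mu p q i j k : R := normal_product mu p q (unit_vec i) (unit_vec j) 0 k.

Lemma unit_vec_rows3 (e0 e1 e2 : 'rV[R]_3) i : unit_vec i *m rows3 e0 e1 e2 = nth 0 [:: e0; e1; e2] i.
Proof. by rewrite -row_rows3 rowE. Qed.

Local Notation E x := (rows3 (e i0 x) (e i1 x) (e i2 x)).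

Let frame_row x i : e i x = unit_vec i *m E x.
Proof. by rewrite unit_vec_rows3; move: i; apply: ord3P. Qed.

Lemma moving_ortho x i j : U x -> bilin (h x) (e i x) (e j x) = (i == j)%:R.
Proof.
move=> Ux; have [[EhE _ _] _] := nf x Ux.
apply: etrans (f_equal2 (bilin (h x)) (frame_row x i) (frame_row x j)) _.
by rewrite bilin_mul EhE bilin_unit !mxE.
Qed.

Lemma moving_shape x i : U x -> Defs.shape G xi x (e i x) = s i x *: e i x.
Proof.
move=> Ux; have [[_ S _] _] := nf x Ux.
rewrite (frame_row x i); apply: etrans (S _) _.
rewrite [RHS]scalemxAl; congr (_ *m _).
by rewrite /s; apply/rowP; move: i; apply: ord3P; apply: ord3P; rewrite /normal_shape !mxE /= ?mulr1 ?mulr0.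
Qed.

Lemma moving_cube x i j k : U x -> bilin (h x) (difference_tensor G xi x (e i x) (e j x)) (e k x)
  = cube (mu x) (p x) 0 i j k.
Proof.
move=> Ux; have [[EhE _ KE] _] := nf x Ux.
have D := KE (unit_vec i) (unit_vec j); rewrite -!frame_row in D.
apply: etrans (f_equal2 (bilin (h x)) D (frame_row x k)) _.
by rewrite bilin_mul EhE /cube bilin_unitr mulmx1.
Qed.

Let csym i j k x (Ux : U x) : Gam i j k x + Gam i k j x = 2 * cube (mu x) (p x) 0 i j k.
Proof.
rewrite -(moving_cube x) //.
exact: (connection_sym U G xi oU sG sxi frame_unit equiaffine h_unit e se moving_ortho i j k x Ux).
Qed.

Let gauss l i j m x (Ux : U x) :=
  gauss_equation U G xi oU sG sxi frame_unit equiaffine e se moving_ortho s moving_shape l i j m x Ux.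

Let csymE x (Ux : U x) :
  (Gam i0 i0 i0 x = 2 * mu x) * (Gam i0 i1 i0 x = - Gam i0 i0 i1 x) * (Gam i0 i2 i0 x = - Gam i0 i0 i2 x) *
  (Gam i0 i1 i1 x = - mu x) * (Gam i0 i2 i2 x = - mu x) * (Gam i0 i2 i1 x = - Gam i0 i1 i2 x) *
  (Gam i1 i0 i0 x = 0) * (Gam i1 i1 i0 x = - 2 * mu x - Gam i1 i0 i1 x) * (Gam i1 i2 i0 x = - Gam i1 i0 i2 x) *
  (Gam i1 i1 i1 x = p x) * (Gam i1 i2 i2 x = - p x) * (Gam i1 i2 i1 x = - Gam i1 i1 i2 x) *
  (Gam i2 i0 i0 x = 0) * (Gam i2 i1 i0 x = - Gam i2 i0 i1 x) * (Gam i2 i2 i0 x = - 2 * mu x - Gam i2 i0 i2 x) *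
  (Gam i2 i1 i1 x = 0) * (Gam i2 i2 i2 x = 0) * (Gam i2 i2 i1 x = - 2 * p x - Gam i2 i1 i2 x).
Proof.
have C i j k : Gam i j k x = 2 * cube (mu x) (p x) 0 i j k - Gam i k j x.
  by rewrite -csym // addrK.
have D i j : Gam i j j x = cube (mu x) (p x) 0 i j j.
  have two0 : (2 : R) != 0 by rewrite pnatr_eq0.
  by apply: (mulfI two0); rewrite -csym // mulr_natl mulr2n.
by do !split; (rewrite D || rewrite C); rewrite /cube /normal_product !mxE /=; ring.
Qed.
Let sGam i j k : smooth_on U (Gam i j k) :=
  smooth_on_connection U G xi oU sG sxi frame_unit e se i j k.

Let dsym c x v i j k : U x -> (forall y, U y -> Gam i j k y = c * Gam i0 i0 i0 y - Gam i k j y) ->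
  'D_v (Gam i j k) x = c * 'D_v (Gam i0 i0 i0) x - 'D_v (Gam i k j) x.
Proof.
move=> Ux E.
have d0 : differentiable (Gam i0 i0 i0) x := smooth_on_differentiable U _ x (sGam _ _ _) Ux.
have d1 : differentiable (Gam i k j) x := smooth_on_differentiable U _ x (sGam _ _ _) Ux.
have D : 'D_v (Gam i j k) x = 'D_v (fun y => c *: Gam i0 i0 i0 y - Gam i k j y) x.
  exact: (eq_in_derive U _ _ x _ oU Ux).
apply: etrans D _.
have D1 : derivable (c *: Gam i0 i0 i0) x v by exact/derivableZ/diff_derivable.
have D2 : derivable (Gam i k j) x v by exact: diff_derivable.
apply: etrans (deriveB D1 D2) _.
by congr (_ - _); apply: deriveZ; exact: diff_derivable.
Qed.

Let dzero x v i j k : U x -> (forall y, U y -> Gam i j k y = 0) -> 'D_v (Gam i j k) x = 0.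
Proof.
move=> Ux E; have D : 'D_v (Gam i j k) x = 'D_v (cst (0 : R)) x.
  exact: (eq_in_derive U _ _ x _ oU Ux).
by rewrite D; apply: derive_cst.
Qed.

Let dGam x l i j k : R := 'D_(e l x) (Gam i j k) x.

Let dcsymE x (Ux : U x) l :
  (dGam x l i0 i1 i0 = - dGam x l i0 i0 i1) * (dGam x l i0 i2 i0 = - dGam x l i0 i0 i2) *
  (dGam x l i1 i0 i0 = 0) * (dGam x l i1 i1 i0 = - dGam x l i0 i0 i0 - dGam x l i1 i0 i1) *
  (dGam x l i1 i2 i0 = - dGam x l i1 i0 i2) * (dGam x l i2 i0 i0 = 0) *
  (dGam x l i2 i1 i0 = - dGam x l i2 i0 i1) * (dGam x l i2 i2 i0 = - dGam x l i0 i0 i0 - dGam x l i2 i0 i2).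
Proof.
have sym c i j k : (forall y, U y -> Gam i j k y = c * Gam i0 i0 i0 y - Gam i k j y) ->
    dGam x l i j k = c * dGam x l i0 i0 i0 - dGam x l i k j by exact: dsym.
have zero i j k : (forall y, U y -> Gam i j k y = 0) -> dGam x l i j k = 0 by exact: dzero.
clearbody dGam.
do !split.
- by rewrite (sym 0) ?mul0r ?sub0r // => y Uy; rewrite mul0r sub0r !csymE.
- by rewrite (sym 0) ?mul0r ?sub0r // => y Uy; rewrite mul0r sub0r !csymE.
- by apply: zero => y Uy; rewrite !csymE.
- by rewrite (sym (-1)) ?mulN1r // => y Uy; rewrite !csymE //; ring.
- by rewrite (sym 0) ?mul0r ?sub0r // => y Uy; rewrite mul0r sub0r !csymE.
- by apply: zero => y Uy; rewrite !csymE.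
- by rewrite (sym 0) ?mul0r ?sub0r // => y Uy; rewrite mul0r sub0r !csymE.
- by rewrite (sym (-1)) ?mulN1r // => y Uy; rewrite !csymE //; ring.
Qed.

Lemma warped_connection x : U x ->
  [/\ Gam i0 i0 i1 x = 0, Gam i0 i0 i2 x = 0, Gam i1 i0 i2 x = 0, Gam i2 i0 i1 x = 0 &
      Gam i1 i0 i1 x = Gam i2 i0 i2 x /\
      'D_(e i1 x) (Gam i0 i0 i0) x = 0 /\ 'D_(e i2 x) (Gam i0 i0 i0) x = 0].
Proof.
move=> Ux; exact: (gauss_connection (fun i j k => Gam i j k x) (dGam x) (fun i => s i x)
  (mu x) (p x) (nf x Ux).2 erefl (csymE x Ux) (dcsymE x Ux) (fun l i j m => gauss l i j m x Ux)).
Qed.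

Lemma warped_curvature x : U x ->
  'D_(e i1 x) (Gam i1 i0 i1) x = 0 /\ 'D_(e i2 x) (Gam i1 i0 i1) x = 0.
Proof.
move=> Ux; have [g1 g2 g3 g4 [g5 _]] := warped_connection x Ux.
have d1 : dGam x i1 i2 i0 i1 = 0 by apply: dzero => // y /warped_connection[].
have d2 : dGam x i2 i1 i0 i2 = 0 by apply: dzero => // y /warped_connection[].
have [D2 D1] := gauss_curvature (fun i j k => Gam i j k x) (dGam x) (fun i => s i x)
  (mu x) (p x) (csymE x Ux) (fun l i j m => gauss l i j m x Ux)
  g1 g2 g3 g4 g5 d1 d2.
split; last exact: D2.
have E : 'D_(e i1 x) (Gam i1 i0 i1) x = 'D_(e i1 x) (Gam i2 i0 i2) x.
  by apply: (eq_in_derive U _ _ x _ oU Ux) => y /warped_connection[_ _ _ _ []].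
exact: etrans E D1.
Qed.

End WarpedFrame.

(** * Coordinates straightening the axis *)

Lemma antiderivative_exists {R : realType} (g : R -> R) (c r : R) : 0 < r ->
  (forall t, ball c r t -> {for t, continuous g}) ->
  exists F : R -> R, forall t, ball c (r / 2) t -> is_derive t 1 F (g t).
Proof.
(* The integration interval has half-length 3 r / 4, strictly between r / 2, where the derivative is
   wanted, and r, up to which [g] is continuous. *)
move=> r0 cg; pose a := c - r * (3 / 4); pose b := c + r * (3 / 4).
have ballE (s t : R) : ball c s t = (c - s < t < c + s) :> Prop.
  by rewrite -ball_normE /= ltr_distlC.
have ab t : a <= t <= b -> ball c r t.
  by rewrite ballE /a /b => H; move: r0 H; clear; lra.
have int : (@lebesgue_measure R).-integrable `[a, b] (EFin \o g).
  apply: continuous_compact_integrable; first exact: segment_compact.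
  by apply: continuous_in_subspaceT => t; rewrite inE /= in_itv /= => /ab /cg.
exists (fun y => (\int[@lebesgue_measure R]_(t in [set` `[a, y]]) (g t))%R) => t.
rewrite ballE => tc.
have tb : t < b by rewrite /b; move: r0 tc; clear; lra.
have at' : a < t by rewrite /a; move: r0 tc; clear; lra.
have [d D] := continuous_FTC1_closed tb int at' (cg t (ab t ltac:(by rewrite !ltW))).
apply: DeriveDef; first exact: d.
exact: etrans (esym (derive1E _ _)) D.
Qed.

Lemma constant_on_leaves {R : realType} (f : 'rV[R]_3 -> R) c r :
  (forall y, ball c r y -> differentiable f y) ->
  (forall y, ball c r y -> 'D_(unit_vec i1) f y = 0 /\ 'D_(unit_vec i2) f y = 0) ->
  forall y z, ball c r y -> ball c r z -> y 0 i0 = z 0 i0 -> f y = f z.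
Proof.
move=> df Df y z cy cz yz.
have cs s : 0 <= s <= 1 -> ball c r (s *: (y - z) + z) by exact: convex_ball_line.
have [s s01] := MVT_line f (y - z) z 1 ltr01 (fun s s01 => df _ (cs s s01)).
rewrite scale1r subrK mul1r; set u := s *: (y - z) + z => E.
have cu : ball c r u by apply: cs; case/andP: s01 => *; rewrite !ltW.
have [D1 D2] := Df u cu.
apply/eqP; rewrite -subr_eq0 E; apply/eqP; apply: etrans (derive_rV f u (y - z) (df u cu)) _.
by rewrite sum3 D1 D2 !mxE yz subrr scale0r !scaler0 !addr0.
Qed.

(** The first column of E J has a single nonzero entry, in the row of the axis; so a vector whose
    image under J has no first component has no axis component either. *)
Lemma leaf_direction {R : fieldType} (E J : 'M[R]_3) (w : 'rV[R]_3) : E \in unitmx -> J \in unitmx ->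
  (row i1 E *m J) 0 i0 = 0 -> (row i2 E *m J) 0 i0 = 0 -> (w *m J) 0 i0 = 0 ->
  exists c1 c2, w = c1 *: row i1 E + c2 *: row i2 E.
Proof.
move=> Eu Ju H1 H2 H; have [M ME] : exists M, E *m J = M by exists (E *m J).
pose c := w *m invmx E.
have wE : w = c *m E by rewrite /c mulmxKV.
have rM i : (row i E *m J) 0 i0 = M i i0 by rewrite -row_mul ME mxE.
have Mu : M \in unitmx by rewrite -ME unitmx_mul Eu.
have M00 : M i0 i0 != 0.
  have := congr1 (fun A : 'M[R]_3 => A i0 i0) (mulVmx Mu).
  rewrite !mxE sum3 -(rM i1) -(rM i2) H1 H2 !mulr0 !addr0 /= => E1.
  by apply/eqP => m0; move/eqP: E1; rewrite m0 mulr0 eq_sym oner_eq0.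
have c0 : c 0 i0 = 0.
  move: H; rewrite wE -mulmxA ME mxE sum3 -!rM H1 H2 !mulr0 !addr0 rM => /eqP.
  by rewrite mulf_eq0 (negPf M00) orbF => /eqP.
exists (c 0 i1), (c 0 i2).
by rewrite [LHS]wE mulmx_sum_row sum3 c0 scale0r add0r.
Qed.

Lemma derive_leaf {R : realType} (E : 'M[R]_3) (f : 'rV[R]_3 -> R) (Phi Psi : 'rV[R]_3 -> 'rV[R]_3) (y v : 'rV[R]_3) :
  E \in unitmx -> differentiable f (Psi y) -> differentiable Psi y -> 'J Phi (Psi y) \in unitmx ->
  (forall w : 'rV[R]_3, 'D_w Psi y = w *m invmx ('J Phi (Psi y))) ->
  (row i1 E *m 'J Phi (Psi y)) 0 i0 = 0 -> (row i2 E *m 'J Phi (Psi y)) 0 i0 = 0 ->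
  'D_(row i1 E) f (Psi y) = 0 -> 'D_(row i2 E) f (Psi y) = 0 ->
  v 0 i0 = 0 -> 'D_v (fun z => f (Psi z)) y = 0.
Proof.
move=> Eu df dPsi Ju DPsi H1 H2 D1 D2 v0.
have [|c1 [c2 wE]] := leaf_direction E ('J Phi (Psi y)) ('D_v Psi y) Eu Ju H1 H2.
  by rewrite DPsi mulmxKV.
apply: etrans (derive_comp Psi f y v dPsi df) _.
rewrite wE deriveE // linearD !linearZ /= -!deriveE // D1 D2.
by rewrite !scaler0 addr0.
Qed.

Lemma is_derive_differentiable {R : realType} (f : R -> R) (t df : R) : is_derive t 1 f df -> differentiable f t.
Proof. by move=> fd; apply/derivable1_diffP; exact: ex_derive. Qed.

Lemma derive_comp1 {R : realType} {V : normedModType R} (k : V -> R) (T : R -> R) x v (dT : R) :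
  differentiable k x -> is_derive (k x) 1 T dT ->
  'D_v (fun y => T (k y)) x = 'D_v k x * dT.
Proof.
move=> dk DT; have dTk := is_derive_differentiable T (k x) dT DT.
apply: etrans (derive_comp k T x v dk dTk) _.
have lin (a : R) : 'D_a T (k x) = a * 'D_1 T (k x).
  rewrite !deriveE // -[in LHS](mulr1 a).
  exact: (linearZ_LR ('d T (k x)) a 1).
by rewrite lin; congr (_ * _); apply: derive_val.
Qed.

Lemma open_preimage {S T : topologicalType} (V : set S) (B : set T) (f : S -> T) :
  open V -> open B -> (forall x, V x -> {for x, continuous f}) -> open (V `&` f @^-1` B).
Proof.
rewrite !openE => oV oB cf x [Vx Bx]; apply: filterI; first exact: oV.
by apply: (cf x Vx); exact: oB.
Qed.

Lemma jacobian_mulmx {R : realType} {n} (f g : 'rV[R]_n -> 'rV[R]_n) (S : 'M[R]_n) x :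
  differentiable f x -> differentiable g x -> (forall v, 'D_v f x = 'D_v g x *m S) ->
  'J f x = 'J g x *m S.
Proof.
move=> df dg fg.
have A (v : 'rV[R]_n) : v *m 'J f x = v *m ('J g x *m S).
  have E1 := deriveEjacobian v df; have E2 := deriveEjacobian v dg.
  refine (etrans (esym E1) (etrans (fg v) _)).
  exact: (etrans (f_equal (fun w : 'rV[R]_n => w *m S) E2) (esym (mulmxA _ _ _))).
apply/row_matrixP => i; apply: etrans (rowE _ _) _; apply: etrans (A _) _.
by apply: esym; exact: rowE.
Qed.

Lemma half_le {R : realFieldType} (d : R) : 0 < d -> d / 2 <= d.
Proof. by move=> ?; lra. Qed.

Lemma row_combinationE {R : pzRingType} {n} (c1 c2 : R) (w1 w2 : 'rV[R]_n) j :
  (c1 *: w1 + c2 *: w2) 0 j = c1 * w1 0 j + c2 * w2 0 j.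
Proof. by rewrite !mxE. Qed.

Section AdaptedCoordinates.
Context {R : realType} (U : set 'rV[R]_3) (oU : open U).
Context (e : 'I_3 -> 'rV[R]_3 -> 'rV[R]_3) (se : forall i, smooth_on U (e i)).
Context (e_unit : forall x, U x -> \matrix_i e i x \in unitmx).
Context (Q : 'rV[R]_3 -> 'rV[R]_3) (sQ : smooth_on U Q).
Context (DQ0 : forall x j, U x -> j != i0 -> 'D_(e i0 x) Q x 0 j = 0).
Context (DQ : forall x i, U x -> i != i0 -> 'D_(e i x) Q x 0 i0 = 0).
Context (bracket : forall x i, U x -> i != i0 -> exists c1 c2,
  'D_(e i0 x) (e i) x - 'D_(e i x) (e i0) x = c1 *: e i1 x + c2 *: e i2 x).
Context (x0 : 'rV[R]_3) (Ux0 : U x0) (JQ0 : 'J Q x0 \in unitmx).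

Let speed x : R := ('D_(e i0 x) Q x) 0 i0.
Let sDQ i : smooth_on U (fun x => 'D_(e i x) Q x).
Proof.
apply: (eq_in_smooth_on U (fun x => e i x *m 'J Q x)) => //.
  by move=> x Ux; apply: esym; apply: deriveEjacobian; exact: smooth_on_differentiable sQ Ux.
by apply: (smooth_on_mulmx _ oU) => //; exact: smooth_on_jacobian.
Qed.

Let sspeed : smooth_on U speed.
Proof. by move/(smooth_on_mxP _ oU) : (sDQ i0); apply. Qed.

Let dQ x (Ux : U x) : differentiable Q x := smooth_on_differentiable U Q x sQ Ux.

(** The bracket of the axis field with a leaf field is tangent to the leaves, where the first
    component of [Q] has derivative zero, so the two mixed derivatives of that component agree and
    one of them is zero. *)
Lemma derive_speed x i : U x -> i != i0 -> 'D_(e i x) speed x = 0.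
Proof.
move=> Ux ni0.
have B := derive_derive_bracket U Q (e i0) (e i) x oU Ux sQ (se i0) (se i).
have [c1 [c2 bE]] := bracket x i Ux ni0; rewrite bE in B.
have D1 : ('D_(e i0 x) (fun y => 'D_(e i y) Q y) x) 0 i0 = 0.
  have dd := smooth_on_differentiable U _ x (sDQ i) Ux.
  apply: etrans (derive_mxE _ x _ 0 i0 dd) _.
  have E : 'D_(e i0 x) (fun y => ('D_(e i y) Q y) 0 i0) x = 'D_(e i0 x) (cst (0 : R)) x.
    by apply: (eq_in_derive U _ _ x _ oU Ux) => y Uy; exact: DQ.
  by rewrite E; apply: derive_cst.
have D2 : ('D_(c1 *: e i1 x + c2 *: e i2 x) Q x) 0 i0 = 0.
  rewrite deriveE; last exact: dQ.
  rewrite linearD !linearZ /= -!deriveE; try exact: dQ.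
  apply: etrans (row_combinationE _ _ _ _ _) _.
  by rewrite (DQ x i1 Ux isT) (DQ x i2 Ux isT) !mulr0 addr0.
have := congr1 (fun w : 'rV[R]_3 => w 0 i0) B; rewrite mxE D1 D2 add0r mxE => /eqP.
rewrite oppr_eq0 => /eqP D3.
have dd := smooth_on_differentiable U _ x (sDQ i0) Ux.
exact: etrans (esym (derive_mxE _ x (e i x) 0 i0 dd)) D3.
Qed.

(* With [T] an antiderivative of the inverse of [speed], which only depends on the first component
   of [Q], the axis field becomes the first coordinate field. *)
Let reparam (T : R -> R) x : 'rV[R]_3 := vec3 (T (Q x 0 i0)) (Q x 0 i1) (Q x 0 i2).

Lemma adapted_coordinates : exists (r d : R) (Phi Psi : 'rV[R]_3 -> 'rV[R]_3),
  [/\ 0 < r /\ 0 < d, ball x0 r `<=` U,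
      smooth_on (ball x0 r) Phi /\ smooth_on (ball (Phi x0) d) Psi,
      (forall y, ball (Phi x0) d y -> ball x0 r (Psi y) /\ Phi (Psi y) = y) /\
      (forall x, ball x0 r x -> ball (Phi x0) d (Phi x) -> Psi (Phi x) = x) &
      (forall y, ball (Phi x0) d y -> 'J Phi (Psi y) \in unitmx /\
         forall v, 'D_v Psi y = v *m invmx ('J Phi (Psi y))) /\
      (forall x, ball x0 r x -> 'D_(e i0 x) Phi x = unit_vec i0 /\
         forall i, i != i0 -> 'D_(e i x) Phi x 0 i0 = 0)].
Proof.
have [r1 [d1 [P1 [[r10 d10] sub1 QP1 P1Q [sP1 DP1]]]]] := inverse_function U Q x0 oU Ux0 sQ JQ0.
have oB1 : open (ball (Q x0) d1) by exact: ball_open.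
have erow x i : row i (\matrix_k e k x) = e i x by rewrite rowK.
pose rho y := speed (P1 y).
have srho : smooth_on (ball (Q x0) d1) rho.
  by apply: (smooth_on_compR _ U P1 speed oB1 _ sP1 sspeed) => y /QP1[/sub1].
have DQJ x v : U x -> v *m 'J Q x = 'D_v Q x.
  by move=> Ux; apply: esym; apply: deriveEjacobian; exact: dQ.
have leaf (y v : 'rV[R]_3) : ball (Q x0) d1 y -> v 0 i0 = 0 -> 'D_v rho y = 0.
  move=> By v0; have [Jy DPy] := DP1 y By; have Uy := sub1 _ (QP1 y By).1.
  apply: (derive_leaf (\matrix_k e k (P1 y)) speed Q P1 y v) => //.
  - exact: e_unit.
  - exact: smooth_on_differentiable sspeed Uy.
  - exact: smooth_on_differentiable sP1 By.
  - by rewrite erow DQJ // DQ.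
  - by rewrite erow DQJ // DQ.
  - by rewrite erow derive_speed.
  - by rewrite erow derive_speed.
(* At zero speed the Jacobian of [Q] would kill the axis field, although it is invertible at this
   point. *)
have rho_neq0 y : ball (Q x0) d1 y -> rho y != 0.
  move=> By; have [Jy _] := DP1 y By; have Uy := sub1 _ (QP1 y By).1.
  apply/eqP => r0; have /rowP := DQJ (P1 y) (e i0 (P1 y)) Uy.
  have -> : 'D_(e i0 (P1 y)) Q (P1 y) = 0.
    apply/rowP; apply: ord3P; rewrite [RHS]mxE; [exact: r0 | exact: DQ0 | exact: DQ0].
  move=> /rowP H; have e0 : e i0 (P1 y) = 0 by rewrite -[LHS](mulmxK Jy) H mul0mx.
  have Eu := e_unit _ Uy; have : delta_mx 0 i0 *m \matrix_k e k (P1 y) = 0 :> 'rV[R]_3.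
    by rewrite -rowE erow e0.
  move=> /(congr1 (mulmx^~ (invmx (\matrix_k e k (P1 y))))); rewrite mulmxK // mul0mx.
  by move=> /rowP/(_ i0); rewrite !mxE !eqxx => /eqP; rewrite oner_eq0.
pose c0 := Q x0 0 i0.
(* [rho] depends on the first coordinate only, so it may be sampled on this line, and its inverse
   there becomes a function of one variable with an antiderivative. *)
pose line t := Q x0 + (t - c0) *: unit_vec i0.
have line_ball t : ball c0 d1 t -> ball (Q x0) d1 (line t).
  rewrite -!ball_normE /= /line opprD addNKr normrN => tc.
  apply: rV_norm_lt => // j; rewrite !mxE /= normrM.
  case: (j == i0); rewrite ?mulr1 ?mulr0 ?normr1 ?normr0 ?mulr1 ?mulr0 //.
  by rewrite distrC.
have oI : open (ball c0 d1) by exact: ball_open.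
have sline : smooth_on (ball c0 d1) line.
  apply: (smooth_onD _ oI); first exact: smooth_on_cst.
  apply: (smooth_onZ _ oI); last exact: smooth_on_cst.
  by apply: (smooth_onB _ oI); [exact: smooth_on_id | exact: smooth_on_cst].
pose g t := (rho (line t))^-1.
have sg : smooth_on (ball c0 d1) g.
  apply: (smooth_onV _ _ oI); first by move=> t /line_ball; exact: rho_neq0.
  exact: (smooth_on_compR _ _ line rho oI line_ball sline srho).
have [T DT] : exists T : R -> R, forall t, ball c0 (d1 / 2) t -> is_derive t 1 T (g t).
  apply: antiderivative_exists => // t Bt; apply: differentiable_continuous.
  exact: smooth_on_differentiable sg Bt.
have sT : smooth_on (ball c0 (d1 / 2)) T.
  apply: (smooth_on_antiderivative _ _ g) => //; first exact: ball_open.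
  by apply: smooth_onS sg; apply: le_ball; exact: half_le.
(* The antiderivative is available on half the radius only, so points are restricted to those whose
   image under [Q] stays within it. *)
pose U2 := ball x0 r1 `&` Q @^-1` ball (Q x0) (d1 / 2).
have oU2 : open U2.
  apply: open_preimage; [exact: ball_open | exact: ball_open |] => x /sub1 Ux.
  by apply: differentiable_continuous; exact: dQ.
have d20 : 0 < d1 / 2 by rewrite divr_gt0.
have U2x0 : U2 x0 by split; apply: ballxx.
have U2U x : U2 x -> U x by case=> /sub1.
have coord x : U2 x -> ball c0 (d1 / 2) (Q x 0 i0).
  case=> _; rewrite -!ball_normE /= => H; apply: le_lt_trans H.
  by have := rV_coord_le (Q x0 - Q x) i0; rewrite !mxE.
have gE x : U2 x -> g (Q x 0 i0) * speed x = 1.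
  move=> Ux; have [B1 B2] := Ux; have Bt := coord x Ux.
  have half : ball (Q x0) d1 (Q x).
    by apply: le_ball B2; exact: half_le.
  have Bl : ball (Q x0) d1 (line (Q x 0 i0)).
    by apply: line_ball; apply: le_ball Bt; exact: half_le.
  have <- : rho (line (Q x 0 i0)) = speed x.
    transitivity (rho (Q x)); last by rewrite /rho P1Q.
    apply: (constant_on_leaves rho (Q x0) d1) => //.
    - by move=> y By; exact: smooth_on_differentiable srho By.
    - by move=> y By; split; apply: leaf => //; rewrite /unit_vec mxE.
    - by rewrite /line !mxE /= mulr1 addrC subrK.
  by rewrite /g mulVf // rho_neq0.
have dcoord x j : U2 x -> differentiable (fun y => Q y 0 j) x.
  by move=> Ux; apply: differentiable_mxE; exact: dQ (U2U x Ux).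
have sPhi : smooth_on U2 (reparam T).
  have sc j : smooth_on U2 (fun y => Q y 0 j).
    by move/(smooth_on_mxP _ oU) : sQ => /(_ 0 j) sQj; apply: smooth_onS sQj.
  apply/(smooth_on_mxP _ oU2) => i; apply: ord3P.
  - apply: (eq_in_smooth_on U2 (fun y => T (Q y 0 i0))) => //; first by move=> y _; rewrite mxE.
    by apply: (smooth_on_comp1 _ _ (fun y => Q y 0 i0) T oU2 coord) => //; exact: sc.
  - by apply: (eq_in_smooth_on U2 (fun y => Q y 0 i1)) => // y _; rewrite mxE.
  - by apply: (eq_in_smooth_on U2 (fun y => Q y 0 i2)) => // y _; rewrite mxE.
have dPhi x : U2 x -> differentiable (reparam T) x by exact: smooth_on_differentiable.
pose scale x : 'M[R]_3 := mx3 (g (Q x 0 i0)) 0 0 0 1 0 0 0 1.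
have DPhi x v : U2 x -> 'D_v (reparam T) x = 'D_v Q x *m scale x.
  move=> Ux; rewrite [X in X *m _]vec3_eta vec3_mul !mulr0 !mulr1 !addr0 !add0r.
  rewrite !(derive_mxE Q x v _ _ (dQ x (U2U x Ux))).
  apply/rowP => j; rewrite (derive_mxE (reparam T) x v 0 j (dPhi x Ux)).
  have E j' : 'D_v (fun y => Q y 0 j') x = 'D_v (fun y => Q y 0 j') x by [].
  move: j; apply: ord3P; rewrite [RHS]mxE /=.
  - have E0 : 'D_v (fun y => reparam T y 0 i0) x = 'D_v (fun y => T (Q y 0 i0)) x.
      by apply: (eq_in_derive U2 _ _ x v oU2 Ux) => y _; rewrite mxE.
    apply: etrans E0 _; apply: (derive_comp1 (fun y => Q y 0 i0) T x v _ (dcoord x i0 Ux)).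
    exact: DT (coord x Ux).
  - by apply: (eq_in_derive U2 _ _ x v oU2 Ux) => y _; rewrite mxE.
  - by apply: (eq_in_derive U2 _ _ x v oU2 Ux) => y _; rewrite mxE.
have JPhi : 'J (reparam T) x0 \in unitmx.
  have -> : 'J (reparam T) x0 = 'J Q x0 *m scale x0.
    apply: jacobian_mulmx; [exact: dPhi | exact: dQ |] => v; exact: DPhi.
  rewrite unitmx_mul JQ0 unitmxE det_mx3 unitfE /=.
  have := gE x0 U2x0; rewrite !(mulr1, mulr0, mul0r, addr0, subr0) => E.
  by apply/eqP => g0; move/eqP: E; rewrite g0 mul0r eq_sym oner_eq0.
have [r [d [Psi [[r0 d0] sub2 PhiK PsiK [sPsi DPsi]]]]] :=
  inverse_function U2 (reparam T) x0 oU2 U2x0 sPhi JPhi.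
exists r, d, (reparam T), Psi; split => //.
- by move=> x /sub2 /U2U.
- by split=> //; apply: smooth_onS sPhi.
split=> // x /sub2 Ux; split.
  rewrite (DPhi x _ Ux); apply/rowP => j.
  have /rowP DE : 'D_(e i0 x) Q x = vec3 (speed x) 0 0.
    apply/rowP; apply: ord3P; rewrite [RHS]mxE //; apply: DQ0 => //; exact: U2U.
  have -> : 'D_(e i0 x) Q x = vec3 (speed x) 0 0 by apply/rowP.
  rewrite vec3_mul !mul0r !mulr0 !addr0 mulrC (gE x Ux).
  by move: j; apply: ord3P; rewrite !mxE.
move=> i ni; rewrite (DPhi x _ Ux) [X in X *m _]vec3_eta vec3_mul mxE /=.
by rewrite (DQ x i (U2U x Ux) ni) mul0r !mulr0 !addr0.
Qed.

End AdaptedCoordinates.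

Lemma derive_sub_scale {R : realType} {V : normedModType R} {m n} (f g : V -> 'M[R]_(m, n)) (k : V -> R) x v :
  differentiable f x -> differentiable k x -> differentiable g x ->
  'D_v (fun y => f y - k y *: g y) x = 'D_v f x - ('D_v k x *: g x + k x *: 'D_v g x).
Proof.
move=> df dk dg.
have dkg : differentiable (fun y => k y *: g y) x.
  by apply: differentiable_mx => i j; under eq_fun do rewrite mxE;
     apply: differentiableM => //; exact: differentiable_mxE.
have D1 : derivable f x v by exact: diff_derivable.
have D2 : derivable (fun y => k y *: g y) x v by exact: diff_derivable.
apply: etrans (deriveB D1 D2) _; f_equal.
by apply: (f_equal (fun w => - w)); exact: derive_scale.
Qed.

Lemma span_eq0 {R : fieldType} {n} (a b : 'rV[R]_n) (al be : R) k l :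
  a 0 k * b 0 l - a 0 l * b 0 k != 0 ->
  (al *: a + be *: b) 0 k = 0 -> (al *: a + be *: b) 0 l = 0 -> al = 0 /\ be = 0.
Proof.
move=> d0; rewrite !mxE => H1 H2; split; apply: (mulIf d0); rewrite mul0r.
  transitivity (b 0 l * (al * a 0 k + be * b 0 k) - b 0 k * (al * a 0 l + be * b 0 l)); first by ring.
  by rewrite H1 H2 !mulr0 subr0.
transitivity (a 0 k * (al * a 0 l + be * b 0 l) - a 0 l * (al * a 0 k + be * b 0 k)); first by ring.
by rewrite H1 H2 !mulr0 subr0.
Qed.

(** * A first integral of the leaves and two first integrals of the axis *)

Section LeafMap.
Context {R : realType} (U : set 'rV[R]_3) (oU : open U).
Context (e : 'I_3 -> 'rV[R]_3 -> 'rV[R]_3).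
Context (g a b : 'rV[R]_3 -> 'rV[R]_4) (w : 'I_3 -> 'rV[R]_3 -> 'rV[R]_4) (kap m n : 'rV[R]_3 -> R).
Context (sg : smooth_on U g) (sa : smooth_on U a) (sb : smooth_on U b) (sk : smooth_on U kap).
Context (D0g : forall x, U x -> 'D_(e i0 x) g x = a x).
Context (D0a : forall x, U x -> 'D_(e i0 x) a x = m x *: a x + b x).
Context (D0b : forall x, U x -> 'D_(e i0 x) b x = n x *: a x).
Context (Dg : forall x i, U x -> i != i0 -> 'D_(e i x) g x = w i x).
Context (Da : forall x i, U x -> i != i0 -> 'D_(e i x) a x = kap x *: w i x).
Context (Dk : forall x i, U x -> i != i0 -> 'D_(e i x) kap x = 0).
Context (x0 : 'rV[R]_3) (Ux0 : U x0).

Let k0 : 'I_4 := Ordinal (isT : (0 < 4)%N).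
Let k1 : 'I_4 := Ordinal (isT : (1 < 4)%N).
Let k2 : 'I_4 := Ordinal (isT : (2 < 4)%N).
Let k3 : 'I_4 := Ordinal (isT : (3 < 4)%N).

Context (g0 : g x0 = 0) (a0 : a x0 = unit_vec k0) (b0 : b x0 = unit_vec k3).
Context (w1 : w i1 x0 = unit_vec k1) (w2 : w i2 x0 = unit_vec k2).

(* [V] is constant along the leaves, and [psi], the point where the plane through [g] spanned by
   [a] and [b] meets the plane of the coordinates 1 and 2, is constant along the axis. *)
Let del x := a x 0 k0 * b x 0 k3 - a x 0 k3 * b x 0 k0.
Let V x := a x - kap x *: g x.
Let p x := (g x 0 k0 * b x 0 k3 - g x 0 k3 * b x 0 k0) / del x.
Let q x := (a x 0 k0 * g x 0 k3 - a x 0 k3 * g x 0 k0) / del x.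
Let psi x := g x - p x *: a x - q x *: b x.

Definition leaf_map x : 'rV[R]_3 := vec3 (V x 0 k3) (psi x 0 k1) (psi x 0 k2).

(** In the application [a], [b] and [w] are E_1, xi and the other frame vectors after an affine
    change of R^4 that makes them the standard basis at [x0]. The coefficients [p] and [q] come from
    Cramer's rule and make the coordinates [k0] and [k3] of [psi] vanish. *)
Lemma leaf_map_spec : exists O, [/\ open O, O x0, O `<=` U, smooth_on O leaf_map &
  [/\ forall x j, O x -> j != i0 -> 'D_(e i0 x) leaf_map x 0 j = 0,
      forall x i, O x -> i != i0 -> 'D_(e i x) leaf_map x 0 i0 = 0 &
      \matrix_i e i x0 *m 'J leaf_map x0 = 1%:M]].
Proof.
have sc (f : 'rV[R]_3 -> 'rV[R]_4) k : smooth_on U f -> smooth_on U (fun x => f x 0 k).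
  by move/(smooth_on_mxP _ oU); apply.
have sdet (f f' h h' : 'rV[R]_3 -> R) : smooth_on U f -> smooth_on U f' -> smooth_on U h -> smooth_on U h' ->
    smooth_on U (fun x => f x * f' x - h x * h' x).
  by move=> *; apply: (smooth_onB _ oU); apply: (smooth_onM _ oU).
have sdel : smooth_on U del by apply: sdet; exact: sc.
pose O := U `&` [set x | del x != 0].
have oO : open O by exact: open_smooth_neq0.
have OU : O `<=` U by move=> x [].
have del0 : del x0 = 1.
  by rewrite /del a0 b0 !mxE /=; ring.
have Ox0 : O x0 by split=> //=; rewrite del0 oner_neq0.
have sOc (f : 'rV[R]_3 -> 'rV[R]_4) k : smooth_on U f -> smooth_on O (fun x => f x 0 k).
  by move=> sf; apply: smooth_onS (sc f k sf).
have sV' : smooth_on O (fun x => (del x)^-1).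
  by apply: smooth_onV => //; [move=> x [] | apply: smooth_onS sdel].
have sp : smooth_on O p.
  by apply: (smooth_onM _ oO) => //; apply: smooth_onS OU _; apply: sdet; exact: sc.
have sq : smooth_on O q.
  by apply: (smooth_onM _ oO) => //; apply: smooth_onS OU _; apply: sdet; exact: sc.
have [sg' sa' sb' sk'] : [/\ smooth_on O g, smooth_on O a, smooth_on O b & smooth_on O kap].
  by split; [exact: smooth_onS sg | exact: smooth_onS sa | exact: smooth_onS sb | exact: smooth_onS sk].
have sV : smooth_on O V by apply: (smooth_on_submx _ oO) => //; exact: smooth_onZ.
pose chi x := g x - p x *: a x.
have schi : smooth_on O chi by apply: (smooth_on_submx _ oO) => //; exact: smooth_onZ.
have spsi : smooth_on O psi by apply: (smooth_on_submx _ oO) => //; exact: smooth_onZ.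
have d (W : normedModType R) (f : 'rV[R]_3 -> W) x : smooth_on O f -> O x -> differentiable f x.
  by move=> sf Ox; exact: smooth_on_differentiable sf Ox.
have DV x v : O x -> 'D_v V x = 'D_v a x - ('D_v kap x *: g x + kap x *: 'D_v g x).
  by move=> Ox; apply: derive_sub_scale; apply: d.
have Dpsi x v : O x -> 'D_v psi x = 'D_v g x - ('D_v p x *: a x + p x *: 'D_v a x)
     - ('D_v q x *: b x + q x *: 'D_v b x).
  move=> Ox; apply: etrans (derive_sub_scale chi b q x v _ _ _) _; try exact: d.
  by f_equal; apply: derive_sub_scale; apply: d.
have psi_k x : O x -> psi x 0 k0 = 0 /\ psi x 0 k3 = 0.
  by case=> Ux dx; rewrite /psi /p /q !mxE; move: dx; rewrite /del /= => dx; split; field.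
have D0psi x : O x -> 'D_(e i0 x) psi x = 0.
  move=> Ox; have Ux := OU x Ox.
  (* The span of [a] and [b] is preserved along the axis, so this derivative lies in it. Its
     coordinates [k0] and [k3] vanish, and the minor [del] is nonzero, so both coefficients are
     zero; no formula for the derivatives of [p] and [q] is needed. *)
  have E : 'D_(e i0 x) psi x = (1 - 'D_(e i0 x) p x - p x * m x - q x * n x) *: a x
      + (- p x - 'D_(e i0 x) q x) *: b x.
    rewrite (Dpsi x _ Ox) D0g // D0a // D0b //.
    by apply/rowP => j; rewrite !mxE; ring.
  have z k : (forall y, O y -> psi y 0 k = 0) -> 'D_(e i0 x) psi x 0 k = 0.
    move=> pk; apply: etrans (derive_mxE psi x _ 0 k (d _ _ _ spsi Ox)) _.
    have E0 : 'D_(e i0 x) (fun y => psi y 0 k) x = 'D_(e i0 x) (cst (0 : R)) x.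
      by apply: (eq_in_derive O _ _ x _ oO Ox) => y Oy; exact: pk.
    by rewrite E0; apply: derive_cst.
  have z0 := z k0 (fun y Oy => (psi_k y Oy).1); have z3 := z k3 (fun y Oy => (psi_k y Oy).2).
  rewrite E in z0 z3; have dx : a x 0 k0 * b x 0 k3 - a x 0 k3 * b x 0 k0 != 0 by case: Ox.
  have [al be] := span_eq0 _ _ _ _ _ _ dx z0 z3.
  by apply: etrans E _; rewrite al be !scale0r addr0.
have slm : smooth_on O leaf_map.
  have sOm (f : 'rV[R]_3 -> 'rV[R]_4) k : smooth_on O f -> smooth_on O (fun x => f x 0 k).
    by move/(smooth_on_mxP _ oO); apply.
  apply/(smooth_on_mxP _ oO) => i; apply: ord3P.
  - by apply: (eq_in_smooth_on O (fun x => V x 0 k3)) => //; [move=> y _; rewrite [RHS]mxE | exact: sOm].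
  - by apply: (eq_in_smooth_on O (fun x => psi x 0 k1)) => //; [move=> y _; rewrite [RHS]mxE | exact: sOm].
  - by apply: (eq_in_smooth_on O (fun x => psi x 0 k2)) => //; [move=> y _; rewrite [RHS]mxE | exact: sOm].
have DL x v : O x -> 'D_v leaf_map x = vec3 ('D_v V x 0 k3) ('D_v psi x 0 k1) ('D_v psi x 0 k2).
  move=> Ox; apply/rowP => j; apply: etrans (derive_mxE leaf_map x v 0 j (d _ _ _ slm Ox)) _.
  have A (f : 'rV[R]_3 -> 'rV[R]_4) l k : smooth_on O f -> (forall y, O y -> leaf_map y 0 l = f y 0 k) ->
      'D_v (fun y => leaf_map y 0 l) x = 'D_v f x 0 k.
    move=> sf lf; have E : 'D_v (fun y => leaf_map y 0 l) x = 'D_v (fun y => f y 0 k) x.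
      exact: (eq_in_derive O _ _ x v oO Ox).
    apply: etrans E _; apply: esym; exact: (derive_mxE f x v 0 k (d _ _ _ sf Ox)).
  have L0 y : O y -> leaf_map y 0 i0 = V y 0 k3 by move=> _; rewrite mxE.
  have L1 y : O y -> leaf_map y 0 i1 = psi y 0 k1 by move=> _; rewrite mxE.
  have L2 y : O y -> leaf_map y 0 i2 = psi y 0 k2 by move=> _; rewrite mxE.
  by move: j; apply: ord3P; rewrite [RHS]mxE /=; [exact: A L0 | exact: A L1 | exact: A L2].
exists O; split => //; split.
- move=> x j Ox nj; rewrite (DL x _ Ox) (D0psi x Ox).
  by move: j nj; apply: ord3P => // _; rewrite !mxE.
- move=> x i Ox ni; have Ux := OU x Ox; rewrite (DL x _ Ox) mxE /= (DV x _ Ox).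
  by rewrite (Da x i Ux ni) (Dg x i Ux ni) (Dk x i Ux ni) scale0r add0r subrr mxE.
have row_J i : row i (\matrix_i e i x0 *m 'J leaf_map x0) = 'D_(e i x0) leaf_map x0.
  rewrite row_mul rowK; apply: esym; apply: deriveEjacobian; exact: d.
apply/row_matrixP => i; apply: etrans (row_J i) _; rewrite row1.
apply: etrans (DL x0 _ Ox0) _.
have p0 : p x0 = 0 by rewrite /p g0 !mxE; ring.
have q0 : q x0 = 0 by rewrite /q g0 !mxE; ring.
have psi_i j k : j != i0 -> 'D_(e j x0) psi x0 0 k =
    w j x0 0 k - 'D_(e j x0) p x0 * unit_vec k0 0 k - 'D_(e j x0) q x0 * unit_vec k3 0 k.
  move=> nj; rewrite (Dpsi x0 _ Ox0) (Dg x0 j Ux0 nj) p0 q0 !scale0r !addr0 a0 b0.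
  by rewrite !mxE.
have V_i j : j != i0 -> 'D_(e j x0) V x0 = 0.
  move=> nj; rewrite (DV x0 _ Ox0) (Da x0 j Ux0 nj) (Dg x0 j Ux0 nj) (Dk x0 j Ux0 nj).
  by rewrite scale0r add0r subrr.
move: i; apply: ord3P.
(* The coordinate [k3] of [V] detects the axis because the axis derivative of [a] contains [b] with
   coefficient one. *)
- rewrite (D0psi x0 Ox0) (DV x0 _ Ox0) D0a // D0g // g0 a0 b0.
  by apply/rowP; apply: ord3P; rewrite !mxE /=; ring.
- rewrite V_i // !psi_i // w1; apply/rowP; apply: ord3P; rewrite !mxE /=; ring.
- rewrite V_i // !psi_i // w2; apply/rowP; apply: ord3P; rewrite !mxE /=; ring.
Qed.
End LeafMap.

Lemma derive_mulmxr {R : realType} {V : normedModType R} {m n p} (f : V -> 'M[R]_(m, n)) (C : 'M[R]_(n, p)) x v :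
  differentiable f x -> 'D_v (fun y => f y *m C) x = 'D_v f x *m C.
Proof.
move=> df; apply: etrans (derive_mulmx f (cst C) x v df (differentiable_cst _ _)) _.
by rewrite derive_cst mulmx0 addr0.
Qed.

Lemma ord3_neq0 (i : 'I_3) : i != i0 -> (i == i1) || (i == i2).
Proof. by move: i; apply: ord3P. Qed.

Section WarpedCoordinates.
Context {R : realType} (U : set 'rV[R]_3) (G xi : 'rV[R]_3 -> 'rV[R]_4).
Context (oU : open U) (sG : smooth_on U G) (sxi : smooth_on U xi).
Context (frame_unit : forall x, U x -> gauss_frame G xi x \in unitmx).
Context (equiaffine : forall x v, U x -> Defs.transversal G xi x ('D_v xi x) = 0).
Context (h_unit : forall x, U x -> affine_metric G xi x \in unitmx).
Context (e : 'I_3 -> 'rV[R]_3 -> 'rV[R]_3) (se : forall i, smooth_on U (e i)).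
Context (mu p la a : 'rV[R]_3 -> R).
Context (nf : forall x, U x ->
  is_normal_frame (affine_metric G xi x) (Defs.shape G xi x) (difference_tensor G xi x)
    (rows3 (e i0 x) (e i1 x) (e i2 x)) (mu x) (p x) 0 (la x) (a x) /\ mu x != 0).
Implicit Types (x u v w : 'rV[R]_3) (i j k l m : 'I_3).

Local Notation Gam := (connection G xi e).
Local Notation Ev := (frame_vector G e).
Local Notation h := (affine_metric G xi).

Let ortho x i j (Ux : U x) := moving_ortho U G xi e mu p la a nf x i j Ux.
Let conn x (Ux : U x) :=
  warped_connection U G xi oU sG sxi frame_unit equiaffine h_unit e se mu p la a nf x Ux.
Let DEv i j x (Ux : U x) := derive_frame_vector U G xi oU sG frame_unit e se ortho i j x Ux.
Let sEv i : smooth_on U (Ev i) := smooth_on_frame_vector U G oU sG e se i.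

Lemma frame_rows_unit x : U x -> \matrix_i e i x \in unitmx.
Proof.
move=> Ux; have [nfx _] := nf x Ux; have := normal_frame_unit nfx.
congr (_ \in unitmx); apply/row_matrixP => i; rewrite row_rows3 rowK.
by move: i; apply: ord3P.
Qed.

(** The mixed coefficients vanish and the two diagonal ones agree, so E_1 moves along the leaves in
    proportion to the position itself; this is why E_1 minus a multiple of G is constant on them. *)
Lemma leaf_derivative_axis x i : U x -> i != i0 -> 'D_(e i x) (Ev i0) x = Gam i1 i0 i1 x *: Ev i x.
Proof.
move=> Ux ni; have [g1 g2 g3 g4 [g5 _]] := conn x Ux.
have g6 : Gam i1 i0 i0 x = 0 /\ Gam i2 i0 i0 x = 0.
  have S j := connection_sym U G xi oU sG sxi frame_unit equiaffine h_unit e se ortho j i0 i0 x Ux.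
  have K j : j != i0 -> bilin (h x) (difference_tensor G xi x (e j x) (e i0 x)) (e i0 x) = 0.
    move=> nj; rewrite (moving_cube U G xi e mu p la a nf x j i0 i0 Ux) /normal_product.
    by move: j nj; apply: ord3P => // _; rewrite !mxE /=; ring.
  have D (z : R) : z + z = 0 -> z = 0 by move/eqP; rewrite -mulr2n mulrn_eq0 => /eqP.
  by split; apply: D; rewrite S K // mulr0.
move: ni; move: i; apply: ord3P => // _; apply: etrans (DEv _ _ x Ux) _.
  by rewrite sum3 g6.1 g3 !scale0r addr0 add0r addr0.
by rewrite sum3 g6.2 g4 -g5 !scale0r !add0r addr0.
Qed.

Lemma axis_derivative_axis x : U x -> 'D_(e i0 x) (Ev i0) x = Gam i0 i0 i0 x *: Ev i0 x + xi x.
Proof.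
move=> Ux; have [g1 g2 g3 g4 [g5 _]] := conn x Ux.
apply: etrans (DEv _ _ x Ux) _.
by rewrite sum3 g1 g2 !scale0r !addr0 eqxx scale1r.
Qed.

(** No axis component: the flow of e_1 carries leaf directions to leaf directions. *)
Lemma axis_bracket x i : U x -> i != i0 -> exists c1 c2,
  'D_(e i0 x) (e i) x - 'D_(e i x) (e i0) x = c1 *: e i1 x + c2 *: e i2 x.
Proof.
move=> Ux ni; have [g1 g2 g3 g4 [g5 _]] := conn x Ux.
have B := frame_bracket U G xi oU sG frame_unit e se ortho i0 i x Ux.
exists (Gam i0 i i1 x - Gam i i0 i1 x), (Gam i0 i i2 x - Gam i i0 i2 x).
apply: etrans B _; rewrite sum3.
suff -> : Gam i0 i i0 x - Gam i i0 i0 x = 0 by rewrite scale0r add0r.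
have S j k := connection_sym U G xi oU sG sxi frame_unit equiaffine h_unit e se ortho j i0 k x Ux.
have K j k : bilin (h x) (difference_tensor G xi x (e j x) (e i0 x)) (e k x) =
    normal_product (mu x) (p x) 0 (unit_vec j) (unit_vec i0) 0 k.
  exact: (moving_cube U G xi e mu p la a nf x j i0 k Ux).
have N1 : normal_product (mu x) (p x) 0 (unit_vec i) (unit_vec i0) 0 i0 = 0.
  by case/orP: (ord3_neq0 i ni) => /eqP ->; rewrite /normal_product !mxE /=; ring.
have N2 : normal_product (mu x) (p x) 0 (unit_vec i0) (unit_vec i0) 0 i = 0.
  by case/orP: (ord3_neq0 i ni) => /eqP ->; rewrite /normal_product !mxE /=; ring.
have S1 := S i i0; have S2 := S i0 i; rewrite K N1 mulr0 in S1; rewrite K N2 mulr0 in S2.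
have E1 : Gam i i0 i0 x = 0 by move/eqP: S1; rewrite -mulr2n mulrn_eq0 => /eqP.
have E0 : Gam i0 i0 i x = 0 by case/orP: (ord3_neq0 i ni) => /eqP ->.
have E2 : Gam i0 i i0 x = 0 by move: S2; rewrite E0 add0r.
by rewrite E1 E2 subr0.
Qed.

Lemma warped_coordinates x0 : U x0 -> exists (r d : R) (Phi Psi : 'rV[R]_3 -> 'rV[R]_3),
  [/\ 0 < r /\ 0 < d, ball x0 r `<=` U,
      smooth_on (ball x0 r) Phi /\ smooth_on (ball (Phi x0) d) Psi,
      (forall y, ball (Phi x0) d y -> ball x0 r (Psi y) /\ Phi (Psi y) = y) /\
      (forall x, ball x0 r x -> ball (Phi x0) d (Phi x) -> Psi (Phi x) = x) &
      (forall y, ball (Phi x0) d y -> 'J Phi (Psi y) \in unitmx /\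
         forall v, 'D_v Psi y = v *m invmx ('J Phi (Psi y))) /\
      (forall x, ball x0 r x -> 'D_(e i0 x) Phi x = unit_vec i0 /\
         forall i, i != i0 -> 'D_(e i x) Phi x 0 i0 = 0)].
Proof.
move=> Ux0.
(* The linear change of R^4 taking the ambient frame at [x0] to the standard basis, so that
   [leaf_map] has an invertible Jacobian there. *)
have [C CE] : exists C : 'M[R]_4, (forall i, Ev i x0 *m C = unit_vec (lshift 1 i)) /\
    xi x0 *m C = unit_vec (rshift 3 ord0).
  pose E : 'M[R]_3 := \matrix_i e i x0; have Eu : E \in unitmx by exact: frame_rows_unit.
  pose B : 'M[R]_4 := col_mx (E *m 'J G x0 : 'M[R]_(3, 4)) (xi x0).
  have BE : B = (block_mx E 0 0 1%:M : 'M[R]_(3 + 1)) *m gauss_frame G xi x0.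
    by rewrite /gauss_frame /B (mul_block_col E 0 0 1%:M) !mul0mx mul1mx addr0 add0r.
  have Bu : B \in unitmx.
    rewrite BE unitmx_mul frame_unit // andbT.
    have D : \det (block_mx E 0 0 1%:M : 'M[R]_(3 + 1)) = \det E.
      by rewrite (det_ublock E 0 1%:M) det1 mulr1.
    by rewrite unitmxE; move: Eu; rewrite unitmxE -D.
  exists (invmx B); split=> [i|].
    have -> : Ev i x0 = row (lshift 1 i) B.
      by rewrite [RHS](rowKu i (E *m 'J G x0 : 'M[R]_(3, 4)) (xi x0)) row_mul rowK.
    by rewrite -row_mul mulmxV // row1.
  have -> : xi x0 = row (rshift 3 ord0) B.
    by rewrite [RHS](rowKd ord0 (E *m 'J G x0 : 'M[R]_(3, 4)) (xi x0)) row_id.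
  by rewrite -row_mul mulmxV // row1.
have [CEv Cxi] := CE.
have dC (f : 'rV[R]_3 -> 'rV[R]_4) x v : smooth_on U f -> U x -> 'D_v (fun y => f y *m C) x = 'D_v f x *m C.
  by move=> sf Ux; apply: derive_mulmxr; exact: smooth_on_differentiable sf Ux.
have sC (f : 'rV[R]_3 -> 'rV[R]_4) : smooth_on U f -> smooth_on U (fun y => f y *m C).
  by move=> sf; apply: (smooth_on_mulmx _ oU) => //; exact: smooth_on_cst.
pose g x := (G x - G x0) *m C.
have sG' : smooth_on U (fun x => G x - G x0).
  by apply: (smooth_on_submx _ oU) => //; exact: smooth_on_cst.
have Dg x i : U x -> 'D_(e i x) g x = Ev i x *m C.
  move=> Ux; apply: etrans (dC _ x _ sG' Ux) _; congr (_ *m _).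
  have dG : derivable G x (e i x) by apply: diff_derivable; exact: smooth_on_differentiable sG Ux.
  apply: etrans (deriveB dG (derivable_cst (G x0) (e i x) x)) _.
  rewrite derive_cst subr0.
  exact: (derive_position U G sG e i x Ux).
pose a' x := Ev i0 x *m C; pose b' x := xi x *m C; pose w' i x := Ev i x *m C.
have D0a x : U x -> 'D_(e i0 x) a' x = Gam i0 i0 i0 x *: a' x + b' x.
  move=> Ux; apply: etrans (dC _ x _ (sEv i0) Ux) _.
  by rewrite (axis_derivative_axis x Ux) mulmxDl -scalemxAl.
have D0b x : U x -> 'D_(e i0 x) b' x = - la x *: a' x.
  move=> Ux; apply: etrans (dC _ x _ sxi Ux) _.
  have N := derive_normal U G xi frame_unit equiaffine e _ (moving_shape U G xi e mu p la a nf) i0 x Ux.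
  by rewrite N -scalemxAl.
have Da x i : U x -> i != i0 -> 'D_(e i x) a' x = Gam i1 i0 i1 x *: w' i x.
  move=> Ux ni; apply: etrans (dC _ x _ (sEv i0) Ux) _.
  by rewrite (leaf_derivative_axis x i Ux ni) -scalemxAl.
have Dk x i : U x -> i != i0 -> 'D_(e i x) (Gam i1 i0 i1) x = 0.
  move=> Ux ni.
  have [H1 H2] := warped_curvature U G xi oU sG sxi frame_unit equiaffine h_unit e se mu p la a nf x Ux.
  by case/orP: (ord3_neq0 i ni) => /eqP ->.
have g0 : g x0 = 0 by rewrite /g subrr mul0mx.
have a0 : a' x0 = unit_vec (Ordinal (isT : (0 < 4)%N)).
  by rewrite /a' (CEv i0); congr unit_vec; exact: val_inj.
have b0 : b' x0 = unit_vec (Ordinal (isT : (3 < 4)%N)).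
  by rewrite /b' Cxi; congr unit_vec; exact: val_inj.
have w1 : w' i1 x0 = unit_vec (Ordinal (isT : (1 < 4)%N)).
  by rewrite /w' (CEv i1); congr unit_vec; exact: val_inj.
have w2 : w' i2 x0 = unit_vec (Ordinal (isT : (2 < 4)%N)).
  by rewrite /w' (CEv i2); congr unit_vec; exact: val_inj.
have sk := smooth_on_connection U G xi oU sG sxi frame_unit e se i1 i0 i1.
have spec := leaf_map_spec U oU e g a' b' w' (Gam i1 i0 i1) (Gam i0 i0 i0) (fun x => - la x)
  (sC _ sG') (sC _ (sEv i0)) (sC _ sxi) sk (fun x Ux => Dg x i0 Ux) D0a D0b (fun x i Ux _ => Dg x i Ux)
  Da Dk x0 Ux0 g0 a0 b0 w1 w2.
have [W [Wo Wx0 WU sQ [DQ0 DQ JQ]]] := spec.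
set Q := (leaf_map _ _ _ _) in sQ DQ0 DQ JQ.
have JQu : 'J Q x0 \in unitmx by case/mulmx1_unit: JQ.
have [r [d [Phi [Psi [rd sub sPP PP DPP]]]]] := adapted_coordinates W Wo e
  (fun i => smooth_onS _ _ _ WU (se i))
  (fun x Wx => frame_rows_unit x (WU x Wx)) Q sQ DQ0 DQ
  (fun x i Wx => axis_bracket x i (WU x Wx)) x0 Wx0 JQu.
by exists r, d, Phi, Psi; split => // x /sub /WU.
Qed.

End WarpedCoordinates.

(** * Change of chart *)

Lemma mulmx_combination {R : pzRingType} {n m p} (c : 'I_n -> R) (v : 'I_n -> 'rV[R]_m) (M : 'M[R]_(m, p)) :
  (\sum_k c k *: v k) *m M = \sum_k c k *: (v k *m M).
Proof. by rewrite mulmx_suml; apply: eq_bigr => k _; rewrite scalemxAl. Qed.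

Section ChangeOfChart.
Context {R : realType} (U : set 'rV[R]_3) (G xi : 'rV[R]_3 -> 'rV[R]_4).
Context (oU : open U) (sG : smooth_on U G) (sxi : smooth_on U xi).
Context (frame_unit : forall x, U x -> gauss_frame G xi x \in unitmx).
Context (equiaffine : forall x v, U x -> Defs.transversal G xi x ('D_v xi x) = 0).
Context (B : set 'rV[R]_3) (Psi : 'rV[R]_3 -> 'rV[R]_3) (J : 'rV[R]_3 -> 'M[R]_3).
Context (oB : open B) (sPsi : smooth_on B Psi) (PsiU : forall y, B y -> U (Psi y)).
Context (J_unit : forall y, B y -> J y \in unitmx) (sJ : smooth_on B J).
Context (DPsi : forall y v, B y -> 'D_v Psi y = v *m invmx (J y)).

Local Notation Gc := (G \o Psi).
Local Notation xic := (xi \o Psi).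

Lemma smooth_on_pullback (f : 'rV[R]_3 -> 'rV[R]_4) : smooth_on U f -> smooth_on B (f \o Psi).
Proof. exact: (smooth_on_comp B U Psi f oB oU PsiU sPsi). Qed.

Lemma derive_pullback {m} (f : 'rV[R]_3 -> 'rV[R]_m) y v : smooth_on U f -> B y ->
  'D_v (f \o Psi) y = 'D_(v *m invmx (J y)) f (Psi y).
Proof.
move=> sf By; have dP := smooth_on_differentiable B Psi y sPsi By.
have df := smooth_on_differentiable U f (Psi y) sf (PsiU y By).
by apply: etrans (derive_comp Psi f y v dP df) _; rewrite DPsi.
Qed.

Lemma jacobian_pullback y : B y -> 'J Gc y = invmx (J y) *m 'J G (Psi y).
Proof.
move=> By; have dGc := smooth_on_differentiable B _ y (smooth_on_pullback G sG) By.
have dG := smooth_on_differentiable U G (Psi y) sG (PsiU y By).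
have A (v : 'rV[R]_3) : v *m 'J Gc y = v *m (invmx (J y) *m 'J G (Psi y)).
  refine (etrans (esym (deriveEjacobian v dGc)) _).
  refine (etrans (derive_pullback G y v sG By) _).
  exact: (etrans (deriveEjacobian _ dG) (esym (mulmxA _ _ _))).
apply/row_matrixP => i; apply: etrans (rowE _ _) _; apply: etrans (A _) _.
by apply: esym; exact: rowE.
Qed.

Lemma gauss_frame_pullback y : B y -> gauss_frame Gc xic y \in unitmx.
Proof.
move=> By; have -> : gauss_frame Gc xic y =
    (block_mx (invmx (J y)) 0 0 1%:M : 'M[R]_(3 + 1)) *m gauss_frame G xi (Psi y).
  rewrite /gauss_frame (mul_block_col (invmx (J y)) 0 0 1%:M) !mul0mx mul1mx addr0 add0r.
  by rewrite jacobian_pullback.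
rewrite unitmx_mul (frame_unit _ (PsiU y By)) andbT.
have D : \det (block_mx (invmx (J y)) 0 0 1%:M : 'M[R]_(3 + 1)) = \det (invmx (J y)).
  by rewrite (det_ublock (invmx (J y)) 0 1%:M) det1 mulr1.
have Ju : invmx (J y) \in unitmx by rewrite unitmx_inv J_unit.
rewrite unitmxE; apply: etrans (f_equal (fun z => z \is a GRing.unit) D) _.
by rewrite -unitmxE.
Qed.

Lemma equiaffine_pullback y v : B y -> Defs.transversal Gc xic y ('D_v xic y) = 0.
Proof.
move=> By; rewrite (derive_pullback xi y v sxi By).
have W := weingarten U G xi frame_unit equiaffine (Psi y) (v *m invmx (J y)) (PsiU y By).
rewrite W; set t := - _.
have -> : t *m 'J G (Psi y) = (t *m J y) *m 'J Gc y + 0 *: xic y.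
  by rewrite scale0r addr0 jacobian_pullback // mulmxA mulmxK // J_unit.
by have [_ ->] := tangential_transversalK B Gc xic gauss_frame_pullback y (t *m J y) 0 By.
Qed.

Section Frame.
Context (h_unit : forall x, U x -> affine_metric G xi x \in unitmx).
Context (e : 'I_3 -> 'rV[R]_3 -> 'rV[R]_3) (se : forall i, smooth_on U (e i)).
Context (mu p la a : 'rV[R]_3 -> R).
Context (nf : forall x, U x ->
  is_normal_frame (affine_metric G xi x) (Defs.shape G xi x) (difference_tensor G xi x)
    (rows3 (e i0 x) (e i1 x) (e i2 x)) (mu x) (p x) 0 (la x) (a x) /\ mu x != 0).

(** [J y] stands for the Jacobian of the inverse of [Psi]. The new components describe the same
    ambient vectors, hence all derivatives in R^4 are unchanged. *)
Definition pull_frame i y : 'rV[R]_3 := e i (Psi y) *m J y.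

Local Notation ec := pull_frame.
Local Notation hc := (affine_metric Gc xic).
Let sGc : smooth_on B Gc := smooth_on_pullback G sG.
Let sxic : smooth_on B xic := smooth_on_pullback xi sxi.
Let ortho x i j (Ux : U x) := moving_ortho U G xi e mu p la a nf x i j Ux.

Lemma smooth_on_pull_frame i : smooth_on B (ec i).
Proof.
apply: (smooth_on_mulmx _ oB) => //.
exact: (smooth_on_comp B U Psi (e i) oB oU PsiU sPsi (se i)).
Qed.

Lemma pull_frame_vector i y : B y -> frame_vector Gc ec i y = frame_vector G e i (Psi y).
Proof.
by move=> By; rewrite /frame_vector jacobian_pullback // mulmxA mulmxK // J_unit.
Qed.

Lemma derive_pull_frame {m} (f : 'rV[R]_3 -> 'rV[R]_m) i y : smooth_on U f -> B y ->
  'D_(ec i y) (f \o Psi) y = 'D_(e i (Psi y)) f (Psi y).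
Proof. by move=> sf By; rewrite (derive_pullback f y _ sf By) /ec mulmxK // J_unit. Qed.

(** The same vector of R^4 is decomposed in the old and in the new chart. Uniqueness of the
    decomposition transports connection and metric together, without any transformation law for
    second derivatives. *)
Let decomposition i j y (By : B y) :
  nabla Gc xic (ec i) (ec j) y = \sum_k connection G xi e i j k (Psi y) *: ec k y /\
  bilin (hc y) (ec i y) (ec j y) = (i == j)%:R.
Proof.
have dec := smooth_on_differentiable B _ y (smooth_on_pull_frame j) By.
have GF := gauss_formula B Gc xic oB sGc gauss_frame_pullback (ec i) (ec j) y By dec.
have Sum : (\sum_k connection G xi e i j k (Psi y) *: ec k y) *m 'J Gc y =
    \sum_k connection G xi e i j k (Psi y) *: frame_vector G e k (Psi y).
  refine (etrans (mulmx_combination _ _ _) (eq_bigr _ (fun k _ => _))).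
  exact: (f_equal (fun w : 'rV[R]_4 => connection G xi e i j k (Psi y) *: w) (pull_frame_vector k y By)).
have E : flat_derivative Gc (ec i) (ec j) y =
    (\sum_k connection G xi e i j k (Psi y) *: ec k y) *m 'J Gc y + (i == j)%:R *: xic y.
  have E1 : flat_derivative Gc (ec i) (ec j) y = 'D_(ec i y) (frame_vector G e j \o Psi) y.
    by apply: (eq_in_derive B _ _ y _ oB By) => z Bz; exact: pull_frame_vector.
  have sEv := smooth_on_frame_vector U G oU sG e se j.
  refine (etrans E1 (etrans (derive_pull_frame _ i y sEv By) _)).
  refine (etrans (derive_frame_vector U G xi oU sG frame_unit e se ortho i j _ (PsiU y By)) _).
  exact: (f_equal (fun w : 'rV[R]_4 => w + (i == j)%:R *: xi (Psi y)) (esym Sum)).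
have {}E := etrans (esym GF) E.
have K1 := tangential_transversalK B Gc xic gauss_frame_pullback y
  (nabla Gc xic (ec i) (ec j) y) (bilin (hc y) (ec i y) (ec j y)) By.
have K2 := tangential_transversalK B Gc xic gauss_frame_pullback y
  (\sum_k connection G xi e i j k (Psi y) *: ec k y) ((i == j)%:R) By.
split.
  exact: (etrans (esym K1.1) (etrans (f_equal (tangential Gc xic y) E) K2.1)).
exact: (etrans (esym K1.2) (etrans (f_equal (Defs.transversal Gc xic y) E) K2.2)).
Qed.

Lemma pull_ortho y i j : B y -> bilin (hc y) (ec i y) (ec j y) = (i == j)%:R.
Proof. by move=> By; exact: (decomposition i j y By).2. Qed.

Lemma connection_pullback i j k y : B y ->
  connection Gc xic ec i j k y = connection G xi e i j k (Psi y).
Proof.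
move=> By.
have S (z : 'I_3 -> 'rV[R]_3) : bilin (hc y) (\sum_l z l) (ec k y) = \sum_l bilin (hc y) (z l) (ec k y).
  by rewrite !sum3 !bilinDl.
refine (etrans (f_equal (fun w => bilin (hc y) w (ec k y)) (decomposition i j y By).1) _).
refine (etrans (S _) (etrans _ (sum_delta (fun l => connection G xi e i j l (Psi y)) k))).
apply: eq_bigr => l _; refine (etrans (bilinZl _ _ _ _) _).
exact: (f_equal (fun z => connection G xi e i j l (Psi y) * z) (pull_ortho y l k By)).
Qed.

Lemma metric_pullback_unit y : B y -> hc y \in unitmx.
Proof.
move=> By; pose E : 'M[R]_3 := \matrix_i ec i y.
have : E *m hc y *m E^T = 1%:M.
  apply/matrixP => i j; rewrite -bilin_unit -bilin_mul -!rowE !rowK pull_ortho //.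
  by rewrite mxE.
by rewrite -mulmxA => /mulmx1_unit[_]; rewrite unitmx_mul => /andP[].
Qed.

(** K is half the symmetrized connection in an orthonormal frame, so it follows from the transport
    of the connection coefficients; the Christoffel symbols of the new metric never have to be
    computed. *)
Lemma pull_product i j y : B y ->
  difference_tensor Gc xic y (ec i y) (ec j y) =
  normal_product (mu (Psi y)) (p (Psi y)) 0 (unit_vec i) (unit_vec j) *m rows3 (ec i0 y) (ec i1 y) (ec i2 y).
Proof.
move=> By; have Uy := PsiU y By.
have C k : bilin (hc y) (difference_tensor Gc xic y (ec i y) (ec j y)) (ec k y) =
    normal_product (mu (Psi y)) (p (Psi y)) 0 (unit_vec i) (unit_vec j) 0 k.
  have S := connection_sym B Gc xic oB sGc sxic gauss_frame_pullback equiaffine_pullback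
    metric_pullback_unit ec smooth_on_pull_frame pull_ortho i j k y By.
  have S' := connection_sym U G xi oU sG sxi frame_unit equiaffine h_unit e se ortho i j k _ Uy.
  have two0 : (2 : R) != 0 by rewrite pnatr_eq0.
  apply: (mulfI two0); rewrite -S !connection_pullback // S'.
  by f_equal; exact: (moving_cube U G xi e mu p la a nf _ i j k Uy).
rewrite [LHS](frame_expansion B Gc xic ec pull_ortho y _ By) [in RHS]mulmx_sum_row.
apply: eq_bigr => k _; rewrite C row_rows3; congr (_ *: _).
by move: k {C}; apply: ord3P.
Qed.

Lemma pull_shape i y : B y ->
  Defs.shape Gc xic y (ec i y) = (if i == i0 then la else a) (Psi y) *: ec i y.
Proof.
move=> By; have Uy := PsiU y By.
have N := derive_normal U G xi frame_unit equiaffine e _ (moving_shape U G xi e mu p la a nf) i _ Uy.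
rewrite /Defs.shape (derive_pull_frame xi i y sxi By) N -(pull_frame_vector i y By).
have [T _] := tangential_transversalK B Gc xic gauss_frame_pullback y (ec i y) 0 By.
by rewrite scale0r addr0 in T; rewrite tangentialZ [X in _ *: X]T scaleNr opprK.
Qed.

Lemma pull_normal_frame y : B y ->
  is_normal_frame (hc y) (Defs.shape Gc xic y) (difference_tensor Gc xic y)
    (rows3 (ec i0 y) (ec i1 y) (ec i2 y)) (mu (Psi y)) (p (Psi y)) 0 (la (Psi y)) (a (Psi y)).
Proof.
move=> By.
have KC u v := difference_tensorC B Gc xic oB sGc sxic gauss_frame_pullback metric_pullback_unit y u v By.
have KL u c v w := difference_tensor_linearr B Gc xic oB sGc sxic gauss_frame_pullback
  equiaffine_pullback metric_pullback_unit y u c v w By.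
have SL c u v := shape_linear B Gc xic sxic y c u v By.
have ort : rows3 (ec i0 y) (ec i1 y) (ec i2 y) *m hc y *m (rows3 (ec i0 y) (ec i1 y) (ec i2 y))^T = 1%:M.
  by rewrite rows3_gram !pull_ortho // mx3_1.
have P i j := pull_product i j y By; have S i := pull_shape i y By.
apply: (normal_frame_of_products (hc y) _ _ KL KC SL _ _ _ ort).
- apply: etrans (P i0 i0) _; rewrite [X in X *m _](_ : _ = vec3 (2 * mu (Psi y)) 0 0).
    by rewrite rows3_mul !scale0r !addr0.
  by apply/rowP; apply: ord3P; rewrite /normal_product !mxE /=; ring.
- apply: etrans (P i0 i1) _; rewrite [X in X *m _](_ : _ = vec3 0 (- mu (Psi y)) 0).
    by rewrite rows3_mul !scale0r add0r !addr0.
  by apply/rowP; apply: ord3P; rewrite /normal_product !mxE /=; ring.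
- apply: etrans (P i0 i2) _; rewrite [X in X *m _](_ : _ = vec3 0 0 (- mu (Psi y))).
    by rewrite rows3_mul !scale0r !add0r.
  by apply/rowP; apply: ord3P; rewrite /normal_product !mxE /=; ring.
- apply: etrans (P i1 i1) _; rewrite [X in X *m _](_ : _ = vec3 (- mu (Psi y)) (p (Psi y)) 0).
    by rewrite rows3_mul !scale0r.
  by apply/rowP; apply: ord3P; rewrite /normal_product !mxE /=; ring.
- apply: etrans (P i1 i2) _; rewrite [X in X *m _](_ : _ = vec3 0 0 (- p (Psi y))).
    by rewrite rows3_mul !scale0r add0r.
  by apply/rowP; apply: ord3P; rewrite /normal_product !mxE /=; ring.
- apply: etrans (P i2 i2) _; rewrite [X in X *m _](_ : _ = vec3 (- mu (Psi y)) (- p (Psi y)) 0).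
    by rewrite rows3_mul !scale0r oppr0 scale0r.
  by apply/rowP; apply: ord3P; rewrite /normal_product !mxE /=; ring.
- exact: (S i0).
- exact: (S i1).
- exact: (S i2).
Qed.

End Frame.
End ChangeOfChart.

(** * The warped product *)

Lemma double_inj {R : realFieldType} (a b : R) : a + a = 2 * b -> a = b.
Proof. by move=> E; lra. Qed.

Lemma half_christoffel {R : realFieldType} (a b c d k : R) : b = 0 -> c = 0 ->
  k * d = 2^-1 * (b + a - c) -> a = 2 * k * d.
Proof. by move=> -> -> E; lra. Qed.

Section WarpedMetric.
Context {R : realType} (U : set 'rV[R]_3) (G xi : 'rV[R]_3 -> 'rV[R]_4).
Context (oU : open U) (sG : smooth_on U G) (sxi : smooth_on U xi).
Context (frame_unit : forall x, U x -> gauss_frame G xi x \in unitmx).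
Context (equiaffine : forall x v, U x -> Defs.transversal G xi x ('D_v xi x) = 0).
Context (h_unit : forall x, U x -> affine_metric G xi x \in unitmx).
Context (e : 'I_3 -> 'rV[R]_3 -> 'rV[R]_3) (se : forall i, smooth_on U (e i)).
Context (mu p la a : 'rV[R]_3 -> R).
Context (nf : forall x, U x ->
  is_normal_frame (affine_metric G xi x) (Defs.shape G xi x) (difference_tensor G xi x)
    (rows3 (e i0 x) (e i1 x) (e i2 x)) (mu x) (p x) 0 (la x) (a x) /\ mu x != 0).
Context (axis : forall x, U x -> e i0 x = unit_vec i0).
Context (leaf : forall x i, U x -> i != i0 -> e i x 0 i0 = 0).
Implicit Types (x u v w : 'rV[R]_3) (i j k l m : 'I_3).

Local Notation Gam := (connection G xi e).
Local Notation Ev := (frame_vector G e).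
Local Notation h := (affine_metric G xi).

Let ortho x i j (Ux : U x) := moving_ortho U G xi e mu p la a nf x i j Ux.
Let sh : smooth_on U h := smooth_on_affine_metric U G xi oU sG sxi frame_unit.
Let dh x (Ux : U x) : differentiable h x := smooth_on_differentiable U _ x sh Ux.
Let hT x (Ux : U x) : (h x)^T = h x := affine_metric_sym U G xi oU sG x Ux.
Let sGam i j k := smooth_on_connection U G xi oU sG sxi frame_unit e se i j k.

(** The function eta, as the sum of the contributions k of the induced connection and [mu] of minus
    K. *)
Definition warping_rate x : R := Gam i1 i0 i1 x + mu x.

(** The other two frame vectors have no first component, so the first component of the orthonormal
    expansion of [v] comes from the unit field e_1 = d/dt alone. *)
Lemma metric_axis x v : U x -> bilin (h x) v (e i0 x) = v 0 i0.
Proof.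
move=> Ux; have E := frame_expansion U G xi e ortho x v Ux.
rewrite [in RHS]E sum3 !mxE (leaf x i1 Ux isT) (leaf x i2 Ux isT) !mulr0 !addr0.
by rewrite [X in _ = _ * X](_ : _ = 1) ?mulr1 // axis // mxE !eqxx.
Qed.

Lemma leaf_vector x v : U x -> v 0 i0 = 0 -> exists c1 c2, v = c1 *: e i1 x + c2 *: e i2 x.
Proof.
move=> Ux v0; exists (bilin (h x) v (e i1 x)), (bilin (h x) v (e i2 x)).
have E := frame_expansion U G xi e ortho x v Ux.
by apply: etrans E _; rewrite sum3 metric_axis // v0 scale0r add0r.
Qed.

Lemma derive_leaf_eq0 (f : 'rV[R]_3 -> R) x v : U x -> differentiable f x ->
  'D_(e i1 x) f x = 0 -> 'D_(e i2 x) f x = 0 -> v 0 i0 = 0 -> 'D_v f x = 0.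
Proof.
move=> Ux df D1 D2 v0; have [c1 [c2 ->]] := leaf_vector x v Ux v0.
by rewrite deriveE // linearD !linearZ /= -!deriveE // D1 D2 !scaler0 addr0.
Qed.

Lemma connection_axis x : U x -> Gam i0 i0 i0 x = 2 * mu x.
Proof.
move=> Ux; apply: double_inj.
have S := connection_sym U G xi oU sG sxi frame_unit equiaffine h_unit e se ortho i0 i0 i0 x Ux.
apply: etrans S _; rewrite (moving_cube U G xi e mu p la a nf x i0 i0 i0 Ux) /normal_product !mxE /=.
ring.
Qed.

(* [mu] is an arbitrary choice function; on [U] it is half a connection coefficient, hence smooth. *)
Let rate' x : R := Gam i1 i0 i1 x + 2^-1 * Gam i0 i0 i0 x.

Let rateE x : U x -> warping_rate x = rate' x.
Proof.
move=> Ux; rewrite /warping_rate /rate' connection_axis // mulrA mulVf ?mul1r //.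
Qed.

Lemma smooth_on_warping_rate : smooth_on U warping_rate.
Proof.
apply: (eq_in_smooth_on U rate') => //; first by move=> x Ux; rewrite rateE.
apply: (smooth_onD _ oU); first exact: sGam.
by apply: (smooth_onM _ oU); [exact: smooth_on_cst | exact: sGam].
Qed.

Lemma derive_warping_rate x v : U x -> v 0 i0 = 0 -> 'D_v warping_rate x = 0.
Proof.
move=> Ux v0.
have D i : i != i0 -> 'D_(e i x) warping_rate x = 0.
  have [_ _ _ _ [_ [D1 D2]]] := warped_connection U G xi oU sG sxi frame_unit equiaffine h_unit e se mu p la a nf x Ux.
  have [C1 C2] := warped_curvature U G xi oU sG sxi frame_unit equiaffine h_unit e se mu p la a nf x Ux.
  have d0 := smooth_on_differentiable U _ x (sGam i0 i0 i0) Ux.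
  have d1 := smooth_on_differentiable U _ x (sGam i1 i0 i1) Ux.
  have S : smooth_on U (fun y => 2^-1 * Gam i0 i0 i0 y).
    by apply: (smooth_onM _ oU); [exact: smooth_on_cst | exact: sGam].
  have d2 := smooth_on_differentiable U _ x S Ux.
  move=> ni; apply: etrans (eq_in_derive U _ _ x _ oU Ux rateE) _.
  apply: etrans (derive_add _ _ x (e i x) d1 d2) _.
  have Z : 'D_(e i x) (fun y => 2^-1 * Gam i0 i0 i0 y) x = 2^-1 *: 'D_(e i x) (Gam i0 i0 i0) x.
    by apply: deriveZ; exact: diff_derivable.
  by rewrite Z; case/orP: (ord3_neq0 i ni) => /eqP ->; rewrite ?C1 ?C2 ?D1 ?D2 scaler0 addr0.
apply: (derive_leaf_eq0 warping_rate x v Ux _ _ _ v0).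
- exact: smooth_on_differentiable smooth_on_warping_rate Ux.
- exact: D i1 isT.
- exact: D i2 isT.
Qed.

(** The Levi-Civita derivative is the induced one minus K: tangent to the leaves the former is k v,
    and K(v, e_1) = -mu v. *)
Lemma levi_civita_axis x v : U x -> v 0 i0 = 0 ->
  levi_civita h (cst v) (e i0) x = warping_rate x *: v.
Proof.
move=> Ux v0; have [c1 [c2 vE]] := leaf_vector x v Ux v0.
have de := smooth_on_differentiable U _ x (se i0) Ux.
have N := nabla_levi_civita U G xi oU sG frame_unit (cst v) (e i0) x Ux de.
have L i := leaf_derivative_axis U G xi oU sG sxi frame_unit equiaffine h_unit e se mu p la a nf x i Ux.
have DE : 'D_v (Ev i0) x = (Gam i1 i0 i1 x *: v) *m 'J G x + 0 *: xi x.
  have dE := smooth_on_differentiable U _ x (smooth_on_frame_vector U G oU sG e se i0) Ux.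
  have E : 'D_v (Ev i0) x = c1 *: 'D_(e i1 x) (Ev i0) x + c2 *: 'D_(e i2 x) (Ev i0) x.
    by rewrite vE; move: (e i1 x) (e i2 x) => y z; rewrite !deriveE // linearD !linearZ.
  rewrite scale0r addr0; apply: etrans E _; rewrite (L i1 isT) (L i2 isT) [in RHS]vE /frame_vector.
  by rewrite -[RHS]scalemxAl mulmxDl -![in RHS]scalemxAl scalerDr !scalerA ![c1 * _]mulrC ![c2 * _]mulrC.
have NE : nabla G xi (cst v) (e i0) x = Gam i1 i0 i1 x *: v.
  have [T _] := tangential_transversalK U G xi frame_unit x (Gam i1 i0 i1 x *: v) 0 Ux.
  exact: etrans (f_equal (tangential G xi x) DE) T.
have KE : difference_tensor G xi x v (e i0 x) = - mu x *: v.
  have [[_ _ K] _] := nf x Ux.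
  have vE' : v = vec3 0 c1 c2 *m rows3 (e i0 x) (e i1 x) (e i2 x).
    by rewrite rows3_mul scale0r add0r.
  have eE : e i0 x = vec3 1 0 0 *m rows3 (e i0 x) (e i1 x) (e i2 x).
    by rewrite rows3_mul !scale0r scale1r !addr0.
  apply: etrans (f_equal2 (difference_tensor G xi x) vE' eE) _.
  apply: etrans (K _ _) _; rewrite [in RHS]vE' [RHS]scalemxAl; congr (_ *m _).
  by rewrite normal_product_vec3 vec3Z; congr vec3; ring.
have M : levi_civita h (cst v) (e i0) x = nabla G xi (cst v) (e i0) x - difference_tensor G xi x v (e i0 x).
  by rewrite N addrK.
by apply: etrans M _; rewrite NE KE -scalerBl opprK.
Qed.

(** In the Koszul formula for d/dt and two constant leaf directions, the terms differentiating h(w,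
    d/dt) and h(v, d/dt) vanish since these are constant functions; the t-derivative of h(v, w) is
    all that remains. *)
Lemma metric_growth x v w : U x -> v 0 i0 = 0 -> w 0 i0 = 0 ->
  'D_(unit_vec i0) (fun y => bilin (h y) v w) x = 2 * warping_rate x * bilin (h x) v w.
Proof.
move=> Ux v0 w0; have gu := h_unit x Ux.
have Dsym u := derive_affine_metric_sym U G xi oU sG sxi frame_unit x u Ux.
have C := bilin_levi_civita_cst h x (dh x Ux) v (unit_vec i0) w gu.
have const u1 u2 u3 : 'D_u1 (fun y => bilin (h y) u2 u3) x = bilin ('D_u1 h x) u2 u3.
  have D := derive_bilin h x (dh x Ux) (cst u2) (cst u3) u1 (differentiable_cst _ _) (differentiable_cst _ _).
  by apply: etrans D _; rewrite !derive_cst bilin0l bilin0r !addr0.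
have zero u1 u2 : bilin ('D_u1 h x) u2 (unit_vec i0) = 0.
  rewrite -const; have E : 'D_u1 (fun y => bilin (h y) u2 (unit_vec i0)) x = 'D_u1 (cst (u2 0 i0)) x.
    by apply: (eq_in_derive U _ _ x _ oU Ux) => y Uy; rewrite -(axis y Uy) metric_axis.
  by rewrite E; apply: derive_cst.
have zero' u1 u2 : bilin ('D_u1 h x) (unit_vec i0) u2 = 0.
  by rewrite -(zero u1 u2) bilinC.
have LC : levi_civita h (cst v) (cst (unit_vec i0)) x = warping_rate x *: v.
  rewrite -(levi_civita_axis x v Ux v0) /levi_civita; f_equal; last by rewrite axis.
  by apply: (eq_in_derive U _ _ x _ oU Ux) => y Uy; rewrite axis.
rewrite LC bilinZl /christoffel_form in C; rewrite const.
exact: half_christoffel (zero' v w) (zero w v) C.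
Qed.

End WarpedMetric.

Section BoxCoordinates.
Context {R : realType}.
Implicit Types (x y c : 'rV[R]_3) (t r : R) (u : 'rV[R]_2).

Definition box_point t u : 'rV[R]_3 := (row_mx t%:M u : 'rV[R]_(1 + 2)).

Lemma i0E : i0 = 0 :> 'I_3. Proof. exact: val_inj. Qed.
Lemma i1E : i1 = rshift 1 (0 : 'I_2) :> 'I_3. Proof. exact: val_inj. Qed.
Lemma i2E : i2 = rshift 1 (1 : 'I_2) :> 'I_3. Proof. exact: val_inj. Qed.

Lemma point_line t u : (box_point t u) 0 i0 = t.
Proof.
rewrite (_ : i0 = lshift 2 (0 : 'I_1)); last exact: val_inj.
by rewrite /box_point (row_mxEl (t%:M : 'M[R]_1)) mxE eqxx mulr1n.
Qed.

Lemma point_leaf t u j : (box_point t u) 0 (rshift 1 j) = u 0 j.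
Proof. by rewrite /box_point (row_mxEr (t%:M : 'M[R]_1)). Qed.

Lemma leaf_coordE x j : leaf_coord x 0 j = x 0 (rshift 1 j).
Proof. by rewrite mxE. Qed.

Lemma leaf_point t u : leaf_coord (box_point t u) = u.
Proof. by apply/rowP => j; rewrite leaf_coordE point_leaf. Qed.

Lemma ord3_split (P : 'I_3 -> Prop) : P i0 -> (forall j : 'I_2, P (rshift 1 j)) -> forall i, P i.
Proof.
move=> P0 P1; apply: ord3P => //; [rewrite i1E | rewrite i2E]; exact: P1.
Qed.

(** The norm on row vectors is the maximum norm, so a ball is already a product of an interval and a
    plane ball, the shape required of a warped product. *)
Lemma ball_box c r x : 0 < r ->
  ball c r x <-> ball (c 0 i0) r (x 0 i0) /\ ball (leaf_coord c) r (leaf_coord x).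
Proof.
move=> r0; rewrite -!ball_normE /=; split=> [H|[H0 H1]].
  split; first by apply: le_lt_trans H; have := rV_coord_le (c - x) i0; rewrite !mxE.
  apply: rV_norm_lt => // j; rewrite !mxE; apply: le_lt_trans H.
  by have := rV_coord_le (c - x) (rshift 1 j); rewrite !mxE.
apply: rV_norm_lt => // i; rewrite !mxE; move: i; apply: ord3_split => // j.
apply: le_lt_trans H1; have := rV_coord_le (leaf_coord c - leaf_coord x) j.
by rewrite !mxE.
Qed.

Lemma ball_warped_domain c r : 0 < r ->
  ball c r = warped_domain (line_coord c - r) (line_coord c + r) (ball (leaf_coord c) r).
Proof.
move=> r0; apply/seteqP; split=> x.
  by case/(ball_box c r x r0) => H0 H1; split=> //; rewrite /line_coord -i0E -ltr_distlC; move: H0; rewrite -ball_normE.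
case=> H0 H1; apply/(ball_box c r x r0); split=> //.
by rewrite -ball_normE /=; move: H0; rewrite /line_coord -i0E -ltr_distlC.
Qed.

Lemma smooth_on_point_leaf (N : set 'rV[R]_2) t : open N -> smooth_on N (box_point t).
Proof.
move=> oN; apply/(smooth_on_mxP _ oN) => i; rewrite (ord1 i); apply: ord3_split => [|j].
  by apply: (eq_in_smooth_on N (cst t)) => //; [move=> y _; rewrite point_line | exact: smooth_on_cst].
apply: (eq_in_smooth_on N (fun y : 'rV[R]_2 => y 0 j)) => //; first by move=> y _; rewrite point_leaf.
exact: smooth_on_coord.
Qed.

Lemma smooth_on_point_line (I : set R) u : open I -> smooth_on I (box_point^~ u).
Proof.
move=> oI; apply/(smooth_on_mxP _ oI) => i; rewrite (ord1 i); apply: ord3_split => [|j].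
  by apply: (eq_in_smooth_on I id) => //; [move=> y _; rewrite point_line | exact: smooth_on_id].
by apply: (eq_in_smooth_on I (cst (u 0 j))) => //; [move=> y _; rewrite point_leaf | exact: smooth_on_cst].
Qed.

Lemma constant_on_lines (f : 'rV[R]_3 -> R) c r :
  (forall y, ball c r y -> differentiable f y) ->
  (forall y, ball c r y -> 'D_(unit_vec i0) f y = 0) ->
  forall y z, ball c r y -> ball c r z -> leaf_coord y = leaf_coord z -> f y = f z.
Proof.
move=> df Df y z cy cz yz.
have cs s : 0 <= s <= 1 -> ball c r (s *: (y - z) + z) by exact: convex_ball_line.
have [s s01] := MVT_line f (y - z) z 1 ltr01 (fun s s01 => df _ (cs s s01)).
rewrite scale1r subrK mul1r; set u := s *: (y - z) + z => E.
have cu : ball c r u by apply: cs; case/andP: s01 => *; rewrite !ltW.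
apply/eqP; rewrite -subr_eq0 E; apply/eqP; apply: etrans (derive_rV f u (y - z) (df u cu)) _.
have leaf j : (y - z) 0 (rshift 1 j) = 0.
  by rewrite !mxE -!leaf_coordE yz subrr.
by rewrite sum3 (Df u cu) i1E i2E !leaf !scale0r scaler0 !addr0.
Qed.

End BoxCoordinates.

Lemma bilin_mulmx {R : realType} {m n} (A : 'M[R]_n) (S : 'M[R]_(m, n)) u v :
  bilin (S *m A *m S^T) u v = bilin A (u *m S) (v *m S).
Proof. by rewrite /bilin trmx_mul !mulmxA. Qed.

Lemma bilin_scale {R : realType} {n} (k : R) (A : 'M[R]_n) u v : bilin (k *: A) u v = k * bilin A u v.
Proof. by rewrite /bilin -scalemxAr -scalemxAl mxE. Qed.

Section WarpedProductStructure.
Context {R : realType} (c : 'rV[R]_3) (d : R) (d0 : 0 < d).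
Context (h : 'rV[R]_3 -> 'M[R]_3) (eta : 'rV[R]_3 -> R).
Local Notation U := (ball c d).
Local Notation W := (ball c (d / 2)).
Context (sh : smooth_on U h) (h_pos : forall x, U x -> posdef (h x)) (seta : smooth_on U eta).
Context (axis : forall x (v : 'rV[R]_3), U x -> bilin (h x) v (unit_vec i0) = v 0 i0).
Context (leaf_eta : forall x (v : 'rV[R]_3), U x -> v 0 i0 = 0 -> 'D_v eta x = 0).
Context (growth : forall x (v w : 'rV[R]_3), U x -> v 0 i0 = 0 -> w 0 i0 = 0 ->
  'D_(unit_vec i0) (fun y => bilin (h y) v w) x = 2 * eta x * bilin (h x) v w).

Let oU : open U. Proof. exact: ball_open. Qed.
Let d20 : 0 < d / 2. Proof. by rewrite divr_gt0. Qed.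
Let oW : open W. Proof. exact: ball_open. Qed.
Let WU x : W x -> U x. Proof. by apply: le_ball; exact: half_le. Qed.

Let axis_point t := box_point t (leaf_coord c).
Let axis_point_U t : ball (c 0 i0) d t -> U (axis_point t).
Proof.
move=> Bt; apply/(ball_box c d _ d0); rewrite point_line leaf_point; split=> //.
exact: ballxx.
Qed.

(** As [eta] is constant on the leaves, it is integrated along the axis through the centre. The
    antiderivative is provided on half the radius, which is the reason for the smaller ball. *)
Lemma warping_function : exists f : R -> R, forall x, W x -> is_derive (x 0 i0) 1 f (eta x).
Proof.
have oI : open (ball (c 0 i0) d) by exact: ball_open.
have sE : smooth_on (ball (c 0 i0) d) (fun t => eta (axis_point t)).
  apply: (smooth_on_compR _ U axis_point eta oI axis_point_U) => //.
  exact: smooth_on_point_line.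
have [f Df] : exists f : R -> R, forall t, ball (c 0 i0) (d / 2) t -> is_derive t 1 f (eta (axis_point t)).
  apply: (antiderivative_exists (fun t => eta (axis_point t)) _ _ d0) => t Bt.
  by apply: differentiable_continuous; exact: smooth_on_differentiable sE Bt.
exists f => x Wx; have Bt : ball (c 0 i0) (d / 2) (x 0 i0) by case/(ball_box c _ x d20): Wx.
have -> : eta x = eta (axis_point (x 0 i0)); last exact: Df.
apply: (constant_on_leaves eta c d).
- by move=> y Uy; exact: smooth_on_differentiable seta Uy.
- by move=> y Uy; split; apply: leaf_eta => //; rewrite /unit_vec mxE.
- exact: WU.
- by apply: axis_point_U; apply: le_ball Bt; exact: half_le.
- by rewrite point_line.
Qed.

Context (f : R -> R) (Df : forall x, W x -> is_derive (x 0 i0) 1 f (eta x)).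

Let damped (v w x : 'rV[R]_3) := expR (- 2 * f (x 0 i0)) * bilin (h x) v w.

(** The factor e^(-2f) compensates the growth rate 2 eta because f' = eta. *)
Lemma damped_constant (v w : 'rV[R]_3) : v 0 i0 = 0 -> w 0 i0 = 0 ->
  forall x y : 'rV[R]_3, W x -> W y -> leaf_coord x = leaf_coord y -> damped v w x = damped v w y.
Proof.
move=> v0 w0.
have dk (x : 'rV[R]_3) : differentiable (fun y : 'rV[R]_3 => y 0 i0) x.
  exact: smooth_on_differentiable (smooth_on_coord setT 0 i0 openT) I.
have DT (x : 'rV[R]_3) : W x -> is_derive (x 0 i0) 1 (fun t => expR (- 2 * f t)) (expR (- 2 * f (x 0 i0)) * (- 2 * eta x)).
  move=> Wx; have D := Df x Wx.
  have D2 : is_derive (x 0 i0) 1 (fun t => - 2 * f t) (- 2 * eta x).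
    exact: is_deriveZ.
  exact: (is_derive1_comp (f := expR) (g := fun t => - 2 * f t) (is_derive_expR _) D2).
have dE (x : 'rV[R]_3) : W x -> differentiable (fun y : 'rV[R]_3 => expR (- 2 * f (y 0 i0))) x.
  move=> Wx; have := is_derive_differentiable _ _ _ (DT x Wx).
  exact: (differentiable_comp (dk x)).
have sB : smooth_on U (fun y : 'rV[R]_3 => bilin (h y) v w).
  by apply: (smooth_on_bilin _ oU) => //; exact: smooth_on_cst.
have dB (x : 'rV[R]_3) (Wx : W x) := smooth_on_differentiable U _ x sB (WU x Wx).
apply: constant_on_lines => x Wx; first exact: differentiableM (dE x Wx) (dB x Wx).
have Ux := WU x Wx.
apply: etrans (deriveM (diff_derivable (dE x Wx)) (diff_derivable (dB x Wx))) _.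
have D1 : 'D_(unit_vec i0) (fun y : 'rV[R]_3 => y 0 i0) x = 1.
  have di : differentiable (@id 'rV[R]_3) x by exact: smooth_on_differentiable (smooth_on_id setT) I.
  apply: etrans (esym (derive_mxE id x (unit_vec i0) 0 i0 di)) _.
  by rewrite derive_id mxE !eqxx.
have E := derive_comp1 _ _ x (unit_vec i0) _ (dk x) (DT x Wx).
rewrite (growth x v w Ux v0 w0) E D1 /GRing.scale /=; ring.
Qed.

(** The metric of the slice through the centre, rescaled by the value there of e^(-2f), since the
    antiderivative [f] is not normalized to vanish at the centre. *)
Definition leaf_metric (u : 'rV[R]_2) : 'M[R]_2 := \matrix_(j, l)
  (expR (- 2 * f (c 0 i0)) * bilin (h (box_point (c 0 i0) u)) (unit_vec (rshift 1 j)) (unit_vec (rshift 1 l))).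

Let N := ball (leaf_coord c) (d / 2).
Let oN : open N. Proof. exact: ball_open. Qed.

Let leaf_point_W u : N u -> W (box_point (c 0 i0) u).
Proof.
move=> Nu; apply/(ball_box c _ _ d20); rewrite point_line leaf_point; split=> //.
exact: ballxx.
Qed.

Let rshift_unit (j : 'I_2) : (unit_vec (rshift 1 j) : 'rV[R]_3) 0 i0 = 0.
Proof. by rewrite /unit_vec mxE. Qed.

Lemma warped_metricE x : W x -> h x = warped_metric f leaf_metric x.
Proof.
move=> Wx; have Ux := WU x Wx; have [hT _] := h_pos x Ux.
have B i j : h x i j = bilin (h x) (unit_vec i) (unit_vec j) by rewrite bilin_unit.
have E0 : i0 = lshift 2 (0 : 'I_1) :> 'I_3 by exact: val_inj.
have col0 i : h x i i0 = (i == i0)%:R by rewrite B axis // /unit_vec mxE eqxx eq_sym.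
apply/matrixP => i j; rewrite /warped_metric.
have D k l : (block_mx 1%:M 0 0 (expR (2 * f (line_coord x)) *: leaf_metric (leaf_coord x)) : 'M[R]_(1 + 2))
    (rshift 1 k) (rshift 1 l) = expR (2 * f (line_coord x)) * leaf_metric (leaf_coord x) k l.
  by rewrite (block_mxEdr 1%:M 0 0 _ k l) mxE.
have UL : (block_mx 1%:M 0 0 (expR (2 * f (line_coord x)) *: leaf_metric (leaf_coord x)) : 'M[R]_(1 + 2))
    i0 i0 = 1.
  by rewrite E0 (block_mxEul 1%:M 0 0 _ 0 0) mxE eqxx.
have UR l : (block_mx 1%:M 0 0 (expR (2 * f (line_coord x)) *: leaf_metric (leaf_coord x)) : 'M[R]_(1 + 2))
    i0 (rshift 1 l) = 0.
  by rewrite E0 (block_mxEur 1%:M 0 0 _ 0 l) mxE.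
have DL k : (block_mx 1%:M 0 0 (expR (2 * f (line_coord x)) *: leaf_metric (leaf_coord x)) : 'M[R]_(1 + 2))
    (rshift 1 k) i0 = 0.
  by rewrite E0 (block_mxEdl 1%:M 0 0 _ k 0) mxE.
move: i; apply: ord3_split => [|k]; move: j; apply: ord3_split => [|l].
- by apply: etrans _ (esym UL); rewrite col0 eqxx.
- by apply: etrans _ (esym (UR l)); rewrite -hT mxE col0.
- by apply: etrans _ (esym (DL k)); rewrite col0.
apply: etrans _ (esym (D k l)).
have Wp : W (box_point (c 0 i0) (leaf_coord x)) by apply: leaf_point_W; case/(ball_box c _ x d20): Wx.
have F := damped_constant _ _ (rshift_unit k) (rshift_unit l) x _ Wx Wp (esym (leaf_point _ _)).
have F' : expR (- 2 * f (x 0 i0)) * bilin (h x) (unit_vec (rshift 1 k)) (unit_vec (rshift 1 l)) =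
    leaf_metric (leaf_coord x) k l.
  by rewrite mxE; move: F; rewrite /damped point_line.
rewrite -F' mulrA -expRD /line_coord -i0E mulNr subrr expR0 mul1r.
exact: B.
Qed.

Lemma leaf_metric_riemannian : riemannian_metric_on N leaf_metric.
Proof.
split=> [|u Nu].
  have sp := smooth_on_point_leaf N (c 0 i0) oN.
  have shp : smooth_on N (fun u => h (box_point (c 0 i0) u)).
    by apply: (smooth_on_comp N U (box_point (c 0 i0)) h oN oU _ sp sh) => u /leaf_point_W /WU.
  apply/(smooth_on_mxP _ oN) => j l.
  apply: (eq_in_smooth_on N (fun u => expR (- 2 * f (c 0 i0)) *
     bilin (h (box_point (c 0 i0) u)) (unit_vec (rshift 1 j)) (unit_vec (rshift 1 l)))) => //.
    by move=> u _; rewrite mxE.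
  apply: (smooth_onM _ oN); first exact: smooth_on_cst.
  by apply: (smooth_on_bilin _ oN) => //; exact: smooth_on_cst.
have [hT hp] := h_pos _ (WU _ (leaf_point_W u Nu)).
set y := box_point (c 0 i0) u in hT hp.
split; first by apply/matrixP => j l; rewrite !mxE -/y bilinC.
move=> v v0; pose S : 'M[R]_(2, 3) := \matrix_j unit_vec (rshift 1 j).
have vS j : (v *m S) 0 (rshift 1 j) = v 0 j.
  rewrite mxE (bigD1 j) //= big1 ?addr0 => [|k nk]; first by rewrite !mxE !eqxx mulr1.
  by rewrite !mxE eqxx eq_rshift eq_sym (negPf nk) mulr0.
have w0 : v *m S != 0.
  apply: contra_neq v0 => w0; apply/rowP => j.
  by rewrite -vS w0 !mxE.
have LS : leaf_metric u = expR (- 2 * f (c 0 i0)) *: (S *m h y *m S^T).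
  apply/matrixP => j l; rewrite mxE [RHS]mxE -bilin_unit bilin_mulmx.
  by rewrite /unit_vec -!rowE !rowK.
by rewrite LS bilin_scale bilin_mulmx mulr_gt0 ?expR_gt0 // hp.
Qed.

End WarpedProductStructure.

Section SymmetricHypersurface.
Context {R : realType} (U : set 'rV[R]_3) (G xi : 'rV[R]_3 -> 'rV[R]_4).
Context (oU : open U) (sG : smooth_on U G) (sxi : smooth_on U xi).
Context (frame_unit : forall x, U x -> gauss_frame G xi x \in unitmx).
Context (equiaffine : forall x v, U x -> Defs.transversal G xi x ('D_v xi x) = 0).
Context (h_pos : forall x, U x -> posdef (affine_metric G xi x)).
Implicit Types (x u v w : 'rV[R]_3) (i j k : 'I_3).
Local Notation h := (affine_metric G xi).

Let h_unit x (Ux : U x) : h x \in unitmx := posdef_unitmx _ (h_pos x Ux).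
Let sh : smooth_on U h := smooth_on_affine_metric U G xi oU sG sxi frame_unit.

Lemma smooth_on_levi_civita_cst u v : smooth_on U (fun x => levi_civita h (cst u) (cst v) x).
Proof.
have shij i j : smooth_on U (fun y => h y i j) by move/(smooth_on_mxP _ oU) : sh; apply.
have schr i j : smooth_on U (fun x => christoffel h i j x).
  apply: (smooth_on_mulmx _ oU); last exact: smooth_on_invmx.
  apply/(smooth_on_mxP _ oU) => i' k.
  apply: (eq_in_smooth_on U (fun x => 2^-1 * ('D_(unit_vec i) (fun y => h y j k) x
      + 'D_(unit_vec j) (fun y => h y i k) x - 'D_(unit_vec k) (fun y => h y i j) x))) => //.
    by move=> x _; rewrite [RHS]mxE.
  apply: (smooth_onM _ oU); first exact: smooth_on_cst.
  by apply: (smooth_onB _ oU); [apply: (smooth_onD _ oU) |]; apply: smooth_on_derive; exact: shij.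
apply: (eq_in_smooth_on U (fun x => \sum_i \sum_j (u 0 i * v 0 j) *: christoffel h i j x)) => //.
  by move=> x _; rewrite /levi_civita derive_cst add0r.
apply: (smooth_on_sum _ oU) => i _; apply: (smooth_on_sum _ oU) => j _.
by apply: (smooth_onZ _ oU); [exact: smooth_on_cst | exact: schr].
Qed.

Lemma smooth_on_difference_tensor u v : smooth_on U (fun x => difference_tensor G xi x u v).
Proof.
apply: (smooth_on_submx _ oU); last exact: smooth_on_levi_civita_cst.
apply: (smooth_on_tangential U G xi) => //.
apply: smooth_on_derive; apply: (smooth_on_mulmx _ oU); first exact: smooth_on_cst.
exact: smooth_on_jacobian.
Qed.

Context (volume : forall x (X : 'M[R]_3), U x ->
  `|\det (col_mx (X *m 'J G x) (xi x) : 'M[R]_(3 + 1))|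
  = Num.sqrt `|\det (X *m affine_metric G xi x *m X^T)|).
Context (symmetric : (forall x, U x -> Z3_symmetric_at G xi x) \/ (forall x, U x -> SO2_symmetric_at G xi x)).

(** The tensors enter as matrices depending smoothly on the point. The hypothesis on the group
    supplies a special normal frame everywhere, but the simplicity of the axis eigenvalue is used at
    [x0] and spread by continuity. *)
Lemma local_normal_frame x0 : U x0 -> exists (V : set 'rV[R]_3) (e : 'I_3 -> 'rV[R]_3 -> 'rV[R]_3)
    (mu p la a : 'rV[R]_3 -> R),
  [/\ open V, V `<=` U, V x0, forall i, smooth_on V (e i) &
   forall x, V x -> is_normal_frame (h x) (Defs.shape G xi x) (difference_tensor G xi x)
    (rows3 (e i0 x) (e i1 x) (e i2 x)) (mu x) (p x) 0 (la x) (a x) /\ mu x != 0].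
Proof.
move=> Ux0.
pose Sm x := shape_mx G xi x; pose Km x u := difference_mx G xi x u.
have SE x : U x -> mulmx^~ (Sm x) = Defs.shape G xi x.
  by move=> Ux; apply/funext => v; rewrite (shape_mxE U G xi sxi x v Ux).
have KE x : U x -> (fun u => mulmx^~ (Km x u)) = difference_tensor G xi x.
  move=> Ux; apply/funext => u; apply/funext => v.
  by rewrite (difference_mxE U G xi oU sG sxi frame_unit equiaffine h_unit x u v Ux).
have sS : smooth_on U Sm.
  apply/(smooth_on_mxP _ oU) => i j.
  have sSi := smooth_on_shape U G xi oU sG sxi frame_unit (unit_vec i).
  apply: (eq_in_smooth_on U (fun x => Defs.shape G xi x (unit_vec i) 0 j)) => //.
    by move=> x _; rewrite [RHS]mxE.
  by move/(smooth_on_mxP _ oU) : sSi; apply.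
have sK u : smooth_on U (Km^~ u).
  apply/(smooth_on_mxP _ oU) => i j.
  have sKi := smooth_on_difference_tensor u (unit_vec i).
  apply: (eq_in_smooth_on U (fun x => difference_tensor G xi x u (unit_vec i) 0 j)) => //.
    by move=> x _; rewrite [RHS]mxE.
  by move/(smooth_on_mxP _ oU) : sKi; apply.
have KC x u v : U x -> difference_tensor G xi x u v = difference_tensor G xi x v u.
  by move=> Ux; exact: (difference_tensorC U G xi oU sG sxi frame_unit h_unit).
have Ksym x u v w : U x -> bilin (h x) (difference_tensor G xi x u v) w
    = bilin (h x) (difference_tensor G xi x u w) v.
  by move=> Ux; exact: (cubic_formC23 U G xi oU sG sxi frame_unit equiaffine h_unit).
have Kap x u (E : 'M[R]_3) : U x -> E *m h x *m E^T = 1%:M ->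
    \sum_i bilin (h x) (difference_tensor G xi x u (row i E)) (row i E) = 0.
  by move=> Ux; exact: (apolar_frame U G xi oU sG sxi frame_unit equiaffine h_unit volume x u E Ux).
have KL x u c v w : U x -> difference_tensor G xi x u (c *: v + w)
    = c *: difference_tensor G xi x u v + difference_tensor G xi x u w.
  by move=> Ux; exact: (difference_tensor_linearr U G xi oU sG sxi frame_unit equiaffine h_unit).
have SL x c v w : U x -> Defs.shape G xi x (c *: v + w) = c *: Defs.shape G xi x v + Defs.shape G xi x w.
  by move=> Ux; exact: (shape_linear U G xi sxi).
have Ssym x v w : U x -> bilin (h x) (Defs.shape G xi x v) w = bilin (h x) v (Defs.shape G xi x w).
  by move=> Ux; exact: (shape_selfadjoint U G xi oU sG sxi frame_unit equiaffine).
have special x : U x -> exists E mu p l a,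
    special_normal_frame (h x) (Defs.shape G xi x) (difference_tensor G xi x) E mu p l a.
  move=> Ux; case: symmetric => H.
    have [comm L3 _] := Z3_symmetry _ _ _ (H x Ux).
    exact: (special_normal_frame_exists (h x) _ _ (h_pos x Ux) (fun u c v w => KL x u c v w Ux)
      (fun u v => KC x u v Ux) (fun u v w => Ksym x u v w Ux) (fun u E => Kap x u E Ux)
      (fun c v w => SL x c v w Ux) (fun v w => Ssym x v w Ux) comm L3).
  have [comm L3 _] := SO2_symmetry _ _ _ (H x Ux).
  exact: (special_normal_frame_exists (h x) _ _ (h_pos x Ux) (fun u c v w => KL x u c v w Ux)
    (fun u v => KC x u v Ux) (fun u v w => Ksym x u v w Ux) (fun u E => Kap x u E Ux)
    (fun c v w => SL x c v w Ux) (fun v w => Ssym x v w Ux) comm L3).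
have [E0 [mu0 [p0 [l0 [a0 [nf0 mu00 gen0]]]]]] := special x0 Ux0.
have rot : p0 != 0 \/ forall x (E : 'M[R]_3) (mu p q l a : R), U x -> mu != 0 ->
    is_normal_frame (h x) (mulmx^~ (Sm x)) (fun u => mulmx^~ (Km x u)) E mu p q l a -> p = 0 /\ q = 0.
  case: symmetric => H; [left | right].
    exact: Z3_normal_frame (H x0 Ux0) nf0.
  move=> x E mu p q l a Ux mun; rewrite SE // KE // => nfx.
  exact: (SO2_normal_frame _ _ _ _ _ _ _ _ _ mun (H x Ux) nfx).
have nf x : U x -> exists E mu p l a,
    is_normal_frame (h x) (mulmx^~ (Sm x)) (fun u => mulmx^~ (Km x u)) E mu p 0 l a /\ mu != 0.
  move=> Ux; have [E [mu [p [l [a [nfx mun _]]]]]] := special x Ux.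
  by exists E, mu, p, l, a; rewrite SE // KE.
have nf0' : is_normal_frame (h x0) (mulmx^~ (Sm x0)) (fun u => mulmx^~ (Km x0 u)) E0 mu0 p0 0 l0 a0.
  by rewrite SE // KE.
have Km1 x u v : U x -> v *m Km x u = difference_tensor G xi x u v.
  by move=> Ux; rewrite -KE.
have [V [e1 [e2 [e3 [[oV VU] Vx0 [s1 s2 s3] nfV]]]]] := smooth_normal_frame U oU h Sm Km sh sS sK h_pos
  ltac:(by move=> x u v Ux; rewrite !Km1 // KC)
  ltac:(by move=> x u v w Ux; rewrite !Km1 // Ksym)
  ltac:(by move=> x u E Ux EhE; rewrite -[RHS](Kap x u E Ux EhE); apply: eq_bigr => i _; rewrite Km1)
  nf x0 Ux0 E0 mu0 p0 l0 a0 nf0' gen0 rot.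
(* The parameters are picked point by point, with a dummy value off [V]; no regularity in the point
   is claimed for them here. *)
have /choice [q qP] : forall x, exists q : R * R * R * R, V x ->
    is_normal_frame (h x) (Defs.shape G xi x) (difference_tensor G xi x)
      (rows3 (e1 x) (e2 x) (e3 x)) q.1.1.1 q.1.1.2 0 q.1.2 q.2 /\ q.1.1.1 != 0.
  move=> x; have [Vx|nVx] := pselect (V x); last by exists (0, 0, 0, 0) => /nVx.
  have [mu [p [l [a H]]]] := nfV x Vx; exists (mu, p, l, a) => _.
  by rewrite SE ?KE in H; [exact: H | exact: VU | exact: VU].
exists V, (fun i x => nth 0 [:: e1 x; e2 x; e3 x] i), (fun x => (q x).1.1.1), (fun x => (q x).1.1.2),
  (fun x => (q x).1.2), (fun x => (q x).2); split=> //.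
by apply: ord3P.
Qed.

End SymmetricHypersurface.

(** In an orthonormal frame the quadratic form is a sum of squares; this restores positivity in the
    new coordinates from the transported frame. *)
Lemma gram_posdef {R : realType} (h E : 'M[R]_3) : h^T = h -> E *m h *m E^T = 1%:M -> posdef h.
Proof.
move=> hT EhE; split=> // v v0.
have Eu : E \in unitmx by have /mulmx1_unit[] : E *m (h *m E^T) = 1%:M by rewrite mulmxA.
have [w vE] : exists w : 'rV[R]_3, v = w *m E by exists (v *m invmx E); rewrite mulmxKV.
have w0 : w != 0 by apply: contra_neq v0 => w0; rewrite vE w0 mul0mx.
rewrite vE bilin_mul EhE /bilin mulmx1 mxE; under eq_bigr do rewrite mxE.
rewrite lt_neqAle sumr_ge0 ?andbT => [|i _]; last by rewrite -expr2 sqr_ge0.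
rewrite eq_sym psumr_neq0 => [|i _]; last by rewrite -expr2 sqr_ge0.
have [i wi] : exists i, w 0 i != 0 by apply/rV0Pn.
by apply/hasP; exists i; rewrite ?mem_index_enum //= -expr2 exprn_even_gt0.
Qed.

Lemma normal_frame_products {R : realType} (h : 'M[R]_3) S K e1 e2 e3 mu p l a :
  is_normal_frame h S K (rows3 e1 e2 e3) mu p 0 l a ->
  [/\ K e1 e1 = (2 * mu) *: e1, K e1 e2 = - mu *: e2, K e1 e3 = - mu *: e3 &
   [/\ K e2 e2 = - mu *: e1 + p *: e2, K e2 e3 = - p *: e3 & K e3 e3 = - mu *: e1 - p *: e2]] /\
  [/\ S e1 = l *: e1, S e2 = a *: e2 & S e3 = a *: e3].
Proof.
case=> _ SE KE; pose E := rows3 e1 e2 e3.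
have E1 : e1 = vec3 1 0 0 *m E by rewrite rows3_mul !scale0r scale1r !addr0.
have E2 : e2 = vec3 0 1 0 *m E by rewrite rows3_mul !scale0r scale1r addr0 add0r.
have E3 : e3 = vec3 0 0 1 *m E by rewrite rows3_mul !scale0r scale1r !add0r.
have KV u v u' v' : u = u' *m E -> v = v' *m E -> K u v = normal_product mu p 0 u' v' *m E.
  by move=> -> ->; exact: KE.
have SV u u' : u = u' *m E -> S u = normal_shape l a u' *m E by move=> ->; exact: SE.
by split; split; rewrite ?(KV _ _ _ _ E1 E1) ?(KV _ _ _ _ E1 E2) ?(KV _ _ _ _ E1 E3) ?(KV _ _ _ _ E2 E2)
   ?(KV _ _ _ _ E2 E3) ?(KV _ _ _ _ E3 E3) ?(SV _ _ E1) ?(SV _ _ E2) ?(SV _ _ E3)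
   ?normal_product_vec3 ?normal_shape_vec3 ?rows3_mul; try split;
   rewrite ?(KV _ _ _ _ E2 E2) ?(KV _ _ _ _ E2 E3) ?(KV _ _ _ _ E3 E3) ?normal_product_vec3 ?rows3_mul;
   apply/rowP => j; rewrite !mxE; ring.
Qed.

Lemma adapted_frame_of_normal {R : realType} (G xi : 'rV[R]_3 -> 'rV[R]_4) (W : set 'rV[R]_3)
    (e1 e2 e3 : 'rV[R]_3 -> 'rV[R]_3) (mu p la a : 'rV[R]_3 -> R) :
  smooth_on W e1 -> smooth_on W e2 -> smooth_on W e3 ->
  (forall x, W x -> is_normal_frame (affine_metric G xi x) (Defs.shape G xi x) (difference_tensor G xi x)
    (rows3 (e1 x) (e2 x) (e3 x)) (mu x) (p x) 0 (la x) (a x) /\ mu x != 0) ->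
  adapted_frame_on G xi W e1 e2 e3.
Proof.
move=> s1 s2 s3 nf; split=> //; exists mu, p, la, a => x Wx h K S.
have [nfx mun] := nf x Wx; have [[K1 K2 K3 K4] S1] := normal_frame_products _ _ _ _ _ _ _ _ _ _ nfx.
have [EhE _ _] := nfx; have [[h11 h12 h13] [_ h22 h23] [_ _ h33]] := orthonormal_rows3 _ _ _ _ EhE.
split=> //; split=> //.
exact: (normal_frame_SO2 _ _ _ _ _ _ _ _ mun nfx).
Qed.

Section LocalWarpedProduct.
Context {R : realType} (U : set 'rV[R]_3) (G xi : 'rV[R]_3 -> 'rV[R]_4).
Context (oU : open U) (sG : smooth_on U G) (sxi : smooth_on U xi).
Context (frame_unit : forall x, U x -> gauss_frame G xi x \in unitmx).
Context (equiaffine : forall x v, U x -> Defs.transversal G xi x ('D_v xi x) = 0).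
Context (h_pos : forall x, U x -> posdef (affine_metric G xi x)).
Context (volume : forall x (X : 'M[R]_3), U x ->
  `|\det (col_mx (X *m 'J G x) (xi x) : 'M[R]_(3 + 1))|
  = Num.sqrt `|\det (X *m affine_metric G xi x *m X^T)|).
Context (symmetric : (forall x, U x -> Z3_symmetric_at G xi x) \/ (forall x, U x -> SO2_symmetric_at G xi x)).

Lemma local_warped_product x0 : U x0 ->
  exists (r d : R) (Phi Psi : 'rV[R]_3 -> 'rV[R]_3) (a b : R) (N : set 'rV[R]_2)
         (gN : 'rV[R]_2 -> 'M[R]_2) (f : R -> R)
         (e1 e2 e3 : 'rV[R]_3 -> 'rV[R]_3) (eta : 'rV[R]_3 -> R),
  let W := ball (Phi x0) d in
  let Gc := G \o Psi in let xic := xi \o Psi in let h := affine_metric Gc xic in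
  [/\ [/\ 0 < r, 0 < d, ball x0 r `<=` U, smooth_on (ball x0 r) Phi & smooth_on W Psi],
      (forall y, W y -> ball x0 r (Psi y) /\ Phi (Psi y) = y) /\
      (forall x, ball x0 r x -> W (Phi x) -> Psi (Phi x) = x),
      [/\ W = warped_domain a b N, open N, riemannian_metric_on N gN & smooth_on [set` `]a, b[] f],
      adapted_frame_on Gc xic W e1 e2 e3 /\ (forall x, W x -> e1 x = unit_vec 0) &
      (forall x v, W x -> bilin (h x) v (e1 x) = 0 -> levi_civita h (cst v) e1 x = eta x *: v) /\
      (forall x, W x -> h x = warped_metric f gN x /\ is_derive (line_coord x) 1 f (eta x))].
Proof.
move=> Ux0.
have [V [e [mu [p [la [a [oV VU Vx0 se nf]]]]]]] :=
  local_normal_frame U G xi oU sG sxi frame_unit equiaffine h_pos volume symmetric x0 Ux0.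
have sGV : smooth_on V G := smooth_onS _ _ _ VU sG.
have sxiV : smooth_on V xi := smooth_onS _ _ _ VU sxi.
have fuV x : V x -> gauss_frame G xi x \in unitmx by move=> /VU; exact: frame_unit.
have eqV x v : V x -> Defs.transversal G xi x ('D_v xi x) = 0 by move=> /VU; exact: equiaffine.
have huV x : V x -> affine_metric G xi x \in unitmx by move=> /VU Ux; exact: posdef_unitmx (h_pos x Ux).
have [r [d [Phi [Psi [[r0 d0] subV [sPhi sPsi] [PhiK PsiK] [DPsi DPhi]]]]]] :=
  warped_coordinates V G xi oV sGV sxiV fuV eqV huV e se mu p la a nf x0 Vx0.
pose B := ball (Phi x0) d; pose J y := 'J Phi (Psi y).
have oB : open B by exact: ball_open.
have oX : open (ball x0 r) by exact: ball_open.
have PsiB y : B y -> ball x0 r (Psi y) by move=> /PhiK[].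
have PsiV y : B y -> V (Psi y) by move=> /PsiB /subV.
have J_unit y : B y -> J y \in unitmx by move=> /DPsi[].
have sJ : smooth_on B J.
  exact: (smooth_on_comp B (ball x0 r) Psi _ oB oX PsiB sPsi (smooth_on_jacobian _ _ oX sPhi)).
have DPsi' y v : B y -> 'D_v Psi y = v *m invmx (J y).
  by move=> By; have [_ H] := DPsi y By; exact: H.
pose Gc := G \o Psi; pose xic := xi \o Psi; pose ec := pull_frame Psi J e.
have sGc : smooth_on B Gc := smooth_on_pullback V oV B Psi oB sPsi PsiV G sGV.
have sxic : smooth_on B xic := smooth_on_pullback V oV B Psi oB sPsi PsiV xi sxiV.
have fuc y : B y -> gauss_frame Gc xic y \in unitmx.
  exact: (gauss_frame_pullback V G xi oV sGV fuV B Psi J oB sPsi PsiV J_unit DPsi').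
have eqc y v : B y -> Defs.transversal Gc xic y ('D_v xic y) = 0.
  exact: (equiaffine_pullback V G xi oV sGV sxiV fuV eqV B Psi J oB sPsi PsiV J_unit DPsi').
have sec i : smooth_on B (ec i).
  exact: (smooth_on_pull_frame V oV B Psi J oB sPsi PsiV sJ e se).
pose mu' := mu \o Psi; pose p' := p \o Psi; pose la' := la \o Psi; pose a' := a \o Psi.
have nfc y : B y -> is_normal_frame (affine_metric Gc xic y) (Defs.shape Gc xic y) (difference_tensor Gc xic y)
    (rows3 (ec i0 y) (ec i1 y) (ec i2 y)) (mu' y) (p' y) 0 (la' y) (a' y) /\ mu' y != 0.
  move=> By; split; last by have [] := nf _ (PsiV y By).
  exact: (pull_normal_frame V G xi oV sGV sxiV fuV eqV B Psi J oB sPsi PsiV J_unit sJ DPsi' huV e se mu p la a nf y By).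
have dPhi x : ball x0 r x -> differentiable Phi x by exact: smooth_on_differentiable.
have axis y : B y -> ec i0 y = unit_vec i0.
  move=> By; have [<- _] := DPhi _ (PsiB y By).
  by apply: esym; apply: deriveEjacobian; apply: dPhi; exact: PsiB.
have leaf y i : B y -> i != i0 -> ec i y 0 i0 = 0.
  move=> By ni; have [_ /(_ i ni) <-] := DPhi _ (PsiB y By).
  have E : 'D_(e i (Psi y)) Phi (Psi y) = ec i y.
    by apply: deriveEjacobian; apply: dPhi; exact: PsiB.
  by rewrite E.
have huc y : B y -> affine_metric Gc xic y \in unitmx.
  move=> By; have [[EhE _ _] _] := nfc y By; move: EhE.
  by rewrite -mulmxA => /mulmx1_unit[_]; rewrite unitmx_mul => /andP[].
have hposc y : B y -> posdef (affine_metric Gc xic y).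
  move=> By; have [[EhE _ _] _] := nfc y By.
  exact: gram_posdef (affine_metric_sym B Gc xic oB sGc y By) EhE.
pose hc := affine_metric Gc xic; pose eta := warping_rate Gc xic ec mu'.
have maxis y (v : 'rV[R]_3) : B y -> bilin (hc y) v (ec i0 y) = v 0 i0.
  exact: (metric_axis B Gc xic ec mu' p' la' a' nfc axis leaf y v).
have LC y (v : 'rV[R]_3) : B y -> v 0 i0 = 0 -> levi_civita hc (cst v) (ec i0) y = eta y *: v.
  exact: (levi_civita_axis B Gc xic oB sGc sxic fuc eqc huc ec sec mu' p' la' a' nfc axis leaf y v).
have growth y (v w : 'rV[R]_3) : B y -> v 0 i0 = 0 -> w 0 i0 = 0 ->
    'D_(unit_vec i0) (fun z => bilin (hc z) v w) y = 2 * eta y * bilin (hc y) v w.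
  exact: (metric_growth B Gc xic oB sGc sxic fuc eqc huc ec sec mu' p' la' a' nfc axis leaf y v w).
have seta : smooth_on B eta.
  exact: (smooth_on_warping_rate B Gc xic oB sGc sxic fuc eqc huc ec sec mu' p' la' a' nfc).
have leaf_eta y (v : 'rV[R]_3) : B y -> v 0 i0 = 0 -> 'D_v eta y = 0.
  exact: (derive_warping_rate B Gc xic oB sGc sxic fuc eqc huc ec sec mu' p' la' a' nfc axis leaf y v).
have shc : smooth_on B hc := smooth_on_affine_metric B Gc xic oB sGc sxic fuc.
have uaxis y (v : 'rV[R]_3) : B y -> bilin (hc y) v (unit_vec i0) = v 0 i0.
  by move=> By; rewrite -(axis y By); exact: maxis.
have [f Df] := warping_function (Phi x0) d d0 eta seta leaf_eta.
have d20 : 0 < d / 2 by rewrite divr_gt0.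
have WB y : ball (Phi x0) (d / 2) y -> B y by apply: le_ball; exact: half_le.
(* Half the radius of the straightening chart, where the warping function is defined; the box is the
   corresponding ball in the maximum norm. *)
exists r, (d / 2), Phi, Psi, (line_coord (Phi x0) - d / 2), (line_coord (Phi x0) + d / 2),
  (ball (leaf_coord (Phi x0)) (d / 2)), (leaf_metric (Phi x0) hc f), f, (ec i0), (ec i1), (ec i2), eta.
move=> W Gc' xic' h'.
have sW (g : 'rV[R]_3 -> 'rV[R]_3) : smooth_on B g -> smooth_on W g by apply: smooth_onS; exact: WB.
split.
- split=> //; first by move=> x /subV /VU.
  by apply: smooth_onS sPsi; exact: WB.
- split=> [y /WB|x Bx /WB Wx]; [exact: PhiK | exact: PsiK].
- split; [exact: ball_warped_domain | exact: ball_open | |].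
    exact: (leaf_metric_riemannian (Phi x0) d d0 hc shc hposc f).
  pose E (t : R) : R := eta (box_point t (leaf_coord (Phi x0))).
  have I_ball t : `](line_coord (Phi x0) - d / 2), (line_coord (Phi x0) + d / 2)[%classic t ->
      W (box_point t (leaf_coord (Phi x0))).
    rewrite /= in_itv /= => Ht; rewrite /W (ball_warped_domain _ _ d20); split.
      have L : line_coord (box_point t (leaf_coord (Phi x0))) = t by rewrite /line_coord -i0E point_line.
      by rewrite L.
    by rewrite leaf_point; exact: ballxx.
  have oI : open `](line_coord (Phi x0) - d / 2), (line_coord (Phi x0) + d / 2)[%classic.
    exact: itv_open.
  apply: (smooth_on_antiderivative _ f E oI).
    by move=> t /I_ball Wt; have := Df _ Wt; rewrite point_line.
  apply: (smooth_on_compR _ B _ eta oI _ (smooth_on_point_line _ _ oI) seta).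
  by move=> t /I_ball /WB.
- split; last by move=> x /WB /axis ->; rewrite i0E.
  apply: (adapted_frame_of_normal _ _ _ _ _ _ mu' p' la' a').
  + exact: sW (sec i0).
  + exact: sW (sec i1).
  + exact: sW (sec i2).
  + by move=> x /WB; exact: nfc.
- split=> [x v /WB Bx|x Wx].
    by rewrite (maxis x v Bx); exact: LC.
  split; first exact: (warped_metricE (Phi x0) d d0 hc eta shc hposc uaxis growth f Df x Wx).
  by rewrite /line_coord -i0E; exact: Df.
Qed.

End LocalWarpedProduct.

(** * Charts of the manifold *)

Section Charts.
Context {R : realType} {M : topologicalType}.
Implicit Types (c d : chart R M 3) (D : set M).

Lemma chart_img_of c x : is_chart c -> chart_img c x -> chart_dom c (chart_of c x) /\ chart_to c (chart_of c x) = x.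
Proof. by case=> _ _ K _ _ [p cp <-]; rewrite K. Qed.

Lemma chart_to_img c p : chart_dom c p -> chart_img c (chart_to c p).
Proof. by move=> cp; exists p. Qed.

Lemma continuous_chart_to c p : is_chart c -> chart_dom c p -> {for p, continuous (chart_to c)}.
Proof.
case=> oc _ _ cto _ cp; move: cto; rewrite continuous_open_subspace // => cto.
by apply: cto; rewrite inE.
Qed.

Lemma continuous_chart_of c x : is_chart c -> chart_img c x -> {for x, continuous (chart_of c)}.
Proof.
case=> _ oi _ _ cof cx; move: cof; rewrite continuous_open_subspace // => cof.
by apply: cof; rewrite inE.
Qed.

Lemma chart_imgI c D : is_chart c ->
  chart_to c @` (chart_dom c `&` D) = chart_img c `&` chart_of c @^-1` D.
Proof.
move=> ic; apply/seteqP; split=> [_ [p [cp Dp] <-]|x [cx Dx]].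
  split; first exact: chart_to_img.
  by case: ic => _ _ K _ _ /=; rewrite K.
by have [H1 H2] := chart_img_of c x ic cx; exists (chart_of c x).
Qed.

Lemma open_chart_imgI c D : is_chart c -> open D -> open (chart_to c @` (chart_dom c `&` D)).
Proof.
move=> ic oD; rewrite chart_imgI //; apply: open_preimage => //; first by case: ic.
by move=> x cx; exact: continuous_chart_of.
Qed.

Section Reparametrization.
Context (d : chart R M 3) (chart_d : is_chart d) (B W : set 'rV[R]_3) (oB : open B) (oW : open W).
Context (BI : B `<=` chart_img d) (Phi Psi : 'rV[R]_3 -> 'rV[R]_3).
Context (sPhi : smooth_on B Phi) (sPsi : smooth_on W Psi).
Context (PhiK : forall y, W y -> B (Psi y) /\ Phi (Psi y) = y).
Context (PsiK : forall x, B x -> W (Phi x) -> Psi (Phi x) = x).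

(** The domain is cut by both [B] and the preimage of [W], so that [Phi] and [Psi] are mutually
    inverse on it and the image is exactly the box [W]. *)
Definition reparametrize : chart R M 3 :=
  Chart (chart_dom d `&` chart_to d @^-1` (B `&` Phi @^-1` W)) (Phi \o chart_to d) (chart_of d \o Psi).

Let c := reparametrize.

Lemma reparametrize_img : chart_img c = W.
Proof.
apply/seteqP; split=> [_ [p [_ [_ Wp]] <-] //|y Wy].
have [By Phiy] := PhiK y Wy; have [dp toK] := chart_img_of d (Psi y) chart_d (BI _ By).
exists (chart_of d (Psi y)); last by rewrite /= toK.
by split=> //=; rewrite toK Phiy.
Qed.

Let dPhi x (Bx : B x) : {for x, continuous Phi}.
Proof. by apply: differentiable_continuous; exact: smooth_on_differentiable sPhi Bx. Qed.
Let dPsi y (Wy : W y) : {for y, continuous Psi}.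
Proof. by apply: differentiable_continuous; exact: smooth_on_differentiable sPsi Wy. Qed.

Lemma is_chart_reparametrize : is_chart c.
Proof.
have [od oi dK _ _] := chart_d.
have oc : open (chart_dom c).
  apply: open_preimage => //; last by move=> p dp; exact: continuous_chart_to.
  by apply: open_preimage.
split=> //.
- by rewrite reparametrize_img.
- by move=> p [dp [Bp Wp]]; rewrite /= PsiK // dK.
- rewrite continuous_open_subspace // => p; rewrite inE => -[dp [Bp Wp]].
  apply: continuous_comp; first exact: continuous_chart_to.
  exact: dPhi.
- rewrite reparametrize_img continuous_open_subspace // => y; rewrite inE => Wy.
  apply: continuous_comp; first exact: dPsi.
  by apply: continuous_chart_of => //; apply: BI; have [] := PhiK y Wy.
Qed.

Lemma smooth_transition_from_reparametrize d' : open (chart_dom d') ->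
  smooth_transition d d' -> smooth_transition c d'.
Proof.
move=> od' sd; have ic := is_chart_reparametrize.
have oS : open (chart_to c @` (chart_dom c `&` chart_dom d')) by exact: open_chart_imgI.
have oT : open (chart_to d @` (chart_dom d `&` chart_dom d')) by exact: open_chart_imgI.
have SW y : (chart_to c @` (chart_dom c `&` chart_dom d')) y -> W y.
  by case=> p [[_ [_ Wp]] _] <-.
have sPsi' := smooth_onS _ _ _ SW sPsi.
apply: (smooth_on_comp _ _ Psi (chart_to d' \o chart_of d) oS oT _ sPsi' sd) => y Sy.
case: Sy => p [[dp [Bp Wp]] d'p] <-; exists p => //.
by rewrite /= PsiK.
Qed.

Lemma smooth_transition_to_reparametrize d' : is_chart d' ->
  smooth_transition d' d -> smooth_transition d' c.
Proof.
move=> id' sd; have ic := is_chart_reparametrize; have [oc _ _ _ _] := ic; have [_ _ K' _ _] := id'.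
have oS : open (chart_to d' @` (chart_dom d' `&` chart_dom c)) by exact: open_chart_imgI.
have ST y : (chart_to d' @` (chart_dom d' `&` chart_dom c)) y -> (chart_to d' @` (chart_dom d' `&` chart_dom d)) y.
  by case=> p [d'p [dp _]] <-; exists p.
have sd' := smooth_onS _ _ _ ST sd.
apply: (smooth_on_comp _ B (chart_to d \o chart_of d') Phi oS oB _ sd' sPhi) => y Sy.
by case: Sy => p [d'p [dp [Bp Wp]]] <-; rewrite /= K'.
Qed.

End Reparametrization.
End Charts.

Theorem lemma7 (R : realType) (M : topologicalType) (A : set (chart R M 3))
    (F xi : M -> 'rV[R]_4) :
  smooth_manifold A ->
  positive_definite_affine_hypersurface A F xi ->
  pointwise_Z3_symmetric A F xi \/ pointwise_SO2_symmetric A F xi ->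
  forall p : M,
  exists (c : chart R M 3) (a b : R) (N : set 'rV[R]_2)
         (gN : 'rV[R]_2 -> 'M[R]_2) (f : R -> R)
         (e1 e2 e3 : 'rV[R]_3 -> 'rV[R]_3) (eta : 'rV[R]_3 -> R),
  let W := warped_domain a b N in
  let G := in_chart c F in
  let xi_c := in_chart c xi in
  let h := affine_metric G xi_c in
  [/\ smooth_chart A c /\ chart_dom c p,
      [/\ chart_img c = W, open N, riemannian_metric_on N gN &
          smooth_on [set` `]a, b[] f],
      adapted_frame_on G xi_c W e1 e2 e3 /\
      (forall x, W x -> e1 x = unit_vec 0),
      (forall x v, W x -> bilin (h x) v (e1 x) = 0 ->
         levi_civita h (cst v) e1 x = eta x *: v) &
      forall x, W x ->
        h x = warped_metric f gN x /\ is_derive (line_coord x) 1 f (eta x)].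
Proof.
move=> [_ _ charts cover trans] hyp sym p.
have [d [Ad dp]] := cover p; have chart_d := charts d Ad.
have [[sG _] [sxi bn] _ h_pos] := hyp d Ad.
have oI : open (chart_img d) by case: chart_d.
have sym' : (forall x, chart_img d x -> Z3_symmetric_at (in_chart d F) (in_chart d xi) x) \/
    (forall x, chart_img d x -> SO2_symmetric_at (in_chart d F) (in_chart d xi) x).
  by case: sym => H; [left | right] => _ [q dq <-]; exact: H.
have frame_unit x : chart_img d x -> gauss_frame (in_chart d F) (in_chart d xi) x \in unitmx by case/bn.
have equiaffine x v : chart_img d x -> Defs.transversal (in_chart d F) (in_chart d xi) x ('D_v (in_chart d xi) x) = 0.
  by move=> Ix; have [_ H _] := bn x Ix; exact: H.
have volume x (X : 'M[R]_3) : chart_img d x -> `|\det (col_mx (X *m 'J (in_chart d F) x) (in_chart d xi x) : 'M[R]_(3 + 1))|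
    = Num.sqrt `|\det (X *m affine_metric (in_chart d F) (in_chart d xi) x *m X^T)|.
  by move=> Ix; have [_ _ H] := bn x Ix; exact: H.
(* The local result is applied to the expressions of [F] and [xi] in one chart around [p], at the
   coordinates of [p]; composing that chart with [Phi] gives the chart sought. *)
have [r [s [Phi [Psi [a [b [N [gN [f [e1 [e2 [e3 [eta L]]]]]]]]]]]]] :=
  local_warped_product (chart_img d) (in_chart d F) (in_chart d xi) oI sG sxi frame_unit equiaffine
    h_pos volume sym' (chart_to d p) (chart_to_img d p dp).
case: L => -[r0 s0 BI sPhi sPsi] [PhiK PsiK] [WE oN mN sf] [adapted axis] [LC metric].
have oB : open (ball (chart_to d p) r) by exact: ball_open.
have oW : open (ball (Phi (chart_to d p)) s) by exact: ball_open.
exists (reparametrize d (ball (chart_to d p) r) (ball (Phi (chart_to d p)) s) Phi Psi).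
exists a, b, N, gN, f, e1, e2, e3, eta; rewrite -WE; split.
- split; last by split=> //; split; exact: ballxx.
  split; first exact: is_chart_reparametrize.
  move=> d' Ad'; have id' := charts d' Ad'; split.
    by apply: smooth_transition_from_reparametrize => //; [case: id' | exact: trans].
  by apply: smooth_transition_to_reparametrize => //; exact: trans.
- by split=> //; exact: reparametrize_img.
- by split; [exact: adapted | exact: axis].
- exact: LC.
- exact: metric.
Qed.
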